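(* Let $M$ be a compact, connected smooth $d$-dimensional submanifold of a Euclidean space. For each fixed pair $x,y\in M$, $$\bigl(\mathrm{dist}_{M;q}(x,y)-\mathrm{dist}_M(x,y)\bigr)\xrightarrow{q\to\infty}0.$$
   Context: $M$ carries the induced Riemannian metric. $\mathrm{dist}_M(x,y)$ is the infimum of lengths of smooth paths in $M$ from $x$ to $y$. $C^\infty(M)$ is the space of smooth real-valued functions on $M$, $\langle f,g\rangle=\int_Mfg$ (Riemannian volume), $\nabla_M$ is the gradient, $\|\nabla_Mf\|_\infty=\sup_{x\in M}\|\nabla_Mf(x)\|$. $\Delta_M$ is the negative Laplace-Beltrami operator: $\int_M f\Delta_Mg=-\int_M\nabla_Mf\cdot\nabla_Mg$. Its non-zero eigenvalues, with multiplicity, are $\lambda_1\ge\lambda_2\ge\cdots$, and $e_1,e_2,\ldots$ is a fixed $L_2$-orthonormal choice of eigenfunctions with $\Delta_Me_i=\lambda_ie_i$; put $\hat f_i=\langle f,e_i\rangle$. The truncated distance is $\mathrm{dist}_{M;q}(x,y)=\sup_f|f(x)-f(y)|$, over all $f\in C^\infty(M)$ with $\|\nabla_Mf\|_\infty\le1$ and $\hat f_i=0$ for all $i>q$. *)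

(* Defs.v *)
From HB Require Import structures.
From mathcomp Require Import all_boot all_order all_algebra.
From mathcomp Require Import all_classical all_reals all_analysis.
Set Implicit Arguments.
Unset Strict Implicit.
Unset Printing Implicit Defensive.
Import Order.TTheory GRing.Theory Num.Theory.
Import numFieldNormedType.Exports.
Local Open Scope classical_set_scope.
Local Open Scope ring_scope.

(* Points of R^n are row vectors 'rV[R]_n.  The library
   norm `|_| on 'rV[R]_n is the sup norm: it is only used through the topology
   and the derivatives; all metric notions use the Euclidean norm [enorm]. *)

Section Euclidean.
Context {R : realType}.

Definition edot n (u v : 'rV[R]_n) : R := \sum_(i < n) u 0 i * v 0 i.

Definition enorm n (u : 'rV[R]_n) : R := Num.sqrt (edot u u).

(* Integral over R^n as an iterated Lebesgue integral, the first coordinate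
   outermost; it is only applied to continuous compactly supported functions. *)
Fixpoint integral_rV n : ('rV[R]_n -> R) -> R :=
  match n with
  | 0 => fun f => f 0
  | n'.+1 => fun f =>
      \int[lebesgue_measure]_(t in setT)
        integral_rV (fun v : 'rV[R]_n' => f (row_mx (t%:M : 'rV[R]_1) v))
  end.

End Euclidean.

Section Smoothness.
Context {R : realType} {V W : normedModType R}.

(* V is meant to be finite dimensional: all iterated directional derivatives up
   to order k exist on U, and those of order k are continuous on U. *)
Fixpoint Ck_open (k : nat) (U : set V) (f : V -> W) : Prop :=
  match k with
  | 0 => forall x, U x -> {for x, continuous f}
  | k'.+1 => forall v : V,
      (forall x, U x -> derivable f x v) /\ Ck_open k' U ('D_v f)
  end.

Definition smooth_open (U : set V) (f : V -> W) : Prop :=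
  forall k, Ck_open k U f.

(* Smoothness on an arbitrary subset A: local smooth extendability.  It only
   depends on the values of f on A. *)
Definition smooth_on (A : set V) (f : V -> W) : Prop :=
  forall p, A p -> exists U : set V, exists F : V -> W,
    [/\ open_nbhs p U, smooth_open U F & forall x, A x -> U x -> f x = F x].

End Smoothness.

Section Submanifold.
Context {R : realType} {N : nat}.
Implicit Types (M : set 'rV[R]_N) (p : 'rV[R]_N).

(* phi is an injective immersion of the open set D of R^d and a homeomorphism
   onto a relatively open subset of M.  The rows of [jacobian phi u] are the
   partial derivatives of phi at u. *)
Definition local_parametrization d M (D : set 'rV[R]_d)
    (phi : 'rV[R]_d -> 'rV[R]_N) : Prop :=
  [/\ open D, smooth_open D phi,
      forall u, D u -> row_free (jacobian phi u),
      forall u v, D u -> D v -> phi u = phi v -> u = v &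
      forall B, open B -> B `<=` D ->
        exists2 U : set 'rV[R]_N, open U & phi @` B = M `&` U].

Definition smooth_submanifold d M : Prop :=
  forall p, M p -> exists D : set 'rV[R]_d, exists phi,
    local_parametrization M D phi /\ (phi @` D) p.

(* A smooth function on M is represented by a total function on R^N, of which
   only the values on M matter. *)
Definition smooth_fun M (f : 'rV[R]_N -> R) : Prop := smooth_on M f.

Definition curve_through M p (c : R -> 'rV[R]_N) : Prop :=
  c 0 = p /\
  exists2 U : set R, open_nbhs 0 U & smooth_open U c /\ c @` U `<=` M.

Definition tangent_space M p : set 'rV[R]_N :=
  [set derive1 c 0 | c in curve_through M p].

Definition is_gradient M (f : 'rV[R]_N -> R) p (g : 'rV[R]_N) : Prop :=
  tangent_space M p g /\
  forall c, curve_through M p c -> derive1 (f \o c) 0 = edot g (derive1 c 0).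

Definition gradient M (f : 'rV[R]_N -> R) p : 'rV[R]_N :=
  xget 0 [set g | is_gradient M f p g].

(* sup over M of the norm of the gradient; a genuine (finite) supremum when M is
   compact and nonempty and f is smooth on M. *)
Definition gradient_sup_norm M (f : 'rV[R]_N -> R) : R :=
  sup [set enorm (gradient M f p) | p in M].

Definition path_in M (x y : 'rV[R]_N) (c : R -> 'rV[R]_N) : Prop :=
  [/\ smooth_on (`[0, 1] : set R) c, c @` `[0, 1] `<=` M, c 0 = x & c 1 = y].

Definition path_length (c : R -> 'rV[R]_N) : R :=
  \int[lebesgue_measure]_(t in `[0, 1]) enorm (derive1 c t).

Definition riemannian_dist M (x y : 'rV[R]_N) : R :=
  inf [set path_length c | c in path_in M x y].

(* sqrt(det(g_ij)), with g_ij the induced Riemannian metric in the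
   parametrization phi. *)
Definition volume_density d (phi : 'rV[R]_d -> 'rV[R]_N) (u : 'rV[R]_d) : R :=
  Num.sqrt (\det (jacobian phi u *m (jacobian phi u)^T)).

Definition partition_of_unity d M n (D : 'I_n -> set 'rV[R]_d)
    (phi : 'I_n -> 'rV[R]_d -> 'rV[R]_N) (rho : 'I_n -> 'rV[R]_N -> R) : Prop :=
  [/\ forall i, local_parametrization M (D i) (phi i),
      forall i, smooth_fun M (rho i),
      forall i p, M p -> 0 <= rho i p,
      forall p, M p -> \sum_(i < n) rho i p = 1 &
      forall i, exists K : set 'rV[R]_d, [/\ compact K, K `<=` D i &
        forall p, M p -> ~ (phi i @` K) p -> rho i p = 0]].

Definition is_integral d M (f : 'rV[R]_N -> R) (s : R) : Prop :=
  exists n : nat, exists D : 'I_n -> set 'rV[R]_d,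
  exists phi : 'I_n -> 'rV[R]_d -> 'rV[R]_N,
  exists rho : 'I_n -> 'rV[R]_N -> R,
    partition_of_unity M D phi rho /\
    s = \sum_(i < n) integral_rV
          ((fun u => rho i (phi i u) * f (phi i u) * volume_density (phi i) u)
             \_ (D i)).

(* Integral over the compact d-dimensional submanifold M of a function
   continuous on M, against the Riemannian volume: the sum in [is_integral] does
   not depend on the partition of unity. *)
Definition integral_on d M (f : 'rV[R]_N -> R) : R :=
  xget 0 [set s | is_integral d M f s].

Definition L2_inner d M (f g : 'rV[R]_N -> R) : R :=
  integral_on d M (fun p => f p * g p).

(* h = Delta_M g on M, where Delta_M has nonpositive spectrum. *)
Definition is_laplacian d M (g h : 'rV[R]_N -> R) : Prop :=
  [/\ smooth_fun M g, smooth_fun M h &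
      forall f, smooth_fun M f ->
        integral_on d M (fun p => f p * h p) =
        - integral_on d M (fun p => edot (gradient M f p) (gradient M g p))].

Definition is_eigenfunction d M (mu : R) (g : 'rV[R]_N -> R) : Prop :=
  is_laplacian d M g (fun p => mu * g p).

(* lam i, for i in I, are the nonzero eigenvalues of Delta_M repeated with
   multiplicity, and the e i are corresponding orthonormal eigenfunctions: for
   every mu != 0 the e i with lam i = mu form a basis of the mu-eigenspace.
   I is an initial segment of {1, 2, ...}: all of it if d > 0, and empty if M is
   a point. *)
Record nonzero_eigensystem d M (I : set nat) (lam : nat -> R)
    (e : nat -> 'rV[R]_N -> R) : Prop := {
  eigen_index_gt0 : forall i, I i -> (0 < i)%N ;
  eigen_index_initial : forall i j, I j -> (0 < i <= j)%N -> I i ;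
  eigen_neq0 : forall i, I i -> lam i != 0 ;
  eigen_nonincreasing :
    forall i j, I i -> I j -> (i <= j)%N -> lam j <= lam i ;
  eigen_eigenfunction : forall i, I i -> is_eigenfunction d M (lam i) (e i) ;
  eigen_orthonormal :
    forall i j, I i -> I j -> L2_inner d M (e i) (e j) = (i == j)%:R ;
  eigen_multiplicity : forall mu g, mu != 0 -> is_eigenfunction d M mu g ->
    exists s : seq nat, exists a : nat -> R,
      (forall i, i \in s -> I i /\ lam i = mu) /\
      (forall p, M p -> g p = \sum_(i <- s) a i * e i p)
}.

Definition truncated_dist d M (I : set nat) (e : nat -> 'rV[R]_N -> R) (q : nat)
    (x y : 'rV[R]_N) : R :=
  sup [set `|f x - f y| | f in
    [set f | [/\ smooth_fun M f, gradient_sup_norm M f <= 1 &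
      forall i, I i -> (q < i)%N -> L2_inner d M f (e i) = 0]]].

End Submanifold.

(* Main.v *)
Require Import Defs.
From HB Require Import structures.
From mathcomp Require Import all_boot all_order all_algebra.
From mathcomp Require Import all_classical all_reals all_analysis.
From mathcomp Require Import ring lra.
Set Implicit Arguments.
Unset Strict Implicit.
Unset Printing Implicit Defensive.
Import Order.TTheory GRing.Theory Num.Theory.
Import numFieldNormedType.Exports.
Local Open Scope classical_set_scope.
Local Open Scope ring_scope.

(* If |grad f| <= 1, integrating along paths gives |f x - f y| <= dist_M(x, y); hence dist_{M;q} <= dist_M
   for every q.

   Conversely, nearby points p, q of M are joined by the image of a segment in a chart, of length at most
   (1 + eps) |q - p|. So the function r = dist_M(x, .) is locally (1 + eps)-Lipschitz for the Euclidean
   distance, and it is uniformly approximated by a smooth function with gradient at most 1 + 3 eps, namely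
   the soft minimum - h ln (sum_j chi_j exp (- phi_j / h)) over a fine net (p_j) of
   phi_j z = r p_j + (1 + eps) sqrt (|z - p_j|^2 + s^2) + c |z - p_j|^2, with cutoffs chi_j: the last term of
   phi_j makes the derivatives of the cutoffs negligible.

   It remains to remove from a smooth f its components along the e_i with i > q. With X_a f the a-th
   coordinate of grad f, the operator L = 1 - Delta is 1 - sum_a (X_a X_a + H_a X_a), where - H_a - X_a is the
   adjoint of X_a; as the X_a are closed under commutators over the smooth functions, Sobolev norms defined
   by words in the X_a satisfy |u|_(s+1) <= C (|u|_s + |L u|_s). With the Sobolev inequality, this bounds all
   X_w e_i by powers of 1 + |lam_i|; Bessel's inequality then gives i <= C (1 + |lam_i|)^k, and the
   coefficients of f decay faster than any power of lam_i. So the tail of the expansion of f is smooth and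
   small in C^1, and a rescaling of f minus this tail is admissible. Completeness of the e_i is not needed.

   The integral on M is handled through its action on the concentrated kernels beta (|p - q|^2 / s^2), which
   determines a bounded functional on C(M): this gives the independence of the partition of unity. *)

(** [integral_on] picks one of the sums given by all partitions of unity, so that neither linearity
    nor any computation is available before these sums are known to agree. Testing on a kernel of
    width s settles this: as s tends to 0 the charts become linear, the only change of variables
    left is the one for a quadratic form, and the volume density cancels exactly. The global
    derivations X_a keep every operator defined on all of M. The price is that adjoints and
    commutators produce lower order terms; the estimates are arranged so that these terms are always
    one order below the leading one and can be absorbed. Of the distance r, the smoothing uses only
    the inequality r q <= r p + (1 + eps) |q - p| between nearby points. It also carries the strict
    part of the argument: charts are only almost isometric after a linear change, and the factor 1 +
    eps, then 1 + 3 eps for the gradient and 1 + 4 eps after truncation, is removed at the very end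
    by rescaling. *)

Lemma scaleRE {R : realType} (a b : R) : (a *: (b : R^o) : R) = a * b.
Proof. by []. Qed.

(** * Smooth functions *)

Section DirectionalDerivative.
Context {R : realType} {V W : normedModType R}.
Implicit Types (f : V -> W) (x v w : V).

Lemma is_derive_line f x v t :
  derivable f (x + t *: v) v ->
  is_derive t 1 (fun s : R => f (x + s *: v)) ('D_v f (x + t *: v)).
Proof.
move=> df.
have E : (fun h : R => h^-1 *: (f (h *: v + (x + t *: v)) - f (x + t *: v))) =
  (fun h : R => h^-1 *: (((fun s : R => f (x + s *: v)) \o shift t) (h *: 1) - f (x + t *: v))).
  apply/funext => h /=; congr (_ *: (f _ - _)).
  by rewrite [h%:A]mulr1 scalerDl addrCA.
split.
- by rewrite /derivable -E.
- by rewrite /derive -E.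
Qed.

(** Derivability is assumed in the single direction v. On the line through x it becomes
    differentiability of a function of one variable, to which the chain rule with multiplication by
    a applies. *)
Lemma derivableZv f x v (a : R) : derivable f x v -> derivable f x (a *: v) /\
  'D_(a *: v) f x = a *: 'D_v f x.
Proof.
move=> df; have [->|a0] := eqVneq a 0.
  by rewrite !scale0r; split; [exact: derivable0|exact: derive0].
have H := is_derive_line (f := f) (x := x) (v := v) (t := 0).
rewrite scale0r addr0 in H; move: {H}(H df) => H.
pose g := fun s : R => f (x + s *: v).
have dg : derivable g 0 1 by case: H.
have /derivable1_diffP dg' := dg.
have dg2 : is_derive (0:R) (1:R) (g \o ( *:%R^~ a : R -> R)) (a *: 'D_v f x).
  apply: DeriveDef.
    apply/derivable1_diffP; apply: differentiable_comp.
      by apply: differentiableZl.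
    by rewrite scale0r.
  rewrite deriveE; last first.
    apply: differentiable_comp; last by rewrite scale0r.
    exact: differentiableZl.
  rewrite diff_comp; [|exact: differentiableZl|by rewrite scale0r].
  rewrite /= scale0r diff_val /= scale1r.
  have := diff1E dg'; rewrite derive1E => ->; congr (_ *: _).
  by rewrite -derive1E derive1E; case: H.
have E : (fun h : R => h^-1 *: (f (h *: (a *: v) + x) - f x)) =
  (fun h : R => h^-1 *: (((g \o ( *:%R^~ a : R -> R)) \o shift 0) (h *: 1) - (g \o ( *:%R^~ a : R -> R)) 0)).
  apply/funext => h /=; rewrite /g /= addr0 scale0r [0 *: _]scale0r addr0; congr (_ *: (f _ - _)).
  by rewrite [h%:A]mulr1 [h *: a]/(h * a) -scalerA addrC.
case: dg2 => d1 d2; split; first by rewrite /derivable E.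
by rewrite -d2 /derive E.
Qed.

End DirectionalDerivative.

Section Smooth.
Context {R : realType} {V W : normedModType R}.
Implicit Types (f g : V -> W) (U : set V).

Lemma open_near U (P : V -> Prop) x : open U -> U x -> (forall y, U y -> P y) ->
  \forall y \near x, P y.
Proof. by move=> oU Ux H; apply: filterS H _; exact: open_nbhs_nbhs. Qed.

Lemma Ck_ext k U f g : open U -> (forall x, U x -> f x = g x) ->
  Ck_open k U f -> Ck_open k U g.
Proof.
move=> oU; elim: k f g => [|k IH] f g fg /=.
  move=> H x Ux; rewrite /prop_for /continuous_at -(fg x Ux).
  apply: cvg_trans (H x Ux); apply: near_eq_cvg.
  exact: (open_near oU Ux fg).
move=> H v; have [d c] := H v; split.
  move=> x Ux; apply: near_eq_derivable (d x Ux).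
  exact: (open_near oU Ux fg).
apply: IH c => x Ux; apply: near_eq_derive.
exact: (open_near oU Ux fg).
Qed.

Lemma smooth_ext U f g : open U -> (forall x, U x -> f x = g x) ->
  smooth_open U f -> smooth_open U g.
Proof. by move=> oU fg H k; apply: Ck_ext (H k). Qed.

Lemma smooth_sub U U' f : U' `<=` U -> smooth_open U f -> smooth_open U' f.
Proof.
move=> sU H k; move: (H k) => {H}; elim: k f => [|k IH] f /=.
  by move=> H x /sU; exact: H.
move=> H v; have [d c] := H v; split; last exact: IH.
by move=> x /sU; exact: d.
Qed.

Lemma smooth_local U f :
  (forall x, U x -> exists U', [/\ open U', U' x & smooth_open U' f]) ->
  smooth_open U f.
Proof.
move=> H k.
have {}H x : U x -> exists U', [/\ open U', U' x & Ck_open k U' f].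
  by move=> /H[U' [? ? s]]; exists U'; split.
elim: k f H => [|k IH] f H /=.
  by move=> x /H[U' [oU' U'x]]; exact.
move=> v; split.
  by move=> x /H[U' [oU' U'x /(_ v)[d _]]]; exact: d.
apply: IH => x /H[U' [oU' U'x /(_ v)[d c]]].
by exists U'.
Qed.

Lemma smooth_cont U f x : smooth_open U f -> U x -> {for x, continuous f}.
Proof. by move=> /(_ 0); exact. Qed.

Lemma smooth_derivable U f x v : smooth_open U f -> U x -> derivable f x v.
Proof. by move=> /(_ 1 v)[d _]; exact: d. Qed.

Lemma smooth_derive U f v : smooth_open U f -> smooth_open U ('D_v f).
Proof. by move=> H k; have [_] := H k.+1 v. Qed.

(** Coinduction: a class of continuous functions closed under directional derivatives consists of
    smooth functions. Enlarging the class until it is closed replaces Leibniz or Faa di Bruno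
    formulas of all orders. *)
Lemma smooth_coind (P : (V -> W) -> Prop) U : open U ->
  (forall f, P f -> (forall x, U x -> {for x, continuous f}) /\
    forall v, exists2 g, P g & forall x, U x -> is_derive x v f (g x)) ->
  forall f, P f -> smooth_open U f.
Proof.
move=> oU H f Pf k; elim: k f Pf => [|k IH] f Pf /=; first by have [] := H f Pf.
have [_ Hv] := H f Pf => v; have [g Pg dg] := Hv v; split.
  by move=> x /dg[].
apply: (Ck_ext oU _ (IH g Pg)) => x Ux.
by have [_ ->] := dg x Ux.
Qed.

End Smooth.

Section SmoothScalar.
Context {R : realType} {V : normedModType R}.
Implicit Types (f g : V -> R) (U : set V) (x v w : V).

Lemma smooth_cst {W : normedModType R} U (a : W) : open U -> smooth_open U (fun _ : V => a).
Proof.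
move=> oU; refine (@smooth_coind _ V W (fun h => exists a, h = fun _ => a) U oU _ _ (ex_intro _ a erefl)).
move=> _ [b ->]; split; first by move=> x _; exact: cst_continuous.
move=> v; exists (fun _ => 0); first by exists 0.
by move=> x _; exact: is_derive_cst.
Qed.

(** Products of smooth functions are not closed under derivation, but sums of such products are, as
    [smooth_coind] requires. *)
Inductive sumprod U : (V -> R) -> Prop :=
| sp_mul f g : smooth_open U f -> smooth_open U g -> sumprod U (fun x => f x * g x)
| sp_add f g : sumprod U f -> sumprod U g -> sumprod U (fun x => f x + g x).

Lemma sumprod_smooth U f : open U -> sumprod U f -> smooth_open U f.
Proof.
move=> oU; move: f; refine (@smooth_coind _ V R (sumprod U) U oU _) => f; elim=> {f}.
  move=> f g sf sg; split.
    by move=> x Ux; apply: continuousM; [exact: smooth_cont sf Ux|exact: smooth_cont sg Ux].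
  move=> v; exists (fun x => f x * 'D_v g x + g x * 'D_v f x).
    by apply: sp_add; apply: sp_mul => //; exact: smooth_derive.
  move=> x Ux; apply: is_deriveM; apply: derivableP.
    exact: smooth_derivable sf Ux.
  exact: smooth_derivable sg Ux.
move=> f g _ [cf df] _ [cg dg]; split.
  by move=> x Ux; apply: continuousD; [exact: cf|exact: cg].
move=> v; have [f' Pf' df'] := df v; have [g' Pg' dg'] := dg v.
exists (fun x => f' x + g' x); first exact: sp_add.
by move=> x Ux; apply: is_deriveD; [exact: df'|exact: dg'].
Qed.

Lemma smoothM U f g : open U -> smooth_open U f -> smooth_open U g ->
  smooth_open U (fun x => f x * g x).
Proof. by move=> oU sf sg; apply: sumprod_smooth => //; exact: sp_mul. Qed.

Lemma smoothD U f g : open U -> smooth_open U f -> smooth_open U g ->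
  smooth_open U (fun x => f x + g x).
Proof.
move=> oU sf sg.
have := sp_add (sp_mul sf (smooth_cst (1 : R) oU)) (sp_mul sg (smooth_cst (1 : R) oU)).
move=> /(sumprod_smooth oU); apply: smooth_ext => // x Ux.
by rewrite !mulr1.
Qed.

Lemma smoothZ U (a : R) f : open U -> smooth_open U f -> smooth_open U (fun x => a * f x).
Proof. by move=> oU; apply: smoothM => //; exact: smooth_cst. Qed.

Lemma smoothN U f : open U -> smooth_open U f -> smooth_open U (fun x => - f x).
Proof.
move=> oU sf; apply: (smooth_ext oU _ (smoothZ (-1) oU sf)) => x _.
by rewrite mulN1r.
Qed.

Lemma smoothB U f g : open U -> smooth_open U f -> smooth_open U g ->
  smooth_open U (fun x => f x - g x).
Proof. by move=> oU sf sg; apply: smoothD => //; exact: smoothN. Qed.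

Lemma smooth_sum U (I : Type) (r : seq I) (f : I -> V -> R) : open U ->
  (forall i, smooth_open U (f i)) -> smooth_open U (fun x => \sum_(i <- r) f i x).
Proof.
move=> oU sf; elim: r => [|i r IH].
  by apply: (smooth_ext oU _ (smooth_cst (0 : R) oU)) => x _; rewrite big_nil.
by apply: (smooth_ext oU _ (smoothD oU (sf i) IH)) => x _; rewrite big_cons.
Qed.

Lemma smooth_prod U (I : Type) (r : seq I) (f : I -> V -> R) : open U ->
  (forall i, smooth_open U (f i)) -> smooth_open U (fun x => \prod_(i <- r) f i x).
Proof.
move=> oU sf; elim: r => [|i r IH].
  by apply: (smooth_ext oU _ (smooth_cst (1 : R) oU)) => x _; rewrite big_nil.
by apply: (smooth_ext oU _ (smoothM oU (sf i) IH)) => x _; rewrite big_cons.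
Qed.

Lemma MVT_line f x v :
  (forall t : R, 0 <= t <= 1 -> derivable f (x + t *: v) v) ->
  exists2 t : R, 0 <= t <= 1 & f (x + v) - f x = 'D_v f (x + t *: v).
Proof.
move=> df.
have [] := @MVT_segment R (fun t => f (x + t *: v)) (fun t => 'D_v f (x + t *: v)) 0 1 ler01.
- by move=> t; rewrite in_itv /= => /andP[/ltW t0 /ltW t1]; apply: is_derive_line; apply: df; rewrite t0.
- apply: continuous_in_subspaceT => t; rewrite inE /= in_itv /= => t01.
  have [d _] := is_derive_line (df t t01).
  by apply: differentiable_continuous; apply/derivable1_diffP.
move=> t t01; rewrite scale1r scale0r addr0 subr0 mulr1 => E.
by exists t => //; move: t01; rewrite in_itv.
Qed.

End SmoothScalar.

(** * Row vectors: sup norm and Euclidean product *)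

Section RowNorm.
Context {R : realType}.

Lemma coord_le_norm n (u : 'rV[R]_n) i : `|u 0 i| <= `|u|.
Proof.
rewrite [leRHS]/Num.Def.normr /= mx_normrE.
exact: (le_bigmax _ (fun ij : 'I_1 * 'I_n => `|u ij.1 ij.2|) (0, i)).
Qed.

Lemma norm_le_coord n (u : 'rV[R]_n) c : 0 <= c -> (forall i, `|u 0 i| <= c) -> `|u| <= c.
Proof.
move=> c0 H; rewrite [leLHS]/Num.Def.normr /= mx_normrE; apply: bigmax_le => // -[i j] _ /=.
by rewrite ord1; exact: H.
Qed.

Lemma edotC n (u v : 'rV[R]_n) : edot u v = edot v u.
Proof. by apply: eq_bigr => i _; rewrite mulrC. Qed.

Lemma edotDr n (u v w : 'rV[R]_n) : edot u (v + w) = edot u v + edot u w.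
Proof. by rewrite -big_split; apply: eq_bigr => i _; rewrite !mxE mulrDr. Qed.

Lemma edotZr n a (u v : 'rV[R]_n) : edot u (a *: v) = a * edot u v.
Proof. by rewrite /edot mulr_sumr; apply: eq_bigr => i _; rewrite !mxE mulrCA. Qed.

Lemma edotE n (u v : 'rV[R]_n) : edot u v = (u *m v^T) 0 0.
Proof. by rewrite mxE; apply: eq_bigr => i _; rewrite !mxE. Qed.

Lemma edot_linear n (a : 'rV[R]_n) : linear (edot a : 'rV[R]_n -> R^o).
Proof. by move=> k u v; rewrite edotDr edotZr. Qed.

Definition edot_lin n (a : 'rV[R]_n) : {linear 'rV[R]_n -> R^o} :=
  HB.pack (edot a : 'rV[R]_n -> R^o) (GRing.isLinear.Build _ _ _ _ _ (@edot_linear n a)).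

Lemma edot_le n (a v : 'rV[R]_n) : `|edot a v| <= (\sum_i `|a 0 i|) * `|v|.
Proof.
rewrite /edot (le_trans (ler_norm_sum _ _ _)) // mulr_suml.
by apply: ler_sum => i _; rewrite normrM ler_wpM2l // coord_le_norm.
Qed.

Lemma edot_lin_continuous n (a : 'rV[R]_n) : continuous (edot_lin a).
Proof.
apply: (@bounded_linear_continuous R 'rV[R]_n R^o (edot_lin a)).
apply/linear_boundedP; near=> M => x.
apply: (le_trans (edot_le a x)); rewrite ler_wpM2r //.

Unshelve. all: by end_near. Qed.

End RowNorm.

(** * From directional derivatives to strict differentiability *)

Section Differentiability.
Context {R : realType} {V W : normedModType R}.

Lemma differentiable_approx (f : V -> W) (df : {linear V -> W}) x :
  continuous df ->
  (forall eps : R, 0 < eps -> \forall h \near 0, `|f (h + x) - f x - df h| <= eps * `|h|) ->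
  differentiable f x /\ 'd f x = df :> (V -> W).
Proof.
move=> dfc H.
have E : f \o shift x = cst (f x) + df +o_ 0 id.
  apply/eqaddoP => eps e0; move: (H eps e0); apply: filterS => h.
  by rewrite /= opprD addrA.
have D := diff_unique dfc E; split=> //.
by apply/diff_locallyP; rewrite D.
Qed.

Lemma near_ball (P : V -> Prop) x : (\forall y \near x, P y) ->
  exists2 r : R, 0 < r & forall y, `|y - x| < r -> P y.
Proof.
move=> /nbhs_ballP[r /= r0 H]; exists r => // y yr; apply: H.
by rewrite -ball_normE /= distrC.
Qed.

Lemma ball_near (P : V -> Prop) x (r : R) : 0 < r -> (forall y, `|y - x| < r -> P y) ->
  \forall y \near x, P y.
Proof.
move=> r0 H; apply/nbhs_ballP; exists r => //= y.
by rewrite -ball_normE /= distrC => /H.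
Qed.

End Differentiability.

Section SmoothDifferentiable.
Context {R : realType}.

(** The increment along [h *: (v + w)] is split into [h *: v], then [h *: w]. The second part is h
    times a value of ['D_w f] at a point close to x, by the mean value theorem, and continuity of
    ['D_w f] brings that point back to x. *)
Lemma derive_additive {V : normedModType R} U (f : V -> R) x v w : open U ->
  smooth_open U f -> U x -> 'D_(v + w) f x = 'D_v f x + 'D_w f x.
Proof.
move=> oU sf Ux.
have dvw := smooth_derivable (v := v + w) sf Ux.
have dv := smooth_derivable (v := v) sf Ux.
suff H (e : R) : 0 < e -> `|'D_(v + w) f x - ('D_v f x + 'D_w f x)| <= e.
  by apply/eqP; rewrite -subr_eq0 -normr_le0; apply/ler_addgt0Pr => e /H; rewrite add0r.
move=> e0.
have e3 : 0 < e / 3 by rewrite divr_gt0.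
have cD : {for x, continuous ('D_w f)} := smooth_cont (smooth_derive w sf) Ux.
have /near_ball[r1 r10 H1] : \forall y \near x, U y /\ `|'D_w f y - 'D_w f x| < e / 3.
  apply: filterI; first exact: open_nbhs_nbhs.
  by move/cvgrPdist_lt: cD => /(_ _ e3); apply: filterS => y; rewrite distrC.
have [d1 [d10 E1]] : exists d1 : R, 0 < d1 /\ forall h : R, h != 0 -> `|h| < d1 ->
    `|h^-1 *: (f (h *: (v + w) + x) - f x) - 'D_(v + w) f x| <= e / 3.
  have /cvgrPdist_le /(_ _ e3) := dvw.
  move=> /nbhs_ballP[d /= d0 Hd]; exists d; split=> // h h0 hd.
  by rewrite distrC; apply: Hd => //=; rewrite /ball /= sub0r normrN.
have [d2 [d20 E2]] : exists d1 : R, 0 < d1 /\ forall h : R, h != 0 -> `|h| < d1 ->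
    `|h^-1 *: (f (h *: v + x) - f x) - 'D_v f x| <= e / 3.
  have /cvgrPdist_le /(_ _ e3) := dv.
  move=> /nbhs_ballP[d /= d0 Hd]; exists d; split=> // h h0 hd.
  by rewrite distrC; apply: Hd => //=; rewrite /ball /= sub0r normrN.
pose C := `|v| + `|w| + 1.
have C0 : 0 < C by rewrite /C ltr_wpDl // addr_ge0.
have [h [h0 hd1 hd2 hr]] : exists h : R, [/\ 0 < h, h < d1, h < d2 & h * C < r1].
  exists (Num.min (Num.min d1 d2) (r1 / C) / 2).
  have m0 : 0 < Num.min (Num.min d1 d2) (r1 / C) by rewrite !lt_min d10 d20 divr_gt0.
  have : Num.min (Num.min d1 d2) (r1 / C) / 2 < Num.min (Num.min d1 d2) (r1 / C).
    by rewrite ltr_pdivrMr // ltr_pMr // ltr1n.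
  by rewrite divr_gt0 // !lt_min => /andP[/andP[-> ->]]; rewrite ltr_pdivlMr.
have inU (t : R) : 0 <= t <= 1 -> `|h *: v + x + t *: (h *: w) - x| < r1.
  move=> /andP[t0 t1]; rewrite addrAC addrK; apply: le_lt_trans hr.
  rewrite (le_trans (ler_normD _ _)) // !normrZ (gtr0_norm h0) (ger0_norm t0).
  rewrite mulrCA -mulrDr ler_wpM2l ?(ltW h0) // /C -addrA lerD2l.
  rewrite (@le_trans _ _ (`|w|)) // ?lerDl //.
  by rewrite -[leRHS]mul1r ler_wpM2r.
have [t t01 Et] : exists2 t : R, 0 <= t <= 1 &
    f (h *: v + x + h *: w) - f (h *: v + x) = 'D_(h *: w) f (h *: v + x + t *: (h *: w)).
  apply: MVT_line => t /inU /H1[Uy _].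
  by have [] := derivableZv h (smooth_derivable (v := w) sf Uy).
have [Uy Dy] := H1 _ (inU t t01).
have [_] := derivableZv h (smooth_derivable (v := w) sf Uy); move: Et => /[swap] -> Et.
have := E1 h (lt0r_neq0 h0); rewrite gtr0_norm // => /(_ hd1) {}E1.
have := E2 h (lt0r_neq0 h0); rewrite gtr0_norm // => /(_ hd2) {}E2.
have Eq : h^-1 *: (f (h *: (v + w) + x) - f x) =
    'D_w f (h *: v + x + t *: (h *: w)) + h^-1 *: (f (h *: v + x) - f x).
  have -> : h *: (v + w) + x = h *: v + x + h *: w by rewrite scalerDr addrAC.
  rewrite -(subrK (f (h *: v + x)) (f (h *: v + x + h *: w))) Et -addrA scalerDr.
  by rewrite [h^-1 *: (h *: 'D_w f _)]scalerA mulVf ?lt0r_neq0 // scale1r.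
rewrite Eq in E1.
set A := 'D_(v + w) f x in E1 *; set B := 'D_v f x in E2 *; set Cc := 'D_w f x in Dy *.
set D := 'D_w f _ in E1 Dy; set Q := _ *: _ in E1 E2.
have -> : A - (B + Cc) = - (D + Q - A) + (Q - B) + (D - Cc) by ring.
rewrite (le_trans (ler_normD _ _)) // (le_trans (lerD (ler_normD _ _) (lexx _))) // normrN.
have -> : e = e / 3 + e / 3 + e / 3 by field.
by apply: lerD; [apply: lerD; [exact: E1|exact: E2]|exact: ltW].
Qed.

Definition pd n (j : 'I_n) (f : 'rV[R]_n -> R) := 'D_(delta_mx 0 j) f.

Definition grad n (f : 'rV[R]_n -> R) (x : 'rV[R]_n) : 'rV[R]_n := \row_j pd j f x.

Lemma derive_grad n U (f : 'rV[R]_n -> R) x v : open U ->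
  smooth_open U f -> U x -> 'D_v f x = edot (grad f x) v.
Proof.
move=> oU sf Ux.
have E : v = \sum_j v 0 j *: delta_mx 0 j by exact: row_sum_delta.
rewrite {1}E /edot; apply: (@etrans _ _ (\sum_j v 0 j * pd j f x)); last first.
  by apply: eq_bigr => j _; rewrite mxE mulrC.
elim: (index_enum _) => [|j r IH]; first by rewrite !big_nil derive0.
rewrite !big_cons (derive_additive _ _ oU sf Ux) IH; congr (_ + _).
by have [_ ->] := derivableZv (v 0 j) (smooth_derivable (v := delta_mx 0 j) sf Ux).
Qed.

(** In finite dimension all directional derivatives are combinations of finitely many partial
    derivatives, hence continuous uniformly in the direction. *)
Lemma smooth_grad_cont n U (f : 'rV[R]_n -> R) x : open U -> smooth_open U f -> U x ->
  forall e : R, 0 < e -> \forall y \near x, U y /\ forall v, `|'D_v f y - 'D_v f x| <= e * `|v|.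
Proof.
move=> oU sf Ux e e0.
have : \forall y \near x, U y /\ forall j, `|pd j f y - pd j f x| < e / (n%:R + 1).
  apply: filterI; first exact: open_nbhs_nbhs.
  apply: (@filter_forall _ _ (fun j => [set y | `|pd j f y - pd j f x| < e / (n%:R + 1)]) (nbhs x) _) => j.
  have := smooth_cont (smooth_derive (delta_mx 0 j) sf) Ux.
  move/cvgrPdist_lt => /(_ (e / (n%:R + 1))); rewrite divr_gt0 ?ltr_wpDl // => /(_ isT).
  by apply: filterS => y; rewrite distrC.
apply: filterS => y [Uy Hy]; split=> // v.
rewrite !(derive_grad v oU sf) // -sumrB.
rewrite (le_trans (ler_norm_sum _ _ _)) //.
apply: (@le_trans _ _ (\sum_(i < n) e / (n%:R + 1) * `|v|)).
  apply: ler_sum => i _; rewrite -mulrBl normrM !mxE.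
  by rewrite ler_pM // ?coord_le_norm // ltW.
rewrite sumr_const card_ord -mulrnAl ler_wpM2r // -mulr_natr -mulrA ler_piMr ?ltW //.
rewrite mulrC ltr_pdivrMr ?ltr_wpDl // mul1r ltrDl //.
Qed.

(** Strict differentiability: both points vary while the derivative stays at x. This uniformity is
    what the local inverse, the kernel limits and the short paths rely on. *)
Lemma smooth_strict n U (f : 'rV[R]_n -> R) x : open U -> smooth_open U f -> U x ->
  forall e : R, 0 < e -> exists2 r, 0 < r & forall y z, `|y - x| < r -> `|z - x| < r ->
    [/\ U y, U z & `|f y - f z - 'D_(y - z) f x| <= e * `|y - z|].
Proof.
move=> oU sf Ux e e0; have /near_ball[r r0 H] := smooth_grad_cont oU sf Ux e0.
exists r => // y z yr zr; split; [by have [] := H _ yr|by have [] := H _ zr|].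
have inB (t : R) : 0 <= t <= 1 -> `|z + t *: (y - z) - x| < r.
  move=> /andP[t0 t1].
  have -> : z + t *: (y - z) - x = t *: (y - x) + (1 - t) *: (z - x).
    rewrite !scalerBr !scalerBl !scale1r; apply/rowP => i; rewrite !mxE; ring.
  rewrite (le_lt_trans (ler_normD _ _)) // !normrZ (ger0_norm t0) ger0_norm ?subr_ge0 //.
  have -> : r = t * r + (1 - t) * r by ring.
  have [->|tn] := eqVneq t 0; first by rewrite !mul0r !add0r subr0 !mul1r.
  by rewrite ltr_leD ?ltr_pM2l ?lt0r ?tn // ler_wpM2l ?subr_ge0 // ltW.
have [t t01] : exists2 t : R, 0 <= t <= 1 &
    f (z + (y - z)) - f z = 'D_(y - z) f (z + t *: (y - z)).
  by apply: MVT_line => t /inB /H[Uy _]; exact: smooth_derivable sf Uy.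
rewrite subrKC => ->.
by have [_] := H _ (inB t t01).
Qed.

Lemma smooth_differentiable n U (f : 'rV[R]_n -> R) x : open U -> smooth_open U f -> U x ->
  differentiable f x.
Proof.
move=> oU sf Ux.
have [] // := @differentiable_approx R 'rV[R]_n R^o f (edot_lin (grad f x)) x.
  exact: edot_lin_continuous.
move=> e e0; have [r r0 H] := smooth_strict oU sf Ux e0.
apply: (@ball_near R _ _ 0 r) => // h; rewrite subr0 => hr.
have [||_ _] := H (h + x) x; rewrite ?addrK ?subrr ?normr0 //.
by rewrite (derive_grad _ oU sf Ux).
Qed.

Lemma derive_line {V W : normedModType R} (f : V -> W) x v :
  'D_1 (fun t : R => f (t *: v + x)) 0 = 'D_v f x.
Proof.
have E : (fun h : R => h^-1 *: (f ((h *: 1 + 0) *: v + x) - f (0 *: v + x))) =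
         (fun h : R => h^-1 *: (f (h *: v + x) - f x)).
  by apply/funext => h; rewrite scale0r add0r addr0 [h%:A]mulr1.
by rewrite /derive /= E.
Qed.

(** G is only derivable in one direction, so both maps are restricted to the line through x, where
    differentiable maps compose. *)
Lemma chain_rule {V U W : normedModType R} (F : U -> W) (G : V -> U) x v :
  differentiable F (G x) -> derivable G x v ->
  is_derive x v (F \o G) ('D_('D_v G x) F (G x)).
Proof.
move=> dF dG.
pose g := fun t : R => G (t *: v + x).
have E0 : g 0 = G x by rewrite /g scale0r add0r.
have dg : derivable g 0 1 by move/derivable1P: dG.
have Dg : 'D_1 g 0 = 'D_v G x by rewrite derive_line.
have dg' : differentiable g 0 by apply/derivable1_diffP.
have dF' : differentiable F (g 0) by rewrite E0.
have d2 : differentiable (F \o g) 0 by exact: differentiable_comp.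
split.
  apply/derivable1P; apply/derivable1_diffP; exact: d2.
have -> : 'D_v (F \o G) x = 'D_1 (F \o g) 0.
  by rewrite -(derive_line (F \o G)).
have E1 : 'D_1 (F \o g) 0 = 'd F (g 0) ('d g 0 (1 : R)) by rewrite (deriveE (1 : R) d2) (diff_comp dg' dF').
rewrite E1 -(deriveE (1 : R) dg') Dg E0.
by rewrite -(deriveE _ dF).
Qed.

Lemma chain_rule1 {V : normedModType R} (F : R -> R) (G : V -> R) x v :
  derivable F (G x) 1 -> derivable G x v ->
  is_derive x v (F \o G) ('D_1 F (G x) * 'D_v G x).
Proof.
move=> dF dG; have dF' : differentiable (F : R^o -> R^o) (G x) by apply/derivable1_diffP.
apply: (is_derive_eq (@chain_rule V R^o R^o F G x v dF' dG)).
have [_ E] := @derivableZv R R^o R^o F (G x) 1 ('D_v G x) dF.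
by rewrite mulrC -[RHS]E scaleRE mulr1.
Qed.

End SmoothDifferentiable.

(** * Smooth vector-valued maps and composition *)

Section SmoothVector.
Context {R : realType}.

Lemma rV_continuous_at {V : topologicalType} m (f : V -> 'rV[R]_m) x :
  (forall j, {for x, continuous (fun y => f y 0 j)}) -> {for x, continuous f}.
Proof.
move=> H; apply/cvgrPdist_le => e e0.
suff : \forall y \near x, forall j, `|f x 0 j - f y 0 j| <= e.
  apply: filterS => y Hy; apply: norm_le_coord; first exact: ltW.
  by move=> i; rewrite !mxE.
apply: (@filter_forall _ _ (fun j => [set y | `|f x 0 j - f y 0 j| <= e]) (nbhs x) _) => j.
by have /cvgrPdist_le := H j; apply.
Qed.

Lemma smooth_coord {V : normedModType R} m U (f : V -> 'rV[R]_m) j : open U ->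
  smooth_open U f -> smooth_open U (fun x => f x 0 j).
Proof.
move=> oU sf k; move: (sf k) => {sf}; elim: k f => [|k IH] f /=.
  move=> H x Ux; have c := H x Ux.
  by apply: (@continuous_comp _ _ _ f (fun u : 'rV[R]_m => u 0 j)) => //; exact: coord_continuous.
move=> H v; have [d c] := H v; split.
  by move=> x Ux; have /derivable_mxP := d x Ux; apply.
apply: (Ck_ext oU _ (IH _ c)) => x Ux /=.
by rewrite (derive_mx (d x Ux)) mxE.
Qed.

Lemma smooth_rV {V : normedModType R} m U (f : V -> 'rV[R]_m) : open U ->
  (forall j, smooth_open U (fun x => f x 0 j)) -> smooth_open U f.
Proof.
move=> oU sf k; have {}sf j := sf j k; elim: k f sf => [|k IH] f sf /=.
  by move=> x Ux; apply: rV_continuous_at => j; exact: sf.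
move=> v.
have df x : U x -> derivable f x v.
  move=> Ux; apply/derivable_mxP => i j; rewrite ord1.
  by have [d _] := sf j v; exact: d.
split=> //; apply: IH => j.
have [_ c] := sf j v; apply: (Ck_ext oU _ c) => x Ux.
by rewrite (derive_mx (df x Ux)) mxE.
Qed.

Lemma smooth_proj m (U : set 'rV[R]_m) j : open U -> smooth_open U (fun x : 'rV[R]_m => x 0 j).
Proof.
move=> oU.
refine (@smooth_coind _ _ R^o (fun f => exists a b : R, f = fun x : 'rV[R]_m => a * x 0 j + b) U oU _ _ _).
  move=> _ [a [b ->]]; split.
    move=> x _; apply: continuousD; last exact: cst_continuous.
    apply: continuousM; [exact: cst_continuous|exact: coord_continuous].
  move=> v; exists (fun _ => a * v 0 j).
    by exists 0, (a * v 0 j); apply/funext => x; rewrite mul0r add0r.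
  move=> x _.
  have d : is_derive x v (fun x : 'rV[R]_m => x 0 j) (v 0 j).
    split; first by apply: diff_derivable; exact: differentiable_coord.
    rewrite /derive; apply: lim_near_cst => //; near=> h.
    rewrite /= !mxE addrK [_ *: _]mulrA mulVf ?mul1r //.
    by near: h; exact: nbhs_dnbhs_neq.
  have := is_deriveD (is_deriveZ a d) (is_derive_cst b x v).
  by rewrite addr0.
exists 1, 0; apply/funext => x; by rewrite mul1r addr0.
Unshelve. all: by end_near. Qed.

Section Jac.
Context {n m : nat} (U : set 'rV[R]_n) (f : 'rV[R]_n -> 'rV[R]_m) (x : 'rV[R]_n).
Hypotheses (oU : open U) (sf : smooth_open U f) (Ux : U x).

Let J : 'M[R]_(n, m) := \matrix_(i, j) pd i (fun y => f y 0 j) x.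

Let JE v : v *m J = \row_j 'D_v (fun y => f y 0 j) x.
Proof.
apply/rowP => j; rewrite !mxE (derive_grad v oU (smooth_coord j oU sf) Ux).
by apply: eq_bigr => i _; rewrite !mxE mulrC.
Qed.

Lemma smooth_strictV : forall e : R, 0 < e -> exists2 r : R, 0 < r & forall y z,
   `|y - x| < r -> `|z - x| < r ->
    [/\ U y, U z & `|f y - f z - (y - z) *m J| <= e * `|y - z|].
Proof.
move=> e e0.
have H j := smooth_strict oU (smooth_coord j oU sf) Ux e0.
have : \forall r \near (0:R)^'+, forall j, forall y z, `|y - x| < r -> `|z - x| < r ->
    [/\ U y, U z & `|f y 0 j - f z 0 j - 'D_(y - z) (fun y => f y 0 j) x| <= e * `|y - z|].
  apply: (@filter_forall _ _ (fun j => [set r : R | forall y z, `|y - x| < r -> `|z - x| < r ->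
    [/\ U y, U z & `|f y 0 j - f z 0 j - 'D_(y - z) (fun y => f y 0 j) x| <= e * `|y - z|]])
    ((0:R)^'+) _) => j /=.
  have [r r0 {}H] := H j; near=> s => y z ys zs; apply: H.
    by apply: lt_trans ys _; near: s; exact: nbhs_right_lt.
  by apply: lt_trans zs _; near: s; exact: nbhs_right_lt.
move=> Hn.
have Un : \forall r \near (0:R)^'+, forall y, `|y - x| < r -> U y.
  have /near_ball[s s0 Hs] : \forall y \near x, U y by exact: open_nbhs_nbhs.
  near=> r => y yr; apply: Hs; apply: lt_trans yr _; near: r; exact: nbhs_right_lt.
near (0:R)^'+ => r; exists r => // y z yr zr.
have Uy : U y by move: y yr; near: r.
have Uz : U z by move: z zr; near: r.
split=> //; rewrite JE.
apply: norm_le_coord => [|j]; first by rewrite mulr_ge0 // ltW.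
rewrite !mxE.
suff [] : [/\ U y, U z & `|f y 0 j - f z 0 j - 'D_(y - z) (fun y => f y 0 j) x| <= e * `|y - z|] by [].
by move: j y z yr zr Uy Uz; near: r; apply: filterS Hn => r Hr j y z yr zr _ _; exact: Hr.
Unshelve. all: by end_near. Qed.

Lemma smooth_differentiableV : differentiable f x.
Proof.
have [] // := @differentiable_approx R 'rV[R]_n 'rV[R]_m f (mulmxr J : {linear 'rV[R]_n -> 'rV[R]_m}) x.
  move=> v; apply: rV_continuous_at => j.
  have -> : (fun y => mulmxr J y 0 j) = edot_lin (\row_i J i j).
    apply/funext => y /=; rewrite mxE /edot; apply: eq_bigr => i _.
    by rewrite [in RHS]mxE mulrC.
  exact: edot_lin_continuous.
move=> e e0; have [r r0 H] := smooth_strictV e0.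
apply: (@ball_near R _ _ 0 r) => // h; rewrite subr0 => hr.
by have [||_ _] := H (h + x) x; rewrite ?addrK ?subrr ?normr0.
Qed.

Lemma jacobianE : jacobian f x = J.
Proof.
apply/row_matrixP => i; rewrite !rowE -deriveEjacobian; last exact: smooth_differentiableV.
apply/rowP => j; rewrite derive_mx; last exact: smooth_derivable sf Ux.
by rewrite -rowE !mxE.
Qed.

Lemma smooth_strict_jac : forall e : R, 0 < e -> exists2 r : R, 0 < r & forall y z,
   `|y - x| < r -> `|z - x| < r ->
    [/\ U y, U z & `|f y - f z - (y - z) *m jacobian f x| <= e * `|y - z|].
Proof. by rewrite jacobianE; exact: smooth_strictV. Qed.

End Jac.

Section Comp.
Context {V : normedModType R} {n : nat} (U : set V) (U' : set 'rV[R]_n) (G : V -> 'rV[R]_n).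
Hypotheses (oU : open U) (oU' : open U') (sG : smooth_open U G) (UG : forall x, U x -> U' (G x)).

(** Closed under derivation: deriving [F (G x) * a x] produces the factors [pd j F (G x)], and the
    derivatives of G are absorbed into a. *)
Inductive comp_class : (V -> R) -> Prop :=
| cc_mul (F : 'rV[R]_n -> R) (a : V -> R) : smooth_open U' F -> smooth_open U a -> comp_class (fun x => F (G x) * a x)
| cc_add f g : comp_class f -> comp_class g -> comp_class (fun x => f x + g x).

Lemma cc_sum (I : Type) (r : seq I) (f : I -> V -> R) : (forall i, comp_class (f i)) ->
  comp_class (fun x => \sum_(i <- r) f i x).
Proof.
move=> H; elim: r => [|i r IH].
  have := cc_mul (smooth_cst (0:R) oU') (smooth_cst (0:R) oU).
  by congr comp_class; apply/funext => x; rewrite big_nil mul0r.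
have := cc_add (H i) IH.
by congr comp_class; apply/funext => x; rewrite big_cons.
Qed.

Lemma smooth_comp (F : 'rV[R]_n -> R) : smooth_open U' F -> smooth_open U (fun x => F (G x)).
Proof.
move=> sF.
have := cc_mul sF (smooth_cst (1:R) oU).
have H f : comp_class f -> smooth_open U f.
  move: f; refine (@smooth_coind _ _ R^o comp_class U oU _) => f; elim=> {f}; last first.
    move=> f g _ [cf df] _ [cg dg]; split.
      by move=> x Ux; apply: continuousD; [exact: cf|exact: cg].
    move=> v; have [f' Pf' df'] := df v; have [g' Pg' dg'] := dg v.
    exists (fun x => f' x + g' x); first exact: cc_add.
    by move=> x Ux; apply: is_deriveD; [exact: df'|exact: dg'].
  move=> {sF}F a sF sa; split.
    move=> x Ux; apply: continuousM; last exact: smooth_cont sa Ux.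
    apply: continuous_comp; first exact: smooth_cont sG Ux.
    exact: smooth_cont sF (UG Ux).
  move=> v.
  exists (fun x => \sum_j (pd j F (G x) * (('D_v G x) 0 j * a x)) + F (G x) * 'D_v a x).
    apply: cc_add; last by apply: cc_mul => //; exact: smooth_derive.
    apply: cc_sum => j; apply: (cc_mul (F := pd j F)); first exact: smooth_derive.
    apply: smoothM => //; apply: (smooth_coord (f := 'D_v G)) => //; exact: smooth_derive.
  move=> x Ux.
  have dG := smooth_derivable (v := v) sG Ux.
  have dF := smooth_differentiable oU' sF (UG Ux).
  have := is_deriveM (chain_rule dF dG) (derivableP (smooth_derivable (v := v) sa Ux)).
  rewrite addrC (derive_grad _ oU' sF (UG Ux)) => H.
  apply: (is_derive_eq H); congr (_ + _).
  rewrite /edot [_ *: _]mulr_sumr; apply: eq_bigr => j _.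
  by rewrite mxE mulrCA [a x * _]mulrC.
move=> /H; apply: smooth_ext => // x _; by rewrite mulr1.
Qed.

End Comp.

Lemma smooth_compV {V : normedModType R} n m (U : set V) (U' : set 'rV[R]_n)
    (G : V -> 'rV[R]_n) (F : 'rV[R]_n -> 'rV[R]_m) :
  open U -> open U' -> smooth_open U G -> (forall x, U x -> U' (G x)) ->
  smooth_open U' F -> smooth_open U (F \o G).
Proof.
move=> oU oU' sG UG sF; apply: smooth_rV => // j.
exact: (smooth_comp oU oU' sG UG (smooth_coord j oU' sF)).
Qed.

Section Comp1.
Context {V : normedModType R} (U : set V) (U' : set R) (G : V -> R).
Hypotheses (oU : open U) (oU' : open U') (sG : smooth_open U G) (UG : forall x, U x -> U' (G x)).

Inductive comp1_class : (V -> R) -> Prop :=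
| c1_mul (F : R -> R) (a : V -> R) : smooth_open U' F -> smooth_open U a -> comp1_class (fun x => F (G x) * a x)
| c1_add f g : comp1_class f -> comp1_class g -> comp1_class (fun x => f x + g x).

Lemma smooth_comp1 (F : R -> R) : smooth_open U' F -> smooth_open U (fun x => F (G x)).
Proof.
move=> sF.
have := c1_mul sF (smooth_cst (1:R) oU).
have H f : comp1_class f -> smooth_open U f.
  move: f; refine (@smooth_coind _ _ R^o comp1_class U oU _) => f; elim=> {f}; last first.
    move=> f g _ [cf df] _ [cg dg]; split.
      by move=> x Ux; apply: continuousD; [exact: cf|exact: cg].
    move=> v; have [f' Pf' df'] := df v; have [g' Pg' dg'] := dg v.
    exists (fun x => f' x + g' x); first exact: c1_add.
    by move=> x Ux; apply: is_deriveD; [exact: df'|exact: dg'].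
  move=> {sF}F a sF sa; split.
    move=> x Ux; apply: continuousM; last exact: smooth_cont sa Ux.
    apply: continuous_comp; first exact: smooth_cont sG Ux.
    exact: smooth_cont sF (UG Ux).
  move=> v.
  exists (fun x => 'D_1 F (G x) * ('D_v G x * a x) + F (G x) * 'D_v a x).
    apply: c1_add; last by apply: c1_mul => //; exact: smooth_derive.
    apply: (c1_mul (F := 'D_1 F)); first exact: smooth_derive.
    by apply: smoothM => //; exact: smooth_derive.
  move=> x Ux.
  have dG := smooth_derivable (v := v) sG Ux.
  have dF := smooth_derivable (v := (1:R)) sF (UG Ux).
  have := is_deriveM (chain_rule1 dF dG) (derivableP (smooth_derivable (v := v) sa Ux)).
  rewrite addrC => H.
  apply: (is_derive_eq H); congr (_ + _).
  by rewrite [LHS]mulrC mulrA.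
move=> /H; apply: smooth_ext => // x _; by rewrite mulr1.
Qed.

End Comp1.
End SmoothVector.

(** * Elementary smooth functions and the smooth step *)

Section SmoothReal.
Context {R : realType}.

Lemma open_neq0 : open [set x : R | x != 0].
Proof.
have -> : [set x : R | x != 0] = ~` [set 0].
  by apply/seteqP; split=> x /= /eqP.
by apply: closed_openC; exact: closed_eq.
Qed.

Lemma smooth_idfun : smooth_open setT (fun t : R => t).
Proof.
case=> [|k] => [x _|v]; first exact: cvg_id.
split; first by move=> x _; exact: derivable_id.
by apply: (Ck_ext openT _ (smooth_cst v openT k)) => x _; rewrite derive_id.
Qed.

Lemma is_derive_invX {V : normedModType R} n (g : V -> R) (x v : V) dg : is_derive x v g dg ->
  is_derive x v (fun x => g x ^+ n) (n%:R * g x ^+ n.-1 * dg).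
Proof.
move=> d.
have d1 : derivable (fun y : R => y ^+ n) (g x) 1 by exact: exprn_derivable.
have H := chain_rule1 d1 (@ex_derive _ _ _ _ _ _ _ d).
by apply: (is_derive_eq H); rewrite -derive1E exp_derive1 derive_val.
Qed.

Lemma smooth_inv : smooth_open [set x : R | x != 0] (fun x : R => x^-1).
Proof.
refine (@smooth_coind _ R^o R^o (fun f => exists (c : R) n, f = fun x : R => c * x^-1 ^+ n) _ open_neq0 _ _ _).
  move=> _ [c [n ->]].
  have D (v x : R) : x != 0 -> is_derive x v (fun x : R => c * x^-1 ^+ n) (- (c * n%:R * v) * x^-1 ^+ n.+1).
    move=> x0.
    have d1 : is_derive x v (fun x : R => x^-1) (- x ^- 2 *: v).
      have dx : derivable (@idfun R : R -> R^o) x v by exact: derivable_id.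
      split; first by have := derivableV (f := @idfun R) (x := x) (v := v) x0 dx.
      by rewrite (deriveV (f := @idfun R) (x := x) (v := v) x0 dx) derive_id.
    have H := is_deriveZ c (is_derive_invX n d1).
    apply: (is_derive_eq H).
    case: n {d1 H} => [|n]; first by rewrite !mulr0 !mul0r oppr0 mul0r [_ *: _]mulr0.
    rewrite -[x ^- 2]exprVn !scaleRE /= !exprS expr0.
    ring.
  split.
    move=> x x0; have [d _] := D 1 x x0.
    by apply: differentiable_continuous; apply/derivable1_diffP.
  move=> v; exists (fun x => - (c * n%:R * v) * x^-1 ^+ n.+1); first by do 2 eexists.
  by move=> x x0; exact: D.
by exists 1, 1%N; apply/funext => x; rewrite mul1r expr1.
Qed.

Lemma smooth_exp : smooth_open setT (expR : R -> R).
Proof.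
refine (@smooth_coind _ R^o R^o (fun f => exists (c : R), f = fun x : R => c * expR x) _ openT _ _ _).
  move=> _ [c ->]; split.
    move=> x _; apply: continuousM; [exact: cst_continuous|exact: continuous_expR].
  move=> v; exists (fun x => c * v * expR x); first by eexists.
  move=> x _.
  have d : is_derive x v (expR : R -> R) (v * expR x).
    have -> : v = v *: 1 :> R by rewrite [RHS]mulr1.
    have d1 : is_derive x 1 (expR : R -> R) (expR x) by exact: is_derive_expR.
    have [dd E] := derivableZv (v : R) (@ex_derive _ _ _ _ _ _ _ d1).
    split=> //; rewrite E [_ *: _]/(v * _) derive_val [_%:A]mulr1 //.
  by apply: (is_derive_eq (is_deriveZ c d)); rewrite [LHS]mulrA.
by exists 1; apply/funext => x; rewrite mul1r.
Qed.

Lemma smooth_ln : smooth_open [set x : R | 0 < x] (@ln R).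
Proof.
have oP : open [set x : R | 0 < x] by exact: open_gt.
have sI : smooth_open [set x : R | 0 < x] (fun x : R => x^-1).
  by apply: smooth_sub smooth_inv => x /= x0; rewrite gt_eqF.
case=> [|k].
  by move=> x /= x0; exact: continuous_ln.
move=> v.
have D (x : R) : 0 < x -> is_derive x v (@ln R) (v * x^-1).
  move=> x0.
  have d1 : is_derive x 1 (@ln R) (x^-1) by exact: is_derive1_ln.
  have [dd E] := derivableZv (v : R) (@ex_derive _ _ _ _ _ _ _ d1).
  have E1 : v *: (1 : R) = v by rewrite [LHS]mulr1.
  by rewrite E1 in dd E; split=> //; rewrite E [_ *: _]/(v * _) derive_val.
split; first by move=> x /= /D[].
have := smoothZ v oP sI => /(_ k); apply: Ck_ext => // x /= x0.
by have [_ ->] := D x x0.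
Qed.

Lemma smooth_sqrt : smooth_open [set x : R | 0 < x] (fun x : R => Num.sqrt x).
Proof.
have oP : open [set x : R | 0 < x] by exact: open_gt.
have s1 : smooth_open [set x : R | 0 < x] (fun x => expR (2^-1 * ln x)).
  refine (@smooth_comp1 R R^o _ setT (fun x : R => 2^-1 * ln x) oP _ _ expR smooth_exp) => //.
  by apply: smoothZ => //; exact: smooth_ln.
apply: (smooth_ext oP _ s1) => x /= x0.
apply/eqP; rewrite eq_sym -(@eqrXn2 _ 2) ?sqrtr_ge0 ?expR_ge0 // sqr_sqrtr ?ltW //.
by rewrite -expRM_natl mulrA mulfV // mul1r lnK.
Qed.

(** [flat 0] is exp (- 1/t) extended by 0. The powers of 1/t are included so that the span of the
    family is closed under derivation. *)
Definition flat (n : nat) (t : R) : R := if 0 < t then t^-1 ^+ n * expR (- t^-1) else 0.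

Lemma flat_ge0 n t : 0 <= flat n t.
Proof.
rewrite /flat; case: ifP => // t0.
by rewrite mulr_ge0 ?expR_ge0 // exprn_ge0 // invr_ge0 ltW.
Qed.

Lemma flat_gt0 t : 0 < t -> 0 < flat 0 t.
Proof. by move=> t0; rewrite /flat t0 expr0 mul1r expR_gt0. Qed.

Lemma flat_le0 n t : t <= 0 -> flat n t = 0.
Proof. by move=> t0; rewrite /flat ltNge t0. Qed.

Lemma flat_bound n : exists2 C : R, 0 < C & forall t, flat n t <= C * `|t| ^+ 2.
Proof.
(* The inequality exp s >= (s / m)^m, with s = 1/t and m = n + 2, leaves a factor t^2 once t^-n is
   accounted for. A quadratic bound makes the derivative at 0 vanish. *)
pose m := n.+2; exists (m%:R ^+ m); first by rewrite exprn_gt0.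
move=> t; have [t0|t0] := ltP 0 t; last by rewrite flat_le0 // mulr_ge0 // exprn_ge0.
rewrite /flat t0 gtr0_norm //.
have s0 : 0 < t^-1 by rewrite invr_gt0.
have : (t^-1 / m%:R) ^+ m <= expR (t^-1).
  have -> : expR t^-1 = expR (t^-1 / m%:R) ^+ m.
    by rewrite -expRM_natl mulrC divfK // pnatr_eq0.
  rewrite ler_pXn2r ?nnegrE ?expR_ge0 ?divr_ge0 ?(ltW s0) //.
  by rewrite (le_trans _ (expR_ge1Dx _)) // lerDr.
rewrite expr_div_n ler_pdivrMr ?exprn_gt0 // => H.
rewrite expRN ler_pdivrMr ?expR_gt0 //.
rewrite -(ler_pM2r (x := t^-1 ^+ 2)) ?exprn_gt0 // -exprD addn2.
apply: (le_trans H).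
rewrite [leRHS](_ : _ = expR t^-1 * m%:R ^+ m * (t * t^-1) ^+ 2); last by rewrite exprMn; ring.
by rewrite mulfV ?expr1n ?mulr1 ?gt_eqF.
Qed.

Lemma is_derive_flat n (t : R) :
  is_derive t (1:R) (flat n) (- n%:R * flat n.+1 t + flat n.+2 t).
Proof.
have [t0|t0|<-] := ltgtP 0 t.
- have d1 : is_derive t 1 (fun x : R => x^-1) (- t ^- 2).
    have dx : derivable (@idfun R : R -> R^o) t 1 by exact: derivable_id.
    have x0 : t != 0 by rewrite gt_eqF.
    split; first by have := derivableV (f := @idfun R) (x := t) (v := 1) x0 dx.
    by rewrite (deriveV (f := @idfun R) (x := t) (v := 1) x0 dx) derive_id [_ *: _]mulr1.
  have d2 : derivable (fun x : R => - x^-1) t 1 by apply: derivableN; case: d1.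
  have d2' : 'D_1 (fun x : R => - x^-1) t = t ^- 2.
    by case: d1 => dd E; rewrite (deriveN dd) E opprK.
  have d3 : is_derive t 1 (fun x : R => expR (- x^-1)) (expR (- t^-1) * t ^- 2).
    have e1 : derivable (expR : R -> R) (- t^-1) 1 by exact: derivable_expR.
    by apply: (is_derive_eq (@chain_rule1 R R^o expR (fun x : R => - x^-1) t 1 e1 d2)); rewrite d2' derive_val.
  apply: (@near_eq_is_derive R R^o R^o (fun x : R => x^-1 ^+ n * expR (- x^-1))).
    near=> x; rewrite /flat ifT //; near: x; exact: lt_nbhsr.
  have H := is_deriveM (is_derive_invX n d1) d3.
  apply: (is_derive_eq H); rewrite /flat t0 /=.
  rewrite !scaleRE -exprVn.
  case: n {H} => [|n]; rewrite /= ?exprS ?expr0; ring.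
- apply: (@near_eq_is_derive R R^o R^o (fun x : R => 0)).
    near=> x; rewrite flat_le0 // ltW //; near: x; exact: lt_nbhsl.
  rewrite !flat_le0 ?ltW // mulr0 addr0; exact: is_derive_cst.
rewrite !flat_le0 // mulr0 addr0.
have [C C0 HC] := flat_bound n.
have [] := @differentiable_approx R R^o R^o (flat n) (\0 : {linear R^o -> R^o}) 0.
- exact: cst_continuous.
- move=> e e0; apply: (@ball_near R R^o _ 0 (e / C)); first by rewrite divr_gt0.
  move=> h; rewrite subr0 => hh; change (`|flat n (h + 0) - flat n 0 - 0| <= e * `|h|).
  rewrite addr0 (flat_le0 n (lexx 0)) !subr0.
  rewrite ger0_norm ?flat_ge0 // (le_trans (HC h)) // expr2 mulrA ler_wpM2r //.
  by rewrite mulrC -ler_pdivlMr // ltW.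
move=> /derivable1_diffP d E; split=> //.
by rewrite deriveE ?E //; apply/derivable1_diffP.
Unshelve. all: by end_near. Qed.

Inductive flat_class : (R -> R) -> Prop :=
| fl_base c n : flat_class (fun t => c * flat n t)
| fl_add f g : flat_class f -> flat_class g -> flat_class (fun t => f t + g t).

Lemma smooth_flat : smooth_open setT (flat 0).
Proof.
refine (@smooth_coind _ R^o R^o flat_class _ openT _ _ _); last first.
  by have := fl_base 1 0; congr flat_class; apply/funext => t; rewrite mul1r.
move=> f; elim=> {f}; last first.
  move=> f g _ [cf df] _ [cg dg]; split.
    by move=> x Ux; apply: continuousD; [exact: cf|exact: cg].
  move=> v; have [f' Pf' df'] := df v; have [g' Pg' dg'] := dg v.
  exists (fun x => f' x + g' x); first exact: fl_add.
  by move=> x Ux; apply: is_deriveD; [exact: df'|exact: dg'].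
move=> c n.
have cf (x : R) : {for x, continuous (flat n)}.
  apply: differentiable_continuous; apply/derivable1_diffP.
  by have [] := is_derive_flat n x.
split.
  by move=> x _; apply: continuousM; [exact: cst_continuous|exact: cf].
move=> v; exists (fun t => - (c * v * n%:R) * flat n.+1 t + c * v * flat n.+2 t).
  by apply: fl_add; exact: fl_base.
move=> x _.
have [dd E] := derivableZv (v : R) (@ex_derive _ _ _ _ _ _ _ (is_derive_flat n x)).
have E1 : v *: (1 : R) = v by rewrite [LHS]mulr1.
rewrite E1 in dd E.
have H := is_deriveZ c (derivableP dd); apply: (is_derive_eq H).
rewrite E (@derive_val _ _ _ _ _ _ _ (is_derive_flat n x)) !scaleRE; ring.
Qed.

Definition step (t : R) : R := flat 0 t / (flat 0 t + flat 0 (1 - t)).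

Lemma step_den t : 0 < flat 0 t + flat 0 (1 - t).
Proof.
have [t0|t0] := ltP 0 t; first by rewrite ltr_wpDr ?flat_ge0 // flat_gt0.
by rewrite ltr_wpDl ?flat_ge0 // flat_gt0 // subr_gt0 (le_lt_trans t0).
Qed.

Lemma smooth_step : smooth_open setT step.
Proof.
apply: smoothM; [exact: openT|exact: smooth_flat|].
refine (@smooth_comp1 R R^o _ _ (fun t : R => flat 0 t + flat 0 (1 - t)) openT _ _ _ smooth_inv).
  apply: smoothD; [exact: openT|exact: smooth_flat|].
  refine (@smooth_comp1 R R^o _ setT (fun t : R => 1 - t) openT _ _ _ smooth_flat) => //.
  apply: smoothB; [exact: openT|exact: smooth_cst openT|].
  exact: smooth_idfun.
by move=> t _ /=; rewrite gt_eqF // step_den.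
Qed.

Lemma step_le0 t : t <= 0 -> step t = 0.
Proof. by move=> t0; rewrite /step flat_le0 // mul0r. Qed.

Lemma step_ge1 t : 1 <= t -> step t = 1.
Proof.
move=> t1; rewrite /step (flat_le0 _ (t := 1 - t)) ?subr_le0 // addr0 mulfV //.
by rewrite gt_eqF // flat_gt0 // (lt_le_trans ltr01).
Qed.

Lemma step_ge0 t : 0 <= step t.
Proof. by rewrite divr_ge0 ?flat_ge0 // ltW // step_den. Qed.

Lemma step_le1 t : step t <= 1.
Proof. by rewrite ler_pdivrMr ?step_den // mul1r lerDl flat_ge0. Qed.

Lemma flat_homo : {homo flat 0 : x y / x <= y}.
Proof.
move=> x y xy; have [x0|x0] := ltP 0 x; last by rewrite flat_le0 // flat_ge0.
have y0 : 0 < y by exact: lt_le_trans xy.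
by rewrite /flat x0 y0 !expr0 !mul1r ler_expR lerN2 lef_pV2.
Qed.

Lemma step_homo : {homo step : x y / x <= y}.
Proof.
move=> x y xy; rewrite /step ler_pdivrMr ?step_den // mulrAC ler_pdivlMr ?step_den //.
rewrite !mulrDr; apply: lerD; first by rewrite mulrC.
by rewrite ler_pM ?flat_ge0 ?flat_homo // lerB.
Qed.

End SmoothReal.

(** * Symmetry of second derivatives *)

Section Schwarz.
Context {R : realType} {V : normedModType R}.

Lemma is_derive_shiftV (f : V -> R) a y v : derivable f (y + a) v ->
  is_derive y v (fun z => f (z + a)) ('D_v f (y + a)).
Proof.
have E : (fun h : R => h^-1 *: (f (h *: v + y + a) - f (y + a))) =
         (fun h : R => h^-1 *: (f (h *: v + (y + a)) - f (y + a))).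
  by apply/funext => h; rewrite addrA.
by move=> df; split; [rewrite /derivable /= E|rewrite /derive /= E].
Qed.

Lemma double_difference_le (h a b c d A B D1 D2 e : R) : (h == 0) = false ->
  a - b - (c - d) = h ^+ 2 * A -> a - c - (b - d) = h ^+ 2 * B ->
  `|A - D1| < e / 2 -> `|B - D2| < e / 2 -> `|D1 - D2| <= e.
Proof.
move=> h0 E1 E2 H1 H2.
have E : A = B.
  apply: (@mulfI _ (h ^+ 2)); first by rewrite expf_neq0 ?h0.
  rewrite -E1 -E2; ring.
rewrite -E in H2; rewrite (le_trans (ler_distD A _ _)) // (splitr e) lerD //; last exact: ltW.
by rewrite distrC ltW.
Qed.

Lemma double_difference U (f : V -> R) x v w : smooth_open U f ->
  (forall s t : R, 0 <= s <= 1 -> 0 <= t <= 1 -> U (x + s *: v + t *: w)) ->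
  exists s t : R, [/\ 0 <= s <= 1, 0 <= t <= 1 &
    f (x + v + w) - f (x + v) - (f (x + w) - f x) = 'D_w ('D_v f) (x + s *: v + t *: w)].
Proof.
move=> sf HU.
have z01 : 0 <= (0:R) <= 1 by rewrite lexx ler01.
have o01 : 0 <= (1:R) <= 1 by rewrite lexx ler01.
have D (s : R) : 0 <= s <= 1 ->
    is_derive (x + s *: v) v (fun y => f (y + w) - f y) ('D_v f (x + s *: v + w) - 'D_v f (x + s *: v)).
  move=> s01; apply: is_deriveB; first apply: is_derive_shiftV.
    by have := smooth_derivable (v := v) sf (HU _ _ s01 o01); rewrite scale1r.
  by have := derivableP (smooth_derivable (v := v) sf (HU _ _ s01 z01)); rewrite scale0r addr0.
have [s s01 E] := @MVT_line R V (fun y => f (y + w) - f y) x v (fun s s01 => @ex_derive _ _ _ _ _ _ _ (D s s01)).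
have [|t t01 E2] := @MVT_line R V ('D_v f) (x + s *: v) w.
  by move=> t t01; apply: smooth_derivable (smooth_derive v sf) (HU _ _ s01 t01).
exists s, t; split=> //; rewrite -E2 E.
by rewrite (@derive_val _ _ _ _ _ _ _ (D s s01)).
Qed.

Lemma derive2Z U (f : V -> R) x v w (h : R) : open U -> smooth_open U f -> U x ->
  'D_(h *: w) ('D_(h *: v) f) x = h ^+ 2 * 'D_w ('D_v f) x.
Proof.
move=> oU sf Ux.
have -> : 'D_(h *: w) ('D_(h *: v) f) x = 'D_(h *: w) (h *: 'D_v f) x.
  apply: near_eq_derive; apply: (open_near oU Ux) => y Uy.
  by have [_ ->] := derivableZv h (smooth_derivable (v := v) sf Uy).
have d := smooth_derivable (v := h *: w) (smooth_derive v sf) Ux.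
rewrite (@deriveZ R V R ('D_v f) h x (h *: w) d).
have [_ ->] := derivableZv h (smooth_derivable (v := w) (smooth_derive v sf) Ux).
by rewrite [LHS]mulrA expr2.
Qed.

(** The second difference over a parallelogram of size h equals h^2 times either mixed derivative at
    some point of it, by the mean value theorem used in the two orders. Continuity of both
    derivatives concludes. *)
Lemma schwarz U (f : V -> R) x v w : open U -> smooth_open U f -> U x ->
  'D_w ('D_v f) x = 'D_v ('D_w f) x.
Proof.
move=> oU sf Ux.
suff H (e : R) : 0 < e -> `|'D_w ('D_v f) x - 'D_v ('D_w f) x| <= e.
  by apply/eqP; rewrite -subr_eq0 -normr_le0; apply/ler_addgt0Pr => e /H; rewrite add0r.
move=> e0; have e2 : 0 < e / 2 by rewrite divr_gt0.
have [r r0 H] : exists2 r : R, 0 < r & forall y, `|y - x| < r ->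
    [/\ U y, `|'D_w ('D_v f) y - 'D_w ('D_v f) x| < e / 2 &
     `|'D_v ('D_w f) y - 'D_v ('D_w f) x| < e / 2].
  have /cvgrPdist_lt/(_ _ e2)/near_ball[r1 r10 c1] := smooth_cont (smooth_derive w (smooth_derive v sf)) Ux.
  have /cvgrPdist_lt/(_ _ e2)/near_ball[r2 r20 c2] := smooth_cont (smooth_derive v (smooth_derive w sf)) Ux.
  have /near_ball[r3 r30 c3] : \forall y \near x, U y by exact: open_nbhs_nbhs.
  exists (Num.min (Num.min r1 r2) r3); first by rewrite !lt_min r10 r20.
  move=> y; rewrite !lt_min => /andP[/andP[y1 y2] y3].
  by split; [exact: c3|rewrite distrC; exact: c1|rewrite distrC; exact: c2].
pose C := `|v| + `|w| + 1.
have C0 : 0 < C by rewrite /C ltr_wpDl // addr_ge0.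
have [h [h0 hr]] : exists h : R, 0 < h /\ h * C < r.
  exists (r / C / 2); split; first by rewrite !divr_gt0.
  by rewrite -ltr_pdivlMr // ltr_pdivrMr // ltr_pMr ?divr_gt0 // ltr1n.
have inB (s t : R) : 0 <= s <= 1 -> 0 <= t <= 1 -> `|x + s *: (h *: v) + t *: (h *: w) - x| < r.
  move=> /andP[s0 s1] /andP[t0 t1].
  have -> : x + s *: (h *: v) + t *: (h *: w) - x = s *: (h *: v) + t *: (h *: w).
    by rewrite -(addrA x) [LHS]addrC addKr.
  apply: le_lt_trans hr; rewrite (le_trans (ler_normD _ _)) // !normrZ.
  rewrite (gtr0_norm h0) (ger0_norm t0) (ger0_norm s0) !(mulrCA _ h) -mulrDr ler_wpM2l ?(ltW h0) //.
  rewrite -[leRHS]/(`|v| + `|w| + 1) (@le_trans _ _ (`|v| + `|w|)) ?lerDl //.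
  by rewrite lerD // -[leRHS]mul1r ler_wpM2r.
have inB' (s t : R) : 0 <= s <= 1 -> 0 <= t <= 1 -> `|x + s *: (h *: w) + t *: (h *: v) - x| < r.
  by move=> s01 t01; rewrite (addrAC x); exact: inB.
have [|s [t [s01 t01 E1]]] := @double_difference U f x (h *: v) (h *: w) sf.
  by move=> s t s01 t01; have [] := H _ (inB _ _ s01 t01).
have [|s' [t' [s01' t01' E2]]] := @double_difference U f x (h *: w) (h *: v) sf.
  by move=> a b a01 b01; have [] := H _ (inB' _ _ a01 b01).
have [U1 H1 _] := H _ (inB _ _ s01 t01).
have [U2 _ H2] := H _ (inB' _ _ s01' t01').
rewrite (derive2Z _ _ _ oU sf U1) in E1; rewrite (derive2Z _ _ _ oU sf U2) in E2.
by rewrite (addrAC x) in E2; exact: (double_difference_le (gt_eqF h0) E1 E2 H1 H2).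
Qed.

End Schwarz.

(** Completeness of row vectors, for the fixed point theorem in [ift_surj]. *)
HB.instance Definition _ (R : realType) (n : nat) := Complete.on 'rV[R]_n.

Section SmoothMatrix.
Context {R : realType} {V : normedModType R}.

Lemma smooth_det n (U : set V) (A : V -> 'M[R]_n) : open U ->
  (forall i j, smooth_open U (fun x => A x i j)) -> smooth_open U (fun x => \det (A x)).
Proof.
move=> oU sA; rewrite /determinant.
refine (smooth_sum _ oU _) => s.
apply: smoothZ => //.
exact: (smooth_prod _ oU (fun i => sA i _)).
Qed.

Lemma smooth_adj n (U : set V) (A : V -> 'M[R]_n) i j : open U ->
  (forall i j, smooth_open U (fun x => A x i j)) -> smooth_open U (fun x => (\adj (A x)) i j).
Proof.
move=> oU sA.
have : smooth_open U (fun x => (-1) ^+ (j + i) * \det (row' j (col' i (A x)))).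
  apply: smoothZ => //; apply: smooth_det => // k l.
  have := sA (lift j k) (lift i l).
  by apply: smooth_ext => // x _; rewrite !mxE.
by apply: smooth_ext => // x _; rewrite mxE.
Qed.

Lemma smooth_invmx n (U : set V) (A : V -> 'M[R]_n) i j : open U ->
  (forall x, U x -> A x \in unitmx) ->
  (forall i j, smooth_open U (fun x => A x i j)) -> smooth_open U (fun x => (invmx (A x)) i j).
Proof.
move=> oU uA sA.
have sI : smooth_open U (fun x => (\det (A x))^-1).
  refine (@smooth_comp1 R V U [set x : R | x != 0] (fun x => \det (A x)) oU _ _ _ smooth_inv).
    exact: smooth_det.
  by move=> x /uA; rewrite unitmxE unitfE.
have := smoothM oU sI (smooth_adj i j oU sA).
by apply: smooth_ext => // x Ux; rewrite /invmx (uA x Ux) [RHS]mxE.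
Qed.

Lemma smooth_mulmx_row n m (U : set V) (f : V -> 'rV[R]_n) (A : V -> 'M[R]_(n, m)) : open U ->
  smooth_open U f -> (forall i j, smooth_open U (fun x => A x i j)) ->
  smooth_open U (fun x => f x *m A x).
Proof.
move=> oU sf sA; apply: smooth_rV => // j.
have : smooth_open U (fun x => \sum_k f x 0 k * A x k j).
  refine (smooth_sum _ oU _) => k.
  by apply: smoothM => //; exact: smooth_coord.
by apply: smooth_ext => // x _; rewrite mxE.
Qed.

End SmoothMatrix.

(** * Local inverse of an immersion *)

Section InverseFunction.
Context {R : realType}.

Lemma mulmx_bound n m (A : 'M[R]_(n, m)) :
  exists2 C : R, 0 < C & forall v : 'rV[R]_n, `|v *m A| <= C * `|v|.
Proof.
exists (1 + \sum_i \sum_j `|A i j|).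
  by rewrite ltr_wpDr // sumr_ge0 // => i _; rewrite sumr_ge0.
move=> v; apply: norm_le_coord => [|j].
  by rewrite mulr_ge0 // addr_ge0 // sumr_ge0 // => i _; rewrite sumr_ge0.
rewrite mxE (le_trans (ler_norm_sum _ _ _)) //.
apply: (@le_trans _ _ (\sum_i `|A i j| * `|v|)).
  by apply: ler_sum => i _; rewrite normrM mulrC ler_wpM2l // coord_le_norm.
rewrite -mulr_suml ler_wpM2r // -[leLHS]add0r lerD //; apply: ler_sum => i _.
by rewrite (bigD1 j) //= lerDl sumr_ge0.
Qed.

Section Local.
Context {d : nat} (r : R) (u0 : 'rV[R]_d) (F : 'rV[R]_d -> 'rV[R]_d).
Let B : set 'rV[R]_d := [set u | `|u - u0| < r].
Hypotheses (r0 : 0 < r) (sF : smooth_open B F).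
Hypothesis (cF : forall u v, B u -> B v -> `|F u - F v - (u - v)| <= 2^-1 * `|u - v|).

Let oB : open B.
Proof.
have -> : B = ball u0 r.
  by apply/seteqP; split=> u; rewrite /B -ball_normE /= distrC.
exact: ball_open.
Qed.

Lemma ift_lip u v : B u -> B v -> `|u - v| <= 2 * `|F u - F v|.
Proof.
move=> Bu Bv; have := cF Bu Bv; have := ler_distD (F u - F v) (u - v) 0.
rewrite !subr0 distrC; move: (`|u - v|) (`|F u - F v|) (`|_ - _ - _|) => a b c; lra.
Qed.

(** Fixed point of [u - F u + y], which by [cF] halves distances. The closed ball of radius r / 2 is
    preserved: the image of u is off u0 by at most r / 4 from the contraction plus r / 4 from y. *)
Lemma ift_surj y : `|y - F u0| < r / 4 -> exists2 u, B u & F u = y.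
Proof.
move=> yr; pose Bc : set 'rV[R]_d := [set u | `|u - u0| <= r / 2].
have BcB u : Bc u -> B u.
  by rewrite /Bc /B /= => /le_lt_trans; apply; rewrite ltr_pdivrMr // ltr_pMr // ltr1n.
have Bu0 : B u0 by rewrite /B /= subrr normr0.
pose T u := u - F u + y.
have TB : {homo T : u / Bc u >-> Bc u}.
  move=> u Bu; rewrite /Bc /=.
  have -> : T u - u0 = - (F u - F u0 - (u - u0)) + (y - F u0).
    rewrite /T; apply/rowP => i; rewrite !mxE; ring.
  rewrite (le_trans (ler_normD _ _)) // normrN.
  have := cF (BcB u Bu) Bu0; move: Bu; rewrite /Bc /=.
  move: yr; move: (`|y - _|) (`|_ - _ - _|) (`|u - u0|) => a b c; lra.
have cT : is_contraction [fun of mkfun_fun TB].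
  have h0 : 0 <= 2^-1 :> R by rewrite invr_ge0.
  exists (NngNum h0); split=> /=.
    by rewrite invf_lt1 ?ltr1n.
  move=> -[u v] /= [Bu Bv].
  have -> : T u - T v = - (F u - F v - (u - v)).
    rewrite /T; apply/rowP => i; rewrite !mxE; ring.
  by rewrite normrN; apply: cF; exact: BcB.
have [||u Bu E] := banach_fixed_point cT.
- have -> : Bc = closed_ball u0 (r / 2).
    rewrite closed_ballE ?divr_gt0 //; apply/seteqP; split=> u; rewrite /Bc /closed_ball_ /= distrC //.
  exact: closed_ball_closed.
- by exists u0; rewrite /Bc /= subrr normr0 divr_ge0 // ltW.
exists u; first exact: BcB.
move: E; rewrite /mkfun_fun /= /mkfun /T => E.
by apply: (addrI (u - F u)); rewrite -E subrK.
Qed.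

Let W : set 'rV[R]_d := [set y | `|y - F u0| < r / 4].
Definition ift_inv y : 'rV[R]_d := xget u0 [set u | B u /\ F u = y].
Let psi := ift_inv.

Let oW : open W.
Proof.
have -> : W = ball (F u0) (r / 4).
  by apply/seteqP; split=> u; rewrite /W -ball_normE /= distrC.
exact: ball_open.
Qed.

Lemma ift_invP y : W y -> B (psi y) /\ F (psi y) = y.
Proof.
move=> /ift_surj[u Bu Fu].
by rewrite /psi /ift_inv; case: xgetP => [v -> //|/(_ u)]; case.
Qed.

Lemma ift_invK u : B u -> W (F u) -> psi (F u) = u.
Proof.
move=> Bu /ift_invP[Bp E].
have := ift_lip Bp Bu; rewrite E subrr normr0 mulr0 normr_le0 subr_eq0.
by move/eqP.
Qed.

Let J u := jacobian F u.

(** If v is in the kernel of the Jacobian, strict differentiability moves [F (u + t *: v)] by at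
    most a quarter of the step, while [cF] forces it to move by at least half of it. *)
Lemma ift_unit u : B u -> J u \in unitmx.
Proof.
move=> Bu; rewrite -row_free_unit -kermx_eq0.
apply/eqP/row_matrixP => i; rewrite row0; set v := row i _.
have vJ : v *m J u = 0 by rewrite /v -row_mul mulmx_ker row0.
apply/eqP; rewrite -normr_le0 leNgt; apply/negP => v0.
have [s s0 H] := smooth_strict_jac oB sF Bu (ltac:(by rewrite invr_gt0) : 0 < 4^-1).
pose t := s / 2 / `|v|; have t0 : 0 < t by rewrite !divr_gt0.
have tv : `|t *: v| = s / 2 by rewrite normrZ gtr0_norm // divfK // gt_eqF.
have yu : `|u + t *: v - u| < s.
  by rewrite addrC addKr tv ltr_pdivrMr // ltr_pMr // ltr1n.
have [|By _] := H (u + t *: v) u yu; first by rewrite subrr normr0.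
have -> : u + t *: v - u = t *: v by rewrite addrC addKr.
rewrite -scalemxAl vJ scaler0 subr0 tv => H1.
have := cF By Bu; have -> : u + t *: v - u = t *: v by rewrite addrC addKr.
have := ler_distD (F (u + t *: v) - F u) (t *: v) 0; rewrite !subr0 distrC tv.
move: H1; move: (`|F _ - F u|) (`|_ - _ - _|) => a b; lra.
Qed.

Let K u := invmx (J u).

Lemma mulmxr_continuous n m (A : 'M[R]_(n, m)) :
  continuous (mulmxr A : {linear 'rV[R]_n -> 'rV[R]_m}).
Proof.
move=> v; apply: rV_continuous_at => j.
have -> : (fun y => mulmxr A y 0 j) = edot_lin (\row_i A i j).
  apply/funext => y /=; rewrite mxE /edot; apply: eq_bigr => i _.
  by rewrite [in RHS]mxE mulrC.
exact: edot_lin_continuous.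
Qed.

(** Strict differentiability of F at [psi y], read backwards: by [ift_lip] an increment h of y moves
    psi by at most 2 |h|, so the error stays small relative to h after applying the inverse
    Jacobian. *)
Lemma ift_diff y : W y -> differentiable psi y /\ forall v, 'D_v psi y = v *m K (psi y).
Proof.
move=> Wy; have [Bu E] := ift_invP Wy; set u := psi y in Bu E *.
have [C C0 HC] := mulmx_bound (K u).
have [] := @differentiable_approx R 'rV[R]_d 'rV[R]_d psi (mulmxr (K u) : {linear 'rV[R]_d -> 'rV[R]_d}) y.
- exact: mulmxr_continuous.
- move=> e e0.
  have e1 : 0 < e / (2 * C) by rewrite divr_gt0 // mulr_gt0.
  have [s s0 H] := smooth_strict_jac oB sF Bu e1.
  have /near_ball[s' s'0 H'] : \forall z \near y, W z by exact: open_nbhs_nbhs.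
  apply: (@ball_near R _ _ 0 (Num.min (s / 2) s')); first by rewrite lt_min s'0 divr_gt0.
  move=> h; rewrite subr0 lt_min => /andP[hs hs'].
  have [Bw Ew] : B (psi (h + y)) /\ F (psi (h + y)) = h + y.
    by apply: ift_invP; apply: H'; rewrite addrK.
  set w := psi (h + y) in Bw Ew *.
  have wu : `|w - u| <= 2 * `|h| by have := ift_lip Bw Bu; rewrite Ew E addrK.
  have [||_ _] := H w u; rewrite ?subrr ?normr0 //.
    by apply: le_lt_trans wu _; rewrite mulrC -ltr_pdivlMr.
  rewrite Ew E addrK => H1.
  have -> : w - u - h *m K u = - ((h - (w - u) *m J u) *m K u).
    by rewrite mulmxBl -mulmxA mulmxV ?ift_unit // mulmx1 opprB.
  rewrite normrN (le_trans (HC _)) //.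
  apply: (@le_trans _ _ (C * (e / (2 * C) * (2 * `|h|)))).
    rewrite ler_wpM2l ?(ltW C0) // (le_trans H1) // ler_wpM2l //; exact: ltW.
  rewrite le_eqVlt; apply/orP; left; apply/eqP; field; by rewrite gt_eqF.
move=> dp E2; split=> // v; by rewrite deriveE // E2.
Qed.

(** Coinduction on the functions [a \o psi] with a smooth on B. The derivative of psi is itself a
    smooth function evaluated at psi, the inverse Jacobian, so this class is closed under
    derivation. *)
Lemma smooth_ift : smooth_open W psi.
Proof.
apply: smooth_rV => // j.
have := smooth_proj j oB => sj.
refine (@smooth_coind R 'rV[R]_d R^o (fun f => exists a : 'rV[R]_d -> R,
  smooth_open B a /\ f = a \o psi) W oW _ _ (ex_intro _ _ (conj sj erefl))).
move=> _ [a [sa ->]]; split.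
  move=> y Wy; have [Bu _] := ift_invP Wy; have [dp _] := ift_diff Wy.
  apply: continuous_comp; first exact: differentiable_continuous.
  exact: smooth_cont sa Bu.
move=> v; exists ((fun u => \sum_j pd j a u * (v *m K u) 0 j) \o psi).
  eexists; split; last by [].
  refine (smooth_sum _ oB _) => k.
  apply: smoothM => //; first exact: smooth_derive.
  apply: smooth_coord => //; apply: smooth_mulmx_row => //; first exact: smooth_cst.
  move=> i l; apply: smooth_invmx => //; first exact: ift_unit.
  move=> i' l'.
  have : smooth_open B (pd i' (fun y => F y 0 l')) by apply: smooth_derive; exact: smooth_coord.
  by apply: smooth_ext => // x Bx; rewrite /J (jacobianE oB sF Bx) mxE.
move=> y Wy; have [Bu _] := ift_invP Wy; have [dp Dp] := ift_diff Wy.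
have H := chain_rule (smooth_differentiable oB sa Bu) (diff_derivable (v := v) dp).
apply: (is_derive_eq H); rewrite (derive_grad _ oB sa Bu) Dp /edot /=.
by apply: eq_bigr => k _; rewrite mxE.
Qed.

End Local.

Section ChartInverse.
Context {N d : nat} (M : set 'rV[R]_N) (D : set 'rV[R]_d) (phi : 'rV[R]_d -> 'rV[R]_N).
Hypothesis chart : local_parametrization M D phi.

Lemma smooth_mulmxr n m (A : 'M[R]_(n, m)) (U : set 'rV[R]_n) : open U ->
  smooth_open U (fun p => p *m A).
Proof.
move=> oU; apply: (@smooth_mulmx_row R 'rV[R]_n n m U id (fun=> A)) => //.
  by apply: smooth_rV => // j; exact: smooth_proj.
by move=> i j; exact: smooth_cst.
Qed.

(** With A a right inverse of the Jacobian at u0, the map [phi u *m A] is close to the identity up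
    to translation, hence locally invertible. Its inverse composed with [p *m A] is a left inverse
    of phi that is smooth on an open set of the ambient space, not only on M. *)
Lemma chart_inverse u0 : D u0 -> exists W, exists psi : 'rV[R]_N -> 'rV[R]_d,
  [/\ open W, W (phi u0), smooth_open W psi, (forall p, W p -> D (psi p)) &
      forall p, M p -> W p -> phi (psi p) = p].
Proof.
have [oD sphi rf inj ophi] := chart => Du0.
have /row_freeP[A JA] := rf u0 Du0.
have [C C0 HC] := mulmx_bound A.
(* C bounds multiplication by A, so this precision makes the difference between [phi u *m A] and u a
   1/2-Lipschitz map. *)
have e0 : 0 < (2 * C)^-1 by rewrite invr_gt0 mulr_gt0.
have [r r0 H] := smooth_strict_jac oD sphi Du0 e0.
pose B := [set u : 'rV[R]_d | `|u - u0| < r].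
have BD : B `<=` D by move=> u ur; have [] := H u u ur ur.
have oB : open B.
  have -> : B = ball u0 r by apply/seteqP; split=> u; rewrite /B -ball_normE /= distrC.
  exact: ball_open.
have Bu0 : B u0 by rewrite /B /= subrr normr0.
pose F u := phi u *m A.
have sF : smooth_open B F.
  have := smooth_compV oB openT (smooth_sub BD sphi) (fun _ _ => Logic.I) (smooth_mulmxr A openT).
  exact.
have cF u v : B u -> B v -> `|F u - F v - (u - v)| <= 2^-1 * `|u - v|.
  move=> Bu Bv; have [_ _ H1] := H u v Bu Bv.
  have -> : F u - F v - (u - v) = (phi u - phi v - (u - v) *m jacobian phi u0) *m A.
    by rewrite /F 2!(mulmxBl _ _ A) -mulmxA JA mulmx1.
  rewrite (le_trans (HC _)) //.
  apply: (le_trans (ler_wpM2l (ltW C0) H1)).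
  rewrite le_eqVlt; apply/orP; left; apply/eqP; field; by rewrite gt_eqF.
pose psi := ift_inv r u0 F.
pose W0 := [set y : 'rV[R]_d | `|y - F u0| < r / 4].
have oW0 : open W0.
  have -> : W0 = ball (F u0) (r / 4).
    by apply/seteqP; split=> u; rewrite /W0 -ball_normE /= distrC.
  exact: ball_open.
(* U discards the points of M near [phi u0] that do not come from B; on the others [phi \o psi] is
   the identity. *)
have [U oU EU] := ophi B oB BD.
have sA : smooth_open setT (fun p : 'rV[R]_N => p *m A) by exact: smooth_mulmxr openT.
have oWA : open ((fun p : 'rV[R]_N => p *m A) @^-1` W0).
  apply: open_comp => // p _; exact: smooth_cont sA _.
exists (U `&` (fun p : 'rV[R]_N => p *m A) @^-1` W0), (fun p => psi (p *m A)); split.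
- exact: openI.
- split; last by rewrite /= /W0 /= subrr normr0 divr_gt0.
  by have [] : (M `&` U) (phi u0) by rewrite -EU; exists u0.
- apply: (smooth_compV (G := fun p : 'rV[R]_N => p *m A) (U' := W0)) => //.
  + exact: openI.
  + by apply: smooth_sub sA.
  + by move=> p [].
  + exact: smooth_ift.
- by move=> p [_ /(ift_invP r0 cF)[/BD]].
move=> p Mp [Up Wp].
have [u Bu Eu] : (phi @` B) p by rewrite EU.
by rewrite -Eu in Wp *; congr phi; apply: (ift_invK r0 cF).
Qed.

Lemma chart_smooth_on (h : 'rV[R]_N -> R) : smooth_open D (fun u => h (phi u)) ->
  forall p, (phi @` D) p -> exists U : set 'rV[R]_N, exists F : 'rV[R]_N -> R,
    [/\ open_nbhs p U, smooth_open U F & forall x, M x -> U x -> h x = F x].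
Proof.
move=> sh _ [u0 Du0 <-]; have [W [psi [oW Wp spsi DW phiK]]] := chart_inverse Du0.
exists W, (fun p => h (phi (psi p))); split=> //.
  have [oD _ _ _ _] := chart.
  exact: (smooth_comp oW oD spsi DW sh).
by move=> x Mx Wx; rewrite phiK.
Qed.

Lemma smooth_on_chart (h : 'rV[R]_N -> R) : smooth_on M h -> smooth_open D (fun u => h (phi u)).
Proof.
move=> sh; have [oD sphi _ _ ophi] := chart.
have Mphi u : D u -> M (phi u).
  by move=> Du; have [U oU E] := ophi D oD (fun _ => id); have [] : (M `&` U) (phi u) by rewrite -E; exists u.
apply: smooth_local => u0 Du0.
have [U [F [[oU Up] sF E]]] := sh _ (Mphi _ Du0).
have oDU : open (D `&` phi @^-1` U).
  rewrite openE => u [Du Uu]; apply: filterI; first exact: open_nbhs_nbhs.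
  have := smooth_cont sphi Du; apply; exact: open_nbhs_nbhs.
exists (D `&` phi @^-1` U); split=> //.
have := smooth_comp oDU oU (smooth_sub (@subIsetl _ _ _) sphi) (fun _ => snd) sF.
by apply: smooth_ext => // u [Du Uu]; rewrite E //; exact: Mphi.
Qed.

(** Near 0 the curve is phi composed with [psi \o c], which is derivable at 0 because psi is smooth
    around p in the ambient space. Together with [chart_curve] this identifies the tangent space
    with the row space of the Jacobian. *)
Lemma chart_tangent u0 : D u0 -> forall c, curve_through M (phi u0) c ->
  exists w : 'rV[R]_d, derive1 c 0 = w *m jacobian phi u0.
Proof.
move=> Du0 c [c0 [V [oV V0] [sc cM]]]; have [oD sphi _ _ _] := chart.
have [W [psi [oW Wp spsi DW phiK]]] := chart_inverse Du0.
have inj : psi (phi u0) = u0.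
  have [_ _ _ inj _] := chart; apply: inj => //; first exact: DW.
  apply: phiK => //; rewrite -c0; apply: cM; by exists 0.
have cc : {for 0, continuous c} by exact: smooth_cont sc V0.
have nW : \forall t \near (0:R), V t /\ W (c t).
  apply: filterI; first exact: open_nbhs_nbhs.
  apply: cc; rewrite c0; exact: open_nbhs_nbhs.
have dc : derivable c 0 1 by exact: smooth_derivable sc V0.
have dpsi : differentiable psi (c 0) by rewrite c0; exact: smooth_differentiableV oW spsi Wp.
have H1 := chain_rule dpsi dc.
have dphi : differentiable phi ((psi \o c) 0).
  by rewrite /= c0 inj; exact: smooth_differentiableV oD sphi Du0.
have H2 := chain_rule dphi (@ex_derive _ _ _ _ _ _ _ H1).
exists ('D_1 (psi \o c) 0).
rewrite -deriveEjacobian; last by move: dphi; rewrite /= c0 inj.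
rewrite derive1E; have := @derive_val _ _ _ _ _ _ _ H2; rewrite /= c0 inj => <-.
apply: near_eq_derive; move: nW; apply: filterS => t [Vt Wt] /=.
by rewrite phiK //; apply: cM; exists t.
Qed.

Lemma chart_curve u0 w : D u0 ->
  curve_through M (phi u0) (fun t => phi (u0 + t *: w)) /\
  derive1 (fun t : R => phi (u0 + t *: w)) 0 = w *m jacobian phi u0.
Proof.
move=> Du0; have [oD sphi _ _ ophi] := chart.
have Mphi u : D u -> M (phi u).
  by move=> Du; have [U oU E] := ophi D oD (fun _ => id); have [] : (M `&` U) (phi u) by rewrite -E; exists u.
have sl : smooth_open setT (fun t : R => u0 + t *: w).
  apply: smooth_rV; first exact: openT.
  move=> j.
  have : smooth_open setT (fun t : R => u0 0 j + t * w 0 j).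
    apply: smoothD; [exact: openT|exact: smooth_cst openT|].
    apply: smoothM; [exact: openT| |exact: smooth_cst openT].
    exact: smooth_idfun.
  by apply: smooth_ext; [exact: openT|move=> t _; rewrite !mxE].
have oV : open ((fun t : R => u0 + t *: w) @^-1` D).
  apply: open_comp => // t _; exact: smooth_cont sl _.
split.
  split; first by rewrite scale0r addr0.
  exists ((fun t : R => u0 + t *: w) @^-1` D).
    by split=> //=; rewrite scale0r addr0.
  split.
    by apply: (smooth_compV (U := _ @^-1` D) oV oD _ _ sphi) => //; apply: smooth_sub sl.
  by move=> _ [t Dt <-]; exact: Mphi.
have dphi := smooth_differentiableV oD sphi Du0.
have dw : derivable phi (u0 + 0 *: w) w.
  by rewrite scale0r addr0; exact: diff_derivable.
rewrite derive1E (@derive_val _ _ _ _ _ _ _ (is_derive_line dw)) scale0r addr0.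
by rewrite deriveEjacobian.
Qed.

End ChartInverse.
End InverseFunction.

(** * Elliptic estimates for an algebra of functions with derivations *)

Section Calculus.
Context {R : realType} {T : Type} {N : nat}.
Implicit Types (f g : T -> R) (a b : 'I_N).

Definition calc_eq (M : set T) f g := forall p, M p -> f p = g p.

(* An algebra S of functions on M with derivations X_a closed under commutators, and an integral I for
   which -H_a - X_a is the adjoint of X_a. *)
Record calculus (M : set T) (S : (T -> R) -> Prop) (X : 'I_N -> (T -> R) -> T -> R)
    (H : 'I_N -> T -> R) (I : (T -> R) -> R) : Prop := Calculus {
  calc_S_cst : forall c, S (fun _ => c) ;
  calc_S_D : forall f g, S f -> S g -> S (fun p => f p + g p) ;
  calc_S_M : forall f g, S f -> S g -> S (fun p => f p * g p) ;
  calc_S_X : forall a f, S f -> S (X a f) ;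
  calc_S_H : forall a, S (H a) ;
  calc_X_ext : forall a f g, calc_eq M f g -> calc_eq M (X a f) (X a g) ;
  calc_X_cst : forall a c, calc_eq M (X a (fun _ => c)) (fun _ => 0) ;
  calc_X_D : forall a f g, S f -> S g ->
  calc_eq M (X a (fun p => f p + g p)) (fun p => X a f p + X a g p) ;
  calc_X_M : forall a f g, S f -> S g ->
  calc_eq M (X a (fun p => f p * g p)) (fun p => f p * X a g p + X a f p * g p) ;
  calc_X_comm : forall a b, exists c : 'I_N -> T -> R, (forall k : 'I_N, S (c k)) /\
  forall f, S f -> calc_eq M (X a (X b f)) (fun p => X b (X a f) p + \sum_(k < N) c k p * X k f p) ;
  calc_I_ext : forall f g, calc_eq M f g -> I f = I g ;
  calc_I_D : forall f g, S f -> S g -> I (fun p => f p + g p) = I f + I g ;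
  calc_I_Z : forall c f, S f -> I (fun p => c * f p) = c * I f ;
  calc_I_ge0 : forall f, S f -> (forall p, M p -> 0 <= f p) -> 0 <= I f ;
  calc_I_bp : forall a f, S f -> I (X a f) = - I (fun p => H a p * f p) ;
  calc_S_bdd : forall f, S f -> exists C, forall p, M p -> `|f p| <= C
}.

End Calculus.

Section Elliptic.
Context {R : realType} {T : Type} {N : nat} (M : set T).
Context (S : (T -> R) -> Prop) (X : 'I_N -> (T -> R) -> T -> R) (H : 'I_N -> T -> R).
Context (I : (T -> R) -> R).
Implicit Types (u v w f g : T -> R) (a b : 'I_N) (s t k l : nat).

Local Notation eqM f g := (forall p, M p -> f p = g p).

Hypothesis cal : calculus M S X H I.
Let S_cst := calc_S_cst cal.
Let S_D := calc_S_D cal.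
Let S_M := calc_S_M cal.
Let S_X := calc_S_X cal.
Let S_H := calc_S_H cal.
Let X_ext := calc_X_ext cal.
Let X_cst := calc_X_cst cal.
Let X_D := calc_X_D cal.
Let X_M := calc_X_M cal.
Let X_comm := calc_X_comm cal.
Let I_ext := calc_I_ext cal.
Let I_D := calc_I_D cal.
Let I_Z := calc_I_Z cal.
Let I_ge0 := calc_I_ge0 cal.
Let I_bp := calc_I_bp cal.
Let S_bdd := calc_S_bdd cal.

Ltac smooth_closed := solve [repeat first [assumption | simple apply S_X | simple apply S_H
  | simple apply S_cst | simple apply S_M | simple apply S_D]].
Hint Extern 0 (S _) => smooth_closed : core.

Lemma S_Z c f : S f -> S (fun p => c * f p).
Proof. by move=> Sf; apply: S_M. Qed.

Lemma S_N f : S f -> S (fun p => - f p).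
Proof.
move=> /(S_Z (-1)); congr S; apply/funext => p; by rewrite mulN1r.
Qed.

Lemma S_B f g : S f -> S g -> S (fun p => f p - g p).
Proof. by move=> Sf Sg; apply: S_D => //; exact: S_N. Qed.

Lemma S_sum (J : Type) (r : seq J) (F : J -> T -> R) : (forall j, S (F j)) ->
  S (fun p => \sum_(j <- r) F j p).
Proof.
move=> SF; elim: r => [|j r IH].
  by have := S_cst 0; congr S; apply/funext => p; rewrite big_nil.
by have := S_D (SF j) IH; congr S; apply/funext => p; rewrite big_cons.
Qed.

Ltac smooth_closed1 := solve [repeat first [assumption | simple apply S_X | simple apply S_H
  | simple apply S_cst | simple apply S_M | simple apply S_D | simple apply S_N
  | (simple apply S_sum; intro) | match goal with h : forall j, S _ |- _ => simple apply h end]].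
Hint Extern 0 (S _) => smooth_closed1 : core.

Lemma X_Z a c f : S f -> eqM (X a (fun p => c * f p)) (fun p => c * X a f p).
Proof.
by move=> Sf p Mp; rewrite (X_M a (S_cst c) Sf Mp) (X_cst a c Mp) mul0r addr0.
Qed.

Lemma X_N a f : S f -> eqM (X a (fun p => - f p)) (fun p => - X a f p).
Proof.
move=> Sf p Mp; rewrite /= -mulN1r -(X_Z a (-1) Sf Mp); apply: X_ext => // q _.
by rewrite mulN1r.
Qed.

Lemma X_B a f g : S f -> S g -> eqM (X a (fun p => f p - g p)) (fun p => X a f p - X a g p).
Proof. by move=> Sf Sg p Mp; rewrite /= (X_D a Sf (S_N Sg) Mp) (X_N a Sg Mp). Qed.

Lemma X_sum (J : Type) (r : seq J) (F : J -> T -> R) a : (forall j, S (F j)) ->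
  eqM (X a (fun p => \sum_(j <- r) F j p)) (fun p => \sum_(j <- r) X a (F j) p).
Proof.
move=> SF; elim: r => [|j r IH] p Mp /=.
  rewrite big_nil -[RHS](X_cst a 0 Mp); apply: X_ext => // q _; by rewrite big_nil.
rewrite big_cons -(IH p Mp) -(X_D a (SF j) (S_sum r SF) Mp).
by apply: X_ext => // q _; rewrite big_cons.
Qed.

Lemma I_N f : S f -> I (fun p => - f p) = - I f.
Proof.
move=> Sf; rewrite -mulN1r -I_Z //; apply: I_ext => p _; by rewrite mulN1r.
Qed.

Lemma I_le f g : S f -> S g -> (forall p, M p -> f p <= g p) -> I f <= I g.
Proof.
move=> Sf Sg fg; rewrite -subr_ge0 -I_N // -I_D; [|done|exact: S_N].
by apply: I_ge0 => [|p Mp]; [exact: S_B|rewrite subr_ge0 fg].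
Qed.

Lemma I_sum (J : Type) (r : seq J) (F : J -> T -> R) : (forall j, S (F j)) ->
  I (fun p => \sum_(j <- r) F j p) = \sum_(j <- r) I (F j).
Proof.
move=> SF; elim: r => [|j r IH].
  rewrite big_nil -[RHS](mul0r (I (fun _ => 0))) -I_Z //; apply: I_ext => p _.
  by rewrite big_nil mul0r.
rewrite big_cons -IH -I_D //.
by apply: I_ext => p _; rewrite big_cons.
Qed.

Definition dot u v := I (fun p => u p * v p).

(** Sum of the L2 products of X_w u and X_w v over all words w of length at most s. The recursion
    peels off the letter applied first, so that X_a commutes with nothing here and commutators
    appear only through [ell]. *)
Fixpoint sob s u v : R := match s with
  | 0 => dot u v
  | s'.+1 => dot u v + \sum_a sob s' (X a u) (X a v)
  end.

Lemma sob_ext s u u' v v' : eqM u u' -> eqM v v' -> sob s u v = sob s u' v'.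
Proof.
elim: s u u' v v' => [|s IH] u u' v v' uu vv /=.
  by apply: I_ext => p Mp; rewrite uu ?vv.
congr (_ + _); first by apply: I_ext => p Mp; rewrite uu ?vv.
by apply: eq_bigr => a _; apply: IH; exact: X_ext.
Qed.

Lemma sobC s u v : sob s u v = sob s v u.
Proof.
have dC (u' v' : T -> R) : dot u' v' = dot v' u' by rewrite /dot; apply: I_ext => p _; rewrite mulrC.
elim: s u v => [|s IH] u v /=; first exact: dC.
by rewrite dC; congr (_ + _); apply: eq_bigr.
Qed.

Lemma sobDl s u u' v : S u -> S u' -> S v ->
  sob s (fun p => u p + u' p) v = sob s u v + sob s u' v.
Proof.
have dD (w w' z : T -> R) : S w -> S w' -> S z -> dot (fun p => w p + w' p) z = dot w z + dot w' z.
  move=> Sw Sw' Sz; rewrite /dot -I_D //; apply: I_ext => p _; by rewrite mulrDl.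
elim: s u u' v => [|s IH] u u' v Su Su' Sv /=; first exact: dD.
rewrite dD // addrACA -big_split /=; congr (_ + _); apply: eq_bigr => a _.
rewrite -IH //; apply: sob_ext => //; exact: X_D.
Qed.

Lemma sobZl s c u v : S u -> S v -> sob s (fun p => c * u p) v = c * sob s u v.
Proof.
have dZ (w z : T -> R) : S w -> S z -> dot (fun p => c * w p) z = c * dot w z.
  move=> Sw Sz; rewrite /dot -I_Z //; apply: I_ext => p _; by rewrite mulrA.
elim: s u v => [|s IH] u v Su Sv /=; first exact: dZ.
rewrite dZ // mulrDr mulr_sumr; congr (_ + _); apply: eq_bigr => a _.
rewrite -IH //; apply: sob_ext => //; exact: X_Z.
Qed.

Lemma sobNl s u v : S u -> S v -> sob s (fun p => - u p) v = - sob s u v.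
Proof.
move=> Su Sv; rewrite -mulN1r -sobZl //; apply: sob_ext => // p _; by rewrite mulN1r.
Qed.

Lemma sob_suml s (J : Type) (r : seq J) (F : J -> T -> R) v : (forall j, S (F j)) -> S v ->
  sob s (fun p => \sum_(j <- r) F j p) v = \sum_(j <- r) sob s (F j) v.
Proof.
move=> SF Sv; elim: r => [|j r IH].
  rewrite big_nil -[RHS](mul0r (sob s v v)) -sobZl //.
  by apply: sob_ext => // p _; rewrite big_nil mul0r.
rewrite big_cons -IH -sobDl //.
by apply: sob_ext => // p _; rewrite big_cons.
Qed.

Lemma dot_ge0 u : S u -> 0 <= dot u u.
Proof. by move=> Su; apply: I_ge0 => // p _; rewrite -expr2 sqr_ge0. Qed.

Lemma sob_ge0 s u : S u -> 0 <= sob s u u.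
Proof.
elim: s u => [|s IH] u Su /=; first exact: dot_ge0.
by rewrite addr_ge0 ?dot_ge0 // sumr_ge0 // => a _; apply: IH; exact: S_X.
Qed.

Definition nrm s u := Num.sqrt (sob s u u).

Lemma nrm_ge0 s u : 0 <= nrm s u. Proof. exact: sqrtr_ge0. Qed.

Lemma nrm_sqr s u : S u -> nrm s u ^+ 2 = sob s u u.
Proof. by move=> Su; rewrite sqr_sqrtr // sob_ge0. Qed.

Lemma nrm_ext s u v : eqM u v -> nrm s u = nrm s v.
Proof. by move=> uv; rewrite /nrm (sob_ext s uv uv). Qed.

Lemma sob_quad s u v (x : R) : S u -> S v ->
  0 <= sob s u u + 2 * x * sob s u v + x ^+ 2 * sob s v v.
Proof.
move=> Su Sv; have Sx : S (fun p => x * v p) by exact: S_Z.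
have := sob_ge0 s (S_D Su Sx).
rewrite sobDl // (sobC s u) (sobC s (fun p => x * v p)) !sobDl // !sobZl //.
rewrite (sobC s u (fun p => x * v p)) sobZl //  (sobC s v (fun p => x * v p)) sobZl // (sobC s v u).
by congr (0 <= _); ring.
Qed.

Lemma cauchy_schwarz s u v : S u -> S v -> `|sob s u v| <= nrm s u * nrm s v.
Proof.
move=> Su Sv; rewrite -sqrtrM ?sob_ge0 // -sqrtr_sqr ler_sqrt; last first.
  by rewrite mulr_ge0 ?sob_ge0.
have A0 := sob_ge0 s Su; have B0 := sob_ge0 s Sv.
have Q x := sob_quad s x Su Sv.
set A := sob s u u in A0 Q *; set B := sob s v v in B0 Q *; set Cc := sob s u v in Q *.
have [BE|B1] := eqVneq B 0.
  have [->|C0] := eqVneq Cc 0; first by rewrite expr0n /= mulr_ge0.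
  (* When B = 0 the quadratic is affine in x, and this x gives it the value -1. *)
  have := Q (- (A + 1) / (2 * Cc)); rewrite BE.
  have -> : A + 2 * (- (A + 1) / (2 * Cc)) * Cc + (- (A + 1) / (2 * Cc)) ^+ 2 * 0 = - 1 by field.
  by rewrite ler0N1.
have := Q (- Cc / B).
have -> : A + 2 * (- Cc / B) * Cc + (- Cc / B) ^+ 2 * B = (A * B - Cc ^+ 2) / B by field.
by rewrite pmulr_lge0 ?subr_ge0 // invr_gt0 lt0r B1.
Qed.

Lemma nrmD s u v : S u -> S v -> nrm s (fun p => u p + v p) <= nrm s u + nrm s v.
Proof.
move=> Su Sv; rewrite -(@ler_pXn2r _ 2) ?nnegrE ?addr_ge0 ?nrm_ge0 //.
rewrite nrm_sqr // sqrrD !nrm_sqr // sobDl // (sobC s u) (sobC s v) !sobDl //.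
have := ler_norm (sob s u v); rewrite (sobC s v u).
have := cauchy_schwarz s Su Sv; rewrite -mulr_natl; lra.
Qed.

Lemma nrmZ s c u : S u -> nrm s (fun p => c * u p) = `|c| * nrm s u.
Proof.
move=> Su; rewrite /nrm sobZl // sobC sobZl // mulrA -expr2 sqrtrM ?sqr_ge0 //.
by rewrite sqrtr_sqr.
Qed.

Lemma nrmN s u : S u -> nrm s (fun p => - u p) = nrm s u.
Proof.
move=> Su; rewrite -[RHS]mul1r -[X in X * _](normrN1 R) -nrmZ //; apply: nrm_ext => p _.
by rewrite mulN1r.
Qed.

Lemma nrmS s u : S u -> nrm s u <= nrm s.+1 u.
Proof.
move=> Su; rewrite ler_sqrt ?sob_ge0 //; elim: s u Su => [|s IH] u Su.
  by rewrite /= lerDl sumr_ge0 // => a _; apply: dot_ge0; exact: S_X.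
rewrite [leLHS]/= [leRHS]/= lerD2l; apply: ler_sum => a _.
by apply: IH; exact: S_X.
Qed.

Lemma nrm_mono s t u : S u -> (s <= t)%N -> nrm s u <= nrm t u.
Proof.
move=> Su; elim: t => [|t IH]; first by rewrite leqn0 => /eqP->.
rewrite leq_eqVlt => /predU1P[->//|]; rewrite ltnS => /IH /le_trans; apply.
exact: nrmS.
Qed.

Lemma nrm_X s a u : S u -> nrm s (X a u) <= nrm s.+1 u.
Proof.
move=> Su; rewrite ler_sqrt ?sob_ge0 //= (bigD1 a) //= addrCA lerDl addr_ge0 ?dot_ge0 //.
by rewrite sumr_ge0 // => b _; apply: sob_ge0; exact: S_X.
Qed.

Lemma nrmS_le s u : S u -> nrm s.+1 u <= nrm 0 u + \sum_a nrm s (X a u).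
Proof.
move=> Su; have sq_sum (J : Type) (r : seq J) (F : J -> R) : (forall j, 0 <= F j) ->
    \sum_(j <- r) F j ^+ 2 <= (\sum_(j <- r) F j) ^+ 2.
  move=> F0; elim: r => [|j r IH]; first by rewrite !big_nil expr0n.
  rewrite !big_cons sqrrD addrAC; apply: le_trans (lerD (lexx _) IH) _.
  by rewrite lerDl mulrn_wge0 // mulr_ge0 // sumr_ge0.
have A0 : 0 <= \sum_a nrm s (X a u) by rewrite sumr_ge0 // => a _; exact: nrm_ge0.
rewrite -(@ler_pXn2r _ 2) ?nnegrE ?addr_ge0 ?nrm_ge0 // nrm_sqr //= sqrrD.
have E1 : nrm 0 u ^+ 2 = dot u u by rewrite nrm_sqr.
have E2 : \sum_a sob s (X a u) (X a u) <= (\sum_a nrm s (X a u)) ^+ 2.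
  apply: le_trans (sq_sum _ _ _ _); last by move=> a; exact: nrm_ge0.
  by apply: ler_sum => a _; rewrite nrm_sqr.
have E3 : 0 <= nrm 0 u * \sum_a nrm s (X a u) by rewrite mulr_ge0 ?nrm_ge0.
rewrite E1 -addrA lerD2l (le_trans E2) // lerDr mulrn_wge0 //.
Qed.

(* Q has order at most k: measured on Sobolev norms, as there are no symbols here. *)
Definition Op k (Q : (T -> R) -> T -> R) := (forall u, S u -> S (Q u)) /\
  forall s, exists2 C, 0 <= C & forall u, S u -> nrm s (Q u) <= C * nrm (s + k) u.

Lemma Op_ext k Q Q' : (forall u, S u -> S (Q' u)) -> (forall u, S u -> eqM (Q u) (Q' u)) ->
  Op k Q -> Op k Q'.
Proof.
move=> SQ' E [SQ HQ]; split=> // s; have [C C0 HC] := HQ s; exists C => // u Su.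
by rewrite -(nrm_ext s (E u Su)) HC.
Qed.

Lemma Op_le k l Q : (k <= l)%N -> Op k Q -> Op l Q.
Proof.
move=> kl [SQ HQ]; split=> // s; have [C C0 HC] := HQ s; exists C => // u Su.
by rewrite (le_trans (HC u Su)) // ler_wpM2l // nrm_mono // leq_add2l.
Qed.

Lemma Op_X a : Op 1 (X a).
Proof. by split=> [u|s]; [exact: S_X|exists 1 => // u Su; rewrite mul1r addn1 nrm_X]. Qed.

Lemma Op_comp k l P Q : Op k P -> Op l Q -> Op (k + l) (fun u => P (Q u)).
Proof.
move=> [SP HP] [SQ HQ]; split=> [u Su|s]; first by apply: SP; exact: SQ.
have [C C0 HC] := HP s; have [C' C'0 HC'] := HQ (s + k)%N.
exists (C * C'); first exact: mulr_ge0.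
move=> u Su; rewrite (le_trans (HC _ (SQ u Su))) // -mulrA ler_wpM2l //.
by rewrite addnA HC'.
Qed.

Lemma Op_D k P Q : Op k P -> Op k Q -> Op k (fun u p => P u p + Q u p).
Proof.
move=> [SP HP] [SQ HQ]; split=> [u Su|s]; first by apply: S_D; [exact: SP|exact: SQ].
have [C C0 HC] := HP s; have [C' C'0 HC'] := HQ s.
exists (C + C'); first exact: addr_ge0.
move=> u Su; apply: (le_trans (nrmD s (SP u Su) (SQ u Su))); rewrite mulrDl.
by rewrite lerD ?HC ?HC'.
Qed.

Lemma Op_N k Q : Op k Q -> Op k (fun u p => - Q u p).
Proof.
move=> [SQ HQ]; split=> [u Su|s]; first by apply: S_N; exact: SQ.
have [C C0 HC] := HQ s; exists C => // u Su; by rewrite (nrmN s (SQ u Su)) HC.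
Qed.

Lemma Op_0 k : Op k (fun _ _ => 0).
Proof.
split=> // s; exists 0 => // u Su; rewrite mul0r.
rewrite (@nrm_ext s _ (fun p => 0 * 0)); last by move=> p _; rewrite mul0r.
by rewrite nrmZ // normr0 mul0r.
Qed.

Lemma Op_sum k (J : Type) (r : seq J) (Q : J -> (T -> R) -> T -> R) : (forall j, Op k (Q j)) ->
  Op k (fun u p => \sum_(j <- r) Q j u p).
Proof.
move=> OQ; elim: r => [|j r IH].
  by have := Op_0 k; congr Op; apply/funext => u; apply/funext => p; rewrite big_nil.
have := Op_D (OQ j) IH; congr Op; apply/funext => u; apply/funext => p; by rewrite big_cons.
Qed.

Lemma fin_bound (J : finType) (P : J -> R -> Prop) :
  (forall j, exists2 C, 0 <= C & P j C) -> (forall j C C', C <= C' -> P j C -> P j C') ->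
  exists2 C, 0 <= C & forall j, P j C.
Proof.
move=> HP mono.
have /fin_all_exists[C HC] : forall j, exists C, 0 <= C /\ P j C.
  by move=> j; have [C C0 HC] := HP j; exists C.
exists (\sum_j C j); first by rewrite sumr_ge0 // => j _; have [] := HC j.
move=> j; have [_] := HC j; apply: mono.
by rewrite (bigD1 j) //= lerDl sumr_ge0 // => i _; have [] := HC i.
Qed.

(** The induction on s treats all f at once: by the Leibniz rule, passing to order s + 1 also
    involves multiplication by the functions X_a f. *)
Lemma Op_mul f : S f -> Op 0 (fun u p => f p * u p).
Proof.
move=> Sf; split=> [u|s]; first exact: S_M.
elim: s f Sf => [|s IH] f Sf.
  have [C HC] := S_bdd Sf; exists `|C| => // u Su.
  rewrite addn0 -nrmZ // ler_sqrt; last by apply: sob_ge0; exact: S_Z.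
  rewrite /= /dot; apply: I_le => // p Mp.
  rewrite mulrACA [leRHS]mulrACA ler_wpM2r // -?expr2 ?sqr_ge0 //.
  rewrite -(real_normK (num_real (f p))) -(real_normK (num_real C)).
  rewrite ler_pXn2r ?nnegrE //; exact: le_trans (HC p Mp) (ler_norm _).
have [C C0 HC] := IH f Sf.
have [C' C'0 HC'] : exists2 C, 0 <= C &
    forall a u, S u -> nrm s (fun p => X a f p * u p) <= C * nrm s u.
  apply: (@fin_bound _ (fun a C => forall u, S u -> nrm s (fun p => X a f p * u p) <= C * nrm s u)).
    move=> a; have [C' C'0 HC'] := IH (X a f) (S_X a Sf); exists C' => // u Su.
    by have := HC' u Su; rewrite addn0.
  move=> a C1 C2 C12 H1 u Su; by rewrite (le_trans (H1 u Su)) // ler_wpM2r ?nrm_ge0.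
exists (C + \sum_(a < N) (C + C')); first by rewrite addr_ge0 // sumr_ge0 // => a _; rewrite addr_ge0.
move=> u Su; rewrite addn0 (le_trans (nrmS_le s (S_M Sf Su))) // mulrDl; apply: lerD.
  apply: (le_trans (nrm_mono (s := 0) (t := s) _ _)) => //.
  apply: (le_trans (HC u Su)); by rewrite addn0 ler_wpM2l // nrmS.
rewrite mulr_suml; apply: ler_sum => a _.
rewrite (nrm_ext s (X_M a Sf Su)) (le_trans (nrmD s (S_M Sf (S_X a Su)) (S_M (S_X a Sf) Su))) // mulrDl.
apply: lerD.
  have := HC (X a u) (S_X a Su); rewrite addn0 => /le_trans; apply.
  by rewrite ler_wpM2l // nrm_X.
apply: (le_trans (HC' a u Su)); by rewrite ler_wpM2l // nrmS.
Qed.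

Definition ell u p := u p - \sum_a (X a (X a u) p + H a p * X a u p).

Let S_ell0 u a : S u -> S (fun p => X a (X a u) p + H a p * X a u p).
Proof. by move=> Su; apply: S_D; [do 2 apply: S_X|apply: S_M => //; exact: S_X]. Qed.

Lemma S_ell u : S u -> S (ell u).
Proof. by move=> Su; apply: S_B => //; apply: S_sum => a; exact: S_ell0. Qed.

Lemma ell_ext u v : eqM u v -> eqM (ell u) (ell v).
Proof.
move=> uv p Mp; rewrite /ell uv //; congr (_ - _); apply: eq_bigr => a _.
by rewrite (X_ext a (X_ext a uv) Mp) (X_ext a uv Mp).
Qed.

(** With C_a the commutator of X_b and X_a, of order 1, the commutator of X_b with X_a X_a is C_a
    X_a + X_a C_a, and with H_a X_a it is (X_b H_a) X_a + H_a C_a. The terms of order 3 cancel. *)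
Lemma ell_comm b : Op 2 (fun u p => X b (ell u) p - ell (X b u) p).
Proof.
have /fin_all_exists[c Hc] := fun a => X_comm b a.
have OC a : Op 1 (fun u p => \sum_(k < N) c a k p * X k u p).
  apply: Op_sum => k; have Sc : S (c a k) by have [] := Hc a.
  exact: (Op_comp (Op_mul Sc) (Op_X k)).
have SC a u : S u -> S (fun p => \sum_(k < N) c a k p * X k u p) by have [+ _] := OC a; apply.
have Oa a : Op 2 (fun u p => (\sum_(k < N) c a k p * X k (X a u) p) +
    X a (fun q => \sum_(k < N) c a k q * X k u q) p +
    (X b (H a) p * X a u p + H a p * \sum_(k < N) c a k p * X k u p)).
  apply: Op_D; apply: Op_D.
  - exact: (Op_comp (OC a) (Op_X a)).
  - exact: (Op_comp (Op_X a) (OC a)).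
  - exact: (@Op_le 1 2 _ isT (Op_comp (Op_mul (S_X b (S_H a))) (Op_X a))).
  - exact: (@Op_le 1 2 _ isT (Op_comp (Op_mul (S_H a)) (OC a))).
apply: Op_ext (Op_N (Op_sum (index_enum 'I_N) Oa)).
  by move=> u Su; apply: S_B; [apply: S_X; exact: S_ell|apply: S_ell; exact: S_X].
move=> u Su p Mp.
rewrite /ell (X_B b Su (S_sum _ (fun a => S_ell0 a Su)) Mp).
rewrite (X_sum (index_enum 'I_N) b (fun a => S_ell0 a Su) Mp).
rewrite opprB [RHS]addrC addrA subrK -sumrB -sumrN; apply: eq_bigr => a _.
have SXu : S (X a u) by exact: S_X.
have SHX : S (fun p => H a p * X a u p) by exact: S_M.
rewrite (X_D b (S_X a SXu) SHX Mp) (X_M b (S_H a) SXu Mp).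
have [_ Ca] := Hc a.
rewrite (Ca _ SXu p Mp) (Ca u Su p Mp).
rewrite (X_ext a (Ca u Su) Mp) (X_D a (S_X a (S_X b Su)) (SC a u Su) Mp).
move: (\sum_k _ * _) (X a (fun q => _) p) (\sum_k _ * _) => x1 x2 x3.
move: (X b _ p) (X a _ p) (X a (X b u) p) (X a u p) (H a p) => y1 y2 y3 y4 y5; ring.
Qed.

Lemma ell_dot u v : S u -> S v -> dot (ell u) v = dot u v + \sum_a dot (X a u) (X a v).
Proof.
move=> Su Sv; rewrite -[LHS]/(sob 0 (ell u) v) /ell.
rewrite sobDl //.
rewrite sobNl //.
rewrite sob_suml // /=; congr (_ + _); rewrite -sumrN; apply: eq_bigr => a _.
have SXu : S (X a u) by exact: S_X.
have := I_bp a (S_M SXu Sv).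
rewrite (I_ext (X_M a SXu Sv)) I_D // => E.
apply/eqP; rewrite -subr_eq0 -opprD oppr_eq0 addrC.
have -> : dot (fun p => X a (X a u) p + H a p * X a u p) v =
    I (fun p => X a (X a u) p * v p) + I (fun p => H a p * (X a u p * v p)).
  rewrite /dot -I_D //; apply: I_ext => p _; by rewrite mulrDl mulrA.
by rewrite addrA -[X in X + _]/(dot _ _ + _) /dot E addNr.
Qed.

(** At s = 0 this is the exact integration by parts [ell_dot]. Each further order moves one X_b
    across ell, and the commutator has order 2. The error contains the norm of order s + 1 of u but
    only that of order s of v, one less than the leading term, and can be absorbed when v = u. *)
Lemma ell_ibp s : exists2 C, 0 <= C & forall u v, S u -> S v ->
  `|sob s (ell u) v - sob s u v - \sum_a sob s (X a u) (X a v)| <= C * nrm s.+1 u * nrm s v.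
Proof.
elim: s => [|s [C C0 IH]].
  by exists 0 => // u v Su Sv; rewrite !mul0r /= ell_dot // addrAC addrK subrr normr0.
have [K K0 HK] : exists2 K, 0 <= K & forall b u, S u ->
    nrm s (fun p => X b (ell u) p - ell (X b u) p) <= K * nrm s.+2 u.
  apply: (@fin_bound _ (fun b K => forall u, S u ->
    nrm s (fun p => X b (ell u) p - ell (X b u) p) <= K * nrm s.+2 u)).
    move=> b; have [_ /(_ s)[K K0 HK]] := ell_comm b; exists K => // u Su.
    by have := HK u Su; rewrite addn2.
  by move=> b C1 C2 C12 H1 u Su; rewrite (le_trans (H1 u Su)) // ler_wpM2r ?nrm_ge0.
exists (\sum_(b < N) (C + K)); first by rewrite sumr_ge0 // => b _; rewrite addr_ge0.
move=> u v Su Sv /=.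
have -> : dot (ell u) v + \sum_a sob s (X a (ell u)) (X a v) -
    (dot u v + \sum_a sob s (X a u) (X a v)) -
    \sum_a (dot (X a u) (X a v) + \sum_b sob s (X b (X a u)) (X b (X a v))) =
  \sum_b ((sob s (ell (X b u)) (X b v) - sob s (X b u) (X b v) -
            \sum_a sob s (X a (X b u)) (X a (X b v))) +
          sob s (fun p => X b (ell u) p - ell (X b u) p) (X b v)).
  rewrite ell_dot // big_split /= opprD addrA -addrA -addrA.
  under [in RHS]eq_bigr => b _.
    have SXe : S (X b (ell u)) by apply: S_X; exact: S_ell.
    have SeX : S (ell (X b u)) by apply: S_ell; exact: S_X.
    rewrite sobDl // sobNl //; over.
  rewrite !big_split /= !sumrN.
  move: (\sum_a dot _ _) (\sum_a sob s (X a (ell u)) _) (\sum_a sob s (X a u) _) (\sum_b sob s (ell _) _)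
    (\sum_a \sum_b _) (dot u v) => x1 x2 x3 x4 x5 x6; ring.
rewrite (le_trans (ler_norm_sum _ _ _)) // !mulr_suml; apply: ler_sum => b _.
rewrite (le_trans (ler_normD _ _)) // !mulrDl; apply: lerD.
  apply: (le_trans (IH _ _ (S_X b Su) (S_X b Sv))).
  rewrite ler_pM ?mulr_ge0 ?nrm_ge0 ?nrm_X // ler_wpM2l // nrm_X //.
apply: (le_trans (cauchy_schwarz s _ (S_X b Sv))).
  by apply: S_B; [apply: S_X; exact: S_ell|apply: S_ell; exact: S_X].
by rewrite ler_pM ?nrm_ge0 ?nrm_X ?HK.
Qed.

Lemma elliptic_step s : exists2 C, 0 <= C & forall u, S u ->
  nrm s.+1 u <= C * (nrm s u + nrm s (ell u)).
Proof.
have [C C0 HC] := ell_ibp s; exists (C + 2); first by rewrite addr_ge0.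
move=> u Su.
have B1 : nrm s.+1 u ^+ 2 <= nrm s (ell u) * nrm s u + C * nrm s.+1 u * nrm s u.
  have le1 : sob s.+1 u u <= sob s u u + \sum_a sob s (X a u) (X a u).
    rewrite /= lerD2r; have := @nrm_mono 0 s u Su (leq0n s).
    by rewrite ler_sqrt ?sob_ge0.
  have := ler_norm (- (sob s (ell u) u - sob s u u - \sum_a sob s (X a u) (X a u))).
  rewrite normrN => /le_trans /(_ (HC u u Su Su)).
  have := le_trans (ler_norm _) (cauchy_schwarz s (S_ell Su) Su).
  rewrite nrm_sqr //.
  move: le1; move: (sob s.+1 u u) (sob s u u) (\sum_a _) (sob s (ell u) u) (nrm s (ell u) * nrm s u)
     (C * _ * _) => x1 x2 x3 x4 x5 x6; lra.
move: B1 (nrm_ge0 s.+1 u) (nrm_ge0 s u) (nrm_ge0 s (ell u)) C0.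
move: (nrm s.+1 u) (nrm s u) (nrm s (ell u)) => x y z B1 x0 y0 z0 C0.
(* If x > (C + 2)(y + z), then z < x and (C + 1) y < x, so that z y + C x y <= x (C + 1) y < x^2,
   against [B1]. *)
rewrite leNgt; apply/negP => lt1.
have y1 : 0 <= C * z + z by rewrite addr_ge0 ?mulr_ge0.
have y2 : 0 <= C * y by rewrite mulr_ge0.
have x1 : 0 < x by nra.
have x2 : z < x by nra.
have x3 : (C + 1) * y < x by nra.
have : z * y + C * x * y <= x * ((C + 1) * y) by nra.
by nra.
Qed.

Lemma S_iter_ell j u : S u -> S (iter j ell u).
Proof. by move=> Su; elim: j => //= j; exact: S_ell. Qed.

(** Each derivative costs a whole power of ell instead of one half. Since only polynomial bounds in
    the eigenvalues are sought, this waste is harmless. *)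
Theorem elliptic_estimate s : exists2 C, 0 <= C & forall u, S u ->
  nrm s u <= C * \sum_(j < s.+1) nrm 0 (iter j ell u).
Proof.
elim: s => [|s [C C0 IH]].
  by exists 1 => // u Su; rewrite big_ord_recl big_ord0 addr0 mul1r.
have [K K0 HK] := elliptic_step s; exists (K * (C + C)); first by rewrite mulr_ge0 ?addr_ge0.
move=> u Su; rewrite (le_trans (HK u Su)) // -mulrA ler_wpM2l // mulrDl.
apply: lerD; [apply: (le_trans (IH u Su))|apply: (le_trans (IH _ (S_ell Su)))]; rewrite ler_wpM2l //.
  by rewrite [leRHS]big_ord_recr /= lerDl nrm_ge0.
rewrite [leRHS]big_ord_recl -[leLHS]add0r lerD ?nrm_ge0 //.
by apply: ler_sum => j _; rewrite -iterSr.
Qed.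

End Elliptic.

(** * Iterated integrals *)

Section Compactness.
Context {R : realType}.

(** The passage from local radii to a common one always takes this form: uniform continuity,
    boundedness (with s the inverse of the bound), uniform kernel limits and short paths. *)
Lemma compact_unif {V : normedModType R} (K : set V) (P : R -> V -> Prop) : compact K ->
  (forall x, K x -> exists2 r : R, 0 < r & forall y s, `|y - x| < r -> 0 < s < r -> P s y) ->
  exists2 r : R, 0 < r & forall s, 0 < s < r -> forall y, K y -> P s y.
Proof.
move=> /compact_near_coveringP cK H.
have : \forall s \near (0:R)^'+, K `<=` P s.
  apply: cK => x /H[r r0 {}H].
  exists ([set y | `|y - x| < r], [set s | 0 < s < r]); last by move=> [y s] [/= yr sr]; exact: H.
  split=> /=.
    apply/nbhs_ballP; exists r => //= y; by rewrite -ball_normE /= distrC.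
  near=> s => /=; apply/andP; split; first by near: s; exact: nbhs_right_gt.
  by near: s; exact: nbhs_right_lt.
rewrite /at_right near_withinE => /(@near_ball R R^o)[r r0 Hr]; exists r => // s /andP[s0 sr] y Ky.
by apply: (Hr s) => //; rewrite subr0 gtr0_norm.
Unshelve. all: by end_near. Qed.

Lemma continuous_ball {V : normedModType R} (f : V -> R) :
  (forall x (e : R), 0 < e -> exists2 r : R, 0 < r & forall y, `|y - x| < r -> `|f y - f x| <= e) ->
  continuous f.
Proof.
move=> H x; apply/cvgrPdist_le => e e0; have [r r0 Hr] := H x e e0.
by apply: (@ball_near R V _ x r) => // y /Hr; rewrite distrC.
Qed.

Lemma compact_rV_box n (B : R) : compact [set v : 'rV[R]_n | `|v| <= B].
Proof.
apply: bounded_closed_compact.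
  exists B; split; first exact: num_real.
  by move=> M BM v /= /le_trans; apply; exact: ltW.
have -> : [set v : 'rV[R]_n | `|v| <= B] = (fun v => `|v|) @^-1` [set x | x <= B] by [].
apply: closed_comp; last exact: closed_le.
by move=> v _; exact: norm_continuous.
Qed.

End Compactness.

Section Integral1.
Context {R : realType}.
Notation mu := (@lebesgue_measure R).

Definition int1 (f : R -> R) := \int[mu]_(t in setT) f t.

Lemma is_derive_continuous (F : R -> R) (t a : R) : is_derive t 1 F a -> {for t, continuous F}.
Proof. by case=> /derivable1_diffP /differentiable_continuous. Qed.

Lemma deriv_homo (F f : R -> R) (x y : R) : (forall t : R, is_derive t (1 : R) F (f t)) ->
  (forall t, 0 <= f t) -> x <= y -> F x <= F y.
Proof.
move=> dF f0; rewrite le_eqVlt => /predU1P[->//|xy].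
have [|c _ E] := @MVT R F f x y xy (fun t _ => dF t).
  by apply: continuous_subspaceT => t; apply: is_derive_continuous (dF t).
by rewrite -subr_ge0 E mulr_ge0 // subr_ge0 ltW.
Qed.

(** The gateway to one-dimensional integrals: bounds, translation, scaling and positivity below are
    all read off an antiderivative. *)
Lemma int1_FTC (B : R) (f F : R -> R) a b : continuous f -> (forall t, B < `|t| -> f t = 0) ->
  (forall t : R, is_derive t (1 : R) F (f t)) -> a < b -> a <= - B -> B <= b -> int1 f = F b - F a.
Proof.
move=> cf sf dF ab aB Bb.
have E : f = f \_ `[a, b].
  apply/funext => t; rewrite patchE; case: ifPn => // /negP; rewrite inE /= in_itv /= => H.
  apply: sf; rewrite ltNge; apply/negP; rewrite ler_norml => /andP[h1 h2]; apply: H.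
  by rewrite (le_trans aB h1) (le_trans h2 Bb).
rewrite /int1 {1}E -Rintegral_mkcond /Rintegral.
rewrite (@continuous_FTC2 R f F a b ab) //.
- by apply: continuous_subspaceT.
- split=> [t _||].
  + by case: (dF t).
  + by apply: cvg_at_right_filter; exact: is_derive_continuous (dF a).
  + by apply: cvg_at_left_filter; exact: is_derive_continuous (dF b).
- by move=> t _; rewrite derive1E; case: (dF t).
Qed.

Lemma supp_integrable (B : R) (f : R -> R) (A : set R) : measurable A -> continuous f ->
  (forall t, B < `|t| -> f t = 0) -> mu.-integrable A (EFin \o f).
Proof.
move=> mA cf sf; apply: (@integrableS _ _ _ _ setT) => //.
have E : f = f \_ `[- B, B].
  apply/funext => t; rewrite patchE; case: ifPn => // /negP; rewrite inE /= in_itv /= => H.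
  by apply: sf; rewrite ltNge; apply/negP; rewrite ler_norml.
rewrite E -restrict_EFin; apply/integrable_restrict => //; rewrite ?setTI //.
apply: continuous_compact_integrable; first exact: segment_compact.
by apply: continuous_subspaceT.
Qed.

Lemma antiderivative (B : R) (f : R -> R) : continuous f -> (forall t, B < `|t| -> f t = 0) ->
  exists F : R -> R, forall t : R, is_derive t (1 : R) F (f t).
Proof.
move=> cf sf.
exists (fun x => \int[mu]_(t in [set` Interval -oo%O (BRight x)]) f t) => t.
have lt1 : t < t + 1 by rewrite ltrDl.
have H := @continuous_FTC1 R f -oo%O t (t + 1) lt1
  (@supp_integrable B f _ (measurable_itv _) cf sf); cbv zeta in H.
have [||d E] := H; [by rewrite ltNyr|exact: cf|].
by split; [exact: d|rewrite -derive1E].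
Qed.

Definition Cc1 (B : R) (f : R -> R) := continuous f /\ forall t, B < `|t| -> f t = 0.

Lemma int1D B f g : Cc1 B f -> Cc1 B g -> int1 (fun t => f t + g t) = int1 f + int1 g.
Proof.
move=> [cf sf] [cg sg]; have mT := @measurableT _ (measurableTypeR R).
by rewrite /int1 RintegralD //; apply: supp_integrable; eauto.
Qed.

Lemma Cc1_Z B c f : Cc1 B f -> Cc1 B (fun t => c * f t).
Proof.
move=> [cf sf]; split=> [t|t Bt]; last by rewrite sf // mulr0.
by apply: continuousM; [exact: cst_continuous|exact: cf].
Qed.

Lemma int1Z B c f : Cc1 B f -> int1 (fun t => c * f t) = c * int1 f.
Proof.
move=> [cf sf]; have mT := @measurableT _ (measurableTypeR R).
by rewrite /int1 RintegralZl //; apply: supp_integrable; eauto.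
Qed.

Lemma int1_ge0 f : (forall t, 0 <= f t) -> 0 <= int1 f.
Proof. by move=> f0; apply: Rintegral_ge0. Qed.

Lemma int1_bound B f c : 0 < B -> Cc1 B f -> (forall t, `|f t| <= c) -> `|int1 f| <= 2 * B * c.
Proof.
move=> B0 [cf sf] fc; have [F dF] := antiderivative cf sf.
have BB : - B < B by rewrite gtrN.
rewrite (int1_FTC cf sf dF BB) //.
have [|s _ ->] := @MVT R F f (- B) B BB (fun t _ => dF t).
  by apply: continuous_subspaceT => t; apply: is_derive_continuous (dF t).
rewrite normrM opprK (_ : B + B = 2 * B); last by ring.
by rewrite (gtr0_norm (mulr_gt0 _ _)) // mulrC ler_wpM2l // mulr_ge0 // ltW.
Qed.

Lemma int1_shift B f a : 0 < B -> Cc1 B f -> int1 (fun t => f (t + a)) = int1 f.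
Proof.
move=> B0 [cf sf]; have [F dF] := antiderivative cf sf.
pose C := B + `|a|.
have C0 : 0 < C by rewrite ltr_wpDr.
have dG (t : R) : is_derive t (1 : R) (fun s => F (s + a)) (f (t + a)).
  have := @is_derive_shiftV R R^o F a t 1; case: (dF (t + a)) => d <- H; exact: H.
have cg : continuous (fun t => f (t + a)).
  move=> t; apply: (@continuous_comp _ _ _ (fun s => s + a) f); last exact: cf.
  by apply: continuousD; [exact: cvg_id|exact: cst_continuous].
have sg t : C < `|t| -> f (t + a) = 0.
  move=> Ct; apply: sf; have := ler_normD (t + a) (- a); rewrite addrK normrN.
  by move: Ct; rewrite /C; lra.
have aa := ler_norm a; have na := ler_norm (- a); rewrite normrN in na.
rewrite (int1_FTC (a := - C) (b := C) cg sg dG) // ?gtrN //.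
rewrite (int1_FTC (a := - C + a) (b := C + a) cf sf dF) // /C; lra.
Qed.

Lemma int1_scale B f c : 0 < B -> 0 < c -> Cc1 B f -> int1 (fun t => f (c * t)) = c^-1 * int1 f.
Proof.
move=> B0 c0 [cf sf]; have [F dF] := antiderivative cf sf.
pose C := B / c.
have C0 : 0 < C by rewrite divr_gt0.
have dl (t : R) : is_derive t (1 : R) (fun s : R => c * s) c.
  have H := is_deriveZ c (is_derive_id (t : R^o) (1 : R^o)).
  by apply: (is_derive_eq H); rewrite [LHS]mulr1.
have dG (t : R) : is_derive t (1 : R) (fun s => c^-1 * F (c * s)) (f (c * t)).
  case: (dF (c * t)) => d E; case: (dl t) => d' E'.
  have H := is_deriveZ c^-1 (@chain_rule1 R R^o F (fun s => c * s) t 1 d d').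
  apply: (is_derive_eq H); rewrite E E' scaleRE mulrCA mulVf ?mulr1 //; lra.
have cg : continuous (fun t => f (c * t)).
  move=> t; apply: (@continuous_comp _ _ _ (fun s => c * s) f); last exact: cf.
  exact: is_derive_continuous (dl t).
have sg t : C < `|t| -> f (c * t) = 0.
  move=> Ct; apply: sf; by rewrite normrM gtr0_norm // mulrC -ltr_pdivrMr.
rewrite (int1_FTC (a := - C) (b := C) cg sg dG) // ?gtrN //.
rewrite (int1_FTC (a := - B) (b := B) cf sf dF) // ?gtrN // mulrN /C (mulrC c) divfK ?gt_eqF //.
by rewrite mulrBr.
Qed.

Lemma int1_gt0 B f t0 : 0 < B -> Cc1 B f -> (forall t, 0 <= f t) -> 0 < f t0 -> 0 < int1 f.
Proof.
move=> B0 [cf sf] f0 ft; have [F dF] := antiderivative cf sf.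
have [r r0 Hr] : exists2 r : R, 0 < r & forall y, `|y - t0| < r -> 0 < f y.
  have /cvgrPdist_lt/(_ _ ft)/near_ball[r r0 H] := cf t0; exists r => // y /H.
  by rewrite ltr_norml => /andP[_]; lra.
pose C := B + `|t0| + r.
have [t1 t2] : t0 <= `|t0| /\ - t0 <= `|t0|.
  by split; [exact: ler_norm|rewrite -normrN ler_norm].
rewrite (int1_FTC (a := - C) (b := C) cf sf dF) // /C; [|lra..].
have tr : t0 < t0 + r by rewrite ltrDl.
have [|c cI E] := @MVT R F f t0 (t0 + r) tr (fun t _ => dF t).
  by apply: continuous_subspaceT => t; apply: is_derive_continuous (dF t).
have fc : 0 < f c.
  apply: Hr; move: cI; rewrite in_itv /= => /andP[h1 h2]; rewrite gtr0_norm ?subr_gt0 //; lra.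
have E2 : 0 < F (t0 + r) - F t0.
  by rewrite E mulr_gt0 //; lra.
have H1 : F (- C) <= F t0 by apply: (deriv_homo dF) => //; rewrite /C; lra.
have H2 : F (t0 + r) <= F C by apply: (deriv_homo dF) => //; rewrite /C; lra.
rewrite /C in H1 H2; lra.
Qed.

Lemma int1_abs_bound B (v w : R -> R) t : 0 < B -> Cc1 B w -> (forall t, B < `|t| -> v t = 0) ->
  (forall t : R, is_derive t (1 : R) v (w t)) -> `|v t| <= int1 (fun s => `|w s|).
Proof.
move=> B0 [cw sw] sv dv.
have ca : continuous (fun s => `|w s|).
  by move=> s; apply: (@continuous_comp _ _ _ w (fun x => `|x|)); [exact: cw|exact: norm_continuous].
have sa s : B < `|s| -> `|w s| = 0 by move=> /sw ->; rewrite normr0.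
have [G dG] := antiderivative ca sa.
pose C := B + 1 + `|t|.
have [t1 t2] : t <= `|t| /\ - t <= `|t|.
  by split; [exact: ler_norm|rewrite -normrN ler_norm].
rewrite (int1_FTC (a := - C) (b := C) ca sa dG) // /C; [|lra..].
have vC : v (- C) = 0.
  by apply: sv; rewrite normrN ger0_norm /C; have := normr_ge0 t; lra.
have H1 : G t - v t <= G C - v C.
  apply: (@deriv_homo (fun s => G s - v s) (fun s => `|w s| - w s)); last by rewrite /C; lra.
  by move=> s; rewrite subr_ge0 ler_norm.
have H2 : G (- C) - v (- C) <= G t - v t.
  apply: (@deriv_homo (fun s => G s - v s) (fun s => `|w s| - w s)); last by rewrite /C; lra.
  by move=> s; rewrite subr_ge0 ler_norm.
have H3 : G (- C) + v (- C) <= G t + v t.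
  apply: (@deriv_homo (fun s => G s + v s) (fun s => `|w s| + w s)); last by rewrite /C; lra.
  by move=> s; have := ler_norm (- w s); rewrite normrN; lra.
have H4 : G t <= G C by apply: (deriv_homo dG) => //; rewrite /C; lra.
rewrite vC in H2 H3; rewrite -/C ler_norml; lra.
Qed.

End Integral1.

Section IntegralN.
Context {R : realType}.

(** The support radius is a parameter, so that one B serves all slices of a function and all
    functions in an identity. *)
Definition Cc n (B : R) (f : 'rV[R]_n -> R) :=
  continuous f /\ forall v, B < `|v| -> f v = 0.

Definition slice n (f : 'rV[R]_n.+1 -> R) (t : R) (v : 'rV[R]_n) :=
  f (row_mx (t%:M : 'rV[R]_1) v).

Lemma integral_rVS n (f : 'rV[R]_n.+1 -> R) :
  integral_rV f = int1 (fun t => integral_rV (slice f t)).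
Proof. by []. Qed.

Lemma norm_row_mx n (t : R) (v : 'rV[R]_n) :
  `|row_mx (t%:M : 'rV[R]_1) v| = Num.max `|t| `|v|.
Proof.
apply/eqP; rewrite eq_le; apply/andP; split.
  apply: (@norm_le_coord R (1 + n)); first by rewrite le_max normr_ge0.
  move=> i; rewrite mxE; case: splitP => j _.
    by rewrite ord1 mxE eqxx mulr1n le_max lexx.
  by rewrite le_max coord_le_norm orbT.
rewrite ge_max; apply/andP; split.
  have := @coord_le_norm R (1 + n) (row_mx (t%:M : 'rV[R]_1) v) (lshift n 0).
  by rewrite row_mxEl mxE eqxx mulr1n.
apply: norm_le_coord => // i.
have := @coord_le_norm R (1 + n) (row_mx (t%:M : 'rV[R]_1) v) (rshift 1 i).
by rewrite row_mxEr.
Qed.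

Lemma row_mxB n (t s : R) (v w : 'rV[R]_n) :
  row_mx (t%:M : 'rV[R]_1) v - row_mx (s%:M : 'rV[R]_1) w = row_mx ((t - s)%:M : 'rV[R]_1) (v - w).
Proof. by rewrite opp_row_mx add_row_mx raddfB. Qed.

Lemma row_mxD n (t s : R) (v w : 'rV[R]_n) :
  (row_mx (t%:M : 'rV[R]_1) v : 'rV[R]_n.+1) + (row_mx (s%:M : 'rV[R]_1) w : 'rV[R]_n.+1) =
  row_mx ((t + s)%:M : 'rV[R]_1) (v + w).
Proof. by apply: etrans (@add_row_mx _ 1 1 n _ _ _ _) _; rewrite raddfD. Qed.

Lemma row_mxZ n (c t : R) (v : 'rV[R]_n) :
  c *: (row_mx (t%:M : 'rV[R]_1) v : 'rV[R]_n.+1) = row_mx ((c * t)%:M : 'rV[R]_1) (c *: v).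
Proof. by apply: etrans (@scale_row_mx _ 1 1 n _ _ _) _; rewrite scale_scalar_mx. Qed.

Lemma row_mx_split n (v : 'rV[R]_n.+1) : exists t w, v = row_mx (t%:M : 'rV[R]_1) w.
Proof.
exists (lsubmx (v : 'rV[R]_(1 + n)) 0 0), (rsubmx (v : 'rV[R]_(1 + n))).
have E := @hsubmxK R 1 1 n v; apply: (etrans (esym E)); congr (row_mx _ _).
by apply/rowP => i; rewrite ord1 [RHS]mxE eqxx mulr1n.
Qed.

Lemma Cc_unif n B (f : 'rV[R]_n -> R) : Cc B f -> forall e : R, 0 < e ->
  exists2 r : R, 0 < r & forall u v, `|u - v| < r -> `|f u - f v| <= e.
Proof.
move=> [cf sf] e e0.
have [] := @compact_unif R 'rV[R]_n [set v | `|v| <= `|B| + 1] (fun s v => forall u, `|u - v| < s -> `|f u - f v| <= e).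
- exact: compact_rV_box.
- move=> x _; have e2 : 0 < e / 2 by rewrite divr_gt0.
  have /cvgrPdist_le/(_ _ e2)/near_ball[r r0 H] := cf x.
  exists (r / 2); first by rewrite divr_gt0.
  move=> y s yr /andP[s0 sr] u us.
  have ur : `|u - x| < r.
    by have := ler_distD y u x; move: us yr sr; move: (`|_ - _|) (`|_ - _|) (`|_ - _|) => a b c; lra.
  have yr' : `|y - x| < r by move: yr; move: (`|_|) => a; lra.
  have := ler_distD (f x) (f u) (f y); have := H _ ur; have := H _ yr'.
  rewrite (distrC (f x) (f u)).
  by move: (`|f u - f x|) (`|f x - f y|) (`|f u - f y|) => a b c; lra.
move=> r r0 H; pose s := Num.min (r / 2) 1.
have s0 : 0 < s by rewrite lt_min ltr01 divr_gt0.
have sr : 0 < s < r.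
  by rewrite s0 /= gt_min; apply/orP; left; lra.
have s1 : s <= 1 by rewrite ge_min lexx orbT.
exists s => // u v uv.
have [vB|vB] := leP `|v| (`|B| + 1); first exact: (H s sr).
have BB := ler_norm B.
have uB : B < `|u|.
  have := ler_distD u v 0; rewrite !subr0 distrC.
  by move: uv vB BB s1; move: (`|_ - _|) (`|v|) (`|u|) (`|B|) => a b c d; lra.
rewrite sf // sf ?subrr ?normr0 ?ltW //.
by move: vB BB; move: (`|v|) (`|B|) => a b; lra.
Qed.

Lemma Cc_slice n B (f : 'rV[R]_n.+1 -> R) t : Cc B f -> Cc B (slice f t).
Proof.
move=> [cf sf]; split.
  apply: continuous_ball => v e e0.
  have [r r0 H] := Cc_unif (conj cf sf) e0.
  exists r => // w wr; apply: H.
  by rewrite row_mxB subrr norm_row_mx normr0 gt_max r0.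
by move=> v Bv; apply: sf; rewrite norm_row_mx lt_max Bv orbT.
Qed.

Lemma Cc_D n B (f g : 'rV[R]_n -> R) : Cc B f -> Cc B g -> Cc B (fun v => f v + g v).
Proof.
move=> [cf sf] [cg sg]; split=> [v|v Bv]; first by apply: continuousD; [exact: cf|exact: cg].
by rewrite sf // sg // addr0.
Qed.

Lemma Cc_Z n B c (f : 'rV[R]_n -> R) : Cc B f -> Cc B (fun v => c * f v).
Proof.
move=> [cf sf]; split=> [v|v Bv]; first by apply: continuousM; [exact: cst_continuous|exact: cf].
by rewrite sf // mulr0.
Qed.

Lemma Cc_N n B (f : 'rV[R]_n -> R) : Cc B f -> Cc B (fun v => - f v).
Proof.
move=> /(Cc_Z (-1)); congr Cc; apply/funext => v; by rewrite mulN1r.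
Qed.

Lemma Cc_B n B (f g : 'rV[R]_n -> R) : Cc B f -> Cc B g -> Cc B (fun v => f v - g v).
Proof. by move=> Cf Cg; apply: Cc_D => //; exact: Cc_N. Qed.

Lemma Cc_abs n B (f : 'rV[R]_n -> R) : Cc B f -> Cc B (fun v => `|f v|).
Proof.
move=> [cf sf]; split=> [v|v Bv]; last by rewrite sf // normr0.
by apply: (@continuous_comp _ _ _ f (fun x => `|x|)); [exact: cf|exact: norm_continuous].
Qed.

Lemma Cc_leB n B B' (f : 'rV[R]_n -> R) : B <= B' -> Cc B f -> Cc B' f.
Proof. by move=> BB [cf sf]; split=> // v Bv; apply: sf; exact: le_lt_trans Bv. Qed.

(** A joint induction: linearity in dimension n + 1 needs the continuity of the inner integral in
    the outer variable, and this continuity follows from linearity and the bound in the inner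
    dimension. *)
Lemma integral_main n (B : R) : 0 < B ->
  [/\ forall f g : 'rV[R]_n -> R, Cc B f -> Cc B g ->
        integral_rV (fun v => f v + g v) = integral_rV f + integral_rV g,
      forall c (f : 'rV[R]_n -> R), Cc B f -> integral_rV (fun v => c * f v) = c * integral_rV f,
      forall (f : 'rV[R]_n -> R) c, Cc B f -> (forall v, `|f v| <= c) ->
        `|integral_rV f| <= (2 * B) ^+ n * c &
      forall (f : 'rV[R]_n.+1 -> R), Cc B f -> Cc1 B (fun t => integral_rV (slice f t))].
Proof.
move=> B0; elim: n => [|n [IHD IHZ IHb IHc]].
  split=> //= [f c _ H|f [cf sf]]; first by rewrite expr0 mul1r.
  split=> [t|t Bt]; last by rewrite /slice sf // norm_row_mx lt_max Bt.
  apply/cvgrPdist_le => e e0.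
  have [r r0 H] := Cc_unif (conj cf sf) e0.
  apply: (@ball_near R R^o _ t r) => // w wr; apply: H.
  by rewrite row_mxB subrr norm_row_mx normr0 gt_max r0 distrC wr.
have PD (f g : 'rV[R]_n.+1 -> R) : Cc B f -> Cc B g ->
    integral_rV (fun v => f v + g v) = integral_rV f + integral_rV g.
  move=> Cf Cg; rewrite !integral_rVS -(int1D (IHc f Cf) (IHc g Cg)); congr int1.
  apply/funext => t; rewrite -IHD //; exact: Cc_slice.
have PZ c (f : 'rV[R]_n.+1 -> R) : Cc B f -> integral_rV (fun v => c * f v) = c * integral_rV f.
  move=> Cf; rewrite !integral_rVS -(int1Z c (IHc f Cf)); congr int1.
  apply/funext => t; rewrite -IHZ //; exact: Cc_slice.
have Pb (f : 'rV[R]_n.+1 -> R) c : Cc B f -> (forall v, `|f v| <= c) ->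
        `|integral_rV f| <= (2 * B) ^+ n.+1 * c.
  move=> Cf fc; rewrite integral_rVS exprS -mulrA; apply: (int1_bound B0 (IHc f Cf)) => t.
  by apply: IHb => [|v]; [exact: Cc_slice|exact: fc].
split=> // f Cf; have [cf sf] := Cf; split=> [t|t Bt]; last first.
  apply/eqP; rewrite -normr_le0 (le_trans (Pb _ 0 _ _)) ?mulr0 //; first exact: Cc_slice.
  by move=> v; rewrite /slice sf ?normr0 // norm_row_mx lt_max Bt.
apply/cvgrPdist_le => e e0.
have e1 : 0 < e / (2 * B) ^+ n.+1 by rewrite divr_gt0 // exprn_gt0 // mulr_gt0.
have [r r0 H] := Cc_unif Cf e1.
apply: (@ball_near R R^o _ t r) => // w wr.
have -> : integral_rV (slice f t) - integral_rV (slice f w) =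
    integral_rV (fun v => slice f t v + -1 * slice f w v).
  rewrite PD ?PZ ?mulN1r //; do ?apply: Cc_Z; exact: Cc_slice.
apply: le_trans (Pb _ (e / (2 * B) ^+ n.+1) _ _) _.
- by apply: Cc_D; do ?apply: Cc_Z; exact: Cc_slice.
- move=> v; rewrite mulN1r; apply: H.
  by rewrite row_mxB subrr norm_row_mx normr0 gt_max r0 distrC wr.
- by rewrite mulrC divfK // gt_eqF // exprn_gt0 // mulr_gt0.
Qed.

Section Props.
Context (B : R) (B0 : 0 < B) (n : nat).
Implicit Types f g : 'rV[R]_n -> R.

Lemma integralD f g : Cc B f -> Cc B g ->
  integral_rV (fun v => f v + g v) = integral_rV f + integral_rV g.
Proof. by have [H _ _ _] := integral_main n B0; exact: H. Qed.

Lemma integralZ c f : Cc B f -> integral_rV (fun v => c * f v) = c * integral_rV f.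
Proof. by have [_ H _ _] := integral_main n B0; exact: H. Qed.

Lemma integral_bound f c : Cc B f -> (forall v, `|f v| <= c) ->
  `|integral_rV f| <= (2 * B) ^+ n * c.
Proof. by have [_ _ H _] := integral_main n B0; exact: H. Qed.

Lemma integral_slice (f : 'rV[R]_n.+1 -> R) : Cc B f -> Cc1 B (fun t => integral_rV (slice f t)).
Proof. by have [_ _ _ H] := integral_main n B0; exact: H. Qed.

Lemma integralN f : Cc B f -> integral_rV (fun v => - f v) = - integral_rV f.
Proof.
move=> Cf; rewrite -mulN1r -integralZ //; congr integral_rV; apply/funext => v; by rewrite mulN1r.
Qed.

Lemma integralB f g : Cc B f -> Cc B g ->
  integral_rV (fun v => f v - g v) = integral_rV f - integral_rV g.
Proof. by move=> Cf Cg; rewrite integralD ?integralN //; exact: Cc_N. Qed.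

End Props.

Lemma integral_rV_ge0 n (f : 'rV[R]_n -> R) : (forall v, 0 <= f v) -> 0 <= integral_rV f.
Proof.
elim: n f => [|n IH] f f0; first exact: f0.
by rewrite integral_rVS; apply: int1_ge0 => t; apply: IH => v; exact: f0.
Qed.

Lemma integral_rV_le n B (f g : 'rV[R]_n -> R) : 0 < B -> Cc B f -> Cc B g ->
  (forall v, f v <= g v) -> integral_rV f <= integral_rV g.
Proof.
move=> B0 Cf Cg fg; rewrite -subr_ge0 -(integralB B0) //; apply: integral_rV_ge0 => v.
by rewrite subr_ge0.
Qed.

Lemma integral_rV_shift n B (f : 'rV[R]_n -> R) a : 0 < B -> Cc B f ->
  integral_rV (fun v => f (v + a)) = integral_rV f.
Proof.
move=> B0; elim: n f a => [|n IH] f a Cf.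
  by rewrite /=; congr f; apply/rowP; case.
have [a0 [a1 ->]] := row_mx_split a.
rewrite !integral_rVS -[RHS](int1_shift a0 B0 (integral_slice B0 Cf)); congr int1.
apply/funext => t; rewrite -(IH (slice f (t + a0)) a1); last exact: Cc_slice.
by congr integral_rV; apply/funext => v; rewrite /slice row_mxD.
Qed.

Lemma integral_rV_scale n B (f : 'rV[R]_n -> R) c : 0 < B -> 0 < c -> Cc B f ->
  integral_rV (fun v => f (c *: v)) = c ^- n * integral_rV f.
Proof.
move=> B0 c0; elim: n f => [|n IH] f Cf.
  by rewrite expr0 invr1 mul1r /= scaler0.
rewrite !integral_rVS exprSr invfM -mulrA.
rewrite -(int1_scale B0 c0 (integral_slice B0 Cf)).
have C1 : Cc1 (B / c) (fun t => integral_rV (slice f (c * t))).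
  have [c1 s1] := integral_slice B0 Cf; split.
    move=> t; apply: (@continuous_comp _ _ _ (fun s : R => c * s) (fun t => integral_rV (slice f t))); last exact: c1.
    by apply: continuousM; [exact: cst_continuous|exact: cvg_id].
  by move=> t Bt; apply: s1; rewrite normrM gtr0_norm // mulrC -ltr_pdivrMr.
rewrite -(int1Z _ C1); congr int1.
apply/funext => t; rewrite -IH; last exact: Cc_slice.
by congr integral_rV; apply/funext => v; rewrite /slice row_mxZ.
Qed.

Lemma integral_rV_gt0 n B (f : 'rV[R]_n -> R) v0 : 0 < B -> Cc B f -> (forall v, 0 <= f v) ->
  0 < f v0 -> 0 < integral_rV f.
Proof.
move=> B0; elim: n f v0 => [|n IH] f v0 Cf f0 fv.
  by move: fv; rewrite (_ : v0 = 0) //; apply/rowP; case.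
have [t0 [w0 E]] := row_mx_split v0.
rewrite integral_rVS; apply: (int1_gt0 (t0 := t0) B0 (integral_slice B0 Cf)).
  by move=> t; apply: integral_rV_ge0 => v; exact: f0.
apply: (IH _ w0) => [|v|]; [exact: Cc_slice|exact: f0|by rewrite /slice -E].
Qed.

(** The difference quotients in the direction w have integral 0 by translation invariance and
    converge uniformly to g. This treats all directions alike, whatever the order of the iterated
    integrals. *)
Lemma integral_rV_deriv n B (f g : 'rV[R]_n -> R) w : 0 < B -> Cc B f -> Cc B g ->
  (forall v, is_derive v w f (g v)) -> integral_rV g = 0.
Proof.
move=> B0 Cf Cg dfg.
suff H e : 0 < e -> `|integral_rV g| <= (2 * (B + `|w|)) ^+ n * e.
  apply/eqP; rewrite -normr_le0; apply/ler_addgt0Pr => e e0; rewrite add0r.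
  have C0 : 0 < (2 * (B + `|w|)) ^+ n by rewrite exprn_gt0 // mulr_gt0 // ltr_wpDr.
  have := H (e / (2 * (B + `|w|)) ^+ n); rewrite divr_gt0 // => /(_ isT) /le_trans; apply.
  by rewrite mulrC divfK // gt_eqF.
move=> e0; have [r r0 Hr] := Cc_unif Cg e0.
have [h [h0 h1 hr]] : exists h : R, [/\ 0 < h, h <= 1 & h * `|w| < r].
  exists (Num.min 1 (r / (`|w| + 1) / 2)); split.
  - by rewrite lt_min ltr01 !divr_gt0 // ltr_wpDl.
  - by rewrite ge_min lexx.
  have w0 : 0 < `|w| + 1 by rewrite ltr_wpDl.
  apply: (@le_lt_trans _ _ (r / (`|w| + 1) / 2 * (`|w| + 1))).
    apply: ler_pM => //; first by rewrite le_min ler01 !divr_ge0 // ltW.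
      by rewrite ge_min lexx orbT.
    by rewrite lerDl.
  by rewrite mulrAC divfK ?gt_eqF // ltr_pdivrMr // ltr_pMr // ltr1n.
pose B' := B + `|w|.
have B'0 : 0 < B' by rewrite ltr_wpDr.
have BB' : B <= B' by rewrite lerDl.
have hw : `|h *: w| <= `|w| by rewrite normrZ gtr0_norm // ler_piMl.
have Cs : Cc B' (fun v => f (v + h *: w)).
  have [cf sf] := Cf; split=> [v|v Bv].
    apply: (@continuous_comp _ _ _ (fun v : 'rV[R]_n => v + h *: w) f); last exact: cf.
    by apply: continuousD; [exact: cvg_id|exact: cst_continuous].
  apply: sf; have := ler_normD (v + h *: w) (- (h *: w)); rewrite addrK normrN.
  by move: Bv hw; rewrite /B'; move: (`|v|) (`|_ + _|) (`|h *: w|) => a b c; lra.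
have Cq : Cc B' (fun v => h^-1 * (f (v + h *: w) - f v)).
  by apply: Cc_Z; apply: Cc_B => //; exact: Cc_leB Cf.
have I0 : integral_rV (fun v => h^-1 * (f (v + h *: w) - f v)) = 0.
  rewrite (integralZ B'0); last by apply: Cc_B => //; exact: Cc_leB Cf.
  rewrite (integralB B'0) //; last exact: Cc_leB Cf.
  by rewrite (integral_rV_shift _ B0) // subrr mulr0.
have Cg' : Cc B' g by exact: Cc_leB Cg.
have -> : integral_rV g = integral_rV (fun v => g v - h^-1 * (f (v + h *: w) - f v)).
  by rewrite (integralB B'0) // I0 subr0.
apply: (integral_bound B'0); first exact: Cc_B.
move=> v.
have df (t : R) : derivable f (v + t *: (h *: w)) (h *: w).
  have [dd _] := dfg (v + t *: (h *: w)).
  by have [] := derivableZv h dd.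
have [t /andP[t0 t1] ->] := MVT_line (fun t _ => df t).
have [dd E] := dfg (v + t *: (h *: w)).
have [_ ->] := derivableZv h dd; rewrite E scaleRE mulrA mulVf ?mul1r ?gt_eqF //.
apply: Hr; rewrite opprD addrA subrr add0r normrN !normrZ (gtr0_norm h0) (ger0_norm t0).
apply: le_lt_trans hr; by rewrite ler_piMl // mulr_ge0 // ltW.
Qed.

(* [v k] is the derivative of [v 0] in the first k coordinate directions. *)
Lemma sobolev_rV n B (v : nat -> 'rV[R]_n -> R) x : 0 < B -> (forall k, (k <= n)%N -> Cc B (v k)) ->
  (forall k (ltkn : (k < n)%N) u, is_derive u (delta_mx 0 (Ordinal ltkn)) (v k) (v k.+1 u)) ->
  `|v 0 x| <= integral_rV (fun u => `|v n u|).
Proof.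
move=> B0; elim: n v x => [|n IH] v x Cv dv.
  by rewrite /= (_ : x = 0) //; apply/rowP; case.
have [t [w ->]] := row_mx_split x.
have C0 := Cv 0 isT; have C1 := Cv 1 isT.
have deltaE : (delta_mx 0 (Ordinal (ltn0Sn n)) : 'rV[R]_n.+1) = row_mx (1%:M : 'rV[R]_1) (0 : 'rV[R]_n).
  apply/rowP => i; rewrite [LHS]mxE [RHS]mxE eqxx /=; case: splitP => j ij.
    have -> : i == Ordinal (ltn0Sn n) by apply/eqP/val_inj; rewrite /= ij ord1.
    by rewrite mxE ord1.
  have -> : (i == Ordinal (ltn0Sn n)) = false by apply/negbTE/eqP => /(congr1 val) /=; rewrite ij.
  by rewrite mxE.
have d1 (s : R) : is_derive s (1 : R) (fun s => slice (v 0) s w) (slice (v 1) s w).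
  have [] := dv 0 (ltn0Sn n) (row_mx (s%:M : 'rV[R]_1) w); rewrite deltaE => dd E.
  have E0 s' : row_mx (s'%:M : 'rV[R]_1) w = row_mx ((0 : R)%:M : 'rV[R]_1) w +
      s' *: (row_mx (1%:M : 'rV[R]_1) (0 : 'rV[R]_n) : 'rV[R]_n.+1) :> 'rV[R]_n.+1.
    by rewrite row_mxZ row_mxD add0r mulr1 scaler0 addr0.
  have -> : (fun s => slice (v 0) s w) = (fun s => v 0 (row_mx ((0 : R)%:M : 'rV[R]_1) w +
      s *: (row_mx (1%:M : 'rV[R]_1) (0 : 'rV[R]_n) : 'rV[R]_n.+1))).
    by apply/funext => s'; rewrite /slice E0.
  rewrite E0 in dd E; have H := is_derive_line dd.
  by apply: (is_derive_eq H); rewrite E /slice -E0.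
have s0 s : B < `|s| -> slice (v 0) s w = 0.
  by have [_ H] := C0 => Bs; apply: H; rewrite norm_row_mx lt_max Bs.
have Cs : Cc1 B (fun s => slice (v 1) s w).
  have [c1 sv1] := C1; split=> [s|s Bs]; last by apply: sv1; rewrite norm_row_mx lt_max Bs.
  apply/cvgrPdist_le => e e0; have [r r0 Hr] := Cc_unif C1 e0.
  apply: (@ball_near R R^o _ s r) => // s' s'r; apply: Hr.
  by rewrite row_mxB subrr norm_row_mx normr0 gt_max r0 distrC s'r.
apply: le_trans (int1_abs_bound t B0 Cs s0 d1) _.
rewrite integral_rVS.
have Ca : Cc1 B (fun s => `|slice (v 1) s w|).
  have [cc ss] := Cs; split=> [s|s Bs]; last by rewrite ss // normr0.
  by apply: (@continuous_comp _ _ _ (fun s => slice (v 1) s w) (fun x : R => `|x|)); [exact: cc|exact: norm_continuous].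
have Ci : Cc1 B (fun s => integral_rV (slice (fun u => `|v n.+1 u|) s)).
  by apply: integral_slice => //; apply: Cc_abs; exact: Cv.
rewrite -subr_ge0.
have -> : int1 (fun s => integral_rV (slice (fun u => `|v n.+1 u|) s)) - int1 (fun s => `|slice (v 1) s w|) =
   int1 (fun s => integral_rV (slice (fun u => `|v n.+1 u|) s) + -1 * `|slice (v 1) s w|).
  rewrite (int1D Ci) ?(int1Z _ Ca) ?mulN1r //.
  exact: Cc1_Z.
apply: int1_ge0 => s; rewrite mulN1r subr_ge0.
apply: (IH (fun k => slice (v k.+1) s) w).
  by move=> k kn; apply: Cc_slice; exact: Cv.
move=> k kn u.
have ltk : (k.+1 < n.+1)%N by [].
have [dd E] := dv k.+1 ltk (row_mx (s%:M : 'rV[R]_1) u).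
have dE : (delta_mx 0 (Ordinal ltk) : 'rV[R]_n.+1) = row_mx ((0 : R)%:M : 'rV[R]_1) (delta_mx 0 (Ordinal kn) : 'rV[R]_n).
  apply/rowP => i; rewrite [LHS]mxE [RHS]mxE eqxx /=; case: splitP => j ij.
    have -> : (i == Ordinal ltk) = false by apply/negbTE/eqP => /(congr1 val) /=; rewrite ij ord1.
    by rewrite mxE mul0rn.
  have -> : (i == Ordinal ltk) = (j == Ordinal kn) by rewrite -!val_eqE /= ij.
  by rewrite mxE eqxx.
have EE : (fun h : R => h^-1 *: (v k.+1 (h *: delta_mx 0 (Ordinal ltk) + row_mx (s%:M : 'rV[R]_1) u) - v k.+1 (row_mx (s%:M : 'rV[R]_1) u))) =
   (fun h : R => h^-1 *: (slice (v k.+1) s (h *: delta_mx 0 (Ordinal kn) + u) - slice (v k.+1) s u)).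
  apply/funext => h; by rewrite /slice dE row_mxZ mulr0 row_mxD add0r.
split; first by rewrite /derivable /= -EE.
by rewrite -[RHS]/(v k.+2 (row_mx (s%:M : 'rV[R]_1) u)) -E /derive /= -EE.
Qed.

End IntegralN.

(** * Linear changes of variables through quadratic forms *)

Section QuadraticForm.
Context {R : realType}.

Definition qf n (S : 'M[R]_n) (u v : 'rV[R]_n) : R := (u *m S *m v^T) 0 0.

Lemma qfDl n (S : 'M[R]_n) u u' v : qf S (u + u') v = qf S u v + qf S u' v.
Proof. by rewrite /qf !mulmxDl mxE. Qed.

Lemma qfDr n (S : 'M[R]_n) u v v' : qf S u (v + v') = qf S u v + qf S u v'.
Proof. by rewrite /qf linearD mulmxDr mxE. Qed.

Lemma qfZl n (S : 'M[R]_n) a u v : qf S (a *: u) v = a * qf S u v.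
Proof. by rewrite /qf -!scalemxAl mxE. Qed.

Lemma qfZr n (S : 'M[R]_n) a u v : qf S u (a *: v) = a * qf S u v.
Proof. by rewrite /qf linearZ /= -scalemxAr mxE. Qed.

Lemma qfC n (S : 'M[R]_n) u v : S^T = S -> qf S u v = qf S v u.
Proof.
move=> sS; have E : v *m S *m u^T = (u *m S *m v^T)^T by rewrite !trmx_mul trmxK sS mulmxA.
by rewrite /qf E [RHS]mxE.
Qed.

Lemma qf1 n (u v : 'rV[R]_n) : qf 1%:M u v = edot u v.
Proof. by rewrite /qf mulmx1 edotE. Qed.

Lemma qfE n (S : 'M[R]_n) u v : qf S u v = edot (u *m S) v.
Proof. by rewrite edotE. Qed.

Lemma smooth_qf n (S : 'M[R]_n) : smooth_open setT (fun v => qf S v v).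
Proof.
have : smooth_open setT (fun v : 'rV[R]_n => \sum_j (v *m S) 0 j * v 0 j).
  refine (smooth_sum _ openT _) => j; apply: smoothM; first exact: openT.
    apply: smooth_coord; first exact: openT.
    exact: smooth_mulmxr openT.
  exact: smooth_proj openT.
by apply: smooth_ext; [exact: openT|move=> v _; rewrite qfE].
Qed.

Lemma edot_ge_norm n (v : 'rV[R]_n) : `|v| ^+ 2 <= edot v v.
Proof.
have E0 : 0 <= edot v v by apply: sumr_ge0 => i _; rewrite -expr2 sqr_ge0.
rewrite -(sqr_sqrtr E0) ler_pXn2r ?nnegrE ?sqrtr_ge0 //.
apply: norm_le_coord => [|i]; first exact: sqrtr_ge0.
rewrite -sqrtr_sqr ler_sqrt // /edot (bigD1 i) //= -expr2 lerDl.
by apply: sumr_ge0 => j _; rewrite -expr2 sqr_ge0.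
Qed.

Definition cutoff (b : R -> R) := continuous b /\ forall s, 1 <= s -> b s = 0.

(** The radius 1 + 1/m avoids a square root: beyond it m |v|^2 >= 1, where b vanishes. *)
Lemma cutoff_Cc n (S : 'M[R]_n) m b : 0 < m -> (forall v, m * `|v| ^+ 2 <= qf S v v) ->
  cutoff b -> Cc (1 + m^-1) (fun v => b (qf S v v)).
Proof.
move=> m0 coer [cb b1]; split=> [v|v mv].
  apply: (@continuous_comp _ _ _ (fun v => qf S v v) b); last exact: cb.
  exact: smooth_cont (smooth_qf S) _.
apply: b1; apply: le_trans (coer v).
have m1 : 0 < m^-1 by rewrite invr_gt0.
have mm : m * m^-1 = 1 by rewrite mulfV // gt_eqF.
by move: mv; move: (`|v|) => x mv; nra.
Qed.

Lemma cutoff_shift b c : 0 <= c -> cutoff b -> cutoff (fun s => b (s + c)).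
Proof.
move=> c0 [cb b1]; split=> [s|s s1]; last by apply: b1; lra.
apply: (@continuous_comp _ _ _ (fun s : R => s + c) b); last exact: cb.
by apply: continuousD; [exact: cvg_id|exact: cst_continuous].
Qed.

Lemma qf1_coercive n (v : 'rV[R]_n) : 1 * `|v| ^+ 2 <= qf 1%:M v v.
Proof. by rewrite mul1r qf1 edot_ge_norm. Qed.

Lemma coercive_unit n (S : 'M[R]_n) m : 0 < m -> (forall v, m * `|v| ^+ 2 <= qf S v v) ->
  S \in unitmx.
Proof.
move=> m0 coer; rewrite -row_free_unit -kermx_eq0; apply/eqP/row_matrixP => i; rewrite row0.
have vS : row i (kermx S) *m S = 0 by rewrite -row_mul mulmx_ker row0.
have := coer (row i (kermx S)); rewrite /qf vS mul0mx mxE pmulr_rle0 // => H.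
apply/eqP; rewrite -normr_le0 leNgt; apply/negP => v0.
by move: H; rewrite leNgt exprn_gt0.
Qed.

Lemma edot_row_mx n (t : R) (v : 'rV[R]_n) :
  edot (row_mx (t%:M : 'rV[R]_1) v : 'rV[R]_n.+1) (row_mx (t%:M : 'rV[R]_1) v) = edot v v + t ^+ 2.
Proof.
rewrite /edot (@big_split_ord _ _ _ 1 n) big_ord1 [LHS]addrC; congr (_ + _).
  by apply: eq_bigr => i _; rewrite !(@row_mxEr _ 1 1 n).
by rewrite !(@row_mxEl _ 1 1 n) !mxE eqxx mulr1n expr2.
Qed.

(* Completing the square in the first variable reduces the form to its Schur complement. *)
Lemma integral_qf n (S : 'M[R]_n) m b : S^T = S -> 0 < m -> (forall v, m * `|v| ^+ 2 <= qf S v v) ->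
  cutoff b ->
  0 < \det S /\ integral_rV (fun v => b (qf S v v)) * Num.sqrt (\det S) = integral_rV (fun v : 'rV[R]_n => b (edot v v)).
Proof.
move=> + m0; elim: n S b => [|n IH] S b sS coer cb.
  rewrite det_mx00 sqrtr1 mulr1; split=> //=; congr b.
  by rewrite /qf /edot mxE !big_ord0.
pose a := ulsubmx (S : 'M[R]_(1 + n)); pose w := ursubmx (S : 'M[R]_(1 + n)).
pose B := drsubmx (S : 'M[R]_(1 + n)).
have ES : S = block_mx a w w^T B.
  have -> : w^T = dlsubmx (S : 'M[R]_(1 + n)) by rewrite /w trmx_ursub sS.
  exact: (esym (@submxK R 1 n 1 n S)).
have sB : B^T = B by rewrite /B trmx_drsub sS.
have qS t v : qf S (row_mx (t%:M : 'rV[R]_1) v) (row_mx (t%:M : 'rV[R]_1) v) =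
    t ^+ 2 * a 0 0 + (t * (w *m v^T) 0 0) *+ 2 + qf B v v.
  rewrite {1}/qf ES (@tr_row_mx _ 1 1 n) (@mul_row_block _ 1 1 n 1 n) (@mul_row_col _ 1 1 n 1).
  have D (X Y : 'M[R]_1) : (X + Y) 0 0 = X 0 0 + Y 0 0 by rewrite mxE.
  rewrite tr_scalar_mx !mulmxDl !D.
  have E1 : (t%:M *m a *m (t%:M : 'M[R]_1)) 0 0 = t ^+ 2 * a 0 0.
    by rewrite mul_scalar_mx mul_mx_scalar !mxE expr2 mulrA.
  have E2 : (v *m w^T *m (t%:M : 'M[R]_1)) 0 0 = t * (w *m v^T) 0 0.
    rewrite mul_mx_scalar mxE; congr (_ * _).
    by rewrite -[v in LHS]trmxK -trmx_mul mxE.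
  have E3 : (t%:M *m w *m v^T) 0 0 = t * (w *m v^T) 0 0.
    by rewrite mul_scalar_mx -scalemxAl mxE.
  by rewrite E1 E2 E3 mulr2n !addrA.
have coerB v : m * `|v| ^+ 2 <= qf B v v.
  have := coer (row_mx ((0 : R)%:M : 'rV[R]_1) v).
  by rewrite norm_row_mx qS normr0 expr0n /= !mul0r mul0rn !add0r max_r.
have uB := coercive_unit m0 coerB.
pose z : 'rV[R]_n := w *m invmx B.
have zB : z *m B = w by rewrite /z mulmxKV.
pose s := a 0 0 - (z *m w^T) 0 0.
have qz v : qf B z v = (w *m v^T) 0 0 by rewrite /qf zB.
have qzz : qf B z z = (z *m w^T) 0 0 by rewrite qz -[in LHS](trmxK w) -trmx_mul mxE.
have qS2 t v : qf S (row_mx (t%:M : 'rV[R]_1) v) (row_mx (t%:M : 'rV[R]_1) v) =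
    qf B (v + t *: z) (v + t *: z) + t ^+ 2 * s.
  rewrite qS qfDl !qfDr !qfZl !qfZr (qfC v z sB) qz qzz /s mulr2n; ring.
have s0 : 0 < s.
  have := coer (row_mx ((1 : R)%:M : 'rV[R]_1) (- z)).
  rewrite qS2 scale1r addNr norm_row_mx normr1 expr1n mul1r {1}/qf mul0mx mul0mx mxE add0r.
  apply: lt_le_trans; rewrite mulr_gt0 // exprn_gt0 // lt_max ltr01 //.
have [dB0 _] := IH B b sB coerB cb.
(* Multiplication on the left by the unipotent L clears the upper right block and leaves the Schur
   complement s in the corner. *)
have detS : \det S = s * \det B.
  pose L : 'M[R]_(1 + n) := block_mx 1%:M (- z) 0 1%:M.
  have dL : \det L = 1 by rewrite det_ublock !det1 mulr1.
  rewrite -[LHS]mul1r -{1}dL -det_mulmx ES /L mulmx_block !mul1mx !mul0mx !add0r !mulNmx zB subrr.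
  have D2 (P Q : 'M[R]_1) : (P - Q) 0 0 = P 0 0 - Q 0 0 by rewrite !mxE.
  by rewrite det_lblock det_mx11 D2.
split; first by rewrite detS mulr_gt0.
have Bm0 : 0 < 1 + m^-1 by rewrite addr_gt0 // invr_gt0.
have m10 : 0 < m^-1 by rewrite invr_gt0.
(* The first variable enters as a shift of the profile by [t ^+ 2 * s], which is why the induction
   is over all cutoffs b. *)
have cbt (t : R) : cutoff (fun x => b (x + t ^+ 2 * s)).
  by apply: cutoff_shift => //; rewrite mulr_ge0 ?sqr_ge0 // ltW.
have It t : integral_rV (slice (fun v => b (qf S v v)) t) * Num.sqrt (\det B) =
    integral_rV (fun v : 'rV[R]_n => b (edot v v + t ^+ 2 * s)).
  have [_ <-] := IH B _ sB coerB (cbt t); congr (_ * _).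
  have C := cutoff_Cc m0 coerB (cbt t).
  rewrite -[RHS](integral_rV_shift (t *: z) Bm0 C); congr integral_rV; apply/funext => v.
  by rewrite /slice qS2.
have two0 : 0 < 1 + 1^-1 :> R by rewrite addr_gt0 // invr_gt0.
have C1 : Cc (1 + 1^-1) (fun v : 'rV[R]_n.+1 => b (edot v v)).
  have := cutoff_Cc ltr01 (@qf1_coercive n.+1) cb; congr Cc; apply/funext => v; by rewrite qf1.
have CS := cutoff_Cc m0 coer cb.
rewrite detS sqrtrM ?(ltW s0) // mulrCA (mulrC (integral_rV _)).
rewrite (integral_rVS (fun v => b (qf S v v))).
have -> : Num.sqrt (\det B) * int1 (fun t => integral_rV (slice (fun v => b (qf S v v)) t)) =
    int1 (fun t => integral_rV (slice (fun v : 'rV[R]_n.+1 => b (edot v v)) (Num.sqrt s * t))).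
  rewrite -(int1Z _ (integral_slice Bm0 CS)); congr int1; apply/funext => t.
  rewrite mulrC It; congr integral_rV; apply/funext => v; rewrite /slice edot_row_mx.
  by rewrite exprMn sqr_sqrtr ?(ltW s0) // [s * _]mulrC.
have ss : 0 < Num.sqrt s by rewrite sqrtr_gt0.
rewrite (int1_scale two0 ss (integral_slice two0 C1)) mulrA mulfV ?mul1r ?gt_eqF //.
Qed.

End QuadraticForm.

(** * Finite covers and bump functions *)

Section Bump.
Context {R : realType}.

Lemma finite_nbhs_cover {V : normedModType R} (K : set V) (U : V -> set V) : compact K ->
  (forall x, K x -> open (U x) /\ U x x) ->
  exists n, exists c : 'I_n -> V, (forall i, K (c i)) /\ forall y, K y -> exists i, U (c i) y.
Proof.
move=> cK HU; move: cK; rewrite compact_cover => /(_ V K U)[].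
- by move=> x /HU[].
- by move=> x Kx; exists x => //; have [] := HU x Kx.
move=> s sK cov.
pose l := finmap.enum_fset s.
exists (size l), (fun i => nth 0 l i); split.
  move=> i; have il : nth 0 l i \in l by rewrite mem_nth // ltn_ord.
  by have := sK _ il; rewrite inE.
move=> y /cov[x /= xs Uxy].
have ltx : (index x l < size l)%N by rewrite index_mem.
by exists (Ordinal ltx); rewrite /= nth_index.
Qed.

Lemma edot_le_norm n (u : 'rV[R]_n) : edot u u <= n%:R * `|u| ^+ 2.
Proof.
apply: (@le_trans _ _ (\sum_(i < n) `|u| ^+ 2)).
  apply: ler_sum => i _; rewrite -expr2 -(real_normK (num_real (u 0 i))).
  by rewrite ler_pXn2r ?nnegrE // coord_le_norm.
by rewrite sumr_const card_ord mulr_natl.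
Qed.

Lemma edot_ge0 n (u : 'rV[R]_n) : 0 <= edot u u.
Proof. by apply: sumr_ge0 => i _; rewrite -expr2 sqr_ge0. Qed.

Lemma norm_lt_edot n (u : 'rV[R]_n) (r : R) : 0 < r -> edot u u < r ^+ 2 -> `|u| < r.
Proof.
move=> r0 H; rewrite -(ltr_pXn2r (n := 2)) ?nnegrE // ?ltW //.
exact: le_lt_trans (edot_ge_norm u) H.
Qed.

Lemma smooth_edot n (c : 'rV[R]_n) : smooth_open setT (fun z => edot (z - c) (z - c)).
Proof.
refine (smooth_sum _ openT _) => j.
have : smooth_open setT (fun x : 'rV[R]_n => x 0 j - c 0 j).
  by apply: smoothB; [exact: openT|exact: smooth_proj openT|exact: smooth_cst openT].
move=> s; have := smoothM openT s s.
by apply: smooth_ext; [exact: openT|move=> x _; rewrite !mxE].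
Qed.

(** A function of the squared distance, hence smooth at c as well. The transition takes place
    between the radii r and sqrt 2 r. *)
Definition bump n (c : 'rV[R]_n) (r : R) (z : 'rV[R]_n) : R :=
  step (2 - edot (z - c) (z - c) / r ^+ 2).

Lemma smooth_bump n (c : 'rV[R]_n) r : smooth_open setT (bump c r).
Proof.
refine (@smooth_comp1 R _ setT setT (fun z => 2 - edot (z - c) (z - c) / r ^+ 2) openT _ _ step smooth_step) => //.
apply: smoothB; [exact: openT|exact: smooth_cst openT|].
apply: smoothM; [exact: openT|exact: smooth_edot|exact: smooth_cst openT].
Qed.

Lemma bump_ge0 n (c : 'rV[R]_n) r z : 0 <= bump c r z. Proof. exact: step_ge0. Qed.

Lemma bump_eq1 n (c : 'rV[R]_n) r z : 0 < r -> edot (z - c) (z - c) <= r ^+ 2 -> bump c r z = 1.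
Proof.
move=> r0 H; apply: step_ge1.
have : edot (z - c) (z - c) / r ^+ 2 <= 1 by rewrite ler_pdivrMr ?exprn_gt0 // mul1r.
lra.
Qed.

Lemma bump_eq0 n (c : 'rV[R]_n) r z : 0 < r -> 2 * r ^+ 2 <= edot (z - c) (z - c) -> bump c r z = 0.
Proof.
move=> r0 H; apply: step_le0.
have : 2 <= edot (z - c) (z - c) / r ^+ 2 by rewrite ler_pdivlMr ?exprn_gt0.
lra.
Qed.

Lemma bump_neq0 n (c : 'rV[R]_n) r z : 0 < r -> bump c r z != 0 -> edot (z - c) (z - c) < 2 * r ^+ 2.
Proof. by move=> r0; rewrite ltNge; apply: contraNN => H; rewrite bump_eq0. Qed.

Lemma bump_continuous n (c : 'rV[R]_n) r : continuous (bump c r).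
Proof. by move=> z; exact: smooth_cont (smooth_bump c r) _. Qed.

Lemma open_edot_ball n (c : 'rV[R]_n) (r : R) : open [set z | edot (z - c) (z - c) < r].
Proof.
have -> : [set z | edot (z - c) (z - c) < r] = (fun z => edot (z - c) (z - c)) @^-1` [set x | x < r] by [].
apply: open_comp; last exact: open_lt.
by move=> z _; exact: smooth_cont (smooth_edot c) _.
Qed.

End Bump.

(** * Continuous functions on a subset *)

Section ContOn.
Context {R : realType} {N : nat}.
Implicit Types (M : set 'rV[R]_N) (f g : 'rV[R]_N -> R) (p q : 'rV[R]_N).

(** Functions on M are represented by total functions, so continuity is tested between points of M
    only. *)
Definition cont_on M f := forall x, M x -> forall e : R, 0 < e ->
  exists2 r : R, 0 < r & forall y, M y -> `|y - x| < r -> `|f y - f x| <= e.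

Lemma continuous_cont_on M f : continuous f -> cont_on M f.
Proof.
move=> cf x Mx e e0; have /cvgrPdist_le/(_ _ e0)/near_ball[r r0 H] := cf x.
by exists r => // y _ /H; rewrite distrC.
Qed.

Lemma cont_on_ext M f g : (forall p, M p -> f p = g p) -> cont_on M f -> cont_on M g.
Proof.
move=> fg cf x Mx e e0; have [r r0 H] := cf x Mx e e0; exists r => // y My yr.
by rewrite -!fg // H.
Qed.

Lemma cont_on_cst M c : cont_on M (fun _ => c).
Proof. by move=> x Mx e e0; exists 1 => // y _ _; rewrite subrr normr0 ltW. Qed.

Lemma cont_onD M f g : cont_on M f -> cont_on M g -> cont_on M (fun p => f p + g p).
Proof.
move=> cf cg x Mx e e0; have e2 : 0 < e / 2 by rewrite divr_gt0.
have [r r0 H] := cf x Mx _ e2; have [r' r'0 H'] := cg x Mx _ e2.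
exists (Num.min r r'); first by rewrite lt_min r0.
move=> y My; rewrite lt_min => /andP[yr yr'].
rewrite opprD addrACA (le_trans (ler_normD _ _)) // (splitr e) lerD //.
  exact: H.
exact: H'.
Qed.

Lemma cont_onM M f g : cont_on M f -> cont_on M g -> cont_on M (fun p => f p * g p).
Proof.
move=> cf cg x Mx e e0.
pose A := `|f x| + `|g x| + 1.
have A0 : 0 < A by rewrite /A ltr_wpDl // addr_ge0.
pose e1 := Num.min 1 (e / (2 * A)).
have e10 : 0 < e1 by rewrite lt_min ltr01 divr_gt0 // mulr_gt0.
have e11 : e1 <= 1 by rewrite ge_min lexx.
have e1A : e1 * (2 * A) <= e by rewrite -ler_pdivlMr ?mulr_gt0 // ge_min lexx orbT.
have [r r0 H] := cf x Mx _ e10; have [r' r'0 H'] := cg x Mx _ e10.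
exists (Num.min r r'); first by rewrite lt_min r0.
move=> y My; rewrite lt_min => /andP[/(H y My) h1 /(H' y My) h2].
have -> : f y * g y - f x * g x = (f y - f x) * (g y - g x) + (f y - f x) * g x + f x * (g y - g x) by ring.
rewrite (le_trans (ler_normD _ _)) // (le_trans (lerD (ler_normD _ _) (lexx _))) // !normrM.
move: h1 h2 e11 e1A (normr_ge0 (f y - f x)) (normr_ge0 (g y - g x)) (normr_ge0 (f x)) (normr_ge0 (g x)).
rewrite /A; move: (`|f y - f x|) (`|g y - g x|) (`|f x|) (`|g x|) => a b c d; nra.
Qed.

Lemma cont_on_sum M (J : Type) (r : seq J) (F : J -> 'rV[R]_N -> R) :
  (forall j, cont_on M (F j)) -> cont_on M (fun p => \sum_(j <- r) F j p).
Proof.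
move=> cF; elim: r => [|j r IH].
  by apply: cont_on_ext (@cont_on_cst M 0) => p _; rewrite big_nil.
by apply: cont_on_ext (cont_onD (cF j) IH) => p _; rewrite big_cons.
Qed.

Lemma cont_onV M f : cont_on M f -> (forall p, M p -> f p != 0) -> cont_on M (fun p => (f p)^-1).
Proof.
move=> cf f0 x Mx e e0.
have cI : {for f x, continuous (fun y : R => y^-1)} by apply: inv_continuous; exact: f0.
have /cvgrPdist_le/(_ _ e0)/near_ball[s s0 Hs] := cI.
have s2 : 0 < s / 2 by rewrite divr_gt0.
have [r r0 H] := cf x Mx _ s2; exists r => // y My /(H y My) h.
rewrite distrC; apply: Hs; apply: le_lt_trans h _.
by rewrite ltr_pdivrMr // ltr_pMr // ltr1n.
Qed.

Lemma cont_on_abs M f : cont_on M f -> cont_on M (fun p => `|f p|).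
Proof.
move=> cf x Mx e e0; have [r r0 H] := cf x Mx e e0; exists r => // y My yr.
by rewrite (le_trans (ler_dist_dist _ _)) // H.
Qed.

Lemma cont_on_bounded M f : compact M -> cont_on M f ->
  exists2 C, 0 <= C & forall p, M p -> `|f p| <= C.
Proof.
move=> cM cf.
have [] := @compact_unif R 'rV[R]_N M (fun s y => M y -> `|f y| <= s^-1) cM.
  move=> x Mx; have [r r0 H] := cf x Mx 1 ltr01.
  have A0 : 0 < `|f x| + 1 by rewrite ltr_wpDl.
  exists (Num.min r (`|f x| + 1)^-1); first by rewrite lt_min r0 invr_gt0.
  move=> y s; rewrite !lt_min => /andP[yr _] /andP[s0 /andP[_ sA]] My.
  apply: (@le_trans _ _ (`|f x| + 1)).
    have := H y My yr; have := ler_distD (f x) (f y) 0; rewrite !subr0.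
    by move: (`|f y|) (`|f y - f x|) (`|f x|) => a b c; lra.
  by rewrite -(invrK (`|f x| + 1)) lef_pV2 ?posrE ?invr_gt0 // ltW.
move=> r r0 H; exists (r / 2)^-1; first by rewrite invr_ge0 divr_ge0 // ltW.
move=> p Mp; apply: (H (r / 2)) => //; apply/andP; split; lra.
Qed.

(** A bounded linear functional on C(M), acting on representatives: the first clause says that it
    only sees restrictions to M, and in the last one any uniform bound c replaces the sup norm. *)
Definition bfun M (J : ('rV[R]_N -> R) -> R) := [/\
  forall f g, (forall p, M p -> f p = g p) -> J f = J g,
  forall f g, cont_on M f -> cont_on M g -> J (fun p => f p + g p) = J f + J g,
  forall c f, cont_on M f -> J (fun p => c * f p) = c * J f &
  exists2 C, 0 <= C & forall f c, cont_on M f -> (forall p, M p -> `|f p| <= c) -> `|J f| <= C * c].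

(** * Functionals on continuous functions *)

Section Bfun.
Context (M : set 'rV[R]_N) (J : ('rV[R]_N -> R) -> R) (bJ : bfun M J).

Lemma bfun_ext f g : (forall p, M p -> f p = g p) -> J f = J g.
Proof. by case: bJ => H _ _ _; exact: H. Qed.

Lemma bfunD f g : cont_on M f -> cont_on M g -> J (fun p => f p + g p) = J f + J g.
Proof. by case: bJ => _ H _ _; exact: H. Qed.

Lemma bfunZ c f : cont_on M f -> J (fun p => c * f p) = c * J f.
Proof. by case: bJ => _ _ H _; exact: H. Qed.

Lemma bfunB f g : cont_on M f -> cont_on M g -> J (fun p => f p - g p) = J f - J g.
Proof.
move=> cf cg; rewrite -mulN1r -bfunZ // -bfunD //.
  by apply: bfun_ext => p _; rewrite mulN1r.
by apply: cont_onM => //; exact: cont_on_cst.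
Qed.

Lemma bfun_sum (I : Type) (r : seq I) (F : I -> 'rV[R]_N -> R) : (forall i, cont_on M (F i)) ->
  J (fun p => \sum_(i <- r) F i p) = \sum_(i <- r) J (F i).
Proof.
move=> cF; elim: r => [|i r IH].
  rewrite big_nil -[RHS](mul0r (J (fun _ => 0))) -bfunZ; last exact: cont_on_cst.
  by apply: bfun_ext => p _; rewrite big_nil mul0r.
rewrite big_cons -IH -bfunD //; last exact: cont_on_sum.
by apply: bfun_ext => p _; rewrite big_cons.
Qed.

End Bfun.

Lemma cont_onB M f g : cont_on M f -> cont_on M g -> cont_on M (fun p => f p - g p).
Proof.
move=> cf cg; apply: cont_on_ext (cont_onD cf (cont_onM (@cont_on_cst M (-1)) cg)) => p _.
by rewrite mulN1r.
Qed.

(* F is approximated by finite sums of products, through a partition of unity. *)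
Lemma bfun_fubini M J I (F : 'rV[R]_N -> 'rV[R]_N -> R) : compact M -> bfun M J -> bfun M I ->
  (forall e : R, 0 < e -> exists2 r : R, 0 < r & forall p p' q q', M p -> M p' -> M q -> M q' ->
     `|p - p'| < r -> `|q - q'| < r -> `|F p q - F p' q'| <= e) ->
  J (fun p => I (fun q => F p q)) = I (fun q => J (fun p => F p q)).
Proof.
move=> cM bJ bI uF.
have [CJ CJ0 HJ] : exists2 C, 0 <= C & forall f c, cont_on M f -> (forall p, M p -> `|f p| <= c) -> `|J f| <= C * c.
  by case: bJ.
have [CI CI0 HI] : exists2 C, 0 <= C & forall f c, cont_on M f -> (forall p, M p -> `|f p| <= c) -> `|I f| <= C * c.
  by case: bI.
have cF1 p : M p -> cont_on M (F p).
  move=> Mp x Mx e e0; have [r r0 H] := uF e e0; exists r => // y My yr.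
  by apply: H => //; rewrite subrr normr0.
have cF2 q : M q -> cont_on M (fun p => F p q).
  move=> Mp x Mx e e0; have [r r0 H] := uF e e0; exists r => // y My yr.
  by apply: H => //; rewrite subrr normr0.
have cI : cont_on M (fun p => I (F p)).
  move=> x Mx e e0; have e1 : 0 < e / (CI + 1) by rewrite divr_gt0 // ltr_wpDl.
  have [r r0 H] := uF _ e1; exists r => // y My yr.
  rewrite -(bfunB bI (cF1 y My) (cF1 x Mx)).
  have := HI (fun p => F y p - F x p) (e / (CI + 1)) (cont_onB (cF1 y My) (cF1 x Mx)).
  move=> /(_ _)/le_trans; apply.
    by move=> q Mq; apply: H => //; rewrite subrr normr0.
  by rewrite mulrA ler_pdivrMr ?ltr_wpDl // mulrDr mulr1 mulrC lerDl ltW.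
have cJ : cont_on M (fun q => J (fun p => F p q)).
  move=> x Mx e e0; have e1 : 0 < e / (CJ + 1) by rewrite divr_gt0 // ltr_wpDl.
  have [r r0 H] := uF _ e1; exists r => // y My yr.
  rewrite -(bfunB bJ (cF2 y My) (cF2 x Mx)).
  have := HJ (fun p => F p y - F p x) (e / (CJ + 1)) (cont_onB (cF2 y My) (cF2 x Mx)).
  move=> /(_ _)/le_trans; apply.
    by move=> q Mq; apply: H => //; rewrite subrr normr0.
  by rewrite mulrA ler_pdivrMr ?ltr_wpDl // mulrDr mulr1 mulrC lerDl ltW.
suff H e : 0 < e -> `|J (fun p => I (fun q => F p q)) - I (fun q => J (fun p => F p q))| <= (CJ * CI + CI * CJ) * e.
  apply/eqP; rewrite -subr_eq0 -normr_le0; apply/ler_addgt0Pr => e e0; rewrite add0r.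
  have K0 : 0 < CJ * CI + CI * CJ + 1 by rewrite ltr_wpDl // addr_ge0 // mulr_ge0.
  have := H (e / (CJ * CI + CI * CJ + 1)); rewrite divr_gt0 // => /(_ isT) /le_trans; apply.
  by rewrite mulrA ler_pdivrMr // mulrDr mulr1 mulrC lerDl ltW.
move=> e0; have [r r0 Hr] := uF e e0.
have r2 : 0 < r / 2 by rewrite divr_gt0.
(* With radius r / 2, the bumps below are supported within sqrt 2 r / 2 < r of their centres, where
   F varies by at most e. *)
pose U x := [set z : 'rV[R]_N | edot (z - x) (z - x) < (r / 2) ^+ 2].
have oU x : M x -> open (U x) /\ U x x.
  move=> _; split; first exact: open_edot_ball.
  by rewrite /U /= subrr /edot big1 ?exprn_gt0 // => i _; rewrite mxE mul0r.
have [n [c [Mc cov]]] := finite_nbhs_cover cM oU.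
pose B z := \sum_i bump (c i) (r / 2) z.
have B0 z : M z -> 0 < B z.
  move=> /cov[i Hi]; rewrite /B (bigD1 i) //= bump_eq1 // ?(ltW Hi) // ltr_pwDl //.
  by apply: sumr_ge0 => j _; exact: bump_ge0.
pose b i z := bump (c i) (r / 2) z / B z.
have cb i : cont_on M (b i).
  apply: cont_onM; first by apply: continuous_cont_on; exact: bump_continuous.
  apply: cont_onV; last by move=> p Mp; rewrite gt_eqF // B0.
  by apply: cont_on_sum => j; apply: continuous_cont_on; exact: bump_continuous.
have sb z : M z -> \sum_i b i z = 1 by move=> Mz; rewrite -mulr_suml mulfV // gt_eqF // B0.
have b0 i z : M z -> 0 <= b i z by move=> Mz; rewrite divr_ge0 ?bump_ge0 // ltW // B0.
pose G p q := \sum_i b i p * F (c i) q.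
have FG p q : M p -> M q -> `|F p q - G p q| <= e.
  move=> Mp Mq; rewrite -[F p q]mul1r -(sb p Mp) mulr_suml -sumrB (le_trans (ler_norm_sum _ _ _)) //.
  rewrite -[e]mul1r -(sb p Mp) mulr_suml; apply: ler_sum => i _.
  rewrite -mulrBr normrM ger0_norm ?b0 //.
  have [->|bi] := eqVneq (b i p) 0; first by rewrite !mul0r.
  rewrite ler_wpM2l ?b0 //; apply: Hr => //; last by rewrite subrr normr0.
  have /(bump_neq0 r2) Hb : bump (c i) (r / 2) p != 0.
    by apply: contra_neq bi => E; rewrite /b E mul0r.
  apply: norm_lt_edot => //; apply: lt_le_trans Hb _; rewrite expr_div_n; nra.
have cG1 p : M p -> cont_on M (G p).
  by move=> Mp; apply: cont_on_sum => i; apply: cont_onM; [exact: cont_on_cst|exact: cF1].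
have cG2 q : M q -> cont_on M (fun p => G p q).
  by move=> Mq; apply: cont_on_sum => i; apply: cont_onM; [exact: cb|exact: cont_on_cst].
have E1 : J (fun p => I (G p)) = \sum_i J (b i) * I (F (c i)).
  rewrite -[RHS](_ : \sum_i J (fun p => I (F (c i)) * b i p) = _).
    rewrite -(bfun_sum bJ); last by move=> i; apply: cont_onM; [exact: cont_on_cst|exact: cb].
    apply: (bfun_ext bJ) => p Mp; rewrite /G (bfun_sum bI); last first.
      by move=> i; apply: cont_onM; [exact: cont_on_cst|exact: cF1].
    by apply: eq_bigr => i _; rewrite (bfunZ bI) 1?mulrC //; exact: cF1.
  by apply: eq_bigr => i _; rewrite (bfunZ bJ) 1?mulrC.
have E2 : I (fun q => J (fun p => G p q)) = \sum_i J (b i) * I (F (c i)).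
  rewrite -[RHS](_ : \sum_i I (fun q => J (b i) * F (c i) q) = _).
    rewrite -(bfun_sum bI); last by move=> i; apply: cont_onM; [exact: cont_on_cst|exact: cF1].
    apply: (bfun_ext bI) => q Mq; rewrite /G (bfun_sum bJ); last first.
      by move=> i; apply: cont_onM; [exact: cb|exact: cont_on_cst].
    apply: eq_bigr => i _; rewrite [LHS](bfun_ext bJ (g := fun p => F (c i) q * b i p)) //.
      by rewrite (bfunZ bJ) 1?mulrC.
    by move=> p _; rewrite mulrC.
  by apply: eq_bigr => i _; rewrite (bfunZ bI) //; exact: cF1.
have cIG : cont_on M (fun p => I (G p)).
  have : cont_on M (fun p => \sum_i I (F (c i)) * b i p).
    by apply: cont_on_sum => i; apply: cont_onM; [exact: cont_on_cst|exact: cb].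
  apply: cont_on_ext => p Mp; rewrite /G (bfun_sum bI); last first.
    by move=> i; apply: cont_onM; [exact: cont_on_cst|exact: cF1].
  by apply: eq_bigr => i _; rewrite (bfunZ bI) 1?mulrC //; exact: cF1.
have cJG : cont_on M (fun q => J (fun p => G p q)).
  have : cont_on M (fun q => \sum_i J (b i) * F (c i) q).
    by apply: cont_on_sum => i; apply: cont_onM; [exact: cont_on_cst|exact: cF1].
  apply: cont_on_ext => q Mq; rewrite /G (bfun_sum bJ); last first.
    by move=> i; apply: cont_onM; [exact: cb|exact: cont_on_cst].
  apply: eq_bigr => i _; rewrite [RHS](bfun_ext bJ (g := fun p => F (c i) q * b i p)) //.
    by rewrite (bfunZ bJ) 1?mulrC.
  by move=> p _; rewrite mulrC.
have D1 : `|J (fun p => I (F p)) - J (fun p => I (G p))| <= CJ * (CI * e).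
  rewrite -(bfunB bJ cI cIG); apply: HJ; first exact: cont_onB.
  move=> p Mp; rewrite -(bfunB bI (cF1 p Mp) (cG1 p Mp)); apply: HI; first by apply: cont_onB; auto.
  by move=> q Mq; exact: FG.
have D2 : `|I (fun q => J (fun p => F p q)) - I (fun q => J (fun p => G p q))| <= CI * (CJ * e).
  rewrite -(bfunB bI cJ cJG); apply: HI; first exact: cont_onB.
  move=> q Mq; rewrite -(bfunB bJ (cF2 q Mq) (cG2 q Mq)); apply: HJ; first by apply: cont_onB; auto.
  by move=> p Mp; exact: FG.
rewrite (le_trans (ler_distD (J (fun p => I (G p))) _ _)) // mulrDl -!mulrA lerD //.
by rewrite E1 -E2 distrC.
Qed.

(** The profile of the kernel. Being 1-Lipschitz, it reduces every comparison of kernels to one of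
    squared distances. *)
Definition hat (s : R) : R := Num.max 0 (1 - s).

Lemma hat_ge0 s : 0 <= hat s. Proof. by rewrite /hat le_max lexx. Qed.

Lemma hat_le1 s : 0 <= s -> hat s <= 1. Proof. by move=> s0; rewrite /hat ge_max ler01 /=; lra. Qed.

Lemma hat_lip s t : `|hat s - hat t| <= `|s - t|.
Proof.
rewrite /hat; have [s1|s1] := leP 1 s; have [t1|t1] := leP 1 t.
- by rewrite !max_l ?subr_le0 // subrr normr0.
- rewrite max_l ?subr_le0 // max_r; last lra.
  rewrite sub0r normrN !ger0_norm; lra.
- rewrite max_r; last lra.
  rewrite max_l ?subr_le0 // subr0 ger0_norm ?subr_ge0; last lra.
  by rewrite distrC ger0_norm; lra.
- rewrite max_r; last lra.
  rewrite max_r; last lra.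
  by rewrite (_ : 1 - s - (1 - t) = t - s) 1?distrC //; ring.
Qed.

Lemma hat_cutoff : cutoff hat.
Proof.
split; last by move=> s s1; rewrite /hat max_l // subr_le0.
apply: (@continuous_ball R R^o) => s e e0; exists e => // t ts.
by rewrite (le_trans (hat_lip _ _)) // ltW.
Qed.

Definition kern (eps : R) p q : R := hat (edot (p - q) (p - q) / eps ^+ 2).

Lemma kernC eps p q : kern eps p q = kern eps q p.
Proof.
rewrite /kern -(opprB q p); congr (hat (_ / _)).
by apply: eq_bigr => i _; rewrite !mxE mulrNN.
Qed.

Lemma edot_diff n (a b : 'rV[R]_n) : `|edot a a - edot b b| <= n%:R * (`|a - b| * (`|a| + `|b|)).
Proof.
rewrite /edot -sumrB (le_trans (ler_norm_sum _ _ _)) //.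
apply: (@le_trans _ _ (\sum_(i < n) `|a - b| * (`|a| + `|b|))); last first.
  by rewrite sumr_const card_ord mulr_natl.
apply: ler_sum => i _.
have -> : a 0 i * a 0 i - b 0 i * b 0 i = (a - b) 0 i * (a 0 i + b 0 i) by rewrite !mxE; ring.
rewrite normrM; apply: ler_pM => //; first exact: coord_le_norm.
by rewrite (le_trans (ler_normD _ _)) // lerD // coord_le_norm.
Qed.

Lemma kern_unif M eps : compact M -> 0 < eps -> forall e : R, 0 < e ->
  exists2 r : R, 0 < r & forall p p' q q', M p -> M p' -> M q -> M q' ->
     `|p - p'| < r -> `|q - q'| < r -> `|kern eps p q - kern eps p' q'| <= e.
Proof.
move=> cM eps0 e e0.
have [C C0 HC] : exists2 C, 0 <= C & forall p, M p -> `|p| <= C.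
  have [|C C0 HC] := @cont_on_bounded M (fun p => `|p|) cM.
    by apply: continuous_cont_on; exact: norm_continuous.
  by exists C => // p /HC; rewrite normr_id.
pose K := eps ^- 2 * (N%:R * (2 * (4 * C))) + 1.
have K0 : 0 < K.
  by rewrite ltr_wpDl // mulr_ge0 ?invr_ge0 ?exprn_ge0 ?(ltW eps0) // mulr_ge0 // !mulr_ge0.
exists (e / K); first by rewrite divr_gt0.
move=> p p' q q' Mp Mp' Mq Mq' pp qq.
rewrite (le_trans (hat_lip _ _)) // -mulrBl normrM mulrC ger0_norm; last first.
  by rewrite invr_ge0 exprn_ge0 // ltW.
apply: (@le_trans _ _ (eps ^- 2 * (N%:R * ((2 * (e / K)) * (4 * C))))).
  rewrite ler_wpM2l ?invr_ge0 ?exprn_ge0 ?(ltW eps0) // (le_trans (edot_diff _ _)) //.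
  rewrite ler_wpM2l // ler_pM ?addr_ge0 //.
    have -> : p - q - (p' - q') = (p - p') - (q - q').
      by apply/rowP => i; rewrite !mxE; ring.
    rewrite (le_trans (ler_normB _ _)) // mulr_natl mulr2n lerD // ltW //.
  have -> : 4 * C = (C + C) + (C + C) by ring.
  by rewrite lerD // (le_trans (ler_normB _ _)) // lerD // HC.
rewrite [leLHS](_ : _ = (e / K) * (eps ^- 2 * (N%:R * (2 * (4 * C))))); last by ring.
rewrite mulrAC ler_pdivrMr // ler_wpM2l ?(ltW e0) // lerDl //.
Qed.

(** Expresses that J is integration against h times the Riemannian volume, by testing on
    concentrated kernels only. The constant [kap] will be the integral of [hat (edot v v)] over R^d,
    and the limit is uniform in q. *)
Definition has_density (d : nat) (kap : R) M (J : ('rV[R]_N -> R) -> R) (h : 'rV[R]_N -> R) :=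
  forall e : R, 0 < e -> exists2 r : R, 0 < r & forall eps, 0 < eps < r -> forall q, M q ->
    `|eps ^- d * J (fun p => kern eps p q) - kap * h q| <= e.

Lemma cont_kern M eps q : compact M -> 0 < eps -> M q -> cont_on M (fun p => kern eps p q).
Proof.
move=> cM eps0 Mq x Mx e e0; have [r r0 H] := kern_unif cM eps0 e0; exists r => // y My yr.
by apply: H => //; rewrite subrr normr0.
Qed.

(* Pairing the kernel with both functionals and letting eps tend to 0. *)
Lemma density_pairing d kap M J I h h' : compact M -> 0 < kap -> bfun M J -> bfun M I ->
  cont_on M h -> cont_on M h' ->
  has_density d kap M J h -> has_density d kap M I h' -> J h' = I h.
Proof.
move=> cM kap0 bJ bI ch ch' dJ dI.
have [CJ CJ0 HJ] : exists2 C, 0 <= C & forall f c, cont_on M f -> (forall p, M p -> `|f p| <= c) -> `|J f| <= C * c.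
  by case: bJ.
have [CI CI0 HI] : exists2 C, 0 <= C & forall f c, cont_on M f -> (forall p, M p -> `|f p| <= c) -> `|I f| <= C * c.
  by case: bI.
suff H e : 0 < e -> kap * `|J h' - I h| <= (CJ + CI) * e.
  apply/eqP; rewrite -subr_eq0 -normr_le0 -(pmulr_rle0 _ kap0); apply/ler_addgt0Pr => e e0; rewrite add0r.
  have K0 : 0 < CJ + CI + 1 by rewrite ltr_wpDl // addr_ge0.
  have := H (e / (CJ + CI + 1)); rewrite divr_gt0 // => /(_ isT) /le_trans; apply.
  by rewrite mulrA ler_pdivrMr // mulrDr mulr1 mulrC lerDl ltW.
move=> e0; have [r r0 Hr] := dJ e e0; have [s s0 Hs] := dI e e0.
pose eps := Num.min r s / 2.
have m0 : 0 < Num.min r s by rewrite lt_min r0.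
have eps0 : 0 < eps by rewrite divr_gt0.
have epsm : eps < Num.min r s by rewrite ltr_pdivrMr // ltr_pMr // ltr1n.
have [epsr epss] : eps < r /\ eps < s by move: epsm; rewrite lt_min => /andP[].
have {}Hr q Mq := Hr eps (introT andP (conj eps0 epsr)) q Mq.
have {}Hs q Mq := Hs eps (introT andP (conj eps0 epss)) q Mq.
have F := bfun_fubini cM bJ bI (kern_unif cM eps0).
have unifI : cont_on M (fun p => I (fun q => kern eps p q)).
  move=> x Mx t t0; have t1 : 0 < t / (CI + 1) by rewrite divr_gt0 // ltr_wpDl.
  have [r' r'0 H] := kern_unif cM eps0 t1; exists r' => // y My yr.
  have ck z : M z -> cont_on M (kern eps z).
    by move=> Mz; apply: cont_on_ext (cont_kern cM eps0 Mz) => p _; rewrite kernC.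
  rewrite -(bfunB bI (ck y My) (ck x Mx)).
  have := HI _ (t / (CI + 1)) (cont_onB (ck y My) (ck x Mx)).
  move=> /(_ _)/le_trans; apply.
    by move=> q Mq; apply: H => //; rewrite subrr normr0.
  by rewrite mulrA ler_pdivrMr ?ltr_wpDl // mulrDr mulr1 mulrC lerDl ltW.
have unifJ : cont_on M (fun q => J (fun p => kern eps p q)).
  move=> x Mx t t0; have t1 : 0 < t / (CJ + 1) by rewrite divr_gt0 // ltr_wpDl.
  have [r' r'0 H] := kern_unif cM eps0 t1; exists r' => // y My yr.
  rewrite -(bfunB bJ (cont_kern cM eps0 My) (cont_kern cM eps0 Mx)).
  have := HJ _ (t / (CJ + 1)) (cont_onB (cont_kern cM eps0 My) (cont_kern cM eps0 Mx)).
  move=> /(_ _)/le_trans; apply.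
    by move=> q Mq; apply: H => //; rewrite subrr normr0.
  by rewrite mulrA ler_pdivrMr ?ltr_wpDl // mulrDr mulr1 mulrC lerDl ltW.
have ckh : cont_on M (fun q => kap * h q) by apply: cont_onM => //; exact: cont_on_cst.
have ckh' : cont_on M (fun q => kap * h' q) by apply: cont_onM => //; exact: cont_on_cst.
(* By symmetry of the kernel, the inner functional approximates kap h' at p, uniformly; J is then
   applied to this estimate. *)
have A1 : `|eps ^- d * J (fun p => I (fun q => kern eps p q)) - kap * J h'| <= CJ * e.
  have c1 : cont_on M (fun p => eps ^- d * I (fun q => kern eps p q)).
    by apply: cont_onM => //; exact: cont_on_cst.
  rewrite -(bfunZ bJ _ unifI) -(bfunZ bJ _ ch') -(bfunB bJ c1 ckh'); apply: HJ; first exact: cont_onB.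
  move=> p Mp; have := Hs p Mp; rewrite (bfun_ext bI (g := fun q => kern eps p q)) // => q _.
  exact: kernC.
have A2 : `|eps ^- d * I (fun q => J (fun p => kern eps p q)) - kap * I h| <= CI * e.
  have c1 : cont_on M (fun q => eps ^- d * J (fun p => kern eps p q)).
    by apply: cont_onM => //; exact: cont_on_cst.
  rewrite -(bfunZ bI _ unifJ) -(bfunZ bI _ ch) -(bfunB bI c1 ckh); apply: HI; first exact: cont_onB.
  by move=> p Mp; exact: Hr.
rewrite -(gtr0_norm kap0) -normrM mulrBr mulrDl.
rewrite (le_trans (ler_distD (eps ^- d * J (fun p => I (fun q => kern eps p q))) _ _)) // lerD //.
  by rewrite distrC.
by rewrite F.
Qed.

End ContOn.

Section ContinuousAt.
Context {R : realType} {V W : normedModType R}.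

Lemma continuous_at_ball (f : V -> W) x :
  (forall e : R, 0 < e -> exists2 r : R, 0 < r & forall y, `|y - x| < r -> `|f y - f x| <= e) ->
  {for x, continuous f}.
Proof.
move=> H; apply/cvgrPdist_le => e e0; have [r r0 Hr] := H e e0.
by apply: (@ball_near R V _ x r) => // y /Hr; rewrite distrC.
Qed.

Lemma continuous_atP (f : V -> W) x : {for x, continuous f} ->
  forall e : R, 0 < e -> exists2 r : R, 0 < r & forall y, `|y - x| < r -> `|f y - f x| < e.
Proof.
move=> /cvgrPdist_lt cf e /cf/near_ball[r r0 H]; exists r => // y /H.
by rewrite distrC.
Qed.

Lemma open_ballP (U : set V) x : open U -> U x -> exists2 r : R, 0 < r & forall y, `|y - x| < r -> U y.
Proof. by move=> oU Ux; exact: near_ball (open_near oU Ux (fun y Dy => Dy)). Qed.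

Lemma open_norm_ball x (r : R) : open [set y : V | `|y - x| < r].
Proof.
have -> : [set y : V | `|y - x| < r] = ball x r.
  by apply/seteqP; split=> y; rewrite -ball_normE /= distrC.
exact: ball_open.
Qed.

Lemma compact_openC (K : set V) : compact K -> open (~` K).
Proof. by move=> cK; apply: closed_openC; apply: (@compact_closed V K) cK; exact: (@norm_hausdorff R V). Qed.

End ContinuousAt.

Section Patch.
Context {R : realType}.

Lemma compact_norm_le n (K : set 'rV[R]_n) : compact K ->
  exists2 B : R, 0 < B & forall u, K u -> `|u| <= B.
Proof.
move=> /compact_bounded[B [_ HB]]; exists (`|B| + 1); first by rewrite ltr_wpDl.
by move=> u Ku; apply: (HB (`|B| + 1)) => //; rewrite (le_lt_trans (ler_norm B)) // ltrDl.
Qed.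

Lemma patch_in n (D : set 'rV[R]_n) (F : 'rV[R]_n -> R) u : D u -> (F \_ D) u = F u.
Proof. by move=> Du; rewrite patchE mem_set. Qed.

Lemma patch_out n (D : set 'rV[R]_n) (F : 'rV[R]_n -> R) u : ~ D u -> (F \_ D) u = 0.
Proof. by move=> Du; rewrite patchE memNset. Qed.

(** Extension by 0 is continuous across the boundary of D because F already vanishes off the compact
    K. B depends on K alone and so serves all F. *)
Lemma patch_Cc n (D K : set 'rV[R]_n) : open D -> compact K -> K `<=` D ->
  exists2 B : R, 0 < B & forall F : 'rV[R]_n -> R, (forall u, D u -> {for u, continuous F}) ->
    (forall u, D u -> ~ K u -> F u = 0) -> Cc B (F \_ D).
Proof.
move=> oD cK KD; have [B B0 HB] := compact_norm_le cK; exists B => // F cF F0.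
have Z u : ~ K u -> (F \_ D) u = 0.
  by move=> nK; have [Du|/patch_out//] := pselect (D u); rewrite patch_in // F0.
split=> [u|u Bu]; last by apply: Z => /HB; rewrite leNgt Bu.
have [Du|nD] := pselect (D u).
  have [r r0 Hr] := open_ballP oD Du.
  apply: (@continuous_at_ball R _ R^o) => e /(continuous_atP (cF u Du))[s s0 Hs].
  exists (Num.min r s); first by rewrite lt_min r0.
  move=> y; rewrite lt_min => /andP[/Hr Dy /Hs]; rewrite !patch_in //; exact: ltW.
have nK : ~ K u by move=> /KD.
have [r r0 Hr] := open_ballP (@compact_openC R 'rV[R]_n K cK) nK.
apply: (@continuous_at_ball R _ R^o) => e e0; exists r => // y /Hr nKy.
by rewrite !Z // subrr normr0 ltW.
Qed.

Lemma Cc_bounded n B (f : 'rV[R]_n -> R) : Cc B f -> exists2 C, 0 <= C & forall u, `|f u| <= C.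
Proof.
move=> [cf sf]; have [C C0 HC] := cont_on_bounded (@compact_rV_box R n B) (continuous_cont_on cf).
exists C => // u; have [uB|Bu] := leP `|u| B; first exact: HC.
by rewrite sf // normr0.
Qed.

Lemma kap_gt0 n : 0 < integral_rV (fun v : 'rV[R]_n => hat (edot v v)).
Proof.
have H : Cc (1 + 1^-1) (fun v : 'rV[R]_n => hat (qf 1%:M v v)).
  by apply: cutoff_Cc => //; [exact: qf1_coercive|exact: hat_cutoff].
apply: (@integral_rV_gt0 _ _ (1 + 1^-1) _ 0) => //.
- move: H; congr (Cc _ _); apply/funext => v; by rewrite qf1.
- by move=> v; exact: hat_ge0.
- by rewrite /hat /edot big1 ?subr0 ?lt_max ?ltr01 ?orbT // => i _; rewrite mxE mul0r.
Qed.

End Patch.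

Section Gram.
Context {R : realType}.

Lemma row_free_bound d N (J : 'M[R]_(d, N)) : row_free J ->
  exists2 C : R, 0 < C & forall v : 'rV[R]_d, `|v| <= C * `|v *m J|.
Proof.
move=> /row_freeP[J' E]; have [C C0 H] := mulmx_bound J'; exists C => // v.
by rewrite -[v in `|v|]mulmx1 -E mulmxA.
Qed.

Lemma qf_gram d N (J : 'M[R]_(d, N)) v : qf (J *m J^T) v v = edot (v *m J) (v *m J).
Proof. by rewrite /qf edotE trmx_mul !mulmxA. Qed.

Lemma gram_coercive d N (J : 'M[R]_(d, N)) : row_free J ->
  exists2 m : R, 0 < m & forall v, m * `|v| ^+ 2 <= qf (J *m J^T) v v.
Proof.
move=> /row_free_bound[C C0 H]; exists (C ^- 2); first by rewrite invr_gt0 exprn_gt0.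
move=> v; rewrite qf_gram; apply: le_trans (edot_ge_norm _).
rewrite mulrC ler_pdivrMr ?exprn_gt0 // -exprMn mulrC ler_pXn2r ?nnegrE ?mulr_ge0 // ltW //.
Qed.

Lemma gram_sym d N (J : 'M[R]_(d, N)) : (J *m J^T)^T = J *m J^T.
Proof. by rewrite trmx_mul trmxK. Qed.

Lemma gram_unit d N (J : 'M[R]_(d, N)) : row_free J -> J *m J^T \in unitmx.
Proof. by move=> /gram_coercive[m m0 H]; exact: coercive_unit m0 H. Qed.

Lemma gram_det_gt0 d N (J : 'M[R]_(d, N)) : row_free J -> 0 < \det (J *m J^T).
Proof. by move=> /gram_coercive[m m0 H]; have [] := integral_qf (gram_sym J) m0 H hat_cutoff. Qed.

End Gram.

(** * Riemannian integral *)

Section Charts.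
Context {R : realType} {N d : nat} (M : set 'rV[R]_N) (D : set 'rV[R]_d) (phi : 'rV[R]_d -> 'rV[R]_N).
Hypothesis chart : local_parametrization M D phi.

Lemma chart_open : open D. Proof. by case: chart. Qed.

Lemma chart_in u : D u -> M (phi u).
Proof.
case: chart => oD _ _ _ H Du; have [U _ E] := H D oD (fun _ x => x).
by have : (M `&` U) (phi u) by [rewrite -E; exists u|]; case.
Qed.

Lemma chart_smooth : smooth_open D phi. Proof. by case: chart. Qed.

Lemma chart_cont u : D u -> {for u, continuous phi}.
Proof. exact: smooth_cont chart_smooth. Qed.

Lemma chart_inj u v : D u -> D v -> phi u = phi v -> u = v.
Proof. by case: chart => _ _ _ + _; apply. Qed.

Lemma chart_free u : D u -> row_free (jacobian phi u). Proof. by case: chart => _ _ + _ _; apply. Qed.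

Lemma chart_homeo u0 : D u0 -> forall e : R, 0 < e -> exists2 r : R, 0 < r &
  forall p, M p -> `|p - phi u0| < r -> exists u, [/\ D u, phi u = p & `|u - u0| < e].
Proof.
case: chart => oD _ _ _ H Du0 e e0.
have [r r0 Hr] := open_ballP oD Du0.
pose m := Num.min r e.
have m0 : 0 < m by rewrite lt_min r0.
have sub : [set y | `|y - u0| < m] `<=` D.
  by move=> y /= h; apply: Hr; apply: lt_le_trans h _; rewrite ge_min lexx.
have [U oU E] := H _ (open_norm_ball u0 m) sub.
have Up : U (phi u0).
  have : (M `&` U) (phi u0) by rewrite -E; exists u0 => //=; rewrite subrr normr0.
  by case.
have [s s0 Hs] := open_ballP oU Up.
exists s => // p Mp ps; have : (M `&` U) p by split=> //; exact: Hs.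
rewrite -E => -[u] /=; rewrite lt_min => /andP[ur ue] <-.
by exists u; split=> //; exact: Hr.
Qed.

Lemma cont_on_chart f u : cont_on M f -> D u -> {for u, continuous (fun u => f (phi u))}.
Proof.
move=> cf Du; apply: (@continuous_at_ball R _ R^o) => e e0.
have [r r0 Hr] := cf _ (chart_in Du) e e0.
have [s s0 Hs] := continuous_atP (chart_cont Du) r0.
have [t t0 Ht] := open_ballP chart_open Du.
exists (Num.min s t); first by rewrite lt_min s0.
by move=> y; rewrite lt_min => /andP[/Hs h /Ht Dy]; apply: Hr => //; exact: chart_in.
Qed.

Lemma smooth_jac i j : smooth_open D (fun u => jacobian phi u i j).
Proof.
have : smooth_open D (pd i (fun u => phi u 0 j)).
  by apply: smooth_derive; exact: smooth_coord chart_open chart_smooth.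
apply: smooth_ext; first exact: chart_open.
by move=> x Dx; rewrite (jacobianE chart_open chart_smooth Dx) mxE.
Qed.

Lemma smooth_gram i j : smooth_open D (fun u => (jacobian phi u *m (jacobian phi u)^T) i j).
Proof.
have : smooth_open D (fun u => \sum_k jacobian phi u i k * jacobian phi u j k).
  apply: smooth_sum chart_open _ => k; apply: smoothM; [exact: chart_open|exact: smooth_jac..].
apply: smooth_ext; first exact: chart_open.
by move=> x Dx; rewrite mxE; apply: eq_bigr => k _; rewrite !mxE.
Qed.

Lemma volume_gt0 u : D u -> 0 < volume_density phi u.
Proof. by move=> Du; rewrite sqrtr_gt0 gram_det_gt0 // chart_free. Qed.

Lemma smooth_volume : smooth_open D (volume_density phi).
Proof.
refine (@smooth_comp1 R _ D [set x | 0 < x] _ chart_open _ _ (@Num.sqrt R) (@smooth_sqrt R)).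
- apply: smooth_det; [exact: chart_open|exact: smooth_gram].
- by move=> u Du; rewrite /= gram_det_gt0 // chart_free.
Qed.

End Charts.

(** * Concentrated kernels in a chart *)

Section LocalDensity.
Context {R : realType} {N d : nat}.

(** Substituting u = u1 + s v turns the rescaled integral into that of H times [hat] of the squared
    length of (phi (u1 + s v) - phi u1) / s. By strict differentiability this tends uniformly to
    [H u0] times [hat] of |v J|^2, a quadratic form integrated by [integral_qf]. The base point u1
    moves near u0, for later uniformity. *)
Lemma has_kernel_limit (D : set 'rV[R]_d) (phi : 'rV[R]_d -> 'rV[R]_N) (H : 'rV[R]_d -> R) u0 B0 :
  open D -> smooth_open D phi -> D u0 -> row_free (jacobian phi u0) -> {for u0, continuous H} ->
  0 < B0 ->
  forall e : R, 0 < e -> exists2 r : R, 0 < r & forall u1 s (G : 'rV[R]_d -> R),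
   `|u1 - u0| < r -> 0 < s < r -> Cc B0 G -> (forall u, D u -> G u = H u * kern s (phi u) (phi u1)) ->
   (forall u, G u != 0 -> `|u - u0| < r) ->
   `|s ^- d * integral_rV G - H u0 * integral_rV (fun v : 'rV[R]_d => hat (edot v v)) / volume_density phi u0| <= e.
Proof.
move=> oD sphi Du0 rf cH B00 e e0.
set J := jacobian phi u0; pose S := J *m J^T.
have [C C0 HC] := row_free_bound rf.
have [C' C'0 HC'] := mulmx_bound J.
have [m m0 Hm] := gram_coercive rf.
have vol0 : 0 < volume_density phi u0 by rewrite sqrtr_gt0 gram_det_gt0.
have [_ HI] := integral_qf (gram_sym J) m0 Hm hat_cutoff.
have CcS := cutoff_Cc m0 Hm (@hat_cutoff R).
(* A common radius for the supports of the limit, at most 1 + 1/m, and of the rescaled integrand, at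
   most 2 C. *)
pose B := 1 + m^-1 + 2 * C.
have mi0 : 0 < m^-1 by rewrite invr_gt0.
have B1 : 0 < B by rewrite /B; lra.
pose K := N%:R * (B * (B * (2 * C' + 1))) : R.
have K0 : 0 <= K by rewrite /K !mulr_ge0 //; lra.
pose T := (2 * B) ^+ d * (1 + `|H u0| * K).
have T0 : 0 <= T by rewrite /T mulr_ge0 ?exprn_ge0 ?addr_ge0 ?mulr_ge0 //; lra.
have C2 : 0 < (2 * C)^-1 by rewrite invr_gt0; lra.
(* The bound 1 enters the constant K for squared lengths, (2 C)^-1 confines the support of the
   rescaled integrand, and the last term makes the total error at most e. *)
pose e1 := Num.min (Num.min 1 (2 * C)^-1) (e / (T + 1)).
have e10 : 0 < e1 by rewrite !lt_min ltr01 C2 divr_gt0 //; lra.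
have [e11 e1C e1T] : [/\ e1 <= 1, e1 <= (2 * C)^-1 & e1 <= e / (T + 1)].
  by rewrite /e1 !ge_min !lexx ?orbT.
have [r1 r10 Hr1] := smooth_strict_jac oD sphi Du0 e10.
have /cvgrPdist_le/(_ _ e10)/near_ball[r2 r20 Hr2] := cH.
pose r := Num.min r1 r2 / (1 + B).
have r0 : 0 < r by rewrite divr_gt0 ?lt_min ?r10 //; lra.
have [rr1 rr2] : r * (1 + B) <= r1 /\ r * (1 + B) <= r2.
  by rewrite /r divfK; [split; rewrite ge_min lexx ?orbT|rewrite gt_eqF //; lra].
have rB : r <= r * (1 + B) by rewrite ler_peMr //; lra.
exists r => // u1 s G u1r /andP[s0 sr] CcG HG G0.
have sn0 : s != 0 by rewrite gt_eqF.
have HS : integral_rV (fun v => H u0 * hat (qf S v v)) =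
    H u0 * integral_rV (fun v : 'rV[R]_d => hat (edot v v)) / volume_density phi u0.
  rewrite (@integralZ _ (1 + m^-1)) //; last by lra.
  by rewrite -HI mulrA mulfK // gt_eqF.
have HGs : integral_rV (fun v => G (s *: v + u1)) = s ^- d * integral_rV G.
  have cG' : Cc (B0 + `|u1|) (fun v => G (v + u1)).
    case: CcG => cG sG; split=> [v|v Bv].
      apply: (@continuous_at_ball R _ R^o) => t t0; have [q q0 Hq] := continuous_atP (cG (v + u1)) t0.
      by exists q => // y yq; apply: ltW; apply: Hq; rewrite opprD addrACA subrr addr0.
    apply: sG; have : `|v| <= `|v + u1| + `|u1| by rewrite -[v in leLHS](addrK u1) ler_normB.
    move: Bv; lra.
  rewrite (integral_rV_scale (f := fun v => G (v + u1)) _ s0 cG') ?(integral_rV_shift _ B00 CcG) //.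
  by rewrite ltr_wpDr.
have near1 v : `|v| <= B -> `|s *: v + u1 - u0| < r * (1 + B).
  move=> vB; rewrite -addrA (le_lt_trans (ler_normD _ _)) // normrZ gtr0_norm //.
  have : s * `|v| <= r * B by apply: ler_pM => //; exact: ltW.
  lra.
have quot v : s *: v + u1 - u1 = s *: v by rewrite addrK.
have approx v : `|s *: v + u1 - u0| < r1 ->
    `|s^-1 *: (phi (s *: v + u1) - phi u1) - v *m J| <= e1 * `|v|.
  move=> h; have [|_ _] := Hr1 (s *: v + u1) u1 h; first by apply: lt_le_trans u1r _; lra.
  rewrite quot -scalemxAl normrZ gtr0_norm // => h2.
  rewrite -[X in _ - X](scale1r) -(mulVf sn0) -scalerA -scalerBr normrZ gtr0_norm ?invr_gt0 //.
  by rewrite ler_pdivrMl // mulrCA.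
have kernE v : kern s (phi (s *: v + u1)) (phi u1) =
    hat (edot (s^-1 *: (phi (s *: v + u1) - phi u1)) (s^-1 *: (phi (s *: v + u1) - phi u1))).
  rewrite /kern edotZr edotC edotZr; congr hat; field; exact: sn0.
(* Where G is nonzero the rescaled increment has length below 1, so |v| <= C |v J| <= C (1 + e1 |v|)
   <= C + |v| / 2. *)
have suppG v : G (s *: v + u1) != 0 -> `|v| <= 2 * C.
  move=> h; have h1 := G0 _ h.
  have h2 : `|s *: v + u1 - u0| < r1 by lra.
  have [Du _ _] := Hr1 _ _ h2 h2.
  move: h; rewrite HG // mulf_eq0 negb_or => /andP[_]; rewrite kernE.
  have := approx v h2; have := HC v; set a := _ *: (_ - _) => h3 h4 h5.
  have h6 : `|a| < 1.
    apply: norm_lt_edot; rewrite // expr1n ltNge; apply: contraNN h5 => h5.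
    by rewrite (hat_cutoff.2 _ h5).
  have h7 : `|v *m J| <= `|a| + e1 * `|v|.
    rewrite -[v *m J](subKr a) (le_trans (ler_normB _ _)) // lerD2l //.
  have h8 : C * e1 * `|v| <= 2^-1 * `|v|.
    rewrite ler_wpM2r // mulrC -ler_pdivlMr // (le_trans e1C) // invfM //.
  move: h3 h6 h7 h8 (normr_ge0 v); move: (`|v|) (`|a|) (`|v *m J|) => x y z; nra.
have CcG2 : Cc B (fun v => G (s *: v + u1)).
  split=> [v|v Bv].
    apply: (@continuous_at_ball R _ R^o) => t t0; have [q q0 Hq] := continuous_atP (CcG.1 (s *: v + u1)) t0.
    exists (q / s); first exact: divr_gt0.
    move=> y; rewrite ltr_pdivlMr // => yq; apply: ltW; apply: Hq.
    by rewrite opprD addrACA subrr addr0 -scalerBr normrZ gtr0_norm // mulrC.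
  apply/eqP; apply: contraTT (isT) => /suppG h; exfalso; move: Bv h; rewrite /B; lra.
have CcS2 : Cc B (fun v => H u0 * hat (qf S v v)).
  by apply: Cc_leB (Cc_Z _ CcS); rewrite /B; lra.
rewrite -HGs -HS -(integralB B1 CcG2 CcS2).
apply: le_trans (_ : (2 * B) ^+ d * (e1 * (1 + `|H u0| * K)) <= _); last first.
  rewrite mulrCA -/T; have : e1 * (T + 1) <= e by rewrite -ler_pdivlMr //; lra.
  by nra.
apply: integral_bound; [exact: B1|exact: Cc_B|move=> v].
have [vB|Bv] := leP `|v| B; last first.
  rewrite (CcG2.2 _ Bv) (CcS2.2 _ Bv) subrr normr0; apply: mulr_ge0; first exact: ltW.
  by rewrite addr_ge0 // mulr_ge0.
have h1 := near1 v vB.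
have h2 : `|s *: v + u1 - u0| < r1 by lra.
have [Du _ _] := Hr1 _ _ h2 h2.
have h3 := approx v h2.
rewrite HG // kernE qf_gram.
move: h3; set a := _ *: (_ - _) => h3.
have h4 : `|H (s *: v + u1) - H u0| <= e1 by rewrite distrC; apply: Hr2; lra.
have h5 : `|hat (edot a a) - hat (edot (v *m J) (v *m J))| <= e1 * K.
  rewrite (le_trans (hat_lip _ _)) // (le_trans (edot_diff _ _)) // /K [leRHS]mulrCA.
  rewrite ler_wpM2l // [leRHS]mulrA ler_pM ?addr_ge0 //.
    by rewrite (le_trans h3) // ler_wpM2l // ltW.
  have h6 : `|v *m J| <= C' * B by rewrite (le_trans (HC' v)) // ler_wpM2l // ltW.
  have h7 : `|a| <= `|v *m J| + e1 * `|v|.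
    by rewrite -[a](subrK (v *m J)) addrC (le_trans (ler_normD _ _)) // lerD2l.
  have h8 : e1 * `|v| <= 1 * B by apply: ler_pM => //; exact: ltW.
  move: h6 h7 h8; nra.
have h6 : `|hat (edot a a)| <= 1 by rewrite ger0_norm ?hat_ge0 // hat_le1 // edot_ge0.
move: h4 h5 h6; move: (H _) (H u0) (hat _) (hat _) => x y w z h4 h5 h6.
rewrite (_ : x * z - y * w = (x - y) * z + y * (z - w)); last by ring.
rewrite (le_trans (ler_normD _ _)) // !normrM mulrDr mulr1 lerD //.
  by rewrite -[e1]mulr1 ler_pM.
by rewrite mulrCA ler_wpM2l.
Qed.

End LocalDensity.

Lemma compact_image {R : realType} {V W : normedModType R} (f : V -> W) K : compact K ->
  (forall u, K u -> {for u, continuous f}) -> compact (f @` K).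
Proof.
move=> cK cf; apply: continuous_compact => //; apply: continuous_in_subspaceT => u; rewrite inE.
exact: cf.
Qed.

Section SmoothOn.
Context {R : realType} {N : nat}.
Implicit Types (M : set 'rV[R]_N) (f g : 'rV[R]_N -> R) (p q : 'rV[R]_N).

Lemma smooth_on_setT M f : smooth_open setT f -> smooth_on M f.
Proof. by move=> sf p _; exists setT, f; split=> //; split=> //; exact: openT. Qed.

Lemma smooth_on_ext M f g : (forall p, M p -> f p = g p) -> smooth_on M f -> smooth_on M g.
Proof.
move=> fg sf p Mp; have [U [F [oU sF E]]] := sf p Mp; exists U, F; split=> // x Mx Ux.
by rewrite -fg // E.
Qed.

Lemma smooth_on_cst M (a : R) : smooth_on M (fun _ => a).
Proof. by apply: smooth_on_setT; exact: smooth_cst openT. Qed.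

Let smooth_on2 (op : R -> R -> R) M f g :
  (forall U F G, open U -> smooth_open U F -> smooth_open U G ->
     smooth_open U (fun x : 'rV[R]_N => op (F x) (G x))) ->
  smooth_on M f -> smooth_on M g -> smooth_on M (fun p => op (f p) (g p)).
Proof.
move=> H sf sg p Mp; have [U [F [[oU Up] sF EF]]] := sf p Mp; have [U' [G [[oU' Up'] sG EG]]] := sg p Mp.
have oI : open (U `&` U') by exact: openI.
exists (U `&` U'), (fun x => op (F x) (G x)); split=> //.
  apply: H => //; [apply: smooth_sub sF|apply: smooth_sub sG] => x [] //.
by move=> x Mx [Ux U'x]; rewrite EF // EG.
Qed.

Lemma smooth_onD M f g : smooth_on M f -> smooth_on M g -> smooth_on M (fun p => f p + g p).
Proof. by apply: smooth_on2 => U F G oU; exact: smoothD. Qed.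

Lemma smooth_onM M f g : smooth_on M f -> smooth_on M g -> smooth_on M (fun p => f p * g p).
Proof. by apply: smooth_on2 => U F G oU; exact: smoothM. Qed.

Lemma smooth_on_sum M (I : Type) (r : seq I) (F : I -> 'rV[R]_N -> R) :
  (forall i, smooth_on M (F i)) -> smooth_on M (fun p => \sum_(i <- r) F i p).
Proof.
move=> sF; elim: r => [|j r IH].
  by apply: smooth_on_ext (smooth_on_cst (M := M) 0) => p _; rewrite big_nil.
by apply: smooth_on_ext (smooth_onD (sF j) IH) => p _; rewrite big_cons.
Qed.

Lemma smooth_on_comp1 M f (V : set R) (F : R -> R) : open V -> (forall p, M p -> V (f p)) ->
  smooth_open V F -> smooth_on M f -> smooth_on M (fun p => F (f p)).
Proof.
move=> oV fV sF sf p Mp; have [U [G [[oU Up] sG EG]]] := sf p Mp.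
have [r r0 Hr] := open_ballP oU Up.
have [s s0 Hs] := open_ballP oV (fV p Mp).
have [t t0 Ht] := continuous_atP (smooth_cont sG Up) s0.
pose U' := [set y : 'rV[R]_N | `|y - p| < Num.min r t].
have oU' : open U' by exact: open_norm_ball.
have U'U : U' `<=` U by move=> x; rewrite /U' /= lt_min => /andP[/Hr].
exists U', (fun x => F (G x)); split.
- by split=> //; rewrite /U' /= subrr normr0 lt_min r0.
- refine (@smooth_comp1 R _ U' V G oU' (smooth_sub U'U sG) _ F sF) => x.
  by rewrite /U' /= lt_min => /andP[_ /Ht h]; apply: Hs; rewrite (EG p).
- by move=> x Mx /U'U Ux; rewrite EG.
Qed.

Lemma smooth_on_cont M f : smooth_on M f -> cont_on M f.
Proof.
move=> sf p Mp e e0; have [U [G [[oU Up] sG EG]]] := sf p Mp.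
have [r r0 Hr] := open_ballP oU Up.
have [t t0 Ht] := continuous_atP (smooth_cont sG Up) e0.
exists (Num.min r t); first by rewrite lt_min r0.
by move=> y My; rewrite lt_min => /andP[/Hr Uy /Ht h]; rewrite !EG // ltW.
Qed.

End SmoothOn.

Section ChartFunctional.
Context {R : realType} {N d : nat} (M : set 'rV[R]_N) (D K : set 'rV[R]_d) (phi : 'rV[R]_d -> 'rV[R]_N).
Hypotheses (chart : local_parametrization M D phi) (cK : compact K) (KD : K `<=` D).
Local Notation kap := (integral_rV (fun v : 'rV[R]_d => hat (edot v v))).

Definition chart_fun (h f : 'rV[R]_N -> R) :=
  integral_rV ((fun u => h (phi u) * f (phi u) * volume_density phi u) \_ D).

Lemma chart_fun_ext h f g : (forall p, M p -> f p = g p) -> chart_fun h f = chart_fun h g.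
Proof.
move=> fg; rewrite /chart_fun; congr integral_rV; apply/funext => u.
by have [Du|nD] := pselect (D u); [rewrite !patch_in // fg //; exact: chart_in chart u Du|rewrite !patch_out].
Qed.

Lemma chart_fun_Cc : exists2 B : R, 0 < B & forall h f, cont_on M h -> cont_on M f ->
  (forall p, M p -> ~ (phi @` K) p -> h p = 0) ->
  Cc B ((fun u => h (phi u) * f (phi u) * volume_density phi u) \_ D).
Proof.
have [B B0 H] := patch_Cc (chart_open chart) cK KD; exists B => // h f ch cf h0; apply: H => u Du.
  apply: (@continuousM R _ (fun u => h (phi u) * f (phi u))).
    apply: (@continuousM R _ (fun u => h (phi u))); exact: cont_on_chart chart _ _ _ _.
  exact: smooth_cont (smooth_volume chart) Du.
move=> nK; rewrite h0 ?mul0r //; first exact: chart_in chart u Du.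
by move=> [v Kv /(chart_inj chart (KD Kv) Du) E]; apply: nK; rewrite -E.
Qed.

Lemma bfun_chart h : cont_on M h -> (forall p, M p -> ~ (phi @` K) p -> h p = 0) ->
  bfun M (chart_fun h).
Proof.
move=> ch h0; have [B B0 HB] := chart_fun_Cc; split.
- by move=> f g; exact: chart_fun_ext.
- move=> f g cf cg; rewrite /chart_fun -(integralD B0 (HB _ _ ch cf h0) (HB _ _ ch cg h0)).
  congr integral_rV; apply/funext => u.
  by have [Du|nD] := pselect (D u); [rewrite !patch_in // mulrDr mulrDl|rewrite !patch_out // addr0].
- move=> c f cf; rewrite /chart_fun -(integralZ B0 c (HB _ _ ch cf h0)).
  congr integral_rV; apply/funext => u.
  by have [Du|nD] := pselect (D u); [rewrite !patch_in //; ring|rewrite !patch_out // mulr0].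
(* When M is empty the bound c may be negative, which forces the constant 0. *)
have [[p Mp]|nM] := pselect (exists p, M p); last first.
  exists 0 => // f c cf _; rewrite mul0r -(mulr0 ((2 * B) ^+ d)).
  apply: (integral_bound B0 (HB _ _ ch cf h0)) => u.
  have [Du|nD] := pselect (D u); last by rewrite patch_out // normr0.
  by case: nM; exists (phi u); exact: chart_in chart u Du.
have c1 : cont_on M (fun _ => 1) by exact: cont_on_cst.
have [C C0 HC] := Cc_bounded (HB _ _ ch c1 h0).
exists ((2 * B) ^+ d * C); first by rewrite mulr_ge0 // exprn_ge0 // mulr_ge0 // ltW.
move=> f c cf fc; rewrite -mulrA; apply: (integral_bound B0 (HB _ _ ch cf h0)) => u.
have [Du|nD] := pselect (D u); last first.
  by rewrite patch_out // normr0 mulr_ge0 // (le_trans _ (fc p Mp)).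
have := HC u; rewrite !patch_in // mulr1 => h1; rewrite mulrAC normrM ler_pM //.
by apply: fc; exact: chart_in chart u Du.
Qed.

Lemma kern_neq0 s (p q : 'rV[R]_N) : 0 < s -> kern s p q != 0 -> `|p - q| < s.
Proof.
move=> s0 H; apply: norm_lt_edot => //; rewrite ltNge; apply: contraNN H => H.
by rewrite /kern (hat_cutoff.2 _ _) // ler_pdivlMr ?exprn_gt0 // mul1r.
Qed.

(** Away from the support of h narrow kernels see nothing. Near a point of it, [has_kernel_limit] is
    applied to h times the volume density, and the density cancels against the one in the limit. *)
Lemma density_chart h : compact M -> cont_on M h -> (forall p, M p -> ~ (phi @` K) p -> h p = 0) ->
  has_density d kap M (chart_fun h) h.
Proof.
move=> cM ch h0 e e0; have [B B0 HB] := chart_fun_Cc.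
have k0 := kap_gt0 (R := R) d.
pose P s q := M q -> `|s ^- d * chart_fun h (fun p => kern s p q) - kap * h q| <= e.
suff [r r0 H] : exists2 r : R, 0 < r & forall s, 0 < s < r -> forall q, M q -> P s q.
  by exists r => // s sr q Mq; exact: H.
apply: (compact_unif cM).
move=> q0 Mq0; have [[u0 Ku0 E]|nK] := pselect ((phi @` K) q0); last first.
  have cpK : compact (phi @` K).
    apply: (@compact_image R _ _ phi) => // u Ku; exact: (chart_cont chart (KD Ku)).
  have [r r0 Hr] := open_ballP (@compact_openC R 'rV[R]_N _ cpK) nK.
  exists (r / 2); first by rewrite divr_gt0.
  move=> q s qr /andP[s0 sr] Mq.
  have -> : h q = 0 by apply: h0 => //; apply: Hr; lra.
  rewrite mulr0 subr0; suff -> : chart_fun h (fun p => kern s p q) = 0 by rewrite mulr0 normr0 ltW.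
  apply/eqP; rewrite -normr_le0 -(mulr0 ((2 * B) ^+ d)).
  apply: (integral_bound B0 (HB _ _ ch (cont_kern cM s0 Mq) h0)) => u.
  have [Du|nD] := pselect (D u); last by rewrite patch_out // normr0.
  rewrite patch_in //; have [->|/(kern_neq0 s0) h1] := eqVneq (kern s (phi u) q) 0.
    by rewrite mulr0 mul0r normr0.
  rewrite (h0 (phi u)) ?mul0r ?normr0 //; first exact: chart_in chart u Du.
  apply: Hr; rewrite -(subrKA q) (le_lt_trans (ler_normD _ _)) //; lra.
have Du0 := KD Ku0.
have v0 := volume_gt0 chart Du0.
have cH : {for u0, continuous (fun u => h (phi u) * volume_density phi u)}.
  apply: (@continuousM R _ (fun u => h (phi u))); first exact: cont_on_chart chart _ _ _ _.
  exact: smooth_cont (smooth_volume chart) Du0.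
have e2 : 0 < e / 2 by rewrite divr_gt0.
have [r r0 Hr] := has_kernel_limit (chart_open chart) (chart_smooth chart) Du0 (chart_free chart Du0) cH B0 e2.
(* The kernel only makes [phi u] close to q0; that u is then close to u0 is the homeomorphism
   property of the chart. *)
have [r' r'0 Hr'] := chart_homeo chart Du0 r0.
have ek : 0 < e / 2 / kap by rewrite divr_gt0.
have [t t0 Ht] := ch q0 Mq0 _ ek.
exists (Num.min (Num.min r (r' / 2)) t); first by rewrite !lt_min r0 t0 divr_gt0.
move=> q s; rewrite !lt_min => /andP[/andP[_ qr'] qt] /andP[s0 /andP[/andP[sr sr'] _]] Mq.
have [|u1 [Du1 E1 u1r]] := Hr' q Mq; first by rewrite E; lra.
have := Hr u1 s _ u1r (introT andP (conj s0 sr)) (HB _ _ ch (cont_kern cM s0 Mq) h0).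
move=> /(_ _ _)/= h1.
have : `|s ^- d * chart_fun h (fun p => kern s p q) - h (phi u0) * volume_density phi u0 * kap / volume_density phi u0| <= e / 2.
  apply: h1 => u; first by move=> Du; rewrite patch_in // E1 mulrAC.
  have [Du|nD] := pselect (D u); last by rewrite patch_out // eqxx.
  rewrite patch_in // !mulf_eq0 !negb_or => /andP[/andP[_ /(kern_neq0 s0) h2] _].
  have [|u' [Du' E' u'r]] := Hr' (phi u) (chart_in chart Du).
    rewrite E -(subrKA q) (le_lt_trans (ler_normD _ _)) //; lra.
  by rewrite -(chart_inj chart Du' Du E').
rewrite E mulrAC mulfK ?gt_eqF // => h2.
rewrite (le_trans (ler_distD (h q0 * kap) _ _)) // (splitr e) lerD // mulrC -mulrBr normrM gtr0_norm //.
by rewrite mulrC -ler_pdivlMr // distrC Ht.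
Qed.

End ChartFunctional.

Section Integral.
Context {R : realType} {N d : nat} (M : set 'rV[R]_N).
Hypothesis cM : compact M.
Local Notation kap := (integral_rV (fun v : 'rV[R]_d => hat (edot v v))).

Lemma bfun_bigsum n (J : 'I_n -> ('rV[R]_N -> R) -> R) : (forall i, bfun M (J i)) ->
  bfun M (fun f => \sum_i J i f).
Proof.
move=> bJ; split.
- by move=> f g fg; apply: eq_bigr => i _; exact: (bfun_ext (bJ i)).
- by move=> f g cf cg; rewrite -big_split; apply: eq_bigr => i _; exact: (bfunD (bJ i)).
- by move=> c f cf; rewrite mulr_sumr; apply: eq_bigr => i _; exact: (bfunZ (bJ i)).
have /choice[C HC] : forall i, exists C, 0 <= C /\ forall f c, cont_on M f -> (forall p, M p -> `|f p| <= c) -> `|J i f| <= C * c.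
  by move=> i; case: (bJ i) => _ _ _ [C C0 HC]; exists C.
exists (\sum_i C i); first by apply: sumr_ge0 => i _; exact: (HC i).1.
move=> f c cf fc; rewrite (le_trans (ler_norm_sum _ _ _)) // mulr_suml.
by apply: ler_sum => i _; exact: (HC i).2.
Qed.

Lemma density_bigsum n kp (J : 'I_n -> ('rV[R]_N -> R) -> R) (h : 'I_n -> 'rV[R]_N -> R) :
  (forall i, has_density d kp M (J i) (h i)) ->
  has_density d kp M (fun f => \sum_i J i f) (fun p => \sum_i h i p).
Proof.
move=> dJ e e0; have e1 : 0 < e / (n%:R + 1) by rewrite divr_gt0 // ltr_wpDl.
have /choice[r Hr] : forall i, exists r : R, 0 < r /\ forall eps, 0 < eps < r -> forall q, M q ->
    `|eps ^- d * J i (fun p => kern eps p q) - kp * h i q| <= e / (n%:R + 1).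
  by move=> i; have [r r0 Hr] := dJ i _ e1; exists r.
pose r0 : R := \big[Num.min/1]_i r i.
have r00 : 0 < r0 by apply: (big_ind (fun x => 0 < x)) => // [x y x0 y0|i _]; [rewrite lt_min x0|exact: (Hr i).1].
exists r0 => // s /andP[s0 sr] q Mq.
rewrite !mulr_sumr -sumrB (le_trans (ler_norm_sum _ _ _)) //.
apply: (@le_trans _ _ (\sum_(i < n) e / (n%:R + 1))).
  apply: ler_sum => i _; apply: (Hr i).2 => //; rewrite s0 /= (lt_le_trans sr) //.
  exact: bigmin_le_cond.
rewrite sumr_const card_ord -[leLHS]mulr_natl mulrA ler_pdivrMr ?ltr_wpDl //.
by rewrite mulrDr mulr1 mulrC lerDl ltW.
Qed.

Section Partition.
Context (n : nat) (D : 'I_n -> set 'rV[R]_d) (phi : 'I_n -> 'rV[R]_d -> 'rV[R]_N) (rho : 'I_n -> 'rV[R]_N -> R).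
Hypothesis pou : partition_of_unity M D phi rho.

Definition pou_fun f := \sum_i chart_fun (D i) (phi i) (rho i) f.

(** The factor f is moved into the weights, so that integration of f times g becomes a functional of
    g with density f. *)
Lemma bfun_pou f : cont_on M f -> bfun M (fun g => \sum_i chart_fun (D i) (phi i) (fun p => rho i p * f p) g) /\
  has_density d kap M (fun g => \sum_i chart_fun (D i) (phi i) (fun p => rho i p * f p) g) f.
Proof.
case: pou => chart srho _ rho1 out cf.
have ch i : cont_on M (fun p => rho i p * f p) by apply: cont_onM => //; exact: (smooth_on_cont (srho i)).
split.
  apply: bfun_bigsum => i; have [K [cK KD H]] := out i.
  by apply: (bfun_chart (chart i) cK KD) => // p Mp /(H p Mp) ->; rewrite mul0r.
have : has_density d kap M (fun g => \sum_i chart_fun (D i) (phi i) (fun p => rho i p * f p) g)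
    (fun p => \sum_i (rho i p * f p)).
  apply: density_bigsum => i; have [K [cK KD H]] := out i.
  by apply: (density_chart (chart i) cK KD) => // p Mp /(H p Mp) ->; rewrite mul0r.
move=> H e /H[r r0 Hr]; exists r => // s sr q Mq.
by have := Hr s sr q Mq; rewrite -mulr_suml rho1 // mul1r.
Qed.

Lemma bfun_pou1 : bfun M pou_fun /\ has_density d kap M pou_fun (fun _ => 1).
Proof.
have [H1 H2] := bfun_pou (cont_on_cst (M := M) 1).
suff E : (fun g => \sum_i chart_fun (D i) (phi i) (fun p => rho i p * 1) g) = pou_fun by rewrite -E.
apply/funext => g; apply: eq_bigr => i _; congr chart_fun; apply/funext => p; exact: mulr1.
Qed.

(** Pairing I, of density h, with the integral against f, of density f. For I given by a second
    partition of unity and h = 1 this is the independence of the partition; for I the integral in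
    one chart it reduces integrals to that chart. *)
Lemma pou_funE I f h : bfun M I -> has_density d kap M I h -> cont_on M h -> cont_on M f ->
  pou_fun (fun p => h p * f p) = I f.
Proof.
move=> bI dI ch cf; have [bJ dJ] := bfun_pou cf.
rewrite -(density_pairing cM (kap_gt0 d) bJ bI cf ch dJ dI).
apply: eq_bigr => i _; congr integral_rV; apply/funext => u; congr (patch _ _ _ u).
by apply/funext => v; ring.
Qed.

End Partition.

Lemma integral_onE n (D : 'I_n -> set 'rV[R]_d) phi rho f : partition_of_unity M D phi rho ->
  cont_on M f -> integral_on d M f = pou_fun D phi rho f.
Proof.
move=> pou cf; have [b1 d1] := bfun_pou1 pou.
have c1 : cont_on M (fun _ => 1) by exact: cont_on_cst.
rewrite /integral_on; case: xgetP => [s _ [n' [D' [phi' [rho' [pou' ->]]]]]|/(_ (pou_fun D phi rho f))[]].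
  have := pou_funE pou' b1 d1 c1 cf; rewrite -[pou_fun D phi rho f]/(_) => <-.
  apply: eq_bigr => i _; congr integral_rV; apply/funext => u; congr (patch _ _ _ u).
  by apply/funext => v; rewrite mul1r.
by exists n, D, phi, rho.
Qed.

Lemma integral_on_ext f g : (forall p, M p -> f p = g p) -> integral_on d M f = integral_on d M g.
Proof.
move=> fg; congr (xget 0 _); apply/seteqP.
have H f' g' : (forall p, M p -> f' p = g' p) -> [set s | is_integral d M f' s] `<=` [set s | is_integral d M g' s].
  move=> fg' s [n' [D' [phi' [rho' [pou' ->]]]]]; exists n', D', phi', rho'; split=> //.
  apply: eq_bigr => i _; apply: (chart_fun_ext _ _ fg').
  by case: pou' => + _ _ _ _; apply.
by split; apply: H => // p Mp; rewrite fg.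
Qed.

End Integral.

(** A finite partition of unity together with cutoffs chi that equal 1 wherever rho does not vanish
    locally. Multiplying a chart derivative by chi makes it global without changing its effect on
    functions of the form rho f. *)
Record atlas {R : realType} {N : nat} d (M : set 'rV[R]_N) := Atlas {
  at_n : nat ;
  at_D : 'I_at_n -> set 'rV[R]_d ;
  at_phi : 'I_at_n -> 'rV[R]_d -> 'rV[R]_N ;
  at_rho : 'I_at_n -> 'rV[R]_N -> R ;
  at_chi : 'I_at_n -> 'rV[R]_N -> R ;
  at_K : 'I_at_n -> set 'rV[R]_d ;
  at_pou : partition_of_unity M at_D at_phi at_rho ;
  at_compact : forall i, compact (at_K i) ;
  at_sub : forall i, at_K i `<=` at_D i ;
  at_chi_smooth : forall i, smooth_on M (at_chi i) ;
  at_chi_out : forall i p, M p -> ~ (at_phi i @` at_K i) p -> at_chi i p = 0 ;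
  at_chi_near : forall i p, M p -> at_chi i p = 1 \/
    exists2 r : R, 0 < r & forall q, M q -> `|q - p| < r -> at_rho i q = 0
}.

Section AtlasExists.
Context {R : realType} {N d : nat} (M : set 'rV[R]_N).
Hypotheses (cM : compact M) (sM : smooth_submanifold d M).

Lemma chart_ball p : M p -> exists D : set 'rV[R]_d, exists phi K, exists r : R,
  [/\ local_parametrization M D phi, compact K, K `<=` D, 0 < r &
    forall q, M q -> edot (q - p) (q - p) < r ^+ 2 -> (phi @` K) q].
Proof.
move=> Mp; have [D [phi [chart [u0 Du0 <-]]]] := sM Mp.
have [t t0 Ht] := open_ballP (chart_open chart) Du0.
have t2 : 0 < t / 2 by rewrite divr_gt0.
have [r r0 Hr] := chart_homeo chart Du0 t2.
exists D, phi, ((fun v => u0 + v) @` [set v | `|v| <= t / 2]), r; split=> //.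
- apply: compact_image; first exact: compact_rV_box.
  move=> u _; apply: continuous_at_ball => e e0; exists e => // y yu.
  by rewrite opprD addrACA subrr add0r ltW.
- by move=> _ [v vt <-]; apply: Ht; rewrite addrC addKr; move: vt => /=; lra.
move=> q Mq /(norm_lt_edot r0) qr; have [u [Du <- ut]] := Hr q Mq qr.
exists u => //; exists (u - u0); first by rewrite /= ltW.
by rewrite addrC subrK.
Qed.

Lemma atlas_exists : inhabited (atlas d M).
Proof.
pose T := (set 'rV[R]_d * ('rV[R]_d -> 'rV[R]_N) * set 'rV[R]_d * R)%type.
have /choice[c Hc] : forall p, exists c : T, M p -> [/\ local_parametrization M c.1.1.1 c.1.1.2,
    compact c.1.2, c.1.2 `<=` c.1.1.1, 0 < c.2 &
    forall q, M q -> edot (q - p) (q - p) < c.2 ^+ 2 -> (c.1.1.2 @` c.1.2) q].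
  move=> p; have [Mp|nM] := pselect (M p); last by exists (set0, fun _ => 0, set0, 0).
  by have [D [phi [K [r H]]]] := chart_ball Mp; exists (D, phi, K, r).
(* The function rho is supported within sqrt 2 s, chi equals 1 up to 2 s and vanishes beyond 2 sqrt
   2 s, which is less than the chart radius 4 s. *)
pose s p := (c p).2 / 4.
pose U p := [set z : 'rV[R]_N | edot (z - p) (z - p) < s p ^+ 2].
have s0 p : M p -> 0 < s p by move=> /Hc[_ _ _ c0 _]; rewrite divr_gt0.
have oU p : M p -> open (U p) /\ U p p.
  move=> Mp; split; first exact: open_edot_ball.
  by rewrite /U /= subrr /edot big1 ?exprn_gt0 ?s0 // => i _; rewrite mxE mul0r.
have [n [x [Mx cov]]] := finite_nbhs_cover cM oU.
pose S z := \sum_i bump (x i) (s (x i)) z.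
have S0 z : M z -> 0 < S z.
  move=> Mz; have [i Hi] := cov z Mz.
  rewrite /S (bigD1 i) //= bump_eq1 ?s0 // ?(ltW Hi) // ltr_pwDl //.
  by apply: sumr_ge0 => j _; exact: bump_ge0.
pose rho i z := bump (x i) (s (x i)) z * (S z)^-1.
pose chi i z := bump (x i) (2 * s (x i)) z.
have chi_out i p : M p -> ~ ((c (x i)).1.1.2 @` (c (x i)).1.2) p -> chi i p = 0.
  move=> Mp nK; apply: bump_eq0; first by rewrite mulr_gt0 ?s0.
  have [_ _ _ c0 H] := Hc _ (Mx i); rewrite leNgt; apply/negP => h; apply: nK; apply: H => //.
  by apply: lt_le_trans h _; rewrite /s; nra.
have chi_near i p : M p -> chi i p = 1 \/
    exists2 r : R, 0 < r & forall q, M q -> `|q - p| < r -> rho i q = 0.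
  move=> Mp; have si := s0 _ (Mx i).
  have [h|h] := leP (edot (p - x i) (p - x i)) ((2 * s (x i)) ^+ 2).
    by left; apply: bump_eq1 => //; rewrite mulr_gt0.
  right; have oV : open [set z | 2 * s (x i) ^+ 2 < edot (z - x i) (z - x i)].
    have -> : [set z | 2 * s (x i) ^+ 2 < edot (z - x i) (z - x i)] =
       (fun z => edot (z - x i) (z - x i)) @^-1` [set y | 2 * s (x i) ^+ 2 < y] by [].
    apply: open_comp; last exact: open_gt.
    by move=> z _; exact: (smooth_cont (smooth_edot (x i)) (x := z)).
  have [|r r0 Hr] := open_ballP oV (x := p); first by apply: le_lt_trans h; nra.
  exists r => // q Mq /Hr /= h2; rewrite /rho bump_eq0 ?mul0r // ltW //.
have chart i : local_parametrization M (c (x i)).1.1.1 (c (x i)).1.1.2 by have [] := Hc _ (Mx i).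
have cK i : compact (c (x i)).1.2 by have [] := Hc _ (Mx i).
have KD i : (c (x i)).1.2 `<=` (c (x i)).1.1.1 by have [] := Hc _ (Mx i).
have pou : partition_of_unity M (fun i => (c (x i)).1.1.1) (fun i => (c (x i)).1.1.2) rho.
  split=> //.
  - move=> i; apply: smooth_onM; first by apply: smooth_on_setT; exact: smooth_bump.
    apply: (smooth_on_comp1 (V := [set y | y != 0]) (F := fun y => y^-1)).
    + exact: open_neq0.
    + by move=> p Mp; rewrite /= gt_eqF // S0.
    + exact: smooth_inv.
    + by apply: smooth_on_sum => j; apply: smooth_on_setT; exact: smooth_bump.
  - by move=> i p Mp; rewrite mulr_ge0 ?bump_ge0 // invr_ge0 ltW // S0.
  - by move=> p Mp; rewrite -mulr_suml mulfV // gt_eqF // S0.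
  - move=> i; exists (c (x i)).1.2; split=> // p Mp nK.
    have := chi_out i p Mp nK; have [->|[r r0 H]] := chi_near i p Mp.
      by move=> /eqP; rewrite oner_eq0.
    by move=> _; apply: H => //; rewrite subrr normr0.
by apply: inhabits; apply: (Atlas pou cK KD (fun i => _) chi_out chi_near) => i;
   apply: smooth_on_setT; exact: smooth_bump.
Qed.

End AtlasExists.

Section AtlasIntegral.
Context {R : realType} {N d : nat} (M : set 'rV[R]_N) (A : atlas d M).
Hypothesis cM : compact M.
Local Notation I := (integral_on d M).
Implicit Type i : 'I_(at_n A).

Lemma at_chart i : local_parametrization M (at_D i) (at_phi i). Proof. by case: (at_pou A). Qed.

Lemma at_rho_smooth i : smooth_on M (at_rho i).
Proof. by case: (at_pou A) => _ + _ _ _; apply. Qed.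

Lemma at_rho_ge0 i p : M p -> 0 <= at_rho i p.
Proof. by case: (at_pou A) => _ _ + _ _; apply. Qed.

Lemma at_rho_sum p : M p -> \sum_(i < at_n A) at_rho i p = 1.
Proof. by case: (at_pou A) => _ _ _ + _; apply. Qed.

Lemma at_rho_out i p : M p -> ~ (at_phi i @` at_K i) p -> at_rho i p = 0.
Proof.
move=> Mp nK; have := at_chi_out Mp nK; have [->|[r r0 H]] := at_chi_near i Mp.
  by move=> /eqP; rewrite oner_eq0.
by move=> _; apply: H => //; rewrite subrr normr0.
Qed.

Lemma integral_on_bfun : bfun M I.
Proof.
have [b _] := bfun_pou1 cM (at_pou A).
split.
- by move=> f g fg; exact: integral_on_ext.
- move=> f g cf cg; rewrite !(integral_onE cM (at_pou A)) //; first exact: (bfunD b).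
  exact: cont_onD.
- move=> c f cf; rewrite !(integral_onE cM (at_pou A)) //; first exact: (bfunZ b).
  by apply: cont_onM => //; exact: cont_on_cst.
case: b => _ _ _ [C C0 HC]; exists C => // f c cf fc; rewrite (integral_onE cM (at_pou A)) //.
exact: HC.
Qed.

(** The integral in chart i has density f with respect to the kernels, so [pou_funE] compares it
    with the whole integral applied to f times 1. *)
Lemma integral_on_chart i f : cont_on M f -> (forall p, M p -> ~ (at_phi i @` at_K i) p -> f p = 0) ->
  I f = integral_rV ((fun u => f (at_phi i u) * volume_density (at_phi i) u) \_ (at_D i)).
Proof.
move=> cf f0; have c1 : cont_on M (fun _ => 1) by exact: cont_on_cst.
have bJ := bfun_chart (at_chart i) (@at_compact _ _ _ _ A i) (@at_sub _ _ _ _ A i) cf f0.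
have dJ := density_chart (at_chart i) (@at_compact _ _ _ _ A i) (@at_sub _ _ _ _ A i) cM cf f0.
rewrite (integral_on_ext (g := fun p => f p * 1)); last by move=> p _; rewrite mulr1.
rewrite (integral_onE cM (at_pou A)) ?(pou_funE cM (at_pou A) bJ dJ cf c1) //; last exact: cont_onM.
congr integral_rV; apply/funext => u; congr (patch _ _ _ u).
by apply/funext => v; rewrite mulr1.
Qed.

Lemma integral_on_ge0 f : cont_on M f -> (forall p, M p -> 0 <= f p) -> 0 <= I f.
Proof.
move=> cf f0; rewrite (integral_onE cM (at_pou A)) //; apply: sumr_ge0 => i _.
apply: integral_rV_ge0 => u; have [Du|nD] := pselect (at_D i u); last by rewrite patch_out.
have Mu := chart_in (at_chart i) Du.
by rewrite patch_in // !mulr_ge0 ?at_rho_ge0 ?f0 // ltW // (volume_gt0 (at_chart i)).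
Qed.

Lemma integral_on_eq0 f : cont_on M f -> (forall p, M p -> 0 <= f p) -> I f = 0 ->
  forall p, M p -> f p = 0.
Proof.
move=> cf f0 I0 p Mp; apply: contrapT => /eqP fp.
have fp0 : 0 < f p by rewrite lt_def fp f0.
have [i ri] : exists i : 'I_(at_n A), at_rho i p != 0.
  apply: contrapT => H; have := at_rho_sum Mp; rewrite big1 => [/esym/eqP|i _]; first by rewrite oner_eq0.
  by apply/eqP; apply: contrapT => /negP h; apply: H; exists i.
have [[u Ku E]|/(at_rho_out Mp) h] := pselect ((at_phi i @` at_K i) p); last by rewrite h eqxx in ri.
have Du := at_sub Ku.
have [B B0 HB] := chart_fun_Cc (at_chart i) (@at_compact _ _ _ _ A i) (@at_sub _ _ _ _ A i).
have cr : cont_on M (at_rho i) by apply: smooth_on_cont; exact: at_rho_smooth.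
have pos (j : 'I_(at_n A)) v : 0 <= ((fun u => at_rho j (at_phi j u) * f (at_phi j u) * volume_density (at_phi j) u) \_ (at_D j)) v.
  have [Dv|nD] := pselect (at_D j v); last by rewrite patch_out.
  have Mv := chart_in (at_chart j) Dv.
  by rewrite patch_in // !mulr_ge0 ?at_rho_ge0 ?f0 // ltW // (volume_gt0 (at_chart j)).
have : 0 < I f.
  rewrite (integral_onE cM (at_pou A)) // /pou_fun (bigD1 i) //= ltr_pwDl //; last first.
    by apply: sumr_ge0 => j _; exact: integral_rV_ge0.
  apply: (integral_rV_gt0 B0 (HB _ _ cr cf (fun p => @at_rho_out i p)) (pos i) (v0 := u)).
  rewrite patch_in // E !mulr_gt0 // ?(volume_gt0 (at_chart i)) //.
  by rewrite lt_def ri at_rho_ge0.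
by rewrite I0 ltxx.
Qed.

End AtlasIntegral.

Lemma integral_sum {R : realType} n (B : R) (J : Type) (r : seq J) (F : J -> 'rV[R]_n -> R) : 0 < B ->
  (forall j, Cc B (F j)) ->
  integral_rV (fun u => \sum_(j <- r) F j u) = \sum_(j <- r) integral_rV (F j).
Proof.
move=> B0 CF; have C0 : Cc B (fun _ : 'rV[R]_n => 0 : R) by split=> [|//]; exact: cst_continuous.
suff [] : Cc B (fun u => \sum_(j <- r) F j u) /\
  integral_rV (fun u => \sum_(j <- r) F j u) = \sum_(j <- r) integral_rV (F j) by [].
elim: r => [|j r [C1 IH]].
  have -> : (fun u => \sum_(j <- [::]) F j u) = (fun _ => 0) by apply/funext => u; rewrite big_nil.
  split=> //; rewrite big_nil -[RHS](mul0r (integral_rV (fun _ : 'rV[R]_n => 0))) -(integralZ B0 0 C0).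
  by congr integral_rV; apply/funext => u; rewrite mul0r.
have -> : (fun u => \sum_(j <- j :: r) F j u) = (fun u => F j u + \sum_(j <- r) F j u).
  by apply/funext => u; rewrite big_cons.
by split; [exact: Cc_D|rewrite (integralD B0) // big_cons IH].
Qed.

(** * Gradients and tangential derivations *)

Section VectorFields.
Context {R : realType} {d : nat} (D : set 'rV[R]_d).
Hypothesis oD : open D.
Implicit Types (f g : 'rV[R]_d -> R) (u : 'rV[R]_d) (k : 'I_d).

Lemma pd_ext k f g u : D u -> (forall x, D x -> f x = g x) -> pd k f u = pd k g u.
Proof. by move=> Du fg; apply: near_eq_derive; exact: open_near oD Du fg. Qed.

Lemma smooth_pd k f : smooth_open D f -> smooth_open D (pd k f).
Proof. by move=> sf; exact: smooth_derive. Qed.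

Lemma pdD k f g u : smooth_open D f -> smooth_open D g -> D u ->
  pd k (fun x => f x + g x) u = pd k f u + pd k g u.
Proof. by move=> sf sg Du; apply: deriveD; [exact: smooth_derivable sf Du|exact: smooth_derivable sg Du]. Qed.

Lemma pdM k f g u : smooth_open D f -> smooth_open D g -> D u ->
  pd k (fun x => f x * g x) u = f u * pd k g u + pd k f u * g u.
Proof.
move=> sf sg Du; rewrite [LHS]deriveM; [|exact: smooth_derivable sf Du|exact: smooth_derivable sg Du].
by rewrite !scaleRE [in X in _ + X]mulrC.
Qed.

Lemma pd_sum k (J : Type) (r : seq J) (F : J -> 'rV[R]_d -> R) u : (forall j, smooth_open D (F j)) -> D u ->
  pd k (fun x => \sum_(j <- r) F j x) u = \sum_(j <- r) pd k (F j) u.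
Proof.
move=> sF Du; elim: r => [|j r IH].
  rewrite big_nil -[RHS](derive_cst (0 : R) u (delta_mx 0 k)); apply: pd_ext => // x _; exact: big_nil.
rewrite big_cons -IH -pdD //; last exact: smooth_sum.
by apply: pd_ext => // x _; exact: big_cons.
Qed.

Lemma patch_is_derive (K : set 'rV[R]_d) f u v : compact K -> K `<=` D -> smooth_open D f ->
  (forall x, D x -> ~ K x -> f x = 0) -> is_derive u v (f \_ D) (('D_v f \_ D) u).
Proof.
move=> cK KD sf f0; have [Du|nD] := pselect (D u).
  have E : {near u, f =1 f \_ D} by apply: (open_near oD Du) => x Dx; rewrite patch_in.
  rewrite patch_in //; apply: DeriveDef; first exact: near_eq_derivable E (smooth_derivable sf Du).
  by rewrite (near_eq_derive _ E).
have nK : (~` K) u by move=> /KD.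
have E : {near u, cst (0 : R) =1 f \_ D}.
  apply: (open_near (@compact_openC R 'rV[R]_d K cK) nK) => x nx.
  by have [Dx|nDx] := pselect (D x); [rewrite patch_in // f0|rewrite patch_out].
rewrite patch_out //; apply: DeriveDef; first exact: near_eq_derivable E (derivable_cst _ _ _).
by rewrite -(near_eq_derive _ E) derive_cst.
Qed.

Definition vfield (xi : 'I_d -> 'rV[R]_d -> R) f u := \sum_k xi k u * pd k f u.

Lemma vfield_ext xi f g u : D u -> (forall x, D x -> f x = g x) -> vfield xi f u = vfield xi g u.
Proof. by move=> Du fg; apply: eq_bigr => k _; rewrite (pd_ext k Du fg). Qed.

Section Smooth.
Context (xi : 'I_d -> 'rV[R]_d -> R) (sxi : forall k, smooth_open D (xi k)).

Lemma smooth_vfield f : smooth_open D f -> smooth_open D (vfield xi f).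
Proof. by move=> sf; apply: smooth_sum => // k; apply: smoothM => //; exact: smooth_pd. Qed.

Lemma vfieldD f g u : smooth_open D f -> smooth_open D g -> D u ->
  vfield xi (fun x => f x + g x) u = vfield xi f u + vfield xi g u.
Proof. by move=> sf sg Du; rewrite /vfield -big_split; apply: eq_bigr => k _; rewrite pdD // mulrDr. Qed.

Lemma vfieldM f g u : smooth_open D f -> smooth_open D g -> D u ->
  vfield xi (fun x => f x * g x) u = f u * vfield xi g u + vfield xi f u * g u.
Proof.
move=> sf sg Du; rewrite /vfield mulr_sumr mulr_suml -big_split; apply: eq_bigr => k _.
by rewrite /= (pdM k sf sg Du); move: (pd k g u) (pd k f u) => x y; ring.
Qed.

Lemma vfield_cst c u : vfield xi (fun _ => c) u = 0.
Proof. by apply: big1 => k _; rewrite /pd derive_cst mulr0. Qed.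

End Smooth.

(** The second order parts of the two products agree by [schwarz], so the commutator is again a
    vector field. *)
Lemma vfield_comm xi eta f u : (forall k, smooth_open D (xi k)) -> (forall k, smooth_open D (eta k)) ->
  smooth_open D f -> D u -> vfield xi (vfield eta f) u - vfield eta (vfield xi f) u =
  \sum_l (vfield xi (eta l) u - vfield eta (xi l) u) * pd l f u.
Proof.
have H (a b : 'I_d -> 'rV[R]_d -> R) : (forall k, smooth_open D (a k)) -> (forall k, smooth_open D (b k)) ->
    smooth_open D f -> D u -> vfield a (vfield b f) u = \sum_l vfield a (b l) u * pd l f u +
      \sum_j \sum_k a j u * b k u * pd j (pd k f) u.
  move=> sa sb sf Du; rewrite /vfield.
  under [X in _ = X + _]eq_bigr do rewrite mulr_suml.
  rewrite [X in _ = X + _]exchange_big -big_split; apply: eq_bigr => j _ /=.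
  rewrite pd_sum //; last by move=> k; apply: smoothM => //; exact: smooth_pd.
  rewrite mulr_sumr -big_split; apply: eq_bigr => k _ /=; rewrite pdM //; last exact: smooth_pd.
  by ring.
move=> sxi seta sf Du; rewrite !H //.
have -> : \sum_j \sum_k eta j u * xi k u * pd j (pd k f) u = \sum_j \sum_k xi j u * eta k u * pd j (pd k f) u.
  rewrite exchange_big; apply: eq_bigr => j _; apply: eq_bigr => k _ /=.
  by rewrite /pd (schwarz _ _ oD sf Du) mulrAC mulrC mulrA [xi j u * _]mulrC mulrAC mulrC.
rewrite opprD addrACA subrr addr0 -sumrB; apply: eq_bigr => l _; by rewrite mulrBl.
Qed.

End VectorFields.

Section Gradient.
Context {R : realType} {N d : nat} (M : set 'rV[R]_N) (D : set 'rV[R]_d) (phi : 'rV[R]_d -> 'rV[R]_N).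
Hypothesis chart : local_parametrization M D phi.
Let oD := chart_open chart.
Local Notation J := (jacobian phi).

Lemma curve_derive f U F p c : open_nbhs p U -> smooth_open U F -> (forall x, M x -> U x -> f x = F x) ->
  curve_through M p c -> derive1 (f \o c) 0 = edot (grad F p) (derive1 c 0).
Proof.
move=> [oU Up] sF E [c0 [V [oV V0] [sc cM]]].
have cc : {for 0, continuous c} by exact: smooth_cont sc V0.
have dc : derivable c 0 1 by exact: smooth_derivable sc V0.
have dF : differentiable F (c 0) by rewrite c0; exact: smooth_differentiable oU sF Up.
have nW : \forall t \near (0:R), V t /\ U (c t).
  by apply: filterI; [exact: open_nbhs_nbhs|apply: cc; rewrite c0; exact: open_nbhs_nbhs].
rewrite derive1E derive1E -(derive_grad _ oU sF Up).
have := @derive_val _ _ _ _ _ _ _ (chain_rule dF dc); rewrite c0 => <-.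
apply: near_eq_derive; move: nW; apply: filterS => t [Vt Ut] /=.
by rewrite E //; apply: cM; exists t.
Qed.

Lemma smooth_chart_comp f : smooth_on M f -> smooth_open D (fun u => f (phi u) : R).
Proof. exact: (smooth_on_chart chart). Qed.

Lemma derive_curve_chart f c u w : smooth_on M f -> D u -> curve_through M (phi u) c ->
  derive1 c 0 = w *m J u -> derive1 (f \o c) 0 = edot (grad (fun u => f (phi u)) u) w.
Proof.
move=> sf Du cc E; have [U [F [nU sF EF]]] := sf _ (chart_in chart Du).
rewrite (curve_derive nU sF EF cc) E.
have [c2 E2] := chart_curve chart w Du.
rewrite -E2 -(curve_derive nU sF EF c2) derive1E.
rewrite -(derive_grad _ oD (smooth_chart_comp sf) Du) -[RHS]derive_line.
by congr ('D_(1 : R) _ 0); apply/funext => t /=; rewrite addrC.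
Qed.

(** The classical coordinate formula: the index of the differential is raised by the inverse Gram
    matrix, and the result is pushed forward by phi. *)
Lemma is_gradient_chart f u : smooth_on M f -> D u ->
  is_gradient M f (phi u) (grad (fun u => f (phi u)) u *m invmx (J u *m (J u)^T) *m J u).
Proof.
move=> sf Du; split.
  have [cc E] := chart_curve chart (grad (fun u => f (phi u)) u *m invmx (J u *m (J u)^T)) Du.
  by exists (fun t => phi (u + t *: (grad (fun u => f (phi u)) u *m invmx (J u *m (J u)^T)))).
move=> c cc; have [w E] := chart_tangent chart Du cc.
rewrite (derive_curve_chart sf Du cc E) E !edotE trmx_mul !mulmxA -!mulmxA.
by rewrite [X in _ *m (_ *m X)]mulmxA [invmx _ *m _]mulmxA mulVmx ?gram_unit ?(chart_free chart) // mul1mx.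
Qed.

Lemma is_gradient_unique f u g g' : D u -> is_gradient M f (phi u) g -> is_gradient M f (phi u) g' -> g = g'.
Proof.
move=> Du [[c cc Eg] H] [[c' cc' Eg'] H'].
have [w E] := chart_tangent chart Du cc; have [w' E'] := chart_tangent chart Du cc'.
have [c2 E2] := chart_curve chart (w - w') Du.
have := H _ c2; rewrite (H' _ c2) E2 mulmxBl -E -E' Eg Eg' => /eqP.
rewrite -subr_eq0 -[_ - _]opprB oppr_eq0 => /eqP h.
have h0 : edot (g - g') (g - g') = 0.
  by rewrite [LHS]edotDr -scaleN1r edotZr mulN1r !(edotC (g + _)) scaleN1r.
have := edot_ge_norm (g - g'); rewrite h0 => h1.
by apply/eqP; rewrite -subr_eq0 -normr_eq0 -sqrf_eq0 eq_le h1 exprn_ge0.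
Qed.

Lemma gradient_chart f u : smooth_on M f -> D u ->
  gradient M f (phi u) = grad (fun u => f (phi u)) u *m (invmx (J u *m (J u)^T) *m J u).
Proof.
move=> sf Du; have H := is_gradient_chart sf Du; rewrite mulmxA.
rewrite /gradient; case: xgetP => [g _ Hg|/(_ _ H)//].
exact: is_gradient_unique Du Hg H.
Qed.

(* The coordinates of the projection of the a-th basis vector of R^N on the tangent space. *)
Definition xi (a : 'I_N) (k : 'I_d) u := (invmx (J u *m (J u)^T) *m J u) k a.

Lemma smooth_xi a k : smooth_open D (xi a k).
Proof.
have : smooth_open D (fun u => \sum_j invmx (J u *m (J u)^T) k j * J u j a).
  apply: smooth_sum oD _ => j; apply: smoothM oD _ _; last exact: smooth_jac chart j a.
  apply: smooth_invmx oD _ (smooth_gram chart).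
  by move=> x Dx; rewrite gram_unit // (chart_free chart).
by apply: smooth_ext oD _ => x _; rewrite /xi mxE.
Qed.

Lemma gradient_vfield f a u : smooth_on M f -> D u ->
  gradient M f (phi u) 0 a = vfield (xi a) (fun u => f (phi u)) u.
Proof.
move=> sf Du; rewrite gradient_chart // mxE; apply: eq_bigr => k _.
by rewrite mulrC; congr (_ * _); rewrite mxE.
Qed.

Lemma pd_gradient f k u : smooth_on M f -> D u ->
  pd k (fun u => f (phi u)) u = \sum_b J u k b * gradient M f (phi u) 0 b.
Proof.
move=> sf Du; have -> : \sum_b J u k b * gradient M f (phi u) 0 b = (gradient M f (phi u) *m (J u)^T) 0 k.
  by rewrite [RHS]mxE; apply: eq_bigr => b _; rewrite mulrC; congr (_ * _); rewrite [RHS]mxE.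
rewrite gradient_chart // -!mulmxA mulVmx ?gram_unit ?(chart_free chart) // mulmx1.
by rewrite mxE.
Qed.

(** A function of the chart transported to M and extended by 0; inside the chart the chosen preimage
    is unique by injectivity. *)
Definition push (G : 'rV[R]_d -> R) (p : 'rV[R]_N) : R :=
  if pselect (exists2 u, D u & phi u = p) is left _ then G (xget 0 [set u | D u /\ phi u = p]) else 0.

Lemma push_chart G u : D u -> push G (phi u) = G u.
Proof.
move=> Du; rewrite /push; case: pselect => [_|[]]; last by exists u.
case: xgetP => [v _ [Dv /(chart_inj chart Dv Du) ->//]|/(_ u)[]]; by split.
Qed.

Lemma push_out (K : set 'rV[R]_d) G p : (forall u, D u -> ~ K u -> G u = 0) -> ~ (phi @` K) p -> push G p = 0.
Proof.
move=> G0 nK; have [[u Du E]|nD] := pselect (exists2 u, D u & phi u = p).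
  by rewrite -E push_chart // G0 // => Ku; apply: nK; exists u.
by rewrite /push; case: pselect.
Qed.

Lemma smooth_push (K : set 'rV[R]_d) G : compact K -> K `<=` D -> smooth_open D G ->
  (forall u, D u -> ~ K u -> G u = 0) -> smooth_on M (push G).
Proof.
move=> cK KD sG G0 p Mp; have [[u Ku E]|nK] := pselect ((phi @` K) p).
  apply: (chart_smooth_on chart); last by exists u => //; exact: KD.
  by apply: smooth_ext sG => // v Dv; rewrite push_chart.
have cpK : compact (phi @` K).
  apply: (@compact_image R 'rV[R]_d 'rV[R]_N phi K cK) => u Ku; refine (chart_cont chart (KD _ Ku)).
have oC := @compact_openC R 'rV[R]_N _ cpK.
exists (~` (phi @` K)), (fun _ => 0); split=> //; first exact: smooth_cst.
by move=> x _ nx; exact: push_out G0 nx.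
Qed.

Lemma supp_derive (K : set 'rV[R]_d) G k u : compact K -> (forall u, D u -> ~ K u -> G u = 0) ->
  D u -> ~ K u -> pd k G u = 0.
Proof.
move=> cK G0 Du nK; rewrite -[RHS](derive_cst (0 : R) u (delta_mx 0 k)).
apply: (pd_ext (D := D `&` ~` K)); first exact: openI oD (@compact_openC R 'rV[R]_d _ cK).
  by split.
by move=> x [Dx nx]; rewrite G0.
Qed.

End Gradient.

Lemma gradient_near {R : realType} {N : nat} (M : set 'rV[R]_N) f g U p : open_nbhs p U ->
  (forall q, M q -> U q -> f q = g q) -> gradient M f p = gradient M g p.
Proof.
move=> [oU Up] fg; congr (xget 0 _); apply/funext => v; apply/propext.
have H f' g' : (forall q, M q -> U q -> f' q = g' q) -> is_gradient M f' p v -> is_gradient M g' p v.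
  move=> fg' [T Hc]; split=> // c cc; rewrite -(Hc c cc) !derive1E; apply: near_eq_derive.
  have [c0 [V [oV V0] [sc cM]]] := cc.
  have : \forall t \near (0:R), V t /\ U (c t).
    apply: filterI; first exact: open_nbhs_nbhs.
    by apply: (smooth_cont sc V0); rewrite c0; exact: open_nbhs_nbhs.
  by apply: filterS => t [Vt Ut] /=; rewrite fg' //; apply: cM; exists t.
by split; apply: H => // q Mq Uq; rewrite fg.
Qed.

Lemma gradient_ext {R : realType} {N : nat} (M : set 'rV[R]_N) f g p : (forall q, M q -> f q = g q) ->
  gradient M f p = gradient M g p.
Proof. by move=> fg; apply: (gradient_near (U := setT)) => [|q Mq _]; [split=> //; exact: openT|exact: fg]. Qed.

Section AtlasCalculus.
Context {R : realType} {N d : nat} (M : set 'rV[R]_N) (A : atlas d M).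
Hypothesis cM : compact M.
Local Notation I := (integral_on d M).
Implicit Types (f g : 'rV[R]_N -> R) (p : 'rV[R]_N) (a b : 'I_N) (i : 'I_(at_n A)).

Definition X a f p : R := gradient M f p 0 a.

Lemma at_cover p : M p -> exists i : 'I_(at_n A), exists2 u, at_K i u & at_phi i u = p.
Proof.
move=> Mp; apply: contrapT => H; have := at_rho_sum A Mp.
rewrite big1 => [/esym/eqP|i _]; first by rewrite oner_eq0.
by apply: at_rho_out => // -[u Ku E]; apply: H; exists i, u.
Qed.

Lemma chart_ind (P : 'rV[R]_N -> Prop) :
  (forall (i : 'I_(at_n A)) u, at_D i u -> P (at_phi i u)) -> forall p, M p -> P p.
Proof. by move=> H p /at_cover[i [u Ku <-]]; apply: H; exact: at_sub Ku. Qed.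

Lemma X_chart i a f u : smooth_on M f -> at_D i u ->
  X a f (at_phi i u) = vfield (xi (at_phi i) a) (fun u => f (at_phi i u)) u.
Proof. exact: (gradient_vfield (at_chart i)). Qed.

Let at_open (i : 'I_(at_n A)) : open (at_D i) := chart_open (at_chart i).
Let sxi (i : 'I_(at_n A)) a k := smooth_xi (at_chart i) a k.
Let sch f (sf : smooth_on M f) (i : 'I_(at_n A)) := smooth_chart_comp (at_chart i) sf.

Lemma gradientP f p : smooth_on M f -> M p -> is_gradient M f p (gradient M f p).
Proof.
move=> sf; move: p; apply: chart_ind => i u Du.
rewrite (gradient_chart (at_chart i)) // mulmxA; exact: (is_gradient_chart (at_chart i)).
Qed.

Lemma smooth_X a f : smooth_on M f -> smooth_on M (X a f).
Proof.
move=> sf p /at_cover[i [u Ku E]]; apply: (chart_smooth_on (at_chart i)); last by exists u => //; exact: at_sub.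
apply: (smooth_ext (@at_open i) _ (smooth_vfield (@at_open i) (@sxi i a) (@sch _ sf i))).
by move=> x Dx; rewrite X_chart.
Qed.

Lemma X_ext a f g p : (forall q, M q -> f q = g q) -> X a f p = X a g p.
Proof. by move=> fg; rewrite /X (gradient_ext p fg). Qed.

Lemma X_cst a c p : M p -> X a (fun _ => c) p = 0.
Proof.
by move: p; apply: chart_ind => i u Du; rewrite X_chart ?vfield_cst //; exact: smooth_on_cst.
Qed.

Lemma X_D a f g p : smooth_on M f -> smooth_on M g -> M p -> X a (fun p => f p + g p) p = X a f p + X a g p.
Proof.
move=> sf sg; move: p; apply: chart_ind => i u Du; rewrite !X_chart //; last exact: smooth_onD.
by rewrite -(vfieldD _ (@sch _ sf i) (@sch _ sg i) Du).
Qed.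

Lemma X_M a f g p : smooth_on M f -> smooth_on M g -> M p ->
  X a (fun p => f p * g p) p = f p * X a g p + X a f p * g p.
Proof.
move=> sf sg; move: p; apply: chart_ind => i u Du; rewrite !X_chart //; last exact: smooth_onM.
by rewrite (vfieldM _ (@sch _ sf i) (@sch _ sg i) Du).
Qed.

Lemma X_X_chart i a b f u : smooth_on M f -> at_D i u ->
  X a (X b f) (at_phi i u) = vfield (xi (at_phi i) a) (vfield (xi (at_phi i) b) (fun u => f (at_phi i u))) u.
Proof.
move=> sf Du; rewrite X_chart //; last exact: smooth_X.
by apply: (vfield_ext (@at_open i)) => // x Dx; rewrite X_chart.
Qed.

Lemma smooth_coord_fun b : smooth_on M (fun p => p 0 b).
Proof. by apply: smooth_on_setT; exact: smooth_proj openT. Qed.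

Lemma smooth_onB f g : smooth_on M f -> smooth_on M g -> smooth_on M (fun p => f p - g p).
Proof.
move=> sf sg; apply: (smooth_on_ext _ (smooth_onD sf (smooth_onM (smooth_on_cst (M := M) (- 1)) sg))).
by move=> p _; rewrite mulN1r.
Qed.

Lemma X_comm a b : exists c : 'I_N -> 'rV[R]_N -> R, (forall k, smooth_on M (c k)) /\
  forall f, smooth_on M f -> forall p, M p ->
    X a (X b f) p = X b (X a f) p + \sum_k c k p * X k f p.
Proof.
(* The commutator is a field with components beta_l in the chart, and each chart derivative d_l f is
   the sum over k of J_lk X_k f. The resulting coefficient of X_k f is the commutator applied to the
   k-th coordinate function, which is defined globally. *)
exists (fun k p => X a (X b (fun q => q 0 k)) p - X b (X a (fun q => q 0 k)) p); split.
  by move=> k; apply: smooth_onB; do 2!apply: smooth_X; exact: smooth_coord_fun.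
move=> f sf; apply: chart_ind => i u Du.
pose beta l := vfield (xi (at_phi i) a) (xi (at_phi i) b l) u - vfield (xi (at_phi i) b) (xi (at_phi i) a l) u.
have comm g : smooth_on M g -> X a (X b g) (at_phi i u) - X b (X a g) (at_phi i u) =
    \sum_l beta l * pd l (fun u => g (at_phi i u)) u.
  by move=> sg; rewrite !X_X_chart // (vfield_comm (@at_open i) (@sxi i a) (@sxi i b) (@sch _ sg i) Du).
rewrite -[LHS](subrK (X b (X a f) (at_phi i u))) addrC; congr (_ + _).
transitivity (\sum_l beta l * pd l (fun u => f (at_phi i u)) u); first exact: comm.
transitivity (\sum_l \sum_k beta l * (jacobian (at_phi i) u l k * X k f (at_phi i u))).
  by apply: eq_bigr => l _; rewrite -mulr_sumr; congr (_ * _); exact: (pd_gradient (at_chart i)).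
rewrite exchange_big /=; apply: eq_bigr => k _.
transitivity ((\sum_l beta l * pd l (fun v => at_phi i v 0 k) u) * X k f (at_phi i u)); last first.
  by congr (_ * _); exact/esym/(comm _ (smooth_coord_fun k)).
rewrite mulr_suml; apply: eq_bigr => l _; rewrite mulrA; congr (_ * _ * _).
by rewrite (jacobianE (@at_open i) (chart_smooth (at_chart i)) Du) mxE.
Qed.

Let vol i u := volume_density (at_phi i) u.

(** The Riemannian divergence of [at_rho i] times X_a, computed in chart i. As the [at_rho i] add up
    to 1 on M, summing over i gives in [H] the divergence of X_a, by a formula whose smoothness is
    clear. *)
Definition divergence i a u := (vol i u)^-1 *
  \sum_k pd k (fun u => at_rho i (at_phi i u) * xi (at_phi i) a k u * vol i u) u.

Definition H a p := \sum_i push (at_D i) (at_phi i) (divergence i a) p.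

Let rho_out i u : at_D i u -> ~ at_K i u -> at_rho i (at_phi i u) = 0.
Proof.
move=> Du nK; apply: at_rho_out; first exact: (chart_in (at_chart i)).
by move=> [v Kv /(chart_inj (at_chart i) (at_sub Kv) Du) E]; apply: nK; rewrite -E.
Qed.

Let smooth_weight i a k : smooth_open (at_D i) (fun u => at_rho i (at_phi i u) * xi (at_phi i) a k u * vol i u).
Proof.
apply: smoothM; [exact: (@at_open i)| |exact: (smooth_volume (at_chart i))].
by apply: smoothM; [exact: (@at_open i)|exact: (@sch _ (at_rho_smooth i) i)|exact: (@sxi i a k)].
Qed.

Lemma divergence_out i a u : at_D i u -> ~ at_K i u -> divergence i a u = 0.
Proof.
move=> Du nK; rewrite /divergence big1 ?mulr0 // => k _.
apply: (supp_derive (at_chart i) k (@at_compact _ _ _ _ _ i)) => // v Dv nv.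
by rewrite rho_out // !mul0r.
Qed.

Lemma smooth_divergence i a : smooth_open (at_D i) (divergence i a).
Proof.
apply: smoothM; first exact: (@at_open i).
  refine (@smooth_comp1 R _ (at_D i) [set x | x != 0] (vol i) (@at_open i) _ _ (fun x => x^-1) smooth_inv).
    exact: (smooth_volume (at_chart i)).
  by move=> u Du; rewrite /= gt_eqF // (volume_gt0 (at_chart i)).
by apply: smooth_sum (@at_open i) _ => k; apply: smooth_pd; exact: (@smooth_weight i a k).
Qed.

Lemma smooth_H a : smooth_on M (H a).
Proof.
apply: smooth_on_sum => i.
apply: (smooth_push (at_chart i) (@at_compact _ _ _ _ _ i) (@at_sub _ _ _ _ _ i)).
  exact: smooth_divergence.
exact: divergence_out.
Qed.

Lemma I_sum_on (J : Type) (r : seq J) (F : J -> 'rV[R]_N -> R) : (forall j, cont_on M (F j)) ->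
  I (fun p => \sum_(j <- r) F j p) = \sum_(j <- r) I (F j).
Proof. exact: (bfun_sum (integral_on_bfun A cM)). Qed.

(** In the chart, the sum of the two integrands is the coordinate divergence of the compactly
    supported field with components rho xi_k vol f, so [integral_rV_deriv] kills its integral. *)
Lemma I_X_chart i a f : smooth_on M f ->
  I (fun p => at_rho i p * X a f p) = - I (fun p => push (at_D i) (at_phi i) (divergence i a) p * f p).
Proof.
move=> sf.
have sp : smooth_on M (push (at_D i) (at_phi i) (divergence i a)).
  by apply: (smooth_push (at_chart i) (@at_compact _ _ _ _ _ i) (@at_sub _ _ _ _ _ i));
    [exact: smooth_divergence|exact: divergence_out].
have c1 : cont_on M (fun p => at_rho i p * X a f p).
  by apply: smooth_on_cont; apply: smooth_onM; [exact: at_rho_smooth|exact: smooth_X].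
have c2 : cont_on M (fun p => push (at_D i) (at_phi i) (divergence i a) p * f p).
  by apply: smooth_on_cont; apply: smooth_onM.
rewrite !(integral_on_chart (A := A) cM (i := i)) //; first last.
- by move=> p Mp /(at_rho_out Mp) ->; rewrite mul0r.
- by move=> p Mp nK; rewrite (push_out (at_chart i) (@divergence_out i a) nK) mul0r.
have [B B0 HB] := patch_Cc (@at_open i) (@at_compact _ _ _ _ _ i) (@at_sub _ _ _ _ _ i).
pose w k u := at_rho i (at_phi i u) * xi (at_phi i) a k u * vol i u * f (at_phi i u).
have sw k : smooth_open (at_D i) (w k) by apply: smoothM; [exact: (@at_open i)|exact: (@smooth_weight i a k)|exact: (@sch _ sf i)].
have w0 k u : at_D i u -> ~ at_K i u -> w k u = 0 by move=> Du nK; rewrite /w rho_out // !mul0r.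
have dw0 k u : at_D i u -> ~ at_K i u -> pd k (w k) u = 0.
  by move=> Du nK; apply: (supp_derive (at_chart i) k (@at_compact _ _ _ _ _ i)) => //; exact: w0.
have sdw k : smooth_open (at_D i) (pd k (w k)) by apply: smooth_pd; exact: sw.
have int0 k : integral_rV (pd k (w k) \_ (at_D i)) = 0.
  have Cw : Cc B (w k \_ (at_D i)) by apply: HB => [u Du|]; [exact: smooth_cont (sw k) Du|exact: w0].
  have Cdw : Cc B (pd k (w k) \_ (at_D i)).
    by apply: HB => [u Du|]; [exact: smooth_cont (sdw k) Du|exact: dw0].
  apply: (@integral_rV_deriv _ _ B (w k \_ (at_D i)) _ (delta_mx 0 k)) => // v.
  exact: (patch_is_derive (@at_open i) _ _ (@at_compact _ _ _ _ _ i) (@at_sub _ _ _ _ _ i) (sw k) (@w0 k)).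
set F := (X in _ = - integral_rV X); set G := (X in integral_rV X = _).
have CdwB k : Cc B (pd k (w k) \_ (at_D i)).
  by apply: HB => [u Du|]; [exact: smooth_cont (sdw k) Du|exact: dw0].
have E u : G u + F u = \sum_k (pd k (w k) \_ (at_D i)) u.
  rewrite /F /G; have [Du|nD] := pselect (at_D i u); last first.
    by rewrite !patch_out // big1 ?addr0 // => k _; rewrite patch_out.
  rewrite !patch_in // (push_chart (at_chart i)) // X_chart // /divergence.
  have v0 : vol i u != 0 by rewrite gt_eqF // (volume_gt0 (at_chart i)).
  transitivity (\sum_k (at_rho i (at_phi i u) * xi (at_phi i) a k u * vol i u * pd k (fun u => f (at_phi i u)) u +
    pd k (fun u => at_rho i (at_phi i u) * xi (at_phi i) a k u * vol i u) u * f (at_phi i u))); last first.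
    apply: eq_bigr => k _; rewrite patch_in //.
    by rewrite -(pdM k (@smooth_weight i a k) (@sch _ sf i) Du).
  rewrite big_split /= -mulr_suml; congr (_ + _); last first.
    by rewrite mulrAC [X in X * _]mulrAC mulVf // mul1r.
  rewrite /vfield mulr_sumr mulr_suml; apply: eq_bigr => k _.
  by rewrite /vol; move: (pd _ _ _) (xi _ _ _ _) => x y; ring.
have CF : Cc B F.
  apply: HB => [u Du|u Du nK]; last by rewrite (push_chart (at_chart i)) // divergence_out // !mul0r.
  apply: (@continuousM R _ (fun u => push (at_D i) (at_phi i) (divergence i a) (at_phi i u) * f (at_phi i u))).
    exact: (cont_on_chart (at_chart i) c2 Du).
  exact: smooth_cont (smooth_volume (at_chart i)) Du.
have CG : Cc B G.
  apply: HB => [u Du|u Du nK]; last by rewrite rho_out // !mul0r.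
  apply: (@continuousM R _ (fun u => at_rho i (at_phi i u) * X a f (at_phi i u))).
    exact: (cont_on_chart (at_chart i) c1 Du).
  exact: smooth_cont (smooth_volume (at_chart i)) Du.
apply/eqP; rewrite -addr_eq0 -(integralD B0 CG CF); apply/eqP.
have -> : (fun u => G u + F u) = (fun u => \sum_k (pd k (w k) \_ (at_D i)) u) by apply/funext.
by rewrite (integral_sum _ B0 CdwB) big1.
Qed.

Lemma I_X a f : smooth_on M f -> I (X a f) = - I (fun p => H a p * f p).
Proof.
move=> sf; have sXf := smooth_X a sf.
have sp i : smooth_on M (push (at_D i) (at_phi i) (divergence i a)).
  by apply: (smooth_push (at_chart i) (@at_compact _ _ _ _ _ i) (@at_sub _ _ _ _ _ i));
    [exact: smooth_divergence|exact: divergence_out].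
transitivity (I (fun p => \sum_(i < at_n A) at_rho i p * X a f p)).
  by apply: integral_on_ext => p Mp; rewrite -mulr_suml (at_rho_sum A Mp) mul1r.
rewrite I_sum_on; last by move=> i; apply: smooth_on_cont; apply: smooth_onM => //; exact: at_rho_smooth.
transitivity (- I (fun p => \sum_(i < at_n A) push (at_D i) (at_phi i) (divergence i a) p * f p)); last first.
  by congr (- _); apply: integral_on_ext => p Mp; rewrite -mulr_suml.
rewrite [in RHS]I_sum_on; last by move=> i; apply: smooth_on_cont; exact: smooth_onM.
by rewrite -sumrN; apply: eq_bigr => i _; exact: I_X_chart.
Qed.

End AtlasCalculus.

(** * Sobolev inequality *)

Section SobolevEmbedding.
Context {R : realType} {N d : nat} (M : set 'rV[R]_N) (A : atlas d M).
Hypothesis cM : compact M.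
Local Notation I := (integral_on d M).
Local Notation S := (smooth_on M).
Local Notation X := (@X R N M).
Implicit Types (w f g : 'rV[R]_N -> R) (p q : 'rV[R]_N) (a b : 'I_N) (i : 'I_(at_n A)).

Lemma atlas_calculus : calculus M (smooth_on M) X (H A) I.
Proof.
have bI := integral_on_bfun A cM.
split.
- exact: smooth_on_cst.
- by move=> f g; exact: smooth_onD.
- by move=> f g; exact: smooth_onM.
- by move=> a f; exact: (smooth_X A).
- by move=> a; exact: smooth_H.
- by move=> a f g fg p Mp; exact: X_ext.
- by move=> a c p Mp; exact: (X_cst A).
- by move=> a f g sf sg p Mp; exact: (X_D A).
- by move=> a f g sf sg p Mp; exact: (X_M A).
- exact: (X_comm A).
- by move=> f g; exact: integral_on_ext.
- by move=> f g sf sg; apply: (bfunD bI); exact: smooth_on_cont.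
- by move=> c f sf; apply: (bfunZ bI); exact: smooth_on_cont.
- by move=> f sf; apply: (integral_on_ge0 A cM); exact: smooth_on_cont.
- by move=> a f; exact: (@I_X _ _ _ _ A cM).
- by move=> f /smooth_on_cont/(cont_on_bounded cM)[C _ HC]; exists C.
Qed.

Local Notation cal := atlas_calculus.
Local Notation nrm := (nrm X I).
Local Notation Op := (Op (smooth_on M) X I).

Section OneChart.
Context (i : 'I_(at_n A)).
Let oD := chart_open (at_chart i).
Let vol u := volume_density (at_phi i) u.
Let J u := jacobian (at_phi i) u.

Let chi_jac (k : 'I_d) b := push (at_D i) (at_phi i) (fun u => at_chi i (at_phi i u) * J u k b).

Let chi_out u : at_D i u -> ~ at_K i u -> at_chi i (at_phi i u) = 0.
Proof.
move=> Du nK; apply: at_chi_out; first exact: (chart_in (at_chart i)).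
by move=> [v Kv /(chart_inj (at_chart i) (at_sub Kv) Du) E]; apply: nK; rewrite -E.
Qed.

Let smooth_chi_jac k b : S (chi_jac k b).
Proof.
apply: (smooth_push (at_chart i) (@at_compact _ _ _ _ _ i) (@at_sub _ _ _ _ _ i)).
  apply: smoothM; [exact: oD|exact: (smooth_on_chart (at_chart i) (at_chi_smooth i))|].
  exact: (smooth_jac (at_chart i) k b).
by move=> u Du nK; rewrite chi_out // mul0r.
Qed.

(** A global operator of order 1 that coincides with the k-th chart derivative on functions
    vanishing where chi is not 1. Derivatives in the chart are thereby controlled by the norms
    [nrm]. *)
Let Y (k : 'I_d) w p := \sum_b chi_jac k b p * X b w p.

Let Op_Y k : Op 1 (Y k).
Proof.
apply: (Op_sum cal) => b.
exact: (Op_comp (Op_mul cal (@smooth_chi_jac k b)) (Op_X cal b)).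
Qed.

(** The function vanishes on a neighbourhood, not merely at the point, so that the property passes
    to X_b w. *)
Let vanishing w := forall p, M p -> at_chi i p = 1 \/
  exists2 r : R, 0 < r & forall q, M q -> `|q - p| < r -> w q = 0.

Let X_local b w p (r : R) q : M q -> `|q - p| < r -> (forall z, M z -> `|z - p| < r -> w z = 0) -> X b w q = 0.
Proof.
move=> Mq qr H; rewrite /X (gradient_near (g := fun _ => 0) (U := [set z | `|z - p| < r])).
- exact: (X_cst A b 0 Mq).
- by split=> //; exact: open_norm_ball.
- by move=> z Mz zr; exact: H.
Qed.

Let vanishing_X b w : vanishing w -> vanishing (X b w).
Proof.
move=> vw p Mp; have [->|[r r0 H]] := vw p Mp; [by left|right; exists r => // q Mq qr].
exact: X_local qr H.
Qed.

Let vanishing0 w p : vanishing w -> M p -> at_chi i p = 1 \/ w p = 0.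
Proof.
move=> vw Mp; have [->|[r r0 H]] := vw p Mp; [by left|right; apply: H => //].
by rewrite subrr normr0.
Qed.

Let vanishing_Y k w : vanishing w -> vanishing (Y k w).
Proof.
move=> vw p Mp; have [->|[r r0 H]] := vw p Mp; [by left|right; exists r => // q Mq qr].
by apply: big1 => b _; rewrite (X_local b Mq qr H) mulr0.
Qed.

Let dY k w u : S w -> vanishing w -> at_D i u -> pd k (fun u => w (at_phi i u)) u = Y k w (at_phi i u).
Proof.
move=> sw vw Du; rewrite (pd_gradient (at_chart i)) //; apply: eq_bigr => b _.
have Mu := chart_in (at_chart i) Du.
rewrite /chi_jac (push_chart (at_chart i)) // -/(X b w (at_phi i u)).
by have [->|->] := vanishing0 (vanishing_X b vw) Mu; rewrite ?mul1r // !mulr0.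
Qed.

(** The derivative of [at_rho i * f] in the first k chart coordinates. The [insub] turns the natural
    number into a coordinate index; beyond d nothing more is derived. *)
Let sup f : nat -> 'rV[R]_N -> R := fix rec k := match k with
  | 0 => fun p => at_rho i p * f p
  | k'.+1 => if insub k' is Some j then Y j (rec k') else rec k'
  end.

Let supE f k (ltkd : (k < d)%N) : sup f k.+1 = Y (Ordinal ltkd) (sup f k).
Proof. by rewrite /= insubT. Qed.

Let Op_sup k : (k <= d)%N -> Op k (fun f => sup f k).
Proof.
elim: k => [|k IH] lekd; first exact: (Op_mul cal (at_rho_smooth i)).
have -> : (fun f => sup f k.+1) = (fun f => Y (Ordinal lekd) (sup f k)) by apply/funext => f; exact: supE.
by apply: (Op_comp (k := 1)) (IH _) => //; exact: ltnW.
Qed.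

Let vanishing_sup f k : (k <= d)%N -> vanishing (sup f k).
Proof.
elim: k => [_ p Mp /=|k IH lekd]; last by rewrite supE; apply: vanishing_Y; apply: IH; exact: ltnW.
have [->|[r r0 H]] := at_chi_near i Mp; [by left|right; exists r => // q Mq qr].
by rewrite H // mul0r.
Qed.

(** [sobolev_rV] bounds the value by the L1 norm of a single mixed derivative of order d, and the
    compact support turns this into an L2 norm. *)
Lemma sobolev_chart : exists2 C, 0 <= C & forall f, S f -> forall p, M p -> `|at_rho i p * f p| <= C * nrm d f.
Proof.
have [B B0 HB] := patch_Cc oD (@at_compact _ _ _ _ _ i) (@at_sub _ _ _ _ _ i).
have schi := smooth_on_chart (at_chart i) (at_chi_smooth i).
have svol := smooth_volume (at_chart i).
pose chi2 := (fun u => at_chi i (at_phi i u) * at_chi i (at_phi i u)) \_ (at_D i).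
have Cchi2 : Cc B chi2.
  apply: HB => [u Du|u Du nK]; last by rewrite chi_out // mul0r.
  exact: (smooth_cont (smoothM oD schi schi) Du).
pose K2 := integral_rV chi2.
have K20 : 0 <= K2.
  apply: integral_rV_ge0 => u; have [Du|nD] := pselect (at_D i u); last by rewrite /chi2 patch_out.
  by rewrite /chi2 patch_in // -expr2 sqr_ge0.
have Cvol : Cc B ((fun u => at_chi i (at_phi i u) * (vol u)^-1) \_ (at_D i)).
  apply: HB => [u Du|u Du nK]; last by rewrite chi_out // mul0r.
  apply: (@continuousM R _ (fun u => at_chi i (at_phi i u))); first exact: (smooth_cont schi Du).
  apply: (@continuousV R); first by rewrite gt_eqF // (volume_gt0 (at_chart i)).
  exact: (smooth_cont svol Du).
have [C1 C10 HC1] := Cc_bounded Cvol.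
have [_ /(_ 0%N)[C2 C20 HC2]] := Op_sup (leqnn d).
exists ((K2 + C1) / 2 * C2); first by rewrite !mulr_ge0 ?invr_ge0 // addr_ge0.
move=> f sf p Mp.
have [[x Kx E]|nK] := pselect ((at_phi i @` at_K i) p); last first.
  by rewrite at_rho_out // mul0r normr0 mulr_ge0 ?nrm_ge0 // !mulr_ge0 ?invr_ge0 // addr_ge0.
have Dx := at_sub Kx.
pose v k := (fun u => sup f k (at_phi i u)) \_ (at_D i).
have ssup k : (k <= d)%N -> S (sup f k) by move=> /Op_sup[H _]; exact: H.
have sup_out k u : (k <= d)%N -> at_D i u -> ~ at_K i u -> sup f k (at_phi i u) = 0.
  move=> lekd Du nK; have [|//] := vanishing0 (@vanishing_sup f k lekd) (chart_in (at_chart i) Du).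
  by rewrite chi_out // => /esym/eqP; rewrite oner_eq0.
have sv k : (k <= d)%N -> smooth_open (at_D i) (fun u => sup f k (at_phi i u) : R).
  by move=> lekd; exact: (smooth_on_chart (at_chart i) (ssup k lekd)).
have Cv k : (k <= d)%N -> Cc B (v k).
  move=> lekd; apply: HB => [u Du|u Du nK]; first exact: (smooth_cont (sv k lekd) Du).
  exact: sup_out.
have := @sobolev_rV _ _ _ v x B0 Cv _.
have dv : forall k (ltkd : (k < d)%N) u, is_derive u (delta_mx 0 (Ordinal ltkd)) (v k) (v k.+1 u).
  move=> k ltkd u; have lekd := ltnW ltkd.
  have := patch_is_derive oD u (delta_mx 0 (Ordinal ltkd)) (@at_compact _ _ _ _ _ i) (@at_sub _ _ _ _ _ i)
    (sv k lekd) (fun z => @sup_out k z lekd).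
  move=> H; apply: (is_derive_eq H); have [Du|nD] := pselect (at_D i u); last by rewrite /v !patch_out.
  rewrite /v !patch_in // supE; exact: (dY (Ordinal ltkd) (ssup k lekd) (@vanishing_sup f k lekd) Du).
move=> /(_ dv); rewrite {1}/v patch_in // E => Hint.
apply: (le_trans Hint).
set w := sup f d.
have n0 : 0 <= nrm 0 w by exact: nrm_ge0.
(* A substitute for the Cauchy-Schwarz inequality: pointwise 2 |w| <= t + |w|^2 / t where chi = 1,
   and C1 bounds chi / vol, so that 1 <= C1 vol there. *)
have key (t : R) : 0 < t -> integral_rV (fun u => `|v d u|) <= (t * K2 + t^-1 * C1 * nrm 0 w ^+ 2) / 2.
  move=> t0; pose G := (fun u => w (at_phi i u) * w (at_phi i u) * vol u) \_ (at_D i).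
  have CG : Cc B G.
    apply: HB => [u Du|u Du nK]; last by rewrite /w sup_out // !mul0r.
    exact: (smooth_cont (smoothM oD (smoothM oD (sv d (leqnn d)) (sv d (leqnn d))) svol) Du).
  have -> : nrm 0 w ^+ 2 = integral_rV G.
    rewrite (nrm_sqr cal); last exact: ssup.
    apply: (integral_on_chart cM (i := i)).
      by apply: smooth_on_cont; apply: smooth_onM; exact: ssup.
    move=> q Mq nK; have [|E0] := vanishing0 (@vanishing_sup f d (leqnn d)) Mq; last by rewrite /w E0 mul0r.
    by rewrite at_chi_out // => /esym/eqP; rewrite oner_eq0.
  have -> : (t * K2 + t^-1 * C1 * integral_rV G) / 2 =
      integral_rV (fun u => t / 2 * chi2 u + t^-1 * C1 / 2 * G u).
    rewrite (integralD B0 (Cc_Z _ Cchi2) (Cc_Z _ CG)) (integralZ B0 _ Cchi2) (integralZ B0 _ CG) -/K2.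
    by move: (K2) (integral_rV G) (t^-1) => a b c; ring.
  apply: (integral_rV_le B0 (Cc_abs (Cv d (leqnn d))) (Cc_D (Cc_Z _ Cchi2) (Cc_Z _ CG))) => u.
  have [Du|nD] := pselect (at_D i u); last first.
    by rewrite /v /chi2 /G !patch_out // normr0 !mulr0 addr0.
  have Mu := chart_in (at_chart i) Du.
  have v0 : 0 < vol u := volume_gt0 (at_chart i) Du.
  have ti : 0 < t^-1 by rewrite invr_gt0.
  have := HC1 u; rewrite /v /chi2 /G !patch_in // -/w.
  have [->|E0] := vanishing0 (@vanishing_sup f d (leqnn d)) Mu; last first.
    move=> _; rewrite /w E0 normr0 mul0r mul0r mulr0 addr0 mulr_ge0 ?divr_ge0 ?(ltW t0) //.
    by rewrite -expr2 sqr_ge0.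
  rewrite !mul1r mulr1 ger0_norm ?invr_ge0 ?(ltW v0) // => h.
  have h1 : 1 <= C1 * vol u by rewrite -ler_pdivrMr // mul1r.
  have h2 : 0 <= `|w (at_phi i u)| by [].
  rewrite [X in _ + X](_ : _ = t^-1 / 2 * (`|w (at_phi i u)| ^+ 2 * (C1 * vol u))); last first.
    by rewrite -expr2 -(real_normK (num_real (w (at_phi i u)))); move: (`|_|) => a; ring.
  apply: (@le_trans _ _ (t / 2 + t^-1 / 2 * `|w (at_phi i u)| ^+ 2)); last first.
    by rewrite lerD2l ler_wpM2l ?divr_ge0 ?(ltW ti) // ler_peMr // sqr_ge0.
  rewrite -subr_ge0 (_ : _ - _ = t^-1 / 2 * (t - `|w (at_phi i u)|) ^+ 2).
    by rewrite mulr_ge0 ?sqr_ge0 // divr_ge0 // ltW.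
  by move: (`|_|) => a; field; rewrite gt_eqF.
have KC : 0 <= (K2 + C1) / 2 by rewrite divr_ge0 // addr_ge0.
have {key}key : integral_rV (fun u => `|v d u|) <= (K2 + C1) / 2 * nrm 0 w.
  apply/ler_addgt0Pr => e e0.
  (* The optimal t is the L2 norm of w, which may be 0; it is therefore increased by a small s. *)
  pose s := e / ((K2 + C1) / 2 + 1).
  have s0 : 0 < s by rewrite divr_gt0 // ltr_wpDl.
  have t0 : 0 < nrm 0 w + s by rewrite ltr_wpDl.
  apply: (le_trans (key _ t0)).
  apply: (@le_trans _ _ ((K2 + C1) / 2 * (nrm 0 w + s))).
    have h : (nrm 0 w + s)^-1 * nrm 0 w ^+ 2 <= nrm 0 w + s.
      by rewrite ler_pdivrMl // -expr2 ler_pXn2r ?nnegrE ?(ltW t0) // lerDl ltW.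
    have {h}h := ler_wpM2l C10 h; rewrite [_^-1 * C1]mulrC -[C1 / _ * _]mulrA.
    have aux (a b y t : R) : y <= b * t -> (t * a + y) / 2 <= (a + b) / 2 * t by lra.
    exact: aux.
  rewrite mulrDr lerD2l /s mulrA ler_pdivrMr ?ltr_wpDl //.
  by rewrite mulrDr mulr1 mulrC lerDl ltW.
apply: (le_trans key); rewrite -[leRHS]mulrA ler_wpM2l //; exact: HC2.
Qed.

End OneChart.

Lemma sobolev_on : exists2 C, 0 <= C & forall f, S f -> forall p, M p -> `|f p| <= C * nrm d f.
Proof.
have /choice[C HC] : forall i, exists C, 0 <= C /\ forall f, S f -> forall p, M p -> `|at_rho i p * f p| <= C * nrm d f.
  by move=> i; have [C C0 H] := sobolev_chart i; exists C.
exists (\sum_i C i); first by apply: sumr_ge0 => i _; exact: (HC i).1.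
move=> f sf p Mp; rewrite -[f p]mul1r -(at_rho_sum A Mp) mulr_suml (le_trans (ler_norm_sum _ _ _)) // mulr_suml.
by apply: ler_sum => i _; exact: (HC i).2.
Qed.

End SobolevEmbedding.

From mathcomp Require Import zify.

(** * Eigenfunction expansions *)

Section Spectrum.
Context {R : realType} {T : Type} {N : nat} (M : set T).
Context (S : (T -> R) -> Prop) (X : 'I_N -> (T -> R) -> T -> R) (H : 'I_N -> T -> R).
Context (I : (T -> R) -> R) (d : nat).
Implicit Types (u v w f g : T -> R) (a b : 'I_N) (i j k n : nat) (p : T).
Hypothesis cal : calculus M S X H I.
Hypothesis definite : forall w, S w -> I (fun p => w p * w p) = 0 -> forall p, M p -> w p = 0.
Hypothesis sobolev : exists2 C : R, 0 <= C & forall f, S f -> forall p, M p -> `|f p| <= C * nrm X I d f.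
Context (Ix : set nat) (lam : nat -> R) (e : nat -> T -> R).
Hypothesis Ix_gt0 : forall i, Ix i -> (0 < i)%N.
Hypothesis Ix_initial : forall i j, Ix j -> (0 < i <= j)%N -> Ix i.
Hypothesis lam_noninc : forall i j, Ix i -> Ix j -> (i <= j)%N -> lam j <= lam i.
Hypothesis Se : forall i, S (e i).
Hypothesis weak : forall i f, S f ->
  dot I f (fun p => lam i * e i p) = - \sum_a dot I (X a f) (X a (e i)).
Hypothesis orth : forall i j, Ix i -> Ix j -> dot I (e i) (e j) = (i == j)%:R.

Local Notation nrm := (nrm X I).
Local Notation dot := (dot I).
Local Notation ell := (ell X H).
Let S_cst := calc_S_cst cal.
Let S_D := calc_S_D cal.
Let S_M := calc_S_M cal.
Let S_X := calc_S_X cal.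
Let mu i : R := 1 - lam i.

Lemma dotC u v : dot u v = dot v u.
Proof. exact: (sobC cal 0). Qed.

Lemma dotZl c u v : S u -> S v -> dot (fun p => c * u p) v = c * dot u v.
Proof. exact: (sobZl cal 0). Qed.

Lemma lam_le0 i : Ix i -> lam i <= 0.
Proof.
move=> Ii; have := weak i (Se i); rewrite dotC dotZl // orth // eqxx mulr1 => ->.
by rewrite oppr_le0 sumr_ge0 // => a _; apply: (dot_ge0 cal); exact: S_X.
Qed.

Lemma mu_ge1 i : Ix i -> 1 <= mu i.
Proof. by move=> /lam_le0; rewrite /mu; lra. Qed.

Let mu_ge0 i : Ix i -> 0 <= mu i. Proof. by move=> /mu_ge1; lra. Qed.

Lemma mu_homo i j : Ix i -> Ix j -> (i <= j)%N -> mu i <= mu j.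
Proof. by move=> Ii Ij ij; rewrite /mu lerD2l lerN2 lam_noninc. Qed.

(** The eigenvalue equation is given weakly. The difference of the two sides is smooth and
    orthogonal to every smooth function, hence to itself, and the integral is definite. *)
Lemma ell_eigen i p : M p -> ell (e i) p = mu i * e i p.
Proof.
move=> Mp; apply/eqP; rewrite -subr_eq0; apply/eqP.
have Sl : S (ell (e i)) by exact: (S_ell cal).
have Sm c : S (fun p => c * e i p) by exact: S_M.
pose w p := ell (e i) p - mu i * e i p.
have Sw : S w by apply: (S_B cal).
apply: (definite Sw _ Mp); rewrite -/(dot w w).
have -> : dot w w = dot (ell (e i)) w - mu i * dot (e i) w.
  rewrite -[LHS]/(sob X I 0 w w) {1}/w (sobDl cal) //; last exact: (S_N cal).
  by rewrite (sobNl cal) // (sobZl cal).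
rewrite (ell_dot cal) //.
under eq_bigr do rewrite dotC.
have := weak i Sw; rewrite dotC dotZl // => E.
have -> : \sum_i0 dot (X i0 w) (X i0 (e i)) = - (lam i * dot (e i) w) by rewrite E opprK.
by rewrite /mu mulrBl mul1r; move: (dot _ _) => x; ring.
Qed.

Lemma ell_combination (r : seq nat) (c : nat -> R) p : M p ->
  ell (fun p => \sum_(i <- r) c i * e i p) p = \sum_(i <- r) c i * mu i * e i p.
Proof.
have Sc i : S (fun p => c i * e i p) by exact: S_M.
have SX i a : S (fun p => c i * X a (e i) p) by exact/S_M/S_X.
have X1 a q : M q -> X a (fun p => \sum_(i <- r) c i * e i p) q = \sum_(i <- r) c i * X a (e i) q.
  by move=> Mq; rewrite (X_sum cal _ _ Sc Mq); apply: eq_bigr => i _; rewrite (X_Z cal).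
move=> Mp; have E a : X a (X a (fun p => \sum_(i <- r) c i * e i p)) p = \sum_(i <- r) c i * X a (X a (e i)) p.
  rewrite (calc_X_ext cal a (X1 a) Mp) (X_sum cal _ _ (fun i => SX i a) Mp).
  by apply: eq_bigr => i _; rewrite (X_Z cal) //; exact: S_X.
transitivity (\sum_(i <- r) c i * ell (e i) p); last first.
  by apply: eq_bigr => i _; rewrite ell_eigen // mulrA.
rewrite /ell; under [in RHS]eq_bigr do rewrite mulrBr; rewrite sumrB; congr (_ - _).
transitivity (\sum_a \sum_(i <- r) c i * (X a (X a (e i)) p + H a p * X a (e i) p)).
  apply: eq_bigr => a _; rewrite E X1 // mulr_sumr -big_split; apply: eq_bigr => i _ /=.
  by rewrite mulrDr mulrCA.
by rewrite exchange_big; apply: eq_bigr => i _; rewrite mulr_sumr.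
Qed.

Lemma iter_ell_combination (r : seq nat) (c : nat -> R) j p : M p ->
  iter j ell (fun p => \sum_(i <- r) c i * e i p) p = \sum_(i <- r) c i * mu i ^+ j * e i p.
Proof.
elim: j p => [|j IH] p Mp; first by apply: eq_bigr => i _; rewrite mulr1.
rewrite iterS (ell_ext cal (v := fun p => \sum_(i <- r) (c i * mu i ^+ j) * e i p)) //.
by rewrite ell_combination //; apply: eq_bigr => i _; rewrite exprSr mulrA.
Qed.

Lemma nrm0_combination (r : seq nat) (c : nat -> R) : uniq r -> (forall i, i \in r -> Ix i) ->
  nrm 0 (fun p => \sum_(i <- r) c i * e i p) ^+ 2 = \sum_(i <- r) c i ^+ 2.
Proof.
move=> ur rI; have Sc i : S (fun p => c i * e i p) by exact: S_M.
have Ss : S (fun p => \sum_(i <- r) c i * e i p) by exact: (S_sum cal).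
rewrite (nrm_sqr cal) // (sob_suml cal) //; rewrite [LHS]big_seq [RHS]big_seq; apply: eq_bigr => i ir.
rewrite (sobZl cal) // (sobC cal) (sob_suml cal) // (bigD1_seq i) //= big_seq_cond big1 ?addr0.
  by rewrite [dot _ _]dotZl // (orth (rI i ir) (rI i ir)) eqxx mulr1 expr2.
by move=> j /andP[jr ji]; rewrite dotZl // (orth (rI j jr) (rI i ir)) (negbTE ji) mulr0.
Qed.

Lemma nrm0_eigen i : Ix i -> nrm 0 (e i) = 1.
Proof. by move=> Ii; rewrite /nrm [sob _ _ _ _ _]orth // eqxx sqrtr1. Qed.

(** On the span of e_1, ..., e_n the operator ell multiplies coefficients by at most mu n, since the
    mu i increase. The elliptic estimate thus costs mu n to the power s. *)
Lemma nrm_combination_le s : exists2 C : R, 0 <= C & forall n (c : nat -> R), Ix n ->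
  nrm s (fun p => \sum_(i <- iota 1 n) c i * e i p) <=
  C * (mu n ^+ s * Num.sqrt (\sum_(i <- iota 1 n) c i ^+ 2)).
Proof.
have [C C0 HC] := elliptic_estimate cal s.
exists (C * s.+1%:R); first by rewrite mulr_ge0.
move=> n c In; set v := (fun p => _); set Q := \sum_(i <- _) _.
have Sv : S v by apply: (S_sum cal) => i; exact: S_M.
have Q0 : 0 <= Q by apply: sumr_ge0 => i _; exact: sqr_ge0.
apply: (le_trans (HC v Sv)); rewrite -mulrA ler_wpM2l //.
rewrite mulr_natl -[X in _ *+ X](card_ord s.+1) -sumr_const; apply: ler_sum => j _.
rewrite -(ler_pXn2r (n := 2)) ?nnegrE ?nrm_ge0 ?mulr_ge0 ?sqrtr_ge0 ?exprn_ge0 ?mu_ge0 //.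
rewrite (nrm_ext cal 0 (v := fun p => \sum_(i <- iota 1 n) (c i * mu i ^+ j) * e i p)); last first.
  by move=> p Mp; exact: iter_ell_combination.
have rI i : i \in iota 1 n -> Ix i.
  by rewrite mem_iota add1n ltnS => h; exact: Ix_initial In h.
rewrite nrm0_combination ?iota_uniq // exprMn sqr_sqrtr // mulr_sumr big_seq [leRHS]big_seq.
apply: ler_sum => i ir; rewrite exprMn mulrC ler_wpM2r ?sqr_ge0 //.
have Ii := rI i ir; rewrite ler_pXn2r ?nnegrE ?exprn_ge0 ?mu_ge0 //.
have i_n : mu i <= mu n by apply: mu_homo => //; move: ir; rewrite mem_iota add1n ltnS => /andP[].
apply: (@le_trans _ _ (mu n ^+ j)).
  by rewrite lerXn2r // nnegrE mu_ge0 //; exact: rI.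
by rewrite ler_weXn2l ?mu_ge1 // -ltnS.
Qed.

(** For fixed p, the combination of the e_i with coefficients e_i(p) has value Q(p) at p and L2 norm
    sqrt (Q(p)), where Q is the sum of the e_i^2. The Sobolev inequality gives Q(p) <= K^2 mu^(2 d),
    and the integral of Q is n by orthonormality. *)
Lemma eigenvalue_growth : exists2 C : R, 0 <= C & forall n, Ix n -> n%:R <= C * mu n ^+ (2 * d).
Proof.
have [C1 C10 H1] := sobolev; have [C2 C20 H2] := nrm_combination_le d.
pose K := C1 * C2; have K0 : 0 <= K by rewrite mulr_ge0.
have I1 : 0 <= I (fun _ => 1) by apply: (calc_I_ge0 cal).
exists (K ^+ 2 * I (fun _ => 1)); first by rewrite mulr_ge0 // sqr_ge0.
move=> n In; pose Q p := \sum_(i <- iota 1 n) e i p * e i p.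
have SQ : S Q by apply: (S_sum cal) => i; exact: S_M.
have m0 : 0 <= mu n ^+ d by rewrite exprn_ge0 // mu_ge0.
have QK p : M p -> Q p <= K ^+ 2 * mu n ^+ (2 * d).
  move=> Mp; pose v q := \sum_(i <- iota 1 n) e i p * e i q.
  have Sv : S v by apply: (S_sum cal) => i; exact: S_M.
  have E : \sum_(i <- iota 1 n) e i p ^+ 2 = Q p by [].
  have Q0 : 0 <= Q p by rewrite -E; apply: sumr_ge0 => i _; exact: sqr_ge0.
  have := le_trans (H1 v Sv p Mp) (ler_wpM2l C10 (H2 n (fun i => e i p) In)).
  rewrite E -[v p]/(Q p) ger0_norm // !mulrA -/K => h.
  have := sqr_sqrtr Q0; move: h; rewrite mulnC exprM; move: (Num.sqrt (Q p)) (sqrtr_ge0 (Q p)) => s s0 h hs.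
  rewrite -exprMn; move: h; rewrite -hs; move: (K * mu n ^+ d) (mulr_ge0 K0 m0) => t t0 h.
  rewrite ler_pXn2r ?nnegrE //; have [->//|sn] := eqVneq s 0.
  by rewrite -(ler_pM2r (x := s)) ?lt_def ?sn // -expr2.
have IQ : I Q = n%:R.
  rewrite (I_sum cal); last by move=> i; exact: S_M.
  rewrite -[in RHS](size_iota 1 n) -sum1_size natr_sum [LHS]big_seq [RHS]big_seq.
  apply: eq_bigr => i; rewrite mem_iota add1n ltnS => h; have Ii := Ix_initial In h.
  by rewrite -/(dot (e i) (e i)) orth // eqxx.
rewrite -IQ [leRHS]mulrAC -(calc_I_Z cal) //.
apply: (I_le cal) => // p Mp.
by rewrite mulr1; exact: QK.
Qed.

(** Each factor mu i is a power of ell on e_i, moved onto f by the weak equation; the bound is the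
    L2 norm of the k-th iterate of ell on f. *)
Lemma coefficient_decay f k : S f -> exists2 B : R, 0 <= B & forall i, Ix i ->
  mu i ^+ k * `|dot f (e i)| <= B.
Proof.
move=> Sf; exists (nrm 0 (iter k ell f)); first exact: nrm_ge0.
move=> i Ii.
have -> : mu i ^+ k * `|dot f (e i)| = `|dot (iter k ell f) (e i)|.
  rewrite -[mu i ^+ k]ger0_norm ?exprn_ge0 ?mu_ge0 // -normrM; congr `|_|.
  elim: k => [|k IH]; first by rewrite mul1r.
  have Sk : S (iter k ell f) by exact: (S_iter_ell cal).
  rewrite iterS (ell_dot cal) // exprS -mulrA IH.
  have -> : \sum_a dot (X a (iter k ell f)) (X a (e i)) = - dot (iter k ell f) (fun p => lam i * e i p).
    by rewrite weak // opprK.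
  by rewrite [in RHS]dotC [X in _ - X]dotC dotZl // [dot _ (e i)]dotC /mu; move: (dot _ _) => x; ring.
rewrite -[leRHS]mulr1 -(nrm0_eigen Ii).
by apply: (cauchy_schwarz cal 0) => //; exact: (S_iter_ell cal).
Qed.

Definition Xword (l : seq 'I_N) f := foldr X f l.

Lemma S_Xword l f : S f -> S (Xword l f).
Proof. by move=> Sf; elim: l => //= a l IH; exact: S_X. Qed.

Lemma nrm_Xword s l f : S f -> nrm s (Xword l f) <= nrm (s + size l) f.
Proof.
move=> Sf; elim: l s => [|a l IH] s /=; first by rewrite addn0.
by rewrite addnS -addSn; apply: le_trans (IH s.+1); apply: (nrm_X cal); exact: S_Xword.
Qed.

Lemma Xword_eigen_bound l : exists2 C : R, 0 <= C & forall i, Ix i -> forall p, M p ->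
  `|Xword l (e i) p| <= C * mu i ^+ (d + size l).
Proof.
have [C1 C10 H1] := sobolev; have [C2 C20 H2] := elliptic_estimate cal (d + size l).
exists (C1 * (C2 * (d + size l).+1%:R)); first by rewrite !mulr_ge0.
move=> i Ii p Mp; apply: (le_trans (H1 _ (S_Xword l (Se i)) p Mp)); rewrite -mulrA ler_wpM2l //.
apply: (le_trans (nrm_Xword d l (Se i))); apply: (le_trans (H2 _ (Se i))); rewrite -mulrA ler_wpM2l //.
rewrite mulr_natl -[X in _ *+ X](card_ord (d + size l).+1) -sumr_const; apply: ler_sum => j _.
rewrite (nrm_ext cal 0 (v := fun p => mu i ^+ j * e i p)); last first.
  move=> q Mq; have := @iter_ell_combination [:: i] (fun _ => 1) j q Mq.
  rewrite big_seq1 mul1r => <-; congr (iter j ell _ q); apply/funext => z.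
  by rewrite big_seq1 mul1r.
rewrite (nrmZ cal) // nrm0_eigen // mulr1 ger0_norm ?exprn_ge0 ?mu_ge0 //.
by rewrite ler_weXn2l ?mu_ge1 // -ltnS.
Qed.

Lemma eigen_series_bound f l : S f -> exists2 B : R, 0 <= B & forall i, Ix i -> forall p, M p ->
  `|dot f (e i) * Xword l (e i) p| <= B * (i.+1 * i.+2)%:R^-1.
Proof.
move=> Sf; have [C1 C10 H1] := Xword_eigen_bound l; have [C2 C20 H2] := eigenvalue_growth.
(* Twice 2 d to dominate i^2 by [eigenvalue_growth], and d plus the length of l to compensate
   [Xword_eigen_bound]. *)
have [B B0 HB] := coefficient_decay (2 * d + 2 * d + (d + size l)) Sf.
exists (C1 * (6 * C2 ^+ 2 * B)); first by rewrite !mulr_ge0 // sqr_ge0.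
move=> i Ii p Mp; have i0 := Ix_gt0 Ii.
rewrite ler_pdivlMr ?ltr0n // normrM.
have m0 k : 0 <= mu i ^+ k by rewrite exprn_ge0 // mu_ge0.
(* As i >= 1, (i + 1)(i + 2) <= 2 i * 3 i. *)
have ii : (i.+1 * i.+2)%:R <= 6 * C2 ^+ 2 * mu i ^+ (2 * d + 2 * d).
  apply: (@le_trans _ _ (6 * i%:R ^+ 2)).
    by rewrite -natrX -natrM ler_nat (_ : 6 = 2 * 3)%N // -mulnn mulnACA leq_mul // ?mul2n ?mulSn -?addnn; lia.
  rewrite -mulrA ler_wpM2l // exprD -expr2 -exprMn ler_pXn2r ?nnegrE ?mulr_ge0 //.
  exact: H2.
have := HB i Ii; rewrite exprD.
move: (H1 i Ii p Mp) ii (m0 (2 * d + 2 * d)%N) (m0 (d + size l)%N) (normr_ge0 (dot f (e i))).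
move: (mu i ^+ _) (mu i ^+ _) `|dot f (e i)| `|Xword l (e i) p| (normr_ge0 (Xword l (e i) p)) => a b c x x0 h1 ii a0 b0 c0 hB.
apply: (@le_trans _ _ (c * (C1 * b) * (6 * C2 ^+ 2 * a))).
  by apply: ler_pM; rewrite ?mulr_ge0 // ler_wpM2l.
have K0 : 0 <= C1 * (6 * C2 ^+ 2) by rewrite !mulr_ge0 // sqr_ge0.
have := ler_wpM2l K0 hB.
rewrite -!mulrA; apply: le_trans; rewrite le_eqVlt; apply/orP; left; apply/eqP; ring.
Qed.

End Spectrum.

(** * Uniform limits with explicit rates *)

Section UniformLimit.
Context {R : realType}.

Lemma inv_small (B e : R) : 0 <= B -> 0 < e -> exists n : nat, B / n.+1%:R <= e.
Proof.
move=> B0 e0; exists (Num.bound (B / e)).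
rewrite ler_pdivrMr // mulrC -ler_pdivrMr //.
have := archi_boundP (divr_ge0 B0 (ltW e0)); move=> /ltW/le_trans; apply.
by rewrite ler_nat leqnSn.
Qed.

(** The limit is the supremum of the lower bounds u n - B / (n + 1), each of which lies below all
    the upper bounds u m + B / (m + 1); the rate is thereby kept. *)
Lemma cauchy_limit (u : nat -> R) (B : R) : (forall n m, (n <= m)%N -> `|u m - u n| <= B / n.+1%:R) ->
  exists l, forall n, `|u n - l| <= B / n.+1%:R.
Proof.
move=> H; pose E := [set u n - B / n.+1%:R | n in setT].
have bd n m : u n - B / n.+1%:R <= u m + B / m.+1%:R.
  have B0 k : 0 <= B / k.+1%:R by apply: le_trans (H k k (leqnn k)).
  have [nm|/ltnW mn] := leqP n m.
    by move: (B0 m) (H n m nm); rewrite ler_norml; move: (B / n.+1%:R) (B / m.+1%:R) => x y ? /andP[? ?]; lra.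
  by move: (B0 n) (H m n mn); rewrite ler_norml; move: (B / n.+1%:R) (B / m.+1%:R) => x y ? /andP[? ?]; lra.
exists (sup E) => n; rewrite distrC ler_norml; apply/andP; split.
  rewrite lerBrDr addrC; apply: ub_le_sup; last by exists n.
  by exists (u 0%N + B / 1%:R) => _ [k _ <-].
rewrite lerBlDr addrC; apply: ge_sup; first by exists (u n - B / n.+1%:R), n.
by move=> _ [k _ <-].
Qed.

(** The majorant telescopes: 1 / ((i + 1)(i + 2)) = 1 / (i + 1) - 1 / (i + 2). *)
Lemma series_tail (t : nat -> R) (B : R) n m : (forall i, `|t i| <= B * (i.+1 * i.+2)%:R^-1) -> (n <= m)%N ->
  `|\sum_(i < m) t i - \sum_(i < n) t i| <= B / n.+1%:R.
Proof.
move=> H nm; have B0 : 0 <= B.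
  by have := le_trans (normr_ge0 _) (H 0%N); rewrite pmulr_lge0 // invr_gt0.
suff : `|\sum_(i < m) t i - \sum_(i < n) t i| <= B / n.+1%:R - B / m.+1%:R.
  by move=> /le_trans; apply; rewrite gerBl divr_ge0.
rewrite -(subnKC nm); elim: (m - n)%N => [|k IH]; first by rewrite addn0 !subrr normr0.
rewrite addnS big_ord_recr /= addrAC (le_trans (ler_normD _ _)) //.
apply: (le_trans (lerD IH (H _))).
rewrite le_eqVlt; apply/orP; left; apply/eqP; rewrite natrM.
have n1 : (n + k).+1%:R != 0 :> R by rewrite pnatr_eq0.
have n2 : (n + k).+2%:R != 0 :> R by rewrite pnatr_eq0.
have n3 : n.+1%:R != 0 :> R by rewrite pnatr_eq0.
have E : (n + k).+2%:R = (n + k).+1%:R + 1 :> R by rewrite -natr1.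
move: n1 n2 n3 E; move: (n.+1%:R : R) ((n + k).+1%:R : R) ((n + k).+2%:R : R) => y x z n1 n2 n3 E.
by rewrite E in n2 *; field; rewrite n1 n2 n3.
Qed.

Context {V : normedModType R} (U : set V) (oU : open U).

Lemma uniform_cont (S : nat -> V -> R) (F : V -> R) (B : R) : 0 <= B ->
  (forall n x, U x -> {for x, continuous (S n)}) ->
  (forall n x, U x -> `|S n x - F x| <= B / n.+1%:R) -> forall x, U x -> {for x, continuous F}.
Proof.
move=> B0 cS HF x Ux; apply: (@continuous_at_ball R V R^o) => e e0.
have e3 : 0 < e / 3 by rewrite divr_gt0.
have [n Hn] := inv_small B0 e3.
have [r r0 Hr] := open_ballP oU Ux.
have [s s0 Hs] := continuous_atP (cS n x Ux) e3.
exists (Num.min r s); first by rewrite lt_min r0.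
move=> y; rewrite lt_min => /andP[/Hr Uy /Hs h].
have h1 := le_trans (HF n x Ux) Hn; have h2 := le_trans (HF n y Uy) Hn; rewrite distrC in h2.
rewrite -(subrKA (S n y)) (le_trans (ler_normD _ _)) //.
rewrite -[X in _ + `|X|](subrKA (S n x)).
have h3 := ler_normD (S n y - S n x) (S n x - F x).
move: h h1 h2 h3; lra.
Qed.

Lemma quotient_eps (D l h e : R) : h != 0 ->
  (`|l - h^-1 *: (D : R^o)| <= e) = (`|D - h * l| <= e * `|h|).
Proof.
move=> h0; rewrite scaleRE (_ : l - h^-1 * D = - (h^-1 * (D - h * l))); last by field.
by rewrite normrN normrM normfV ler_pdivrMl ?normr_gt0 // (mulrC e).
Qed.

Lemma is_derive_eps (F : V -> R) x v l :
  (forall e : R, 0 < e -> exists2 r : R, 0 < r & forall h : R, h != 0 -> `|h| < r ->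
    `|F (h *: v + x) - F x - h * l| <= e * `|h|) -> is_derive x v F l.
Proof.
move=> H; have C : (fun h : R => h^-1 *: (F (h *: v + x) - F x)) @ 0^' --> l.
  apply/cvgrPdist_le => e e0; have [r r0 Hr] := H e e0.
  rewrite near_withinE; apply: (@ball_near R R^o _ 0 r) => // h.
  rewrite subr0 => hr h0; have := Hr h h0 hr.
  by rewrite quotient_eps.
by apply: DeriveDef; [apply/cvg_ex; exists l|exact: cvg_lim C].
Qed.

(** Termwise differentiation in one direction. F is compared with a fixed S n through S m - S n,
    whose increment the mean value theorem bounds by its derivative, uniformly small. *)
Lemma uniform_derive (S G : nat -> V -> R) (F F' : V -> R) (B : R) v : 0 <= B ->
  (forall n x, U x -> is_derive x v (S n) (G n x)) ->
  (forall n x, U x -> `|S n x - F x| <= B / n.+1%:R) ->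
  (forall n x, U x -> `|G n x - F' x| <= B / n.+1%:R) ->
  forall x, U x -> is_derive x v F (F' x).
Proof.
move=> B0 dS HF HG x Ux; apply: is_derive_eps => e e0.
have e5 : 0 < e / 5 by rewrite divr_gt0.
have [n Hn] := inv_small B0 e5.
have [r r0 Hr] := open_ballP oU Ux.
have v1 : 0 < `|v| + 1 by rewrite ltr_wpDl.
have dn : derivable (S n) x v by have := dS n x Ux; move=> [].
have Dn : 'D_v (S n) x = G n x by have := dS n x Ux; move=> [].
have [s s0 Hs] : exists2 s : R, 0 < s & forall h : R, h != 0 -> `|h| < s ->
    `|S n (h *: v + x) - S n x - h * G n x| <= e / 5 * `|h|.
  have : (fun h : R => h^-1 *: (S n (h *: v + x) - S n x)) @ 0^' --> G n x by rewrite -Dn; exact: dn.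
  move=> /cvgrPdist_le/(_ _ e5); rewrite near_withinE => /near_ball[s s0 Hs].
  exists s => // h h0 hs; have := Hs h; rewrite subr0 => /(_ hs h0).
  by rewrite quotient_eps.
exists (Num.min s (r / (`|v| + 1))); first by rewrite lt_min s0 divr_gt0.
move=> h h0; rewrite lt_min => /andP[hs hr].
have Uline t : 0 <= t <= 1 -> U (x + t *: (h *: v)).
  move=> /andP[t0 t1]; apply: Hr; rewrite addrC addKr !normrZ (ger0_norm t0).
  apply: (@le_lt_trans _ _ (`|h| * `|v|)); first by rewrite -[leRHS]mul1r ler_wpM2r // mulr_ge0.
  apply: (@le_lt_trans _ _ (`|h| * (`|v| + 1))); first by rewrite ler_wpM2l // lerDl.
  by rewrite -ltr_pdivlMr.
have Uh : U (h *: v + x) by have := Uline 1; rewrite scale1r addrC; apply; rewrite ler01 lexx.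
have hp : 0 < `|h| by rewrite normr_gt0.
(* Here m depends on h: replacing F by S m at two points must cost less than a multiple of |h|,
   while n stays fixed. *)
have [m nm Hm] : exists2 m, (n <= m)%N & B / m.+1%:R <= e / 5 / 2 * `|h|.
  have eh : 0 < e / 5 / 2 * `|h| by rewrite mulr_gt0 // divr_gt0.
  have [m Hm] := inv_small B0 eh; exists (maxn n m); first exact: leq_maxl.
  apply: le_trans Hm; rewrite ler_wpM2l // lef_pV2 ?posrE // ler_nat ltnS leq_maxr //.
have Hmn : B / m.+1%:R <= e / 5.
  by apply: le_trans Hn; rewrite ler_wpM2l // lef_pV2 ?posrE // ler_nat ltnS.
pose W y := S m y - S n y.
have dW y : U y -> is_derive y v W (G m y - G n y).
  by move=> Uy; have := dS m y Uy; have := dS n y Uy; move=> d1 d2; exact: is_deriveB.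
have [t t01 HW] : exists2 t : R, 0 <= t <= 1 & W (x + h *: v) - W x = 'D_(h *: v) W (x + t *: (h *: v)).
  apply: MVT_line => t t01; have [H1 _] := dW _ (Uline t t01).
  by have [] := derivableZv h H1.
have Ut := Uline t t01.
have [H1 H2] := dW _ Ut; have [_ H3] := derivableZv h H1.
move: HW; rewrite H3 H2 scaleRE [x + h *: v]addrC => HW.
have b1 : `|W (h *: v + x) - W x| <= `|h| * (2 * (e / 5)).
  rewrite HW normrM ler_wpM2l // -(subrKA (F' (x + t *: (h *: v)))) (le_trans (ler_normD _ _)) //.
  rewrite mulr_natl mulr2n lerD //; first exact: le_trans (HG m _ Ut) Hmn.
  by rewrite distrC; exact: le_trans (HG n _ Ut) Hn.
have b2 := Hs h h0 hs.
have b3 : `|h * (G n x - F' x)| <= e / 5 * `|h|.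
  by rewrite normrM mulrC ler_wpM2r //; exact: le_trans (HG n x Ux) Hn.
have b4 := le_trans (HF m _ Uh) Hm; have b5 := le_trans (HF m _ Ux) Hm.
have -> : F (h *: v + x) - F x - h * F' x = (W (h *: v + x) - W x) +
   (S n (h *: v + x) - S n x - h * G n x) + h * (G n x - F' x) - (S m (h *: v + x) - F (h *: v + x)) + (S m x - F x).
  by rewrite /W; move: (h *: v + x) => y; ring.
move: b1 b2 b3 b4 b5; move: (W _ - W _) (S n _ - _ - _) (h * (G n x - _)) (S m _ - F _) (S m _ - F _) => y1 y2 y3 y4 y5.
move=> b1 b2 b3 b4 b5; rewrite (le_trans (ler_normD _ _)) // (le_trans (lerD (ler_normB _ _) (lexx _))) //.
rewrite (le_trans (lerD (lerD (ler_normD _ _) (lexx _)) (lexx _))) //.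
have := ler_normD y1 y2; move: b1 b2 b3 b4 b5; move: (`|h|) (`|y1 + y2|) (`|y1|) (`|y2|) (`|y3|) (`|y4|) (`|y5|) => k z z1 z2 z3 z4 z5.
lra.
Qed.

End UniformLimit.

(** * The tail of the expansion as a smooth function *)

Section Tail.
Context {R : realType} {N d : nat} (M : set 'rV[R]_N) (A : atlas d M).
Hypothesis cM : compact M.
Local Notation S := (smooth_on M).
Local Notation X := (@X R N M).
Local Notation cal := (atlas_calculus A cM).
Context (e : nat -> 'rV[R]_N -> R) (c : nat -> R) (Bd : seq 'I_N -> R).
Hypothesis Se : forall i, S (e i).
Hypothesis bound : forall l i p, M p -> `|c i * Xword X l (e i) p| <= Bd l * (i.+1 * i.+2)%:R^-1.
Implicit Types (l : seq 'I_N) (p : 'rV[R]_N) (i : 'I_(at_n A)) (b : 'I_N).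

Definition partial l n p := \sum_(i < n) c i * Xword X l (e i) p.

Lemma S_partial l n : S (partial l n).
Proof.
apply: smooth_on_sum => j; apply: smooth_onM; first exact: smooth_on_cst.
exact: (S_Xword cal).
Qed.

Lemma X_partial l n b p : M p -> X b (partial l n) p = partial (b :: l) n p.
Proof.
move=> Mp; have Sl j : S (Xword X l (e j)) by exact: (S_Xword cal).
rewrite (X_sum cal (index_enum 'I_n) b (F := fun j p => c j * Xword X l (e j) p)) //; last first.
  by move=> j; apply: smooth_onM; [exact: smooth_on_cst|].
by apply: eq_bigr => j _; rewrite (X_Z cal).
Qed.

Lemma tail_exists l p : exists s, M p -> forall n, `|partial l n p - s| <= Bd l / n.+1%:R.
Proof.
have [Mp|nM] := pselect (M p); last by exists 0.
have [|s Hs] := @cauchy_limit R (fun n => partial l n p) (Bd l); last by exists s.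
by move=> n m nm; exact: (series_tail (t := fun j => c j * Xword X l (e j) p) (fun j => bound l j Mp) nm).
Qed.

(** The limit of the derivatives along the word l of the partial sums. Keeping all words at once
    gives a family closed under derivation. Off M the condition is vacuous and the value
    arbitrary. *)
Definition tail l p : R := xget 0 [set s | M p -> forall n, `|partial l n p - s| <= Bd l / n.+1%:R].

Lemma tailP l p n : M p -> `|partial l n p - tail l p| <= Bd l / n.+1%:R.
Proof.
move=> Mp; rewrite /tail; case: xgetP => [s _ H|H]; first exact: H.
by have [s Hs] := tail_exists l p; case: (H s).
Qed.

Lemma Bd_ge0 l p : M p -> 0 <= Bd l.
Proof. by move=> /(bound l 0)/(le_trans (normr_ge0 _)); rewrite pmulr_lge0 // invr_gt0. Qed.

Lemma tail_eq_limit (K r : R) p l (Q : nat -> R) : M p -> 0 <= K -> (forall n, `|Q n - partial l n p| <= K / n.+1%:R) ->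
  (forall n, `|Q n - r| <= K / n.+1%:R) -> r = tail l p.
Proof.
move=> Mp K0 H1 H2; apply/eqP; rewrite -subr_eq0 -normr_le0; apply/ler_addgt0Pr => t t0; rewrite add0r.
have B0 := Bd_ge0 l Mp.
have [n Hn] := inv_small (addr_ge0 (addr_ge0 K0 K0) B0) t0; apply: le_trans Hn; rewrite !mulrDl.
rewrite -(subrKA (partial l n p)) (le_trans (ler_normD _ _)) // lerD ?tailP //.
rewrite -(subrKA (Q n)) (le_trans (ler_normD _ _)) // lerD //; by rewrite distrC.
Qed.

Section InChart.
Context (i : 'I_(at_n A)).
Local Notation D := (at_D i).
Local Notation phi := (at_phi i).
Local Notation J := (jacobian phi).
Let oD : open D := chart_open (at_chart i).
Let inM u (Du : D u) : M (phi u) := chart_in (at_chart i) Du.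

Lemma chart_derive f u v : S f -> D u ->
  is_derive u v (fun x => f (phi x)) (\sum_b (v *m J u) 0 b * X b f (phi u)).
Proof.
move=> sf Du; have sfu := smooth_chart_comp (at_chart i) sf.
apply: DeriveDef; first exact: smooth_derivable sfu Du.
rewrite (derive_grad v oD sfu Du) /edot.
transitivity (\sum_k \sum_b J u k b * X b f (phi u) * v 0 k).
  apply: eq_bigr => k _; rewrite mxE (pd_gradient (at_chart i)) // mulr_suml; exact: eq_bigr.
rewrite exchange_big; apply: eq_bigr => b _ /=; rewrite mxE mulr_suml; apply: eq_bigr => k _.
by rewrite mulrC mulrA.
Qed.

Lemma derive_tail l u v : D u ->
  is_derive u v (fun x => tail l (phi x)) (\sum_b (v *m J u) 0 b * tail (b :: l) (phi u)).
Proof.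
move=> Du.
have cJ b : {for u, continuous (fun x => (v *m J x) 0 b)}.
  have : smooth_open D (fun x => \sum_k v 0 k * J x k b).
    apply: smooth_sum oD _ => k; apply: smoothM oD _ _; [exact: smooth_cst oD|exact: (smooth_jac (at_chart i) k b)].
  have E : (fun x => (v *m J x) 0 b) = (fun x => \sum_k v 0 k * J x k b) by apply/funext => x; rewrite mxE.
  by rewrite E => sJ; exact: smooth_cont sJ Du.
have [r r0 Hr] := open_ballP oD Du.
have /choice[s Hs] : forall b, exists s : R, 0 < s /\ forall x, `|x - u| < s -> `|(v *m J x) 0 b - (v *m J u) 0 b| < 1.
  by move=> b; have [s s0 Hs] := continuous_atP (cJ b) ltr01; exists s.
pose r1 : R := \big[Num.min/r]_b s b.
have r10 : 0 < r1 by apply: (big_ind (fun x => 0 < x)) => // [x y x0 y0|b _]; [rewrite lt_min x0|exact: (Hs b).1].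
(* On U the coefficients of the chain rule exceed those at u by at most 1, which makes the
   convergence of the derivatives uniform. *)
pose U := [set x : 'rV[R]_d | `|x - u| < r1].
have UD : U `<=` D by move=> x Ux; apply: Hr; apply: lt_le_trans Ux _; exact: bigmin_le_id.
have UJ b x : U x -> `|(v *m J x) 0 b| <= `|(v *m J u) 0 b| + 1.
  move=> Ux; have h : `|x - u| < s b by apply: lt_le_trans Ux _; exact: bigmin_le_cond.
  have := (Hs b).2 x h; have := ler_normD ((v *m J x) 0 b - (v *m J u) 0 b) ((v *m J u) 0 b).
  by rewrite subrK => h1 h2; apply: le_trans h1 _; rewrite addrC lerD2l ltW.
have B0 l' := Bd_ge0 l' (inM Du).
pose B := Bd l + \sum_b (`|(v *m J u) 0 b| + 1) * Bd (b :: l).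
have Bs : 0 <= \sum_b (`|(v *m J u) 0 b| + 1) * Bd (b :: l).
  by apply: sumr_ge0 => b _; rewrite mulr_ge0 // addr_ge0.
apply: (@uniform_derive R 'rV[R]_d U (open_norm_ball u r1) (fun n x => partial l n (phi x))
  (fun n x => \sum_b (v *m J x) 0 b * partial (b :: l) n (phi x)) _
  (fun x => \sum_b (v *m J x) 0 b * tail (b :: l) (phi x)) B v).
- by rewrite addr_ge0.
- move=> n x Ux; have Dx := UD x Ux; apply: (is_derive_eq (chart_derive v (S_partial l n) Dx)).
  by apply: eq_bigr => b _; rewrite X_partial //; exact: inM.
- move=> n x Ux; apply: (le_trans (tailP l n (inM (UD x Ux)))).
  by rewrite ler_wpM2r ?invr_ge0 // lerDl.
- move=> n x Ux; rewrite -sumrB (le_trans (ler_norm_sum _ _ _)) //.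
  apply: (@le_trans _ _ (\sum_b (`|(v *m J u) 0 b| + 1) * Bd (b :: l) / n.+1%:R)); last first.
    by rewrite -mulr_suml ler_wpM2r ?invr_ge0 // lerDr.
  apply: ler_sum => b _; rewrite -mulrBr normrM -mulrA ler_pM // ?UJ //.
  exact: tailP (inM (UD x Ux)).
- by rewrite /U /= subrr normr0.
Qed.

(** Deriving a tail in a chart gives tails of longer words with smooth coefficients; these
    combinations are closed under derivation, as [smooth_coind] requires. *)
Inductive tail_class : ('rV[R]_d -> R) -> Prop :=
  | tail_class_tail l : tail_class (fun u => tail l (phi u))
  | tail_class_mul (f g : 'rV[R]_d -> R) : smooth_open D f -> tail_class g -> tail_class (fun u => f u * g u)
  | tail_class_add (f g : 'rV[R]_d -> R) : tail_class f -> tail_class g -> tail_class (fun u => f u + g u).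

Lemma tail_class_sum (r : seq 'I_N) (f : 'I_N -> 'rV[R]_d -> R) (l : seq 'I_N) :
  (forall b, smooth_open D (f b)) -> tail_class (fun u => \sum_(b <- r) f b u * tail (b :: l) (phi u)).
Proof.
move=> sf; elim: r => [|b r IH].
  have -> : (fun u => \sum_(b <- [::]) f b u * tail (b :: l) (phi u)) = (fun u => 0 * tail l (phi u)).
    by apply/funext => u; rewrite big_nil mul0r.
  by apply: tail_class_mul; [exact: smooth_cst|exact: tail_class_tail].
have -> : (fun u => \sum_(b <- b :: r) f b u * tail (b :: l) (phi u)) =
    (fun u => f b u * tail (b :: l) (phi u) + \sum_(b <- r) f b u * tail (b :: l) (phi u)).
  by apply/funext => u; rewrite big_cons.
by apply: tail_class_add => //; apply: tail_class_mul => //; exact: tail_class_tail.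
Qed.

Lemma tail_class_derive F : tail_class F -> (forall x, D x -> {for x, continuous F}) /\
  forall v, exists2 G, tail_class G & forall x, D x -> is_derive x v F (G x).
Proof.
elim=> [l|f g sf tg [cg dg]|f g _ [cf df] _ [cg dg]].
- split=> [x Dx|v].
    apply: (uniform_cont oD (Bd_ge0 l (inM Dx)) (S := fun n u => partial l n (phi u))) Dx.
      by move=> n u Du; exact: smooth_cont (smooth_chart_comp (at_chart i) (S_partial l n)) Du.
    by move=> n u Du; exact: tailP (inM Du).
  exists (fun x => \sum_b (v *m J x) 0 b * tail (b :: l) (phi x)); last by move=> x; exact: derive_tail.
  apply: tail_class_sum => b; have : smooth_open D (fun x => \sum_k v 0 k * J x k b).
    apply: smooth_sum oD _ => k; apply: smoothM oD _ _; [exact: smooth_cst oD|exact: (smooth_jac (at_chart i) k b)].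
  by apply: smooth_ext => // x _; rewrite mxE.
- split=> [x Dx|v]; first by apply: (@continuousM R _ f g); [exact: smooth_cont sf Dx|exact: cg].
  have [g' cg' Hg] := dg v; exists (fun x => f x * g' x + 'D_v f x * g x).
    apply: tail_class_add; first exact: tail_class_mul sf cg'.
    exact: tail_class_mul (smooth_derive v sf) tg.
  move=> x Dx; have df : is_derive x v f ('D_v f x) by apply: DeriveDef => //; exact: smooth_derivable sf Dx.
  have dgx := Hg x Dx; apply: (is_derive_eq (is_deriveM df dgx)).
  by rewrite !scaleRE [g x * _]mulrC.
split=> [x Dx|v]; first by apply: (@continuousD R _ _ f g); [exact: cf|exact: cg].
have [f' cf' Hf] := df v; have [g' cg' Hg] := dg v; exists (fun x => f' x + g' x).
  exact: tail_class_add.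
by move=> x Dx; have dfx := Hf x Dx; have dgx := Hg x Dx; exact: is_deriveD.
Qed.

Lemma smooth_tail_chart l : smooth_open D (fun u => tail l (phi u)).
Proof.
apply: (smooth_coind (P := tail_class) oD); last exact: tail_class_tail.
by move=> F /tail_class_derive.
Qed.

End InChart.

Lemma smooth_tail l : S (tail l).
Proof.
move=> p /(at_cover A)[i [u Ku E]]; apply: (chart_smooth_on (at_chart i)); last by exists u => //; exact: at_sub.
exact: smooth_tail_chart.
Qed.

Lemma X_tail l b p : M p -> X b (tail l) p = tail (b :: l) p.
Proof.
move: p; apply: (chart_ind (A := A)) => i u Du; have Mu := chart_in (at_chart i) Du.
pose v k : 'rV[R]_d := delta_mx 0 k.
pose a k b' := (v k *m jacobian (at_phi i) u) 0 b'.
pose K := \sum_k `|xi (at_phi i) b k u| * \sum_b' `|a k b'| * Bd (b' :: l).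
have K0 : 0 <= K.
  by apply: sumr_ge0 => k _; rewrite mulr_ge0 // sumr_ge0 // => b' _; rewrite mulr_ge0 // (Bd_ge0 _ Mu).
apply: (tail_eq_limit (K := K) (Q := fun n => X b (partial l n) (at_phi i u)) Mu K0).
  by move=> n; rewrite X_partial // subrr normr0 divr_ge0.
move=> n; rewrite !(X_chart (A := A)) //; [|exact: smooth_tail|exact: S_partial].
rewrite /vfield -sumrB (le_trans (ler_norm_sum _ _ _)) // mulr_suml; apply: ler_sum => k _.
rewrite -mulrBr normrM -mulrA ler_wpM2l // mulr_suml.
have -> : pd k (fun u => partial l n (at_phi i u)) u = \sum_b' a k b' * partial (b' :: l) n (at_phi i u).
  rewrite /pd (@derive_val _ _ _ _ _ _ _ (chart_derive (v k) (S_partial l n) Du)).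
  by apply: eq_bigr => b' _; rewrite X_partial.
have -> : pd k (fun u => tail l (at_phi i u)) u = \sum_b' a k b' * tail (b' :: l) (at_phi i u).
  by rewrite /pd (@derive_val _ _ _ _ _ _ _ (derive_tail l (v k) Du)).
rewrite -sumrB (le_trans (ler_norm_sum _ _ _)) //; apply: ler_sum => b' _.
by rewrite -mulrBr normrM -mulrA ler_wpM2l // tailP.
Qed.

Lemma tail_small q l p : (forall j, (j <= q)%N -> c j = 0) -> M p -> `|tail l p| <= Bd l / q.+1%:R.
Proof.
move=> c0 Mp; have := tailP l q Mp; rewrite /partial big1 ?sub0r ?normrN //.
by move=> j _; rewrite c0 ?mul0r // ltnW.
Qed.

Local Notation I := (integral_on d M).

(** Partial sums past j have product exactly c j with e j, and the integral is continuous for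
    uniform convergence. *)
Lemma dot_tail j : (forall k, c k * dot I (e k) (e j) = if k == j then c j else 0) ->
  dot I (tail [::]) (e j) = c j.
Proof.
move=> orth; have bI := integral_on_bfun A cM; have [_ _ _ [C C0 HC]] := bI.
have cont f : S f -> cont_on M f by exact: smooth_on_cont.
have [E E0 HE] := cont_on_bounded cM (cont _ (Se j)).
have partial_dot n : (j < n)%N -> dot I (partial [::] n) (e j) = c j.
  move=> jn; rewrite /dot.
  transitivity (I (fun p => \sum_(k < n) c k * (e k p * e j p))).
    by apply: integral_on_ext => p _; rewrite mulr_suml; apply: eq_bigr => k _; rewrite mulrA.
  rewrite (bfun_sum bI); last by move=> k; apply: cont; apply: smooth_onM; [exact: smooth_on_cst|exact: smooth_onM].
  rewrite (bigD1 (Ordinal jn)) //= big1 ?addr0.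
    by rewrite (bfunZ bI) ?orth ?eqxx //; apply: cont; exact: smooth_onM.
  move=> k kj; rewrite (bfunZ bI) ?orth; last by apply: cont; exact: smooth_onM.
  by case: eqP => // kj'; case/eqP: kj; exact: val_inj.
have [[p0 Mp0]|nM] := pselect (exists p, M p); last first.
  have := partial_dot j.+1 (ltnSn j) => <-; apply: integral_on_ext => p Mp.
  by case: nM; exists p.
apply/eqP; rewrite -subr_eq0 -normr_le0; apply/ler_addgt0Pr => t t0; rewrite add0r.
have B0 := Bd_ge0 [::] Mp0.
have [n Hn] := inv_small (mulr_ge0 C0 (mulr_ge0 B0 E0)) t0.
pose m := maxn n j.+1.
rewrite -(partial_dot m (leq_maxr _ _)) /dot -(bfunB bI); last 2 first.
- by apply: cont; apply: smooth_onM; [exact: smooth_tail|exact: Se].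
- by apply: cont; apply: smooth_onM; [exact: S_partial|exact: Se].
apply: (le_trans (HC _ (Bd [::] / m.+1%:R * E) _ _)).
- by apply: cont_onB; apply: cont; apply: smooth_onM; [exact: smooth_tail|exact: Se|exact: S_partial|exact: Se].
- move=> p Mp; rewrite -mulrBl normrM ler_pM //; last exact: HE.
  by rewrite distrC; exact: tailP.
apply: le_trans Hn; rewrite -[leRHS]mulrA ler_wpM2l // mulrAC ler_wpM2l ?mulr_ge0 //.
by rewrite lef_pV2 ?posrE // ler_nat ltnS leq_maxl.
Qed.

End Tail.

(** * Removing high frequencies *)

Section Truncation.
Context {R : realType} {N d : nat} (M : set 'rV[R]_N).
Hypotheses (cM : compact M) (sM : smooth_submanifold d M).
Context (Ix : set nat) (lam : nat -> R) (e : nat -> 'rV[R]_N -> R).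
Hypothesis eigensystem : nonzero_eigensystem d M Ix lam e.
Local Notation I := (integral_on d M).
Local Notation X := (@X R N M).

(* No expansion in eigenfunctions is needed: the coefficients beyond q0 decay fast enough for the tail of
   the eigenfunction expansion to be small in C^1, and this tail is subtracted from f. *)
Lemma spectral_truncation f (eps : R) : smooth_on M f -> 0 < eps -> exists q0 : nat, exists g,
  [/\ smooth_on M g, (forall i, Ix i -> (q0 < i)%N -> L2_inner d M g (e i) = 0) &
    forall p, M p -> `|f p - g p| <= eps /\ forall a, `|X a f p - X a g p| <= eps].
Proof.
move=> sf eps0; have [A] := atlas_exists cM sM.
have cal := atlas_calculus A cM; have bI := integral_on_bfun A cM.
(* Indices outside Ix get the zero function, so that smoothness and the weak equation hold for every
   natural number. *)
pose e' i := if `[< Ix i >] then e i else fun _ => 0.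
have e'E i : Ix i -> e' i = e i by move=> Ii; rewrite /e' asboolT.
have Se' i : smooth_on M (e' i).
  rewrite /e'; case: asboolP => Ii; last exact: smooth_on_cst.
  by have [] := eigen_eigenfunction eigensystem Ii.
have definite (w : 'rV[R]_N -> R) : smooth_on M w -> I (fun p => w p * w p) = 0 -> forall p, M p -> w p = 0.
  move=> sw I0 p Mp; have := @integral_on_eq0 _ _ _ _ A cM (fun p => w p * w p) _ _ I0 p Mp.
  move=> H; apply/eqP; rewrite -sqrf_eq0 expr2; apply/eqP; apply: H.
    by apply: smooth_on_cont; exact: smooth_onM.
  by move=> q _; rewrite -expr2 sqr_ge0.
have weak i (g : 'rV[R]_N -> R) : smooth_on M g ->
    dot I g (fun p => lam i * e' i p) = - \sum_a dot I (X a g) (X a (e' i)).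
  move=> sg; have E : I (fun p => \sum_a X a g p * X a (e' i) p) = \sum_a dot I (X a g) (X a (e' i)).
    apply: (bfun_sum bI) => a; apply: smooth_on_cont; apply: smooth_onM; exact: (smooth_X A).
  rewrite -E /e'; case: asboolP => Ii.
    by have [_ _ H] := eigen_eigenfunction eigensystem Ii; exact: H.
  rewrite -[RHS]mulN1r -(bfunZ bI); last first.
    apply: smooth_on_cont; apply: smooth_on_sum => a; apply: smooth_onM; apply: (smooth_X A) => //.
    exact: smooth_on_cst.
  apply: integral_on_ext => p Mp; rewrite mulr0 mulr0 big1 ?mulr0 // => a _.
  by rewrite (X_cst A) // mulr0.
have orth i j : Ix i -> Ix j -> dot I (e' i) (e' j) = (i == j)%:R.
  by move=> Ii Ij; rewrite !e'E //; exact: eigen_orthonormal eigensystem i j Ii Ij.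
have /choice[B HB] : forall l, exists B : R, 0 <= B /\ forall i, Ix i -> forall p, M p ->
    `|dot I f (e' i) * Xword X l (e' i) p| <= B * (i.+1 * i.+2)%:R^-1.
  move=> l; have [B B0 HB] := eigen_series_bound cal definite (sobolev_on A cM) (eigen_index_gt0 eigensystem)
    (eigen_index_initial eigensystem) (eigen_nonincreasing eigensystem) Se' weak orth l sf.
  by exists B.
(* Dominates the bounds for the empty word and for all one-letter words: values and first
   derivatives are made small by the same q. *)
pose Bs := B [::] + \sum_(a < N) B [:: a].
have Bs0 : 0 <= Bs by rewrite addr_ge0 ?(HB _).1 // sumr_ge0 // => a _; exact: (HB _).1.
have [q Hq] := inv_small Bs0 eps0.
(* Only coefficients beyond q are kept. Subtracting their series cancels them in f, and the
   vanishing of the first ones makes the series itself small. *)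
pose c i := if `[< Ix i /\ (q < i)%N >] then dot I f (e' i) else 0.
have bound l i p : M p -> `|c i * Xword X l (e' i) p| <= B l * (i.+1 * i.+2)%:R^-1.
  move=> Mp; rewrite /c; case: asboolP => [[Ii _]|_]; first exact: (HB l).2.
  by rewrite mul0r normr0 mulr_ge0 ?invr_ge0 // (HB l).1.
have c0 j : (j <= q)%N -> c j = 0.
  by move=> jq; rewrite /c asboolF // => -[_]; rewrite ltnNge jq.
pose h := tail M e' c B [::].
have sh : smooth_on M h by exact: (smooth_tail A cM Se' bound).
have smallB l : B l <= Bs -> B l / q.+1%:R <= eps.
  by move=> BB; apply: le_trans Hq; rewrite ler_wpM2r ?invr_ge0.
have small0 : B [::] / q.+1%:R <= eps.
  by apply: smallB; rewrite lerDl sumr_ge0 // => a _; exact: (HB _).1.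
have small1 a : B [:: a] / q.+1%:R <= eps.
  apply: smallB; rewrite /Bs (bigD1 a) //= addrCA lerDl addr_ge0 ?(HB _).1 // sumr_ge0 // => b _.
  exact: (HB _).1.
exists q, (fun p => f p - h p); split.
- exact: smooth_onB.
- move=> j Ij qj; rewrite /L2_inner -(e'E j Ij).
  transitivity (dot I f (e' j) - dot I h (e' j)).
    rewrite /dot -(bfunB bI); [|by apply: smooth_on_cont; exact: smooth_onM..].
    by apply: integral_on_ext => p _; rewrite mulrBl.
  rewrite (dot_tail A cM Se' bound); first by rewrite /c asboolT ?subrr.
  move=> k; rewrite /c; case: asboolP => [[Ik qk]|nk].
    rewrite orth //; case: eqP => [->|_]; last by rewrite mulr0.
    by rewrite mulr1 asboolT.
  by rewrite mul0r; case: eqP => // kj; case: nk; rewrite kj.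
move=> p Mp; split=> [|a].
  by rewrite opprB addrC subrK; apply: le_trans small0; exact: (tail_small bound _ c0 Mp).
have -> : X a (fun p => f p - h p) p = X a f p - X a h p by exact: (X_B cal).
rewrite opprB addrC subrK (X_tail A cM Se' bound) //.
by apply: le_trans (small1 a); exact: (tail_small bound _ c0 Mp).
Qed.

End Truncation.

From mathcomp Require Import measurable_realfun.

(** * Paths and Riemannian distance *)

Section EuclideanNorm.
Context {R : realType} {n : nat}.
Implicit Types (u v : 'rV[R]_n).

Lemma enorm_ge0 u : 0 <= enorm u. Proof. exact: sqrtr_ge0. Qed.

Lemma enorm_sqr u : enorm u ^+ 2 = edot u u. Proof. by rewrite sqr_sqrtr // edot_ge0. Qed.

Lemma enorm_le u (c : R) : 0 <= c -> (enorm u <= c) = (edot u u <= c ^+ 2).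
Proof. by move=> c0; rewrite -enorm_sqr ler_pXn2r ?nnegrE // enorm_ge0. Qed.

Lemma norm_le_enorm u : `|u| <= enorm u.
Proof. by rewrite -(ler_pXn2r (n := 2)) ?nnegrE ?enorm_ge0 // enorm_sqr edot_ge_norm. Qed.

Lemma edotDl u v w : edot (u + v) w = edot u w + edot v w.
Proof. by rewrite edotC edotDr !(edotC w). Qed.

Lemma edotZl (a : R) u v : edot (a *: u) v = a * edot u v.
Proof. by rewrite edotC edotZr edotC. Qed.

Lemma enormZ (a : R) u : enorm (a *: u) = `|a| * enorm u.
Proof. by rewrite /enorm edotZl edotZr mulrA -expr2 sqrtrM ?sqr_ge0 // sqrtr_sqr. Qed.

Lemma enorm0 : enorm (0 : 'rV[R]_n) = 0.
Proof. by rewrite -(scale0r (0 : 'rV[R]_n)) enormZ normr0 mul0r. Qed.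

Lemma enormN u : enorm (- u) = enorm u.
Proof. by rewrite -scaleN1r enormZ normrN1 mul1r. Qed.

Lemma enorm_eq0 u : enorm u = 0 -> u = 0.
Proof. by move=> E; apply/eqP; rewrite -normr_le0 -E norm_le_enorm. Qed.

Lemma edot_enorm u v : `|edot u v| <= enorm u * enorm v.
Proof.
rewrite -(ler_pXn2r (n := 2)) ?nnegrE ?mulr_ge0 ?enorm_ge0 // real_normK ?num_real // exprMn !enorm_sqr.
have [v0|v0] := eqVneq (edot v v) 0.
  have -> : v = 0 by apply: enorm_eq0; rewrite /enorm v0 sqrtr0.
  by rewrite -(scale0r v) edotZr mul0r expr0n /= mulr_ge0 // edot_ge0.
have vp : 0 < edot v v by rewrite lt_def v0 edot_ge0.
have := edot_ge0 (edot v v *: u + (- edot u v) *: v).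
rewrite edotDl !edotDr !edotZl !edotZr (edotC v u).
move: vp; move: (edot v v) (edot u v) (edot u u) => a b c a0.
by rewrite (_ : _ + _ = a * (c * a - b ^+ 2)); [rewrite pmulr_rge0 // subr_ge0|ring].
Qed.

Lemma enormD u v : enorm (u + v) <= enorm u + enorm v.
Proof.
rewrite enorm_le ?addr_ge0 ?enorm_ge0 // edotDl !edotDr (edotC v u) sqrrD !enorm_sqr.
have := le_trans (ler_norm _) (edot_enorm u v); lra.
Qed.

Lemma enorm_le_norm u : enorm u <= Num.sqrt n%:R * `|u|.
Proof.
rewrite enorm_le ?mulr_ge0 ?sqrtr_ge0 // exprMn sqr_sqrtr //; exact: edot_le_norm.
Qed.

Lemma enorm_continuous : continuous (@enorm R n).
Proof.
apply: (@continuous_ball R 'rV[R]_n) => u e e0.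
exists (e / (Num.sqrt n%:R + 1)); first by rewrite divr_gt0 // ltr_wpDl // sqrtr_ge0.
move=> v; rewrite ltr_pdivlMr ?ltr_wpDl ?sqrtr_ge0 // => h.
have h1 := enormD (v - u) u; have h2 := enormD (u - v) v; rewrite !subrK in h1 h2.
have h3 := enorm_le_norm (v - u); have h4 : enorm (u - v) = enorm (v - u) by rewrite -enormN opprB.
rewrite h4 in h2; have h5 : enorm (v - u) <= e.
  by apply: (le_trans h3); rewrite mulrC; apply: le_trans (ltW h); rewrite ler_wpM2l // lerDl.
by rewrite ler_norml; apply/andP; split; lra.
Qed.

End EuclideanNorm.

Section Primitive.
Context {R : realType}.
Implicit Types (F W g : R -> R).

(** Agreement on the open interval is all that can be expected: at 0 and 1 [derive1] of a path
    depends on its meaningless values outside [0, 1]. The endpoints do not affect the integral. *)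
Lemma length_primitive g W F : (forall t : R, is_derive t (1 : R) F (W t)) -> continuous W ->
  (forall t, 0 < t < 1 -> g t = W t) -> \int[lebesgue_measure]_(t in `[0, 1]) g t = F 1 - F 0.
Proof.
move=> dF cW gW; pose mu := @lebesgue_measure R.
have iW : mu.-integrable (`[0, 1] : set R) (EFin \o W).
  apply: continuous_compact_integrable; first exact: segment_compact.
  exact: continuous_subspaceT.
pose wE : R -> \bar R := fun t => (W t)%:E; pose gE : R -> \bar R := fun t => (g t)%:E.
have mW (A : set R) : measurable A -> A `<=` `[0, 1] -> measurable_fun A wE.
  by move=> mA A01; apply: (measurable_int mu); exact: integrableS iW.
have s1 : (`]0, 1[ : set R) `<=` `[0, 1].
  by move=> t; rewrite /= !in_itv /= => /andP[? ?]; apply/andP; split; exact: ltW.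
have s2 : (`]0, 1] : set R) `<=` `[0, 1].
  by move=> t; rewrite /= !in_itv /= => /andP[? ?]; apply/andP; split=> //; exact: ltW.
have mg : measurable_fun (`]0, 1[ : set R) gE.
  apply: eq_measurable_fun (mW _ (measurable_itv _) s1) => t; rewrite inE /= in_itv /= => t01.
  by rewrite /gE gW.
have mg1 : measurable_fun (`]0, 1] : set R) gE.
  rewrite -(@setUitv1 _ _ (BRight 0) 1 true); last by rewrite bnd_simp ltr01.
  by apply/measurable_funU => //; split=> //; exact: measurable_fun_set1.
pose Ic : set R := [set` `[(0 : R), 1]]; pose Io : set R := [set` `](0 : R), 1[].
have E (h : R -> \bar R) : measurable_fun (`]0, 1] : set R) h -> measurable_fun Io h ->
    (\int[mu]_(t in Ic) h t = \int[mu]_(t in Io) h t)%E.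
  by move=> mh1 mh; rewrite /Ic /Io -(integral_itv_obnd_cbnd mh1) -(integral_itv_bndo_bndc mh).
transitivity (fine (\int[mu]_(t in Io) gE t)%E); first by rewrite -(E gE).
transitivity (fine (\int[mu]_(t in Ic) (W t)%:E)%E).
  rewrite (E wE (mW _ (measurable_itv _) s2) (mW _ (measurable_itv _) s1)); congr fine; apply: eq_integral => t; rewrite inE /Io /= in_itv /= => t01.
  by rewrite /gE gW.
rewrite (@continuous_FTC2 R W F 0 1 ltr01) //.
- by apply: continuous_subspaceT.
- split=> [t _||].
  + by case: (dF t).
  + by apply: cvg_at_right_filter; exact: is_derive_continuous (dF 0).
  + by apply: cvg_at_left_filter; exact: is_derive_continuous (dF 1).
- by move=> t _; rewrite derive1E; case: (dF t).
Qed.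

(** [antiderivative] needs compact support, so W is multiplied by a cutoff equal to 1 for t^2 <= 2
    and to 0 for t^2 >= 3. *)
Lemma primitive_exists W : continuous W ->
  exists F W', [/\ forall t : R, is_derive t (1 : R) F (W' t), continuous W' & forall t, 0 <= t <= 1 -> W' t = W t].
Proof.
move=> cW; pose k t : R := step (3 - t ^+ 2).
have ck : continuous k.
  have sq : smooth_open setT (fun t : R => 3 - t * t).
    apply: smoothB; [exact: openT|exact: smooth_cst openT|].
    by apply: smoothM; [exact: openT|exact: smooth_idfun..].
  have sk := @smooth_comp1 R _ setT setT _ openT sq (fun _ _ => Logic.I) step smooth_step.
  have E : k = (fun t : R => step (3 - t * t)) by [].
  by move=> t; rewrite E; exact: (smooth_cont sk Logic.I).
have cW' : continuous (fun t => W t * k t) by move=> t; apply: continuousM; [exact: cW|exact: ck].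
have [|F dF] := antiderivative (B := 2) cW'.
  move=> t t2; rewrite /k step_le0 ?mulr0 //.
  by rewrite -(real_normK (num_real t)); move: (`|t|) t2 => s; nra.
exists F, (fun t => W t * k t); split=> // t /andP[t0 t1]; rewrite /k step_ge1 ?mulr1 //; nra.
Qed.

Lemma derive_ge0 (f : R -> R) t : {homo f : x y / x <= y} -> derivable f t 1 -> 0 <= 'D_1 f t.
Proof.
move=> hf df; apply/ler_addgt0Pr => e e0.
have : (fun h : R => h^-1 *: (f (h *: 1 + t) - f t)) @ 0^' --> 'D_1 f t by exact: df.
move=> /cvgrPdist_le/(_ _ e0); rewrite near_withinE => /near_ball[s s0 Hs].
have s2 : 0 < s / 2 by rewrite divr_gt0.
have := Hs (s / 2); rewrite subr0 gtr0_norm // gt_eqF // => /(_ _ isT); rewrite ltr_pdivrMr // ltr_pMr // ltr1n => /(_ isT).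
rewrite ler_norml => /andP[h _]; move: h; rewrite scaleRE.
have : 0 <= (s / 2)^-1 * (f (s / 2 *: 1 + t) - f t).
  by rewrite mulr_ge0 ?invr_ge0 ?(ltW s2) // subr_ge0; apply: hf; rewrite scaleRE mulr1 lerDr ltW.
by lra.
Qed.

(** Two smooth extensions of a path have the same derivative even at an endpoint, where they agree
    on one side only. This makes the speed at the ends well defined. *)
Lemma onesided_derive {V : normedModType R} (f g : R -> V) (s r : R) : 0 <= s <= 1 -> 0 < r ->
  derivable f s 1 -> derivable g s 1 -> (forall t, 0 <= t <= 1 -> `|t - s| < r -> f t = g t) ->
  derive1 f s = derive1 g s.
Proof.
move=> /andP[s0 s1] r0 df dg fg; rewrite !derive1E; apply/eqP; rewrite -subr_eq0 -normr_le0.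
rewrite -deriveB //; apply/ler_addgt0Pr => e e0; rewrite add0r.
have dfg : derivable (f - g) s 1 by exact: derivableB.
have : (fun h : R => h^-1 *: ((f - g) (h *: 1 + s) - (f - g) s)) @ 0^' --> 'D_1 (f - g) s by exact: dfg.
move=> /cvgrPdist_le/(_ _ e0); rewrite near_withinE => /near_ball[k k0 Hk].
have Z t : 0 <= t <= 1 -> `|t - s| < r -> (f - g) t = 0 by move=> t01 tr; rewrite /= fctE fg // subrr.
pose a : R := Num.min (Num.min k r) 1 / 2.
have a0 : 0 < a by rewrite divr_gt0 // !lt_min k0 r0 ltr01.
have [ak ar a1] : [/\ a < k, a < r & a <= 2^-1].
  have m0 : 0 < Num.min (Num.min k r) 1 by rewrite !lt_min k0 r0 ltr01.
  have h : a < Num.min (Num.min k r) 1 by rewrite ltr_pdivrMr // ltr_pMr // ltr1n.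
  split; last by rewrite /a -[leRHS]mul1r ler_wpM2r // ge_min lexx orbT.
    by apply: lt_le_trans h _; rewrite !ge_min lexx.
  by apply: lt_le_trans h _; rewrite !ge_min lexx orbT.
(* The increment points into [0, 1]: to the right in the first half of the interval, to the left in
   the second. *)
have [h [hn0 hk hr h01]] : exists h : R, [/\ h != 0, `|h| < k, `|h| < r & 0 <= h + s <= 1].
  have [s2|s2] := leP s 2^-1.
    by exists a; split; rewrite ?gt_eqF ?gtr0_norm //; apply/andP; split; lra.
  by exists (- a); split; rewrite ?oppr_eq0 ?gt_eqF ?normrN ?gtr0_norm //; apply/andP; split; lra.
have := Hk h; rewrite subr0 => /(_ hk hn0).
rewrite (Z s) ?s0 // ?subrr ?normr0 // (Z (h *: 1 + s)) ?scaleRE ?mulr1 //; last by rewrite addrK.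
by rewrite subrr scaler0 subr0.
Qed.

Definition clamp (t : R) : R := Num.max 0 (Num.min 1 t).

Lemma clamp01 t : 0 <= clamp t <= 1.
Proof. by rewrite /clamp le_max lexx /= ge_max ler01 ge_min lexx. Qed.

Lemma clamp_id t : 0 <= t <= 1 -> clamp t = t.
Proof. by move=> /andP[t0 t1]; rewrite /clamp min_r // max_r. Qed.

Lemma clamp_lip s t : `|clamp s - clamp t| <= `|s - t|.
Proof.
wlog st : s t / s <= t => [H|].
  by have [/H//|/ltW/H] := leP s t; rewrite distrC [leRHS]distrC.
suff /andP[h0 h1] : 0 <= clamp t - clamp s <= t - s.
  by rewrite distrC [leRHS]distrC ger0_norm // ger0_norm // subr_ge0.
rewrite /clamp; have [s1|s1] := leP 1 s; have [t1|t1] := leP 1 t; rewrite ?(max_r ler01).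
- by apply/andP; split; lra.
- by exfalso; lra.
- by have [s0|s0] := leP 0 s; apply/andP; split; lra.
by have [s0|s0] := leP 0 s; have [t0|t0] := leP 0 t; apply/andP; split; lra.
Qed.

End Primitive.

Section Paths.
Context {R : realType} {N d : nat} (M : set 'rV[R]_N) (A : atlas d M).
Hypothesis cM : compact M.
Implicit Types (c : R -> 'rV[R]_N) (x y z p q : 'rV[R]_N) (f : 'rV[R]_N -> R).

Lemma open_unit : open [set t : R | 0 < t < 1].
Proof.
have -> : [set t : R | 0 < t < 1] = [set` `](0 : R), 1[] by apply/seteqP; split=> t; rewrite /= in_itv.
exact: itv_open.
Qed.

Lemma smooth_derive1_cont {V : normedModType R} (U : set R) (C : R -> V) s : open U -> smooth_open U C -> U s ->
  {for s, continuous (derive1 C)}.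
Proof.
move=> oU sC Us; have E : derive1 C = 'D_1 C by apply/funext => t; rewrite derive1E.
by rewrite E; exact: (@smooth_cont R R^o V U ('D_1 C) s (@smooth_derive R R^o V U C 1 sC) Us).
Qed.

(** The speed is read off local smooth extensions, where [onesided_derive] makes the choice
    immaterial, and clamping the parameter extends it continuously to the line. *)
Lemma path_speed c : smooth_on (`[0, 1] : set R) c -> exists W : R -> R, continuous W /\
  forall (s : R) (U : set R) (C : R -> 'rV[R]_N), 0 <= s <= 1 -> open U -> U s -> smooth_open U C ->
    (forall t, 0 <= t <= 1 -> U t -> c t = C t) -> W s = enorm (derive1 C s).
Proof.
move=> sc.
have /choice[UC H] : forall s : R, exists UC : set R * (R -> 'rV[R]_N), 0 <= s <= 1 ->
    [/\ open UC.1, UC.1 s, smooth_open UC.1 UC.2 & forall t, 0 <= t <= 1 -> UC.1 t -> c t = UC.2 t].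
  move=> s; have [s01|/negP ns] := boolP (0 <= s <= 1); last by exists (set0, c).
  have [|U [C [[oU Us] sC E]]] := sc s; first by rewrite /= in_itv.
  by exists (U, C) => _; split=> // t t01 Ut; apply: E => //; rewrite /= in_itv.
have uniq (s : R) (U : set R) (C : R -> 'rV[R]_N) : 0 <= s <= 1 -> open U -> U s -> smooth_open U C ->
    (forall t, 0 <= t <= 1 -> U t -> c t = C t) -> derive1 (UC s).2 s = derive1 C s.
  move=> s01 oU Us sC E; have [oU' Us' sC' E'] := H s s01.
  have [r r0 Hr] := open_ballP oU Us; have [r' r'0 Hr'] := open_ballP oU' Us'.
  apply: (onesided_derive (r := Num.min r r')) s01 _ _ _ _.
  - by rewrite lt_min r0.
  - exact: smooth_derivable sC' Us'.
  - exact: smooth_derivable sC Us.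
  by move=> t t01; rewrite lt_min => /andP[/Hr Ut /Hr' Ut']; rewrite -E // -E'.
exists (fun t => enorm (derive1 (UC (clamp t)).2 (clamp t))); split; last first.
  by move=> s U C s01 oU Us sC E; rewrite (clamp_id s01) (uniq s U C).
move=> t; have s01 := clamp01 t; have [oU Us sC E] := H _ s01.
have [r r0 Hr] := open_ballP oU Us.
apply: (@continuous_at_ball R R^o R^o) => e e0.
have cd : {for clamp t, continuous (fun s => enorm (derive1 (UC (clamp t)).2 s))}.
  apply: continuous_comp; first exact: smooth_derive1_cont oU sC Us.
  exact: enorm_continuous.
have [r' r'0 Hr'] := continuous_atP cd e0.
exists (Num.min r r'); first by rewrite lt_min r0.
move=> u; rewrite lt_min => /andP[ur ur'].
have cu : `|clamp u - clamp t| <= `|u - t| by exact: clamp_lip.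
have Uu : (UC (clamp t)).1 (clamp u) by apply: Hr; exact: le_lt_trans cu ur.
rewrite (uniq _ _ _ (clamp01 u) oU Uu sC E).
by apply: ltW; apply: Hr'; exact: le_lt_trans cu ur'.
Qed.

Lemma path_primitive c : smooth_on (`[0, 1] : set R) c -> exists F W : R -> R,
  [/\ forall t : R, is_derive t (1 : R) F (W t), path_length c = F 1 - F 0 &
  forall (s : R) (U : set R) (C : R -> 'rV[R]_N), 0 <= s <= 1 -> open U -> U s -> smooth_open U C ->
    (forall t, 0 <= t <= 1 -> U t -> c t = C t) -> W s = enorm (derive1 C s)].
Proof.
move=> sc; have [W [cW HW]] := path_speed sc; have [F [W' [dF cW' E]]] := primitive_exists cW.
exists F, W'; split=> //; last by move=> s U C s01 oU Us sC Ec; rewrite E // (HW s U C).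
apply: (length_primitive dF cW') => s /andP[s0 s1]; have s01 : 0 <= s <= 1 by rewrite !ltW.
have [|U [C [[oU Us] sC Ec]]] := sc s; first by rewrite /= in_itv.
have Ec' (t : R) : 0 <= t <= 1 -> U t -> c t = C t by move=> t01 Ut; apply: Ec => //; rewrite /= in_itv.
rewrite (E s s01) (HW s U C s01 oU Us sC Ec').
congr enorm; rewrite !derive1E; apply: near_eq_derive.
have o01 := @open_unit.
have oI := openI oU o01; apply: (open_near oI) => [|t [Ut /andP[t0 t1]]]; first by split=> //; rewrite /= s0.
by apply: Ec => //; rewrite /= in_itv /= !ltW.
Qed.

(** At interior times the extension can be shrunk until it coincides with the path, so it stays in M
    and provides admissible curves for tangent vectors and gradients. *)
Lemma path_local x y c (s : R) : path_in M x y c -> 0 < s < 1 -> exists (U : set R) (C : R -> 'rV[R]_N),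
  [/\ open U, U s, smooth_open U C, (forall t, 0 <= t <= 1 -> U t -> c t = C t) &
    (forall t, U t -> M (C t))].
Proof.
move=> [sc cinM _ _] /andP[s0 s1].
have [|U [C [[oU Us] sC Ec]]] := sc s; first by rewrite /= in_itv /= !ltW.
have o01 := @open_unit.
exists (U `&` [set t : R | 0 < t < 1]), C; split.
- exact: openI.
- by split=> //; rewrite /= s0.
- by apply: smooth_sub sC => t [].
- by move=> t t01 [Ut _]; apply: Ec => //; rewrite /= in_itv.
- move=> t [Ut /andP[t0 t1]]; have t01 : [set` `[(0 : R), 1]] t by rewrite /= in_itv /= !ltW.
  by rewrite -Ec //; apply: cinM; exists t.
Qed.

Lemma smooth_shift (U : set R) (C : R -> 'rV[R]_N) (s : R) : open U -> smooth_open U C ->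
  open [set t : R | U (s + t)] /\ smooth_open [set t : R | U (s + t)] (fun t => C (s + t)).
Proof.
move=> oU sC.
have sa : smooth_open setT (fun t : R => s + t).
  by apply: smoothD; [exact: openT|exact: smooth_cst openT|exact: smooth_idfun].
have oV : open [set t : R | U (s + t)].
  by apply: (@open_comp _ _ (fun t : R => s + t)) => // t _; exact: smooth_cont sa _.
split=> //; apply: smooth_rV => // j.
refine (@smooth_comp1 R _ _ U (fun t => s + t) oV _ _ (fun t => C t 0 j) _) => //.
  exact: smooth_sub sa.
exact: smooth_coord.
Qed.

Lemma derive_path f (U : set R) (C : R -> 'rV[R]_N) s : smooth_on M f -> open U -> smooth_open U C ->
  (forall t, U t -> M (C t)) -> U s ->
  is_derive s (1 : R) (fun t => f (C t)) (edot (gradient M f (C s)) (derive1 C s)).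
Proof.
move=> sf oU sC CM Us; have Ms := CM s Us.
have [V [F [[oV Vs] sF E]]] := sf _ Ms.
have [oU' sC'] := smooth_shift s oU sC.
have U0 : [set t : R | U (s + t)] 0 by rewrite /= addr0.
have dC : derivable C s 1 by exact: smooth_derivable sC Us.
have ct : curve_through M (C s) (fun t => C (s + t)).
  split; first by rewrite addr0.
  by exists [set t : R | U (s + t)] => //; split=> // _ [t Ut <-]; exact: CM.
have [_ HG] := gradientP A sf Ms; have := HG _ ct.
rewrite (curve_derive (conj oV Vs) sF E ct).
have -> : derive1 (fun t => C (s + t)) 0 = derive1 C s.
  rewrite !derive1E -[RHS]derive_line; congr ('D_(1 : R) _ 0); apply/funext => t.
  by rewrite scaleRE mulr1 addrC.
move=> <-; rewrite derive1E -(derive_grad _ oV sF Vs).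
have dF : differentiable F (C s) by exact: smooth_differentiable oV sF Vs.
have H := chain_rule dF dC.
have e : {near s, F \o C =1 (fun t => f (C t))}.
  have oW : open (U `&` C @^-1` V).
    rewrite openE => t [Ut Vt]; apply: filterI; first exact: open_nbhs_nbhs.
    by apply: (smooth_cont sC Ut); exact: open_nbhs_nbhs.
  by apply: (open_near oW) => [|t [Ut Vt]] //=; rewrite E //; exact: CM.
apply: DeriveDef; first exact: near_eq_derivable e (@ex_derive _ _ _ _ _ _ _ H).
by rewrite -(near_eq_derive _ e) (@derive_val _ _ _ _ _ _ _ H).
Qed.

Lemma path_lipschitz x y c f (L : R) : 0 <= L -> smooth_on M f ->
  (forall p, M p -> enorm (gradient M f p) <= L) -> path_in M x y c -> `|f y - f x| <= L * path_length c.
Proof.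
move=> L0 sf fL pc; have [sc cinM c0 c1] := pc.
(* The values a = 1 and a = -1 give the absolute value. The function [L * F t - a * f (c t)] has
   nonnegative derivative inside the interval and is continuous up to its ends. *)
suff key a : `|a| <= 1 -> a * (f y - f x) <= L * path_length c.
  rewrite ler_norml lerNl -mulN1r key ?normrN1 //.
  by rewrite -[f y - f x]mul1r key // normr1.
move=> a1; have [F [W [dF -> HW]]] := path_primitive sc.
pose G t := L * F t - a * f (c (clamp t)).
have dG (t : R) : 0 < t < 1 -> exists2 g : R, is_derive t (1 : R) G g & 0 <= g.
  move=> t01; have [U [C [oU Ut sC Ec CM]]] := path_local pc t01.
  have t01' : 0 <= t <= 1 by case/andP: t01 => ? ?; rewrite !ltW.
  have D := derive_path sf oU sC CM Ut.
  have Wt := HW t U C t01' oU Ut sC Ec.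
  exists (L * W t - a * edot (gradient M f (C t)) (derive1 C t)).
    have o01 := @open_unit.
    have e : {near t, (fun t => f (C t)) =1 (fun t => f (c (clamp t)))}.
      apply: (open_near (openI oU o01)) => [|u [Uu /andP[u0 u1]]]; first by split.
      by rewrite clamp_id ?Ec // !ltW.
    have D2 : is_derive t (1 : R) (fun t => f (c (clamp t))) (edot (gradient M f (C t)) (derive1 C t)).
      apply: DeriveDef; first exact: near_eq_derivable e (@ex_derive _ _ _ _ _ _ _ D).
      by rewrite -(near_eq_derive _ e) (@derive_val _ _ _ _ _ _ _ D).
    have D4 : is_derive t (1 : R) (fun t => a * f (c (clamp t))) (a * edot (gradient M f (C t)) (derive1 C t)).
      exact: (is_deriveZ a D2).
    have D1 := dF t.
    have D3 : is_derive t (1 : R) (fun t => L * F t) (L * W t) by exact: (is_deriveZ L D1).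
    exact: is_deriveB.
  rewrite subr_ge0 Wt (le_trans (ler_norm _)) // normrM -[leRHS]mul1r ler_pM //.
  rewrite (le_trans (edot_enorm _ _)) // ler_wpM2r ?enorm_ge0 //.
  by apply: fL; exact: CM.
have cG : continuous G.
  have cF : continuous (fun t : R => L * F t).
    by move=> t; apply: continuousM; [exact: cst_continuous|exact: is_derive_continuous (dF t)].
  suff cf : continuous (fun t : R => f (c (clamp t))).
    have caf : continuous (fun t : R => a * f (c (clamp t))).
      by move=> t; apply: continuousM; [exact: cst_continuous|exact: cf].
    by move=> t; exact: (continuousB (cF t) (caf t)).
  move=> t; have t01 := clamp01 t.
  have [|U [C [[oU Us] sC Ec]]] := sc (clamp t); first by rewrite /= in_itv.
  have MC : M (c (clamp t)) by apply: cinM; exists (clamp t) => //; rewrite /= in_itv.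
  apply: (@continuous_at_ball R R^o R^o) => e e0.
  have [r r0 Hr] := smooth_on_cont sf MC e0.
  have [r1 r10 Hr1] := continuous_atP (smooth_cont sC Us) r0.
  have [r2 r20 Hr2] := open_ballP oU Us.
  exists (Num.min r1 r2); first by rewrite lt_min r10.
  move=> u; rewrite lt_min => /andP[ur1 ur2]; have cu := clamp_lip u t; have u01 := clamp01 u.
  apply: Hr; first by apply: cinM; exists (clamp u) => //; rewrite /= in_itv.
  have Uu : U (clamp u) by apply: Hr2; exact: le_lt_trans cu ur2.
  by rewrite !Ec ?in_itv //; apply: Hr1; exact: le_lt_trans cu ur1.
have /choice[g Hg] : forall t : R, exists g : R, 0 < t < 1 -> is_derive t (1 : R) G g /\ 0 <= g.
  move=> t; have [t01|/negP n] := boolP (0 < t < 1); last by exists 0.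
  by have [g ? ?] := dG t t01; exists g.
have dGt (t : R) : t \in (`]0, 1[ : interval R) -> is_derive t (1 : R) G (g t).
  by rewrite in_itv => /Hg[].
have [|t tI E] := @MVT R G g 0 1 ltr01 dGt; first exact: continuous_subspaceT.
have : 0 <= G 1 - G 0.
  by rewrite E subr0 mulr1; move: tI; rewrite in_itv => /Hg[].
rewrite /G !clamp_id ?lexx ?ler01 // c0 c1; lra.
Qed.

Lemma path_length_le x y c (K : R) : path_in M x y c ->
  (forall t, 0 < t < 1 -> enorm (derive1 c t) <= K) -> path_length c <= K.
Proof.
move=> pc HK; have [sc cinM c0 c1] := pc.
have [F [W [dF -> HW]]] := path_primitive sc.
have [|t tI ->] := @MVT R F W 0 1 ltr01 (fun t _ => dF t).
  by apply: continuous_subspaceT => t; exact: is_derive_continuous (dF t).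
rewrite subr0 mulr1; have t01 : 0 < t < 1 by move: tI; rewrite in_itv.
have [U [C [oU Ut sC Ec CM]]] := path_local pc t01.
have t01' : 0 <= t <= 1 by case/andP: t01 => ? ?; rewrite !ltW.
rewrite (HW t U C) //; suff <- : derive1 c t = derive1 C t by exact: HK.
rewrite !derive1E; apply: near_eq_derive.
have o01 := @open_unit.
apply: (open_near (openI oU o01)) => [|u [Uu /andP[u0 u1]]]; first by split.
by rewrite Ec // !ltW.
Qed.

Lemma path_length_ge0 c : 0 <= path_length c.
Proof. by apply: Rintegral_ge0 => t _; exact: enorm_ge0. Qed.

End Paths.

Lemma smooth_affine {R : realType} (a b : R) : smooth_open setT (fun t : R => a * t + b) /\
  forall t : R, derive1 (fun t : R => a * t + b) t = a.
Proof.
have si : smooth_open setT (fun t : R => t) by exact: smooth_idfun.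
split; first by apply: smoothD; [exact: openT|exact: smoothZ openT si|exact: smooth_cst openT].
move=> t; rewrite derive1E.
have D1 : is_derive t (1 : R) (fun t : R => a * t) (a * 1) by exact: is_deriveZ.
have D2 : is_derive t (1 : R) (fun t : R => a * t + b) (a * 1 + 0) by exact: is_deriveD.
by rewrite (@derive_val _ _ _ _ _ _ _ D2) mulr1 addr0.
Qed.

Section Reparametrization.
Context {R : realType} {N : nat}.
Implicit Types (C : R -> 'rV[R]_N) (sg : R -> R).

Lemma derive_coord C (t : R) j : derivable C t 1 -> ('D_1 C t) 0 j = 'D_1 (fun t => C t 0 j) t.
Proof. by move=> dC; rewrite (derive_mx dC) mxE. Qed.

Lemma smooth_reparam (U : set R) C sg : open U -> smooth_open U C -> smooth_open setT sg ->
  [/\ open [set t : R | U (sg t)], smooth_open [set t : R | U (sg t)] (fun t => C (sg t)) &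
   forall t : R, U (sg t) -> derive1 (fun t => C (sg t)) t = derive1 sg t *: derive1 C (sg t)].
Proof.
move=> oU sC ss.
have oV : open [set t : R | U (sg t)].
  by apply: (@open_comp _ _ sg) => // t _; exact: smooth_cont ss _.
have sV : smooth_open [set t : R | U (sg t)] (fun t => C (sg t)).
  apply: smooth_rV => // j.
  refine (@smooth_comp1 R _ _ U sg oV _ _ (fun t => C t 0 j) _) => //.
    exact: smooth_sub ss.
  exact: smooth_coord.
split=> // t Ut; rewrite !derive1E.
have dC : derivable C (sg t) 1 by exact: smooth_derivable sC Ut.
have dV : derivable (fun t => C (sg t)) t 1 by exact: smooth_derivable sV Ut.
have ds : derivable sg t 1 by exact: smooth_derivable ss Logic.I.
apply/rowP => j; rewrite [RHS]mxE (derive_coord j dV) (derive_coord j dC).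
have dj : derivable (fun t => C t 0 j) (sg t) 1 by exact: smooth_derivable (smooth_coord j oU sC) Ut.
rewrite mulrC; exact: (@derive_val _ _ _ _ _ _ _ (chain_rule1 dj ds)).
Qed.

Lemma derive1_locally_cst C (U : set R) (t : R) y : open U -> U t -> (forall u, U u -> C u = y) ->
  derive1 C t = 0.
Proof.
move=> oU Ut Cy; rewrite derive1E -[RHS](derive_cst y t (1 : R)); apply: near_eq_derive.
exact: open_near oU Ut Cy.
Qed.

(** Turns the Lipschitz bound obtained from strict differentiability at one point into a bound on
    the speed of a path nearby. *)
Lemma lipschitz_derive1 C (t K r : R) : 0 < r -> derivable C t 1 ->
  (forall s, `|s - t| < r -> enorm (C s - C t) <= K * `|s - t|) -> enorm (derive1 C t) <= K.
Proof.
move=> r0 dC HK; apply/ler_addgt0Pr => e e0; rewrite derive1E.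
pose m := Num.sqrt (N%:R : R) + 1; have m0 : 0 < m by rewrite /m ltr_wpDl // sqrtr_ge0.
have : (fun h : R => h^-1 *: (C (h *: 1 + t) - C t)) @ 0^' --> 'D_1 C t by exact: dC.
have em : 0 < e / m by rewrite divr_gt0.
move=> /cvgrPdist_le/(_ _ em); rewrite near_withinE => /near_ball[k k0 Hk].
pose h := Num.min k r / 2.
have kr : 0 < Num.min k r by rewrite lt_min k0.
have h0 : 0 < h by rewrite divr_gt0.
have hm : h < Num.min k r by rewrite ltr_pdivrMr // ltr_pMr // ltr1n.
have hk : h < k by apply: lt_le_trans hm _; rewrite ge_min lexx.
have hr : h < r by apply: lt_le_trans hm _; rewrite ge_min lexx orbT.
have := Hk h; rewrite subr0 gtr0_norm // gt_eqF // => /(_ hk isT).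
rewrite scaleRE mulr1; set q := h^-1 *: _ => Hq.
have eq_ : enorm q <= K.
  rewrite enormZ gtr0_norm ?invr_gt0 // mulrC ler_pdivrMr //.
  by have := HK (h + t); rewrite addrK gtr0_norm // => /(_ hr).
have -> : 'D_1 C t = q + ('D_1 C t - q) by rewrite addrC subrK.
apply: (le_trans (enormD _ _)); rewrite lerD //; apply: (le_trans (enorm_le_norm _)).
have : m * `|'D_1 C t - q| <= e by rewrite mulrC -ler_pdivlMr.
by apply: le_trans; rewrite ler_wpM2r // lerDl.
Qed.

End Reparametrization.

(** * Concatenation of smooth paths *)

Section Joining.
Context {R : realType} {N : nat} (M : set 'rV[R]_N).
Implicit Types (c g : R -> 'rV[R]_N) (x y z p q : 'rV[R]_N).

(* Paths that rest at their endpoints can be joined smoothly; F is a primitive of the speed. *)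
Definition rest_path x y (l : R) : Prop := exists g (F : R -> R),
  [/\ smooth_open setT g, forall t, M (g t),
     forall t : R, is_derive t (1 : R) F (enorm (derive1 g t)),
     forall t, t <= 0 -> g t = x /\ F t = 0 &
     forall t, 1 <= t -> g t = y /\ F t = l].

Lemma rest_path_cst x : M x -> rest_path x x 0.
Proof.
move=> Mx; exists (fun _ => x), (fun _ => 0); split=> //; first exact: smooth_cst openT.
by move=> t; rewrite derive1_cst enorm0; exact: is_derive_cst.
Qed.

Lemma rest_path_path x y l : rest_path x y l -> exists2 c, path_in M x y c & path_length c = l.
Proof.
move=> [g [F [sg gM dF H0 H1]]]; have [g0 F0] := H0 0 (lexx _); have [g1 F1] := H1 1 (lexx _).
exists g; first split=> //.
- by move=> t _; exists setT, g; split=> //; split=> //; exact: openT.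
- by move=> _ [t _ <-]; exact: gM.
rewrite -[RHS]subr0 -{1}F1 -{1}F0; apply: (length_primitive dF) => // t.
apply: continuous_comp; first exact: smooth_derive1_cont openT sg Logic.I.
exact: enorm_continuous.
Qed.

(** Reparametrization by [step], which is constant outside [0, 1] and so brings the path to rest
    smoothly. Since [step] is nondecreasing, [F (step t)] is still a primitive of the speed and the
    length is unchanged. *)
Lemma path_rest_path x y c : path_in M x y c -> rest_path x y (path_length c).
Proof.
move=> [sc cM c0 c1]; have [F [W [dF EF HW]]] := path_primitive sc.
have s01 (t : R) : 0 <= step t <= 1 by rewrite step_ge0 step_le1.
have ds (t : R) : derivable (step : R -> R) t 1 by exact: smooth_derivable (@smooth_step R) Logic.I.
have loc (t : R) : exists (U : set R) (C : R -> 'rV[R]_N), [/\ open U, U (step t), smooth_open U C &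
    forall t : R, 0 <= t <= 1 -> U t -> c t = C t].
  have [|U [C [[oU Us] sC Ec]]] := sc (step t); first by rewrite /= in_itv /= s01.
  by exists U, C; split=> // u u01 Uu; apply: Ec => //; rewrite /= in_itv.
exists (fun t => c (step t)), (fun t => F (step t) - F 0); split.
- apply: smooth_local => t _; have [U [C [oU Ut sC Ec]]] := loc t.
  have [oV sV _] := smooth_reparam oU sC (@smooth_step R).
  exists [set t | U (step t)]; split=> //; apply: smooth_ext sV => // u Uu.
  exact: esym (Ec _ (s01 u) Uu).
- by move=> t; apply: cM; exists (step t) => //; rewrite /= in_itv /= s01.
- move=> t; have [U [C [oU Ut sC Ec]]] := loc t.
  have [oV sV dV] := smooth_reparam oU sC (@smooth_step R).
  have -> : derive1 (fun t => c (step t)) t = derive1 (fun t => C (step t)) t.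
    by rewrite !derive1E; apply: near_eq_derive; apply: (open_near oV) => // u Uu; rewrite Ec.
  rewrite dV // enormZ -(HW _ _ _ (s01 t) oU Ut sC Ec) ger0_norm; last first.
    by rewrite derive1E derive_ge0 //; exact: step_homo.
  have dFt := dF (step t).
  have D := chain_rule1 (@ex_derive _ _ _ _ _ _ _ dFt) (ds t).
  have D2 : is_derive t (1 : R) (fun t => F (step t) - F 0) ('D_1 F (step t) * 'D_1 step t - 0).
    by apply: is_deriveB.
  apply: (is_derive_eq D2); rewrite subr0 mulrC derive1E; congr (_ * _).
  exact: (@derive_val _ _ _ _ _ _ _ dFt).
- by move=> t t0; rewrite step_le0 // subrr.
- by move=> t t1; rewrite step_ge1 // EF.
Qed.

(** The first path runs over [0, 1/3] and the second over [2/3, 1]. Both descriptions are constant,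
    equal to y, on the interval between, so smoothness is a local matter. *)
Lemma rest_path_join x y z l l' : rest_path x y l -> rest_path y z l' -> rest_path x z (l + l').
Proof.
move=> [g [F [sg gM dF Hx Hy]]] [g' [F' [sg' gM' dF' Hy' Hz]]].
pose a (t : R) := 3 * t + 0; pose b (t : R) := 3 * t + (- 2).
have [sa da] := @smooth_affine R 3 0; have [sb db] := @smooth_affine R 3 (- 2).
have [_ sga dga] := smooth_reparam openT sg sa; have [_ sgb dgb] := smooth_reparam openT sg' sb.
pose k (t : R) := if t <= 2^-1 then g (a t) else g' (b t).
have ka (t : R) : t < 2 / 3 -> k t = g (a t).
  rewrite /k /a /b => t1; case: leP => // t2; have [-> _] := Hy' (3 * t + - 2) ltac:(lra).
  by have [-> _] := Hy (3 * t + 0) ltac:(lra).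
have kb (t : R) : 1 / 3 < t -> k t = g' (b t).
  rewrite /k /a /b => t1; case: leP => // t2; have [-> _] := Hy' (3 * t + - 2) ltac:(lra).
  by have [-> _] := Hy (3 * t + 0) ltac:(lra).
have oa : open [set t : R | t < 2 / 3] by exact: open_lt.
have ob : open [set t : R | 1 / 3 < t] by exact: open_gt.
exists k, (fun t => F (a t) + F' (b t)); split.
- apply: smooth_local => t _; have [t1|t1] := ltP t (2 / 3).
    exists [set t : R | t < 2 / 3]; split=> //; apply: smooth_ext (smooth_sub _ sga) => // u ul.
    by rewrite ka.
  exists [set t : R | 1 / 3 < t]; split=> //=; first lra.
  by apply: smooth_ext (smooth_sub _ sgb) => // u ul; rewrite kb.
- by move=> t; rewrite /k; case: ifP.
- move=> t.
  have dFa : is_derive t (1 : R) (fun t => F (a t)) (enorm (derive1 g (a t)) * 3).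
    have da' : derivable a t 1 by exact: smooth_derivable sa Logic.I.
    have D := chain_rule1 (@ex_derive _ _ _ _ _ _ _ (dF (a t))) da'.
    apply: (is_derive_eq D); rewrite (@derive_val _ _ _ _ _ _ _ (dF (a t))); congr (_ * _).
    by rewrite -derive1E da.
  have dFb : is_derive t (1 : R) (fun t => F' (b t)) (enorm (derive1 g' (b t)) * 3).
    have db' : derivable b t 1 by exact: smooth_derivable sb Logic.I.
    have D := chain_rule1 (@ex_derive _ _ _ _ _ _ _ (dF' (b t))) db'.
    apply: (is_derive_eq D); rewrite (@derive_val _ _ _ _ _ _ _ (dF' (b t))); congr (_ * _).
    by rewrite -derive1E db.
  have D : is_derive t (1 : R) (fun t => F (a t) + F' (b t))
      (enorm (derive1 g (a t)) * 3 + enorm (derive1 g' (b t)) * 3) by exact: is_deriveD.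
  apply: (is_derive_eq D); have [t1|t1] := ltP t (2 / 3).
    have -> : derive1 k t = 3 *: derive1 g (a t).
      rewrite -[X in X *: _](da t) -dga // !derive1E; apply: near_eq_derive.
      by apply: (open_near oa) => // u ul; rewrite ka.
    rewrite enormZ ger0_norm // [derive1 g' _](_ : _ = 0) ?enorm0 ?mul0r ?addr0 1?mulrC //.
    apply: (derive1_locally_cst (y := y) (@open_lt R 0)) => [|u ul]; first by rewrite /= /b; lra.
    by have [-> _] := Hy' u (ltW ul).
  have -> : derive1 k t = 3 *: derive1 g' (b t).
    rewrite -[X in X *: _](db t) -dgb // !derive1E; apply: near_eq_derive.
    by apply: (open_near ob) => [|u ul]; [rewrite /=; lra|rewrite kb].
  rewrite enormZ ger0_norm // [derive1 g _](_ : _ = 0) ?enorm0 ?mul0r ?add0r 1?mulrC //.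
  apply: (derive1_locally_cst (y := y) (@open_gt R 1)) => [|u ul]; first by rewrite /= /a; lra.
  by have [-> _] := Hy u (ltW ul).
- move=> t t0; have t1 : t < 2 / 3 by lra.
  rewrite (ka t t1) /a /b.
  have [-> ->] := Hx (3 * t + 0) ltac:(lra); have [_ ->] := Hy' (3 * t + - 2) ltac:(lra).
  by rewrite addr0.
- move=> t t0; have t1 : 1 / 3 < t by lra.
  rewrite (kb t t1) /a /b.
  have [_ ->] := Hy (3 * t + 0) ltac:(lra); have [-> ->] := Hz (3 * t + - 2) ltac:(lra).
  by [].
Qed.

Lemma path_join x y z c c' : path_in M x y c -> path_in M y z c' ->
  exists2 c'', path_in M x z c'' & path_length c'' = path_length c + path_length c'.
Proof.
by move=> /path_rest_path h /path_rest_path h'; exact: rest_path_path (rest_path_join h h').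
Qed.

End Joining.

Section Distance.
Context {R : realType} {N d : nat} (M : set 'rV[R]_N).
Implicit Types (c : R -> 'rV[R]_N) (x y z p q : 'rV[R]_N).

(** Strict differentiability at u0 compares both quantities with |w J|, where w is the difference of
    the parameters: the speed is at most (1 + th) |w J| and the Euclidean distance at least (1 - th)
    |w J|. *)
Lemma chart_segment (D : set 'rV[R]_d) phi u0 (eps : R) : local_parametrization M D phi -> D u0 -> 0 < eps ->
  exists2 r : R, 0 < r & forall p q, M p -> M q -> `|p - phi u0| < r -> `|q - phi u0| < r ->
    exists2 c, path_in M p q c & path_length c <= (1 + eps) * enorm (q - p).
Proof.
move=> chart Du0 eps0.
have [C C0 HC] := row_free_bound (chart_free chart Du0).
pose m := Num.sqrt (N%:R : R) + 1; have m0 : 0 < m by rewrite /m ltr_wpDl // sqrtr_ge0.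
have enm (v : 'rV[R]_N) : enorm v <= m * `|v|.
  by apply: le_trans (enorm_le_norm v) _; rewrite ler_wpM2r // lerDl.
(* Solves (1 + th) / (1 - th) = 1 + eps. Next, e is chosen so that m e C = th, with m for the
   comparison of norms and C for the Jacobian. *)
pose th := eps / (2 + eps); have th0 : 0 < th by rewrite /th divr_gt0 // addr_gt0.
have thE : th * (2 + eps) = eps by rewrite /th divfK // gt_eqF // addr_gt0.
pose e := th / (m * C); have e0 : 0 < e by rewrite /e divr_gt0 // mulr_gt0.
have [r r0 Hr] := smooth_strict_jac (chart_open chart) (chart_smooth chart) Du0 e0.
have [s s0 Hs] := chart_homeo chart Du0 r0.
exists s => // p q Mp Mq ps qs; have [u1 [Du1 <- u1r]] := Hs p Mp ps; have [u2 [Du2 <- u2r]] := Hs q Mq qs.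
pose w := u2 - u1; pose J := jacobian phi u0.
pose l (t : R) := u1 + t *: w.
have le1 (t : R) : 0 <= t <= 1 -> `|l t - u0| < r.
  move=> /andP[t0 t1]; have -> : l t - u0 = (1 - t) *: (u1 - u0) + t *: (u2 - u0).
    by apply/rowP => j; rewrite /l /w !mxE; ring.
  apply: le_lt_trans (ler_normD _ _) _; rewrite !normrZ !ger0_norm ?subr_ge0 //.
  have mr : Num.max `|u1 - u0| `|u2 - u0| < r by rewrite gt_max u1r.
  apply: le_lt_trans mr.
  have h1 : (1 - t) * `|u1 - u0| <= (1 - t) * Num.max `|u1 - u0| `|u2 - u0|.
    by rewrite ler_wpM2l ?subr_ge0 // le_max lexx.
  have h2 : t * `|u2 - u0| <= t * Num.max `|u1 - u0| `|u2 - u0|.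
    by rewrite ler_wpM2l // le_max lexx orbT.
  by apply: le_trans (lerD h1 h2) _; rewrite -mulrDl subrK mul1r.
have wJ : enorm (w *m J) * th >= m * (e * `|w|).
  have h1 : `|w| <= C * enorm (w *m J).
    by apply: le_trans (HC w) _; rewrite ler_wpM2l ?(ltW C0) // norm_le_enorm.
  have -> : th = m * e * C by rewrite /e; field; rewrite !gt_eqF.
  rewrite (_ : _ * (m * e * C) = m * (e * (C * enorm (w *m J)))); last by ring.
  by rewrite !ler_wpM2l // ltW.
pose K := enorm (w *m J) + m * (e * `|w|).
have lip (t t' : R) : `|l t - u0| < r -> `|l t' - u0| < r -> enorm (phi (l t) - phi (l t')) <= K * `|t - t'|.
  move=> tr tr'; have [_ _ H] := Hr _ _ tr tr'.
  have E : l t - l t' = (t - t') *: w by apply/rowP => j; rewrite /l !mxE; ring.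
  rewrite E in H; rewrite -scalemxAl in H.
  rewrite -[X in enorm X](subrK ((t - t') *: (w *m J))).
  apply: le_trans (enormD _ _) _; rewrite enormZ /K mulrDl addrC lerD //.
    by rewrite mulrC.
  apply: le_trans (enm _) _; rewrite -mulrA ler_wpM2l ?(ltW m0) //.
  by apply: le_trans H _; rewrite normrZ (mulrC `|t - t'|) mulrA.
have low : enorm (w *m J) - m * (e * `|w|) <= enorm (phi u2 - phi u1).
  have [_ _ H] := Hr _ _ u2r u1r.
  have h := enormD (phi u2 - phi u1) (- (phi u2 - phi u1 - (u2 - u1) *m J)).
  rewrite enormN (_ : _ + _ = (u2 - u1) *m J) in h; last by rewrite opprB addrC subrK.
  have := le_trans (enm _) (ler_wpM2l (ltW m0) H).
  rewrite -/w -/J in h *; move: h; lra.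
have lengthK : K <= (1 + eps) * enorm (phi u2 - phi u1).
  apply: (@le_trans _ _ ((1 + eps) * (enorm (w *m J) - m * (e * `|w|)))).
    rewrite /K; move: wJ; move: (m * (e * `|w|)) => a; have := enorm_ge0 (w *m J); move: (enorm _) => b b0 H.
    have : (2 + eps) * a <= eps * b.
      have -> : eps * b = (2 + eps) * (b * th) by rewrite -[in LHS]thE; ring.
      by rewrite ler_wpM2l // addr_ge0 ?ltW.
    lra.
  by rewrite ler_wpM2l // addr_ge0 ?ltW.
have sl : smooth_open setT l.
  apply: (smooth_rV openT) => j.
  have [sa _] := @smooth_affine R (w 0 j) (u1 0 j).
  by apply: smooth_ext openT _ sa => t _; rewrite /l /w !mxE; ring.
have oV : open [set t : R | `|l t - u0| < r].
  apply: (@open_comp _ _ l [set u | `|u - u0| < r]); last exact: open_norm_ball.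
  by move=> t _; exact: smooth_cont sl _.
have VD t : `|l t - u0| < r -> D (l t).
  by move=> tr; have [] := Hr _ _ tr tr.
have sV : smooth_open [set t : R | `|l t - u0| < r] (phi \o l).
  apply: (smooth_compV oV (chart_open chart)) (chart_smooth chart).
    exact: smooth_sub sl.
  exact: VD.
have pc : path_in M (phi u1) (phi u2) (phi \o l).
  split.
  - move=> t; rewrite /= in_itv => t01; exists [set t : R | `|l t - u0| < r], (phi \o l).
    by split=> //; split=> //; exact: le1.
  - by move=> _ [t t01 <-]; apply: (chart_in chart); apply: VD; apply: le1; move: t01; rewrite /= in_itv.
  - by rewrite /l /= scale0r addr0.
  - by rewrite /l /= scale1r /w addrC subrK.
exists (phi \o l) => //; apply: le_trans lengthK; apply: (path_length_le pc) => t /andP[t0 t1].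
have tr : `|l t - u0| < r by apply: le1; rewrite !ltW.
have [k k0 Hk] := open_ballP oV tr.
apply: (lipschitz_derive1 k0) => [|s' s'k]; first exact: smooth_derivable sV tr.
by apply: lip => //; exact: Hk.
Qed.

Hypotheses (cM : compact M) (sM : smooth_submanifold d M).

Lemma short_path (eps : R) : 0 < eps -> exists2 dl : R, 0 < dl & forall p q, M p -> M q -> `|q - p| < dl ->
  exists2 c, path_in M p q c & path_length c <= (1 + eps) * enorm (q - p).
Proof.
move=> eps0.
have [] := @compact_unif R 'rV[R]_N M (fun s p => M p -> forall q, M q -> `|q - p| < s ->
  exists2 c, path_in M p q c & path_length c <= (1 + eps) * enorm (q - p)) cM.
  move=> x Mx; have [D [phi [chart [u0 Du0 ux]]]] := sM Mx.
  have [r r0 H] := chart_segment chart Du0 eps0; rewrite ux in H.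
  exists (r / 2); first by rewrite divr_gt0.
  move=> p s pr /andP[s0 sr] Mp q Mq qs; apply: H => //; first lra.
  have -> : q - x = (q - p) + (p - x) by rewrite addrA subrK.
  by apply: le_lt_trans (ler_normD _ _) _; lra.
move=> r r0 H; exists (r / 2); first by rewrite divr_gt0.
move=> p q Mp Mq; apply: (H (r / 2)) => //; apply/andP; split; first by rewrite divr_gt0.
by rewrite ltr_pdivrMr // ltr_pMr // ltr1n.
Qed.

(** The points reachable from x are open and closed in M, because points closer than the uniform
    [dl] are joined by a path. *)
Lemma path_exists x y : connected M -> M x -> M y -> exists c, path_in M x y c.
Proof.
move=> conM Mx My; have [dl dl0 H] := short_path ltr01.
pose B := [set q | M q /\ exists c, path_in M x q c].
have step p q : M p -> M q -> `|q - p| < dl -> (exists c, path_in M x p c) -> exists c, path_in M x q c.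
  move=> Mp Mq pq [c hc]; have [c' hc' _] := H p q Mp Mq pq.
  by have [c'' ? _] := path_join hc hc'; exists c''.
have oU (P : set 'rV[R]_N) : open (\bigcup_(p in P) [set q : 'rV[R]_N | `|q - p| < dl]).
  by apply: bigcup_open => p _; exact: open_norm_ball.
suff : B y by case.
have -> // : B = M; apply: conM.
- by exists x; split=> //; have [c ? _] := rest_path_path (rest_path_cst Mx); exists c.
- exists (\bigcup_(p in B) [set q : 'rV[R]_N | `|q - p| < dl]) => //.
  apply/seteqP; split=> q.
    by move=> [Mq hq]; split=> //; exists q; rewrite /= ?subrr ?normr0.
  by move=> [Mq [p [Mp hp] pq]]; split=> //; exact: step pq hp.
- exists (~` \bigcup_(p in M `\` B) [set q : 'rV[R]_N | `|q - p| < dl]).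
    by apply: open_closedC.
  apply/seteqP; split=> q.
    move=> [Mq hq]; split=> // -[p [Mp np] pq]; apply: np; split=> //.
    by apply: step hq => //; rewrite distrC.
  move=> [Mq nq]; apply: contrapT => nB; apply: nq; exists q => //.
  by rewrite /= subrr normr0.
Qed.

Lemma lengths_lbound x y : lbound [set path_length c | c in path_in M x y] 0.
Proof. by move=> _ [c _ <-]; exact: path_length_ge0. Qed.

Lemma dist_le x y c : path_in M x y c -> riemannian_dist M x y <= path_length c.
Proof. by move=> pc; apply: ge_inf; [exists 0; exact: lengths_lbound|exists c]. Qed.

Lemma dist_refl x : M x -> riemannian_dist M x x <= 0.
Proof.
move=> Mx; have [c pc lc] := rest_path_path (rest_path_cst Mx).
by rewrite -lc; exact: dist_le.
Qed.

(** An almost minimal path to p is prolonged by a short path from p to q. This local inequality is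
    the only input of the smoothing. *)
Lemma dist_step (eps : R) x : connected M -> M x -> 0 < eps ->
  exists2 dl : R, 0 < dl & forall p q, M p -> M q -> `|q - p| < dl ->
    riemannian_dist M x q <= riemannian_dist M x p + (1 + eps) * enorm (q - p).
Proof.
move=> conM Mx eps0; have [dl dl0 H] := short_path eps0; exists dl => // p q Mp Mq pq.
have [c' hc' lc'] := H p q Mp Mq pq; apply/ler_addgt0Pr => e e0.
have hinf : has_inf [set path_length c | c in path_in M x p].
  split; last by exists 0; exact: lengths_lbound.
  by have [c hc] := path_exists conM Mx Mp; exists (path_length c), c.
have [_ [c hc <-] lc] := inf_adherent e0 hinf.
have [c'' hc'' E] := path_join hc hc'.
apply: (le_trans (dist_le hc'')); rewrite E [leRHS]addrAC; apply: lerD => //.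
exact: ltW.
Qed.

End Distance.

(** * Smoothing the distance by a soft minimum *)

Section SquaredDistance.
Context {R : realType} {N : nat}.
Implicit Types (p z v : 'rV[R]_N).

Definition sqdist p z : R := edot (z - p) (z - p).

Lemma smooth_sqdist p : smooth_open setT (sqdist p).
Proof. exact: smooth_edot. Qed.

Lemma sqdist_ge0 p z : 0 <= sqdist p z. Proof. exact: edot_ge0. Qed.

Lemma derive_sqdist p z v : 'D_v (sqdist p) z = 2 * edot (z - p) v.
Proof.
rewrite -derive_line.
have -> : (fun t : R => sqdist p (t *: v + z)) =
    (fun t : R => (edot v v * t + 2 * edot (z - p) v) * t + sqdist p z).
  apply/funext => t; rewrite /sqdist -addrA; move: (z - p) => w.
  rewrite edotDl !edotDr !edotZr (edotC (t *: v) v) (edotC (t *: v) w) !edotZr; ring.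
have [sa da] := @smooth_affine R (edot v v) (2 * edot (z - p) v).
have D1 : is_derive (0 : R) (1 : R) (fun t : R => edot v v * t + 2 * edot (z - p) v) (edot v v).
  by apply: DeriveDef; [exact: smooth_derivable sa Logic.I|rewrite -derive1E da].
have D2 : is_derive (0 : R) (1 : R) (fun t : R => t) 1 by exact: is_derive_id.
have D3 := is_deriveM D1 D2; have D4 := is_deriveD D3 (is_derive_cst (sqdist p z) (0 : R) (1 : R)).
by rewrite (@derive_val _ _ _ _ _ _ _ D4) !scaleRE mulr0 add0r mulr1 mul0r !addr0.
Qed.

Definition smooth_dist (s : R) p z : R := Num.sqrt (sqdist p z + s ^+ 2).

Variable s : R.
Hypothesis s0 : 0 < s.

Lemma smooth_dist_arg p z : 0 < sqdist p z + s ^+ 2.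
Proof. by rewrite ltr_wpDl ?sqdist_ge0 // exprn_gt0. Qed.

Lemma smooth_smooth_dist p : smooth_open setT (smooth_dist s p).
Proof.
refine (@smooth_comp1 R _ setT [set x | 0 < x] (fun z => sqdist p z + s ^+ 2) openT _ _ (@Num.sqrt R) (@smooth_sqrt R)).
  apply: smoothD; [exact: openT|exact: smooth_sqdist|exact: smooth_cst openT].
by move=> z _; exact: smooth_dist_arg.
Qed.

Lemma smooth_dist_gt0 p z : 0 < smooth_dist s p z.
Proof. by rewrite sqrtr_gt0 smooth_dist_arg. Qed.

Lemma enorm_le_smooth_dist p z : enorm (z - p) <= smooth_dist s p z.
Proof. by rewrite /enorm ler_wsqrtr // lerDl exprn_ge0 // ltW. Qed.

(* Differentiating the square of [smooth_dist] avoids the derivative of the square root. *)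
Lemma derive_smooth_dist p z v : `|'D_v (smooth_dist s p) z| <= enorm v.
Proof.
have g0 := smooth_dist_gt0 p z; have sg := smooth_smooth_dist p.
have dg : derivable (smooth_dist s p) z v by exact: smooth_derivable sg Logic.I.
have D1 : is_derive z v (smooth_dist s p) ('D_v (smooth_dist s p) z) by apply: DeriveDef.
have D2 := is_deriveM D1 D1.
have dQ : derivable (sqdist p) z v by exact: smooth_derivable (smooth_sqdist p) Logic.I.
have D3 : is_derive z v (sqdist p) ('D_v (sqdist p) z) by apply: DeriveDef.
have D4 := is_deriveD D3 (is_derive_cst (s ^+ 2) z v).
have E : smooth_dist s p * smooth_dist s p = sqdist p + cst (s ^+ 2).
  by apply/funext => y; rewrite !fctE -expr2 sqr_sqrtr // ltW // smooth_dist_arg.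
have := @derive_val _ _ _ _ _ _ _ D2; rewrite E (@derive_val _ _ _ _ _ _ _ D4) derive_sqdist addr0 !scaleRE => H.
have K : smooth_dist s p z * `|'D_v (smooth_dist s p) z| = `|edot (z - p) v|.
  rewrite -[X in X * _](gtr0_norm g0) -normrM; congr `|_|; move: H; lra.
rewrite -(ler_pM2l g0) K (le_trans (edot_enorm _ _)) // ler_wpM2r ?enorm_ge0 //.
exact: enorm_le_smooth_dist.
Qed.

End SquaredDistance.

Section SoftMinimum.
Context {R : realType} {N n : nat} (b phi : 'I_n -> 'rV[R]_N -> R) (h : R).
Hypotheses (h0 : 0 < h) (sb : forall j, smooth_open setT (b j)) (sphi : forall j, smooth_open setT (phi j)).
Implicit Types (p z v : 'rV[R]_N).

Definition boltzmann j z : R := expR (- phi j z / h).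
Definition partition_sum z : R := \sum_(j < n) b j z * boltzmann j z.
Definition softmin z : R := - h * ln (partition_sum z).

Lemma smooth_boltzmann j : smooth_open setT (boltzmann j).
Proof.
refine (@smooth_comp1 R _ setT setT (fun z => - phi j z / h) openT _ _ expR (@smooth_exp R)) => //.
by apply: smoothM; [exact: openT|exact: smoothN openT _|exact: smooth_cst openT].
Qed.

Lemma smooth_partition_sum : smooth_open setT partition_sum.
Proof.
apply: (smooth_sum _ openT) => j; apply: smoothM; [exact: openT|exact: sb|exact: smooth_boltzmann].
Qed.

Lemma smooth_softmin : open [set z | 0 < partition_sum z] /\ smooth_open [set z | 0 < partition_sum z] softmin.
Proof.
have oU : open [set z | 0 < partition_sum z].
  apply: (@open_comp _ _ partition_sum [set x : R | 0 < x]); last exact: open_gt.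
  by move=> z _; exact: smooth_cont smooth_partition_sum _.
split; first exact: oU.
apply: smoothZ (oU) _.
refine (@smooth_comp1 R _ [set z | 0 < partition_sum z] [set x | 0 < x] partition_sum oU _ _ (@ln R) (@smooth_ln R)) => //.
exact: smooth_sub smooth_partition_sum.
Qed.

Lemma derive_boltzmann j p v : is_derive p v (boltzmann j) (- (boltzmann j p * 'D_v (phi j) p / h)).
Proof.
have dphi : derivable (phi j) p v by exact: smooth_derivable (sphi j) Logic.I.
have sa : smooth_open setT (fun z => - h^-1 * phi j z) by exact: smoothZ openT (sphi j).
have D1 : is_derive p v (phi j) ('D_v (phi j) p) by apply: DeriveDef.
have D2 := is_deriveZ (- h^-1) D1.
have D3 := chain_rule1 (@ex_derive _ _ _ _ _ _ _ (is_derive_expR _)) (@ex_derive _ _ _ _ _ _ _ D2).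
have E : expR \o (- h^-1 \*: phi j) = boltzmann j.
  by apply/funext => z; rewrite /boltzmann /= scaleRE mulNr mulrC -mulNr.
rewrite -E; apply: (is_derive_eq D3).
rewrite (@derive_val _ _ _ _ _ _ _ (is_derive_expR _)) (@derive_val _ _ _ _ _ _ _ D2) scaleRE.
rewrite -/((expR \o (- h^-1 \*: phi j)) p) E; ring.
Qed.

Lemma derive_softmin p v : 0 < partition_sum p -> 'D_v softmin p =
  (\sum_(j < n) (b j p * boltzmann j p * 'D_v (phi j) p - h * 'D_v (b j) p * boltzmann j p)) / partition_sum p.
Proof.
move=> S0.
have Db j : is_derive p v (b j) ('D_v (b j) p).
  by apply: DeriveDef => //; exact: smooth_derivable (sb j) Logic.I.
have D1 j := is_deriveM (Db j) (derive_boltzmann j p v).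
have D2 := is_derive_sum D1.
have E : \sum_(j < n) b j * boltzmann j = partition_sum.
  by apply/funext => z; rewrite /partition_sum fct_sumE.
rewrite E in D2.
have D3 := chain_rule1 (@ex_derive _ _ _ _ _ _ _ (is_derive1_ln S0)) (@ex_derive _ _ _ _ _ _ _ D2).
have D4 := is_deriveZ (- h) D3.
have -> : softmin = - h \*: (@ln R \o partition_sum) by [].
rewrite (@derive_val _ _ _ _ _ _ _ D4) (@derive_val _ _ _ _ _ _ _ (is_derive1_ln S0)) (@derive_val _ _ _ _ _ _ _ D2).
rewrite scaleRE mulrCA mulrC mulr_sumr; congr (_ / _); apply: eq_bigr => j _.
rewrite !scaleRE; field; exact: lt0r_neq0.
Qed.

(** The derivative is an average of the ['D_v (phi j) p] with weights [b j p * boltzmann j p], plus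
    a term from the cutoffs. The latter involves only indices whose cutoff varies at p, where the
    Boltzmann factor is at most a fraction th of the total. *)
Lemma derive_softmin_le p v (K th B : R) : 0 < partition_sum p -> (forall j, 0 <= b j p) ->
  (forall j, b j p != 0 -> `|'D_v (phi j) p| <= K) ->
  (forall j, 'D_v (b j) p != 0 -> boltzmann j p <= th * partition_sum p) ->
  \sum_(j < n) `|'D_v (b j) p| <= B -> 0 <= th -> `|'D_v softmin p| <= K + h * th * B.
Proof.
move=> S0 b0 HK Hth HB th0; rewrite derive_softmin // normrM normfV (gtr0_norm S0) ler_pdivrMr //.
apply: le_trans (ler_norm_sum _ _ _) _.
apply: (@le_trans _ _ (\sum_(j < n) (K * (b j p * boltzmann j p) + h * th * partition_sum p * `|'D_v (b j) p|))).
  apply: ler_sum => j _; apply: le_trans (ler_normB _ _) _; apply: lerD.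
    have [->|bj] := eqVneq (b j p) 0; first by rewrite !mul0r normr0 mulr0.
    rewrite normrM mulrC [X in _ * X]ger0_norm; last by rewrite mulr_ge0 // expR_ge0.
    by rewrite ler_wpM2r ?HK // mulr_ge0 // expR_ge0.
  have [->|dj] := eqVneq ('D_v (b j) p) 0; first by rewrite mulr0 mul0r normr0 mulr0.
  rewrite !normrM (gtr0_norm h0) (ger0_norm (expR_ge0 _)) -!mulrA ler_pM2l //.
  by rewrite mulrC mulrA ler_wpM2r // Hth.
rewrite big_split /= -!mulr_sumr mulrDl lerD //.
rewrite mulrAC; apply: ler_wpM2r; first exact: ltW.
by apply: ler_wpM2l => //; apply: mulr_ge0 => //; exact: ltW.
Qed.

End SoftMinimum.

Section GradientBound.
Context {R : realType} {N d : nat} (M : set 'rV[R]_N) (A : atlas d M).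

(** The bound is tested on v equal to the gradient g itself: g is tangent, so ['D_g f p] is the
    square of its norm. *)
Lemma gradient_le (f : 'rV[R]_N -> R) (U : set 'rV[R]_N) p (K : R) : open U -> smooth_open U f -> U p -> M p ->
  smooth_on M f -> 0 <= K -> (forall v, 'D_v f p <= K * enorm v) -> enorm (gradient M f p) <= K.
Proof.
move=> oU sf Up Mp sM K0 HK; have [[c cc E] Hg] := gradientP A sM Mp; set g := gradient M f p in E Hg *.
have := Hg c cc; rewrite (curve_derive (conj oU Up) sf (fun _ _ _ => erefl) cc) E.
rewrite -(derive_grad _ oU sf Up) => gg; have := HK g; rewrite gg -enorm_sqr expr2.
have [->|g0] := eqVneq (enorm g) 0; first by [].
by rewrite ler_pM2r // lt_def g0 enorm_ge0.
Qed.

End GradientBound.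

Section SmoothApproximation.
Context {R : realType} {N d : nat} (M : set 'rV[R]_N) (A : atlas d M).
Hypothesis cM : compact M.
Implicit Types (p z v q : 'rV[R]_N).

Lemma derive_locally_cst {V : normedModType R} (f : V -> R) (U : set V) (x v : V) (a : R) : open U -> U x ->
  (forall y, U y -> f y = a) -> 'D_v f x = 0.
Proof.
move=> oU Uz fa; rewrite -[RHS](derive_cst a x v); apply: near_eq_derive.
exact: open_near oU Uz fa.
Qed.

(** A cutoff varies only on an annulus, and there the penalty c |z - q|^2 is at least c r^2. *)
Lemma derive_bump q (r : R) z v : 0 < r -> 'D_v (bump q r) z != 0 -> r ^+ 2 <= sqdist q z <= 2 * r ^+ 2.
Proof.
move=> r0 D0; apply/andP; split; rewrite leNgt; apply: contraNN D0 => H; apply/eqP.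
  apply: (@derive_locally_cst _ (bump q r) [set y | sqdist q y < r ^+ 2] z v 1) => //.
    exact: open_edot_ball.
  by move=> y /ltW; exact: bump_eq1.
apply: (@derive_locally_cst _ (bump q r) [set y | 2 * r ^+ 2 < sqdist q y] z v 0) => //.
  apply: (@open_comp _ _ (sqdist q) [set x : R | 2 * r ^+ 2 < x]); last exact: open_gt.
  by move=> y _; exact: smooth_cont (smooth_sqdist q) _.
by move=> y /ltW; exact: bump_eq0.
Qed.

Lemma expRN_le (x : R) : 0 < x -> expR (- x) <= x^-1.
Proof.
move=> x0; rewrite expRN lef_pV2 ?posrE ?expR_gt0 //.
by apply: le_trans (expR_ge1Dx x); rewrite lerDr.
Qed.

Lemma cont_grad_norm n (b : 'I_n -> 'rV[R]_N -> R) : (forall j, smooth_open setT (b j)) ->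
  cont_on M (fun p => \sum_(j < n) enorm (grad (b j) p)).
Proof.
move=> sb; apply: cont_on_sum => j; apply: continuous_cont_on => p.
apply: continuous_comp; last exact: enorm_continuous.
apply: rV_continuous_at => k.
have -> : (fun y => grad (b j) y 0 k) = pd k (b j) by apply/funext => y; rewrite mxE.
exact: (smooth_cont (smooth_derive _ (sb j)) Logic.I).
Qed.

(** A net point within eta of p gives a term of height at most rr p + kap, and every term present at
    p has height at least rr p by the one-step inequality; so the soft minimum is close to rr. Where
    a cutoff varies, the quadratic penalty lifts its term by at least a = c r^2, which makes its
    weight tiny. *)
Lemma smooth_approx (rr : 'rV[R]_N -> R) (eps dl : R) : 0 < eps <= 1 -> 0 < dl ->
  (forall p q, M p -> M q -> `|q - p| < dl -> rr q <= rr p + (1 + eps) * enorm (q - p)) ->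
  exists f, smooth_on M f /\ forall p, M p -> `|f p - rr p| <= eps /\ enorm (gradient M f p) <= 1 + 3 * eps.
Proof.
move=> /andP[eps0 eps1] dl0 H.
(* The bumps have support of radius sqrt 2 r < dl, within reach of the one-step inequality. *)
pose r := dl / 2; have r0 : 0 < r by rewrite divr_gt0.
have dlE : dl = 2 * r by rewrite /r mulrC divfK.
(* On the support of a bump |z - q| <= 3 r / 2, so the penalty adds at most 2 c (3 r / 2) = eps to
   the derivative. *)
clearbody r; pose c := eps / (3 * r); have c0 : 0 < c by rewrite divr_gt0 // mulr_gt0.
have cr : c * r = eps / 3 by rewrite /c; field; rewrite gt_eqF.
clearbody c; pose a := c * r ^+ 2; have a0 : 0 < a by rewrite mulr_gt0 // exprn_gt0.
(* The admissible excess of the best term over rr: at most eps for the approximation, at most a / 2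
   to keep a gap on the annuli. *)
pose kap := Num.min eps (a / 2); have kap0 : 0 < kap by rewrite lt_min eps0 divr_gt0.
have kape : kap <= eps by rewrite ge_min lexx.
have kapa : kap <= a / 2 by rewrite ge_min lexx orbT.
have c6 : 0 < 6 + c by rewrite addr_gt0.
(* The excess at a net point is at most 2 eta from the one-step inequality, 4 eta from the
   regularized distance and c eta from the penalty, as eta^2 <= eta. *)
pose eta := Num.min (Num.min 1 r) (kap / (6 + c)).
have eta0 : 0 < eta by rewrite !lt_min ltr01 r0 divr_gt0.
have eta1 : eta <= 1 by rewrite !ge_min lexx.
have etar : eta <= r by rewrite !ge_min lexx orbT.
have etak : (6 + c) * eta <= kap by rewrite mulrC -ler_pdivlMr // ge_min lexx orbT.
have Uq q : M q -> open [set z | edot (z - q) (z - q) < eta ^+ 2] /\ [set z | edot (z - q) (z - q) < eta ^+ 2] q.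
  move=> _; split; first exact: open_edot_ball.
  by rewrite /= subrr /edot big1 ?exprn_gt0 // => i _; rewrite mxE mul0r.
have [n [q_ [Mq cover]]] := @finite_nbhs_cover R 'rV[R]_N M _ cM Uq.
pose b (j : 'I_n) := bump (q_ j) r.
pose phi (j : 'I_n) z := rr (q_ j) + ((1 + eps) * smooth_dist eta (q_ j) z + c * sqdist (q_ j) z).
have sb j : smooth_open setT (b j) by exact: smooth_bump.
have sphi j : smooth_open setT (phi j).
  apply: smoothD; [exact: openT|exact: smooth_cst openT|].
  apply: smoothD; [exact: openT|exact: smoothZ openT (smooth_smooth_dist eta0 _)|].
  exact: smoothZ openT (smooth_sqdist _).
have [C C0 HC] := cont_on_bounded cM (cont_grad_norm sb).
(* The summand n gives n <= 1 + eps / h <= exp (eps / h), so that having n terms lowers the minimum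
   by at most eps; 2 C / a controls the derivatives of the cutoffs. *)
pose h := Num.min 1 (eps / (1 + n%:R + 2 * C / a)).
have Ca : 0 <= 2 * C / a by apply: divr_ge0; [exact: mulr_ge0|exact: ltW].
have den : 0 < 1 + n%:R + 2 * C / a by rewrite ltr_wpDr // ltr_wpDr.
have h0 : 0 < h by rewrite lt_min ltr01 divr_gt0.
have h1 : h <= 1 by rewrite ge_min lexx.
have hden : h * (1 + n%:R + 2 * C / a) <= eps by rewrite -ler_pdivlMr // ge_min lexx orbT.
have hn : h * n%:R <= eps.
  apply: le_trans hden; rewrite ler_pM2l // -addrA addrCA lerDl addr_ge0 //.
have hC : h * (2 * C / a) <= eps.
  by apply: le_trans hden; rewrite ler_pM2l // lerDr addr_ge0.
pose S := partition_sum b phi h; pose f := softmin b phi h.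
have near2 j p : M p -> sqdist (q_ j) p <= 2 * r ^+ 2 -> rr p + c * sqdist (q_ j) p <= phi j p.
  move=> Mp Q; rewrite /phi addrA lerD2r.
  have pq : `|p - q_ j| < dl.
    apply: norm_lt_edot dl0 _; apply: le_lt_trans Q _.
    have r2 : 0 < r ^+ 2 by exact: exprn_gt0.
    by rewrite dlE exprMn; move: (r ^+ 2) r2 => r2; lra.
  apply: le_trans (H _ _ (Mq j) Mp pq) _; rewrite lerD2l ler_wpM2l ?addr_ge0 ?(ltW eps0) //.
  exact: enorm_le_smooth_dist.
have b0 j p : 0 <= b j p by exact: bump_ge0.
have Sge p : M p -> expR (- (rr p + kap) / h) <= S p.
  move=> Mp; have [j /= Qj] := cover p Mp.
  have bj : b j p = 1.
    by apply: bump_eq1 => //; apply: le_trans (ltW Qj) _; rewrite ler_pXn2r // nnegrE; exact: ltW.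
  have ej : enorm (q_ j - p) <= eta by rewrite -enormN opprB enorm_le; exact: ltW.
  have sj : smooth_dist eta (q_ j) p <= 2 * eta.
    rewrite /smooth_dist -(ger0_norm (x := 2 * eta)) ?mulr_ge0 ?(ltW eta0) // -sqrtr_sqr ler_wsqrtr //.
    by rewrite exprMn; move: Qj; rewrite -/(sqdist (q_ j) p); have := sqr_ge0 eta; lra.
  have qj : sqdist (q_ j) p <= eta.
    by apply: le_trans (ltW Qj) _; rewrite expr2 ger_pMr.
  have pj : phi j p <= rr p + kap.
    have pq : `|q_ j - p| < dl.
      apply: le_lt_trans (norm_le_enorm _) _; apply: le_lt_trans ej _; apply: le_lt_trans etar _.
      by rewrite dlE ltr_pMl // ltr1n.
    have h2 := H _ _ Mp (Mq j) pq.
    have h3 : (1 + eps) * enorm (q_ j - p) <= 2 * eta.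
      by rewrite ler_pM ?addr_ge0 ?enorm_ge0 ?(ltW eps0) //; lra.
    have h4 : (1 + eps) * smooth_dist eta (q_ j) p <= 2 * (2 * eta).
      by rewrite ler_pM ?addr_ge0 ?(ltW eps0) ?(ltW (smooth_dist_gt0 eta0 _ _)) //; lra.
    have h5 : c * sqdist (q_ j) p <= c * eta by rewrite ler_pM2l.
    have h6 := etak; rewrite mulrDl in h6; rewrite /phi; move: h2 h3 h4 h5 h6.
    move: ((1 + eps) * enorm _) ((1 + eps) * smooth_dist _ _ _) (c * sqdist _ _) (c * eta) => x1 x2 x3 x4; lra.
  rewrite /S /partition_sum (bigD1 j) //= bj mul1r -[leLHS]addr0 lerD //.
    by rewrite ler_expR ler_pM2r ?invr_gt0 // lerN2.
  by apply: sumr_ge0 => i _; rewrite mulr_ge0 // expR_ge0.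
have S0 p : M p -> 0 < S p by move=> Mp; apply: lt_le_trans (expR_gt0 _) (Sge p Mp).
have Sle p : M p -> S p <= expR ((eps - rr p) / h).
  move=> Mp; apply: (@le_trans _ _ (n%:R * expR (- rr p / h))).
    rewrite mulr_natl -[n in _ *+ n]card_ord -sumr_const; apply: ler_sum => j _.
    have [->|bj] := eqVneq (b j p) 0; first by rewrite mul0r expR_ge0.
    have Qj := ltW (bump_neq0 r0 bj).
    apply: (@le_trans _ _ (1 * boltzmann phi h j p)); first by rewrite ler_wpM2r ?expR_ge0 // step_le1.
    rewrite mul1r ler_expR ler_pM2r ?invr_gt0 // lerN2.
    by apply: le_trans (near2 j p Mp Qj); rewrite lerDl mulr_ge0 ?sqdist_ge0 // ltW.
  rewrite mulrDl expRD ler_wpM2r ?expR_ge0 //; apply: le_trans (expR_ge1Dx _).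
  rewrite -[leLHS]add0r lerD // ler_pdivlMr // mulrC //.
have sf : smooth_on M f.
  have [oU sU] := @smooth_softmin R N n b phi h sb sphi => p Mp.
  by exists [set z | 0 < partition_sum b phi h z], f; split=> //; split=> //; exact: S0.
exists f; split=> // p Mp; split.
  have lnS : - (rr p + kap) / h <= ln (S p) <= (eps - rr p) / h.
    rewrite -(expRK (- (rr p + kap) / h)) -(expRK ((eps - rr p) / h)).
    by rewrite !ler_ln ?posrE ?expR_gt0 ?S0 // Sge // Sle.
  have : - (rr p + kap) <= h * ln (S p) <= eps - rr p.
    by move: lnS; rewrite ler_pdivrMr // ler_pdivlMr // ![_ * h]mulrC.
  rewrite /f /softmin -/S mulNr ler_norml => /andP[? ?]; apply/andP; split; lra.
have [oU sU] := @smooth_softmin R N n b phi h sb sphi.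
apply: (gradient_le A oU sU (S0 p Mp) Mp sf) => [|v]; first lra.
have v0 := enorm_ge0 v.
have HK j : b j p != 0 -> `|'D_v (phi j) p| <= (1 + 2 * eps) * enorm v.
  move=> bj; have Qj := ltW (bump_neq0 r0 bj).
  have D1 : is_derive p v (smooth_dist eta (q_ j)) ('D_v (smooth_dist eta (q_ j)) p).
    by apply: DeriveDef => //; exact: smooth_derivable (smooth_smooth_dist eta0 _) Logic.I.
  have D2 : is_derive p v (sqdist (q_ j)) ('D_v (sqdist (q_ j)) p).
    by apply: DeriveDef => //; exact: smooth_derivable (smooth_sqdist _) Logic.I.
  have D3 := is_deriveD (is_derive_cst (rr (q_ j)) p v) (is_deriveD (is_deriveZ (1 + eps) D1) (is_deriveZ c D2)).
  have -> : phi j = cst (rr (q_ j)) + ((1 + eps) \*: smooth_dist eta (q_ j) + c \*: sqdist (q_ j)) by [].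
  rewrite (@derive_val _ _ _ _ _ _ _ D3) !scaleRE add0r derive_sqdist.
  apply: le_trans (ler_normD _ _) _; have e1p : 0 < 1 + eps by rewrite addr_gt0.
  rewrite !normrM (gtr0_norm c0) (gtr0_norm e1p) (gtr0_norm (ltr0n R 2 : 0 < 2)).
  have e3 : enorm (p - q_ j) <= 3 / 2 * r.
    rewrite enorm_le ?mulr_ge0 ?(ltW r0) // exprMn; apply: le_trans Qj _.
    by have := sqr_ge0 r; lra.
  have h2 := derive_smooth_dist eta0 (q_ j) p v.
  have h3 : (1 + eps) * `|'D_v (smooth_dist eta (q_ j)) p| <= (1 + eps) * enorm v.
    by rewrite ler_wpM2l // addr_ge0 // ltW.
  have h4 : c * (2 * `|edot (p - q_ j) v|) <= eps * enorm v.
    apply: (@le_trans _ _ (c * (2 * (3 / 2 * r * enorm v)))).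
      rewrite ler_pM2l // ler_pM2l //; apply: le_trans (edot_enorm _ _) _.
      by rewrite ler_wpM2r.
    rewrite (_ : c * _ = 3 * (c * r) * enorm v); last by field.
    by rewrite cr mulrC [3 * _]mulrC divfK // mulrC.
  by apply: le_trans (lerD h3 h4) _; rewrite -mulrDl ler_wpM2r //; lra.
have Hth j : 'D_v (b j) p != 0 -> boltzmann phi h j p <= 2 * h / a * S p.
  move=> /(derive_bump r0)/andP[Q1 Q2].
  have ph : rr p + a <= phi j p.
    by apply: le_trans (near2 j p Mp Q2); rewrite lerD2l /a ler_pM2l.
  (* The gap a - kap >= a / 2 yields a factor exp (- a / (2 h)) <= 2 h / a relative to the lower
     bound for S p. *)
  apply: (@le_trans _ _ (expR (- (a / (2 * h))) * expR (- (rr p + kap) / h))).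
    rewrite -expRD ler_expR.
    have -> : - (a / (2 * h)) + - (rr p + kap) / h = - (rr p + kap + a / 2) / h.
      by field; rewrite gt_eqF.
    by rewrite ler_pM2r ?invr_gt0 // lerN2; move: ph kapa; lra.
  apply: ler_pM; [exact: expR_ge0|exact: expR_ge0| |exact: Sge].
  apply: le_trans (expRN_le _) _; first by rewrite divr_gt0 // mulr_gt0.
  by rewrite invf_div.
have HB : \sum_(j < n) `|'D_v (b j) p| <= C * enorm v.
  apply: (@le_trans _ _ ((\sum_(j < n) enorm (grad (b j) p)) * enorm v)).
    rewrite mulr_suml; apply: ler_sum => j _.
    by rewrite (derive_grad v openT (sb j) Logic.I) edot_enorm.
  by rewrite ler_wpM2r //; exact: le_trans (ler_norm _) (HC p Mp).
have th0 : 0 <= 2 * h / a by rewrite divr_ge0 ?mulr_ge0 ?ltW.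
have := derive_softmin_le h0 sb sphi (S0 p Mp) (fun j => b0 j p) HK Hth HB th0.
move=> D; apply: le_trans (ler_norm _) _; apply: le_trans D _.
rewrite (_ : h * _ * _ = h * (h * (2 * C / a)) * enorm v); last by field; rewrite gt_eqF.
rewrite -mulrDl ler_wpM2r //.
have : h * (h * (2 * C / a)) <= 1 * eps.
  by apply: ler_pM => //; [exact: ltW|apply: mulr_ge0 => //; exact: ltW].
lra.
Qed.

End SmoothApproximation.

(** * Truncated distance *)

Section Comparison.
Context {R : realType} {N d : nat} (M : set 'rV[R]_N) (A : atlas d M).
Hypothesis cM : compact M.
Local Notation X := (@X R N M).
Implicit Types (f g : 'rV[R]_N -> R) (x y p : 'rV[R]_N).

Lemma gradient_Z (a : R) f p : smooth_on M f -> M p -> gradient M (fun p => a * f p) p = a *: gradient M f p.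
Proof.
move=> sf Mp; apply/rowP => j; rewrite [RHS]mxE.
have := X_M A j (@smooth_on_cst R N M a) sf Mp; rewrite (X_cst A) // mul0r addr0; exact.
Qed.

Lemma gradient_bounded f : smooth_on M f -> has_ubound [set enorm (gradient M f p) | p in M].
Proof.
move=> sf.
have c1 : cont_on M (fun p => \sum_(a < N) `|X a f p|).
  by apply: cont_on_sum => a; apply: cont_on_abs; exact: smooth_on_cont (smooth_X A a sf).
have [C C0 HC] := cont_on_bounded cM c1.
exists (Num.sqrt N%:R * C) => _ [p Mp <-]; apply: le_trans (enorm_le_norm _) _.
rewrite ler_wpM2l ?sqrtr_ge0 //; apply: norm_le_coord => // a.
apply: le_trans (HC p Mp); apply: le_trans (ler_norm _).
rewrite (bigD1 a) //= lerDl; exact: sumr_ge0.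
Qed.

Lemma gradient_le_sup f p : smooth_on M f -> M p -> enorm (gradient M f p) <= gradient_sup_norm M f.
Proof. by move=> sf Mp; apply: ub_le_sup; [exact: gradient_bounded|exists p]. Qed.

Lemma variation_le_dist f x y : connected M -> smooth_submanifold d M -> M x -> M y -> smooth_on M f ->
  gradient_sup_norm M f <= 1 -> `|f x - f y| <= riemannian_dist M x y.
Proof.
move=> conM sM Mx My sf f1; apply: lb_le_inf.
  by have [c hc] := path_exists cM sM conM Mx My; exists (path_length c), c.
move=> _ [c hc <-]; rewrite distrC -[leRHS]mul1r.
by apply: (path_lipschitz A _ sf _ hc) => // p Mp; apply: le_trans f1; exact: gradient_le_sup.
Qed.

End Comparison.

Section Approximation.
Context {R : realType} {N d : nat} (M : set 'rV[R]_N).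
Hypotheses (cM : compact M) (conM : connected M) (sM : smooth_submanifold d M).
Context (I : set nat) (lam : nat -> R) (e : nat -> 'rV[R]_N -> R).
Hypothesis eigensystem : nonzero_eigensystem d M I lam e.
Variables (x y : 'rV[R]_N).
Hypotheses (Mx : M x) (My : M y).
Let D := riemannian_dist M x y.

Lemma dist_ge0 : 0 <= D.
Proof.
apply: lb_le_inf; last exact: lengths_lbound.
by have [c hc] := path_exists cM sM conM Mx My; exists (path_length c), c.
Qed.

(** At each of x and y the smoothing and the truncation cost eps each. The gradient is at most 1 + 3
    eps after smoothing and 1 + 4 eps after truncation, and dividing by this number makes the
    function admissible. *)
Lemma near_distance (eps : R) : 0 < eps <= 1 -> exists q0 : nat, exists g,
  [/\ smooth_on M g, gradient_sup_norm M g <= 1,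
    (forall i, I i -> (q0 < i)%N -> L2_inner d M g (e i) = 0) &
    D - 4 * eps <= (1 + 4 * eps) * `|g x - g y|].
Proof.
move=> /andP[eps0 eps1]; have [A] := atlas_exists cM sM.
have [dl dl0 Hdl] := dist_step cM sM conM Mx eps0.
have eps01 : 0 < eps <= 1 by rewrite eps0.
have [f [sf Hf]] := smooth_approx A cM eps01 dl0 Hdl.
(* The truncation controls the coordinates of the gradient; m passes to its Euclidean norm, and the
   summand 1 keeps it positive when N = 0. *)
pose m := Num.sqrt (N%:R : R) + 1; have m0 : 0 < m by rewrite /m ltr_wpDl // sqrtr_ge0.
have em : 0 < eps / m by rewrite divr_gt0.
have [q0 [g [sg Hg Hfg]]] := spectral_truncation cM sM eigensystem sf em.
have em1 : eps / m <= eps by rewrite ler_pdivrMr // ler_pMr // /m lerDr sqrtr_ge0.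
have k0 : 0 < 1 + 4 * eps by rewrite addr_gt0 // mulr_gt0.
have gg p : M p -> enorm (gradient M g p) <= 1 + 4 * eps.
  move=> Mp; have [_ h1] := Hf p Mp; have [_ h2] := Hfg p Mp.
  have h3 : enorm (gradient M g p - gradient M f p) <= eps.
    apply: le_trans (enorm_le_norm _) _.
    have h4 : `|gradient M g p - gradient M f p| <= eps / m.
      by apply: norm_le_coord => [|a]; [exact: ltW|rewrite !mxE distrC; exact: h2].
    apply: (@le_trans _ _ (m * (eps / m))); last by rewrite mulrCA divff ?mulr1 // gt_eqF.
    by apply: ler_pM => //; rewrite lerDl.
  rewrite -(subrK (gradient M f p) (gradient M g p)); apply: le_trans (enormD _ _) _; lra.
exists q0, (fun p => (1 + 4 * eps)^-1 * g p); split.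
- by apply: smooth_onM => //; exact: smooth_on_cst.
- apply: ge_sup; first by exists (enorm (gradient M (fun p => (1 + 4 * eps)^-1 * g p) x)), x.
  move=> _ [p Mp <-]; rewrite (gradient_Z A) // enormZ gtr0_norm ?invr_gt0 //.
  by rewrite mulrC ler_pdivrMr // mul1r gg.
- move=> i Ii qi; have bI := integral_on_bfun A cM.
  have ei := eigen_eigenfunction eigensystem Ii.
  have se : smooth_on M (e i) by case: ei.
  have cge : cont_on M (fun p => g p * e i p) by apply: cont_onM; exact: smooth_on_cont.
  rewrite /L2_inner (integral_on_ext _ (g := fun p => (1 + 4 * eps)^-1 * (g p * e i p))).
    by rewrite (bfunZ bI) //; have := Hg i Ii qi; rewrite /L2_inner => ->; rewrite mulr0.
  by move=> p _; rewrite mulrA.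
rewrite -mulrBr normrM gtr0_norm ?invr_gt0 // mulrA divff ?mul1r ?gt_eqF //.
have [hx _] := Hf x Mx; have [hy _] := Hf y My.
have [hgx _] := Hfg x Mx; have [hgy _] := Hfg y My; have Dx := dist_refl Mx.
have := le_trans (ler_norm (g y - g x)); rewrite distrC => HD; apply: le_trans (HD _ (lexx _)).
move: hx hy hgx hgy; rewrite !ler_norml -/D => /andP[a1 a2] /andP[b1 b2] /andP[c1 c2] /andP[d1 d2].
lra.
Qed.

(** The test function found for q0 satisfies the orthogonality conditions for every larger q. *)
Lemma truncated_dist_bounds (eps : R) : 0 < eps <= 1 -> exists q0 : nat, forall q, (q0 <= q)%N ->
  truncated_dist d M I e q x y <= D /\ D - 4 * eps <= (1 + 4 * eps) * truncated_dist d M I e q x y.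
Proof.
move=> eps01; have [A] := atlas_exists cM sM; have [q0 [g [sg g1 Hg HD]]] := near_distance eps01.
exists q0 => q q0q.
have Tg : [set `|f x - f y| | f in [set f | [/\ smooth_fun M f, gradient_sup_norm M f <= 1 &
    forall i, I i -> (q < i)%N -> L2_inner d M f (e i) = 0]]] `|g x - g y|.
  by exists g => //; split=> // i Ii qi; apply: Hg => //; exact: leq_ltn_trans q0q qi.
have ubD : ubound [set `|f x - f y| | f in [set f | [/\ smooth_fun M f, gradient_sup_norm M f <= 1 &
    forall i, I i -> (q < i)%N -> L2_inner d M f (e i) = 0]]] D.
  by move=> _ [f [sf f1 _] <-]; exact: (variation_le_dist A cM conM sM Mx My sf f1).
split; first by apply: ge_sup => //; exists `|g x - g y|.
apply: le_trans HD _; case/andP: eps01 => eps0 _; rewrite ler_pM2l ?addr_gt0 ?mulr_gt0 //.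
by apply: ub_le_sup Tg; exists D.
Qed.

End Approximation.

Theorem theorem3 (R : realType) (N d : nat) (M : set 'rV[R]_N)
    (compactM : compact M) (connectedM : connected M)
    (submanifoldM : smooth_submanifold d M)
    (I : set nat) (lam : nat -> R) (e : nat -> 'rV[R]_N -> R)
    (eigensystem : nonzero_eigensystem d M I lam e)
    (x y : 'rV[R]_N) (Mx : M x) (My : M y) :
  (fun q : nat => truncated_dist d M I e q x y - riemannian_dist M x y)
    @ \oo --> (0 : R).
Proof.
have D0 := dist_ge0 compactM connectedM submanifoldM Mx My.
set D := riemannian_dist M x y in D0 *.
apply/cvgrPdist_le => e0 e00.
(* Since T <= D, the two bounds give D - T <= 4 eps + 4 eps T <= 4 (D + 1) eps. *)
pose eps := Num.min 1 (e0 / (4 * (D + 1))).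
have D1 : 0 < 4 * (D + 1) by rewrite mulr_gt0 // ltr_wpDl.
have eps01 : 0 < eps <= 1 by rewrite lt_min ltr01 divr_gt0 //= ge_min lexx.
have epse : 4 * (D + 1) * eps <= e0 by rewrite mulrC -ler_pdivlMr // ge_min lexx orbT.
have [q0 Hq] := truncated_dist_bounds compactM connectedM submanifoldM eigensystem Mx My eps01.
exists q0 => // q /= /Hq[]; rewrite -/D; move: (truncated_dist _ _ _ _ _ _ _) => T TD DT.
case/andP: eps01 => eps0 _; rewrite sub0r normrN ler_norml; apply/andP; split; last lra.
have : 4 * eps * T <= 4 * eps * D by rewrite ler_pM2l // mulr_gt0.
move: epse DT; rewrite !mulrDl !mulrDr; lra.
Qed.
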